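(* Let $\mathcal{H}_c(n)$ denote the supremum of the number of crossing limit cycles over all planar piecewise polynomial vector fields of degree at most $n$ with discontinuity line $\{x=0\}$. Then \[ \liminf_{n\to\infty}\frac{\mathcal{H}_c(n)}{n^2}\ \ge\ \frac14 . \] Furthermore, if $\mathcal{H}_c(n)<\infty$ for some $n\in\mathbb{N}$, then $\mathcal{H}_c(n+1)\ge 1+\mathcal{H}_c(n)$.
   Context: A planar piecewise polynomial vector field is $Z=(P,Q)$ with $(P,Q)=(P^+,Q^+)$ for $x>0$ and $(P,Q)=(P^-,Q^-)$ for $x<0$, where $P^\pm,Q^\pm$ are real polynomials in $(x,y)$ (the case $(P^+,Q^+)=(P^-,Q^-)$ is allowed). Trajectories follow the Filippov convention. Set $\deg P=\max\{\deg P^+,\deg P^-\}$ and similarly $\deg Q$. A point $(0,y)$ is a crossing point if $P^+(0,y)P^-(0,y)>0$; there, trajectories of one side are continued by trajectories of the other side. A crossing limit cycle is a limit cycle (isolated periodic orbit) of $Z$ that intersects the discontinuity line $\{x=0\}$ and crosses it transversely, i.e. meets it only at (finitely many) crossing points. Let $\pi_c(P,Q)$ be the number of crossing limit cycles of $Z$, and \[ \mathcal{H}_c(n):=\sup\{\pi_c(P,Q):\ \deg P\le n,\ \deg Q\le n\}\in\mathbb{N}\cup\{0,\infty\}. \] *)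

(* Defs.v *)
(* MathComp-Analysis, over an arbitrary [R : realType]. *)
From HB Require Import structures.
From mathcomp Require Import all_boot all_order all_algebra.

Set Implicit Arguments.
Unset Strict Implicit.
Unset Printing Implicit Defensive.

(* The import of mpoly is confined to this module because its notations clash
   with those of MathComp-Analysis. *)
Module Bivariate.
From mathcomp Require Import mpoly.

Definition poly2 (R : nzRingType) : Type := {mpoly R[2]}.

(* Variable 0 is x and variable 1 is y. *)
Definition eval2 (R : nzRingType) (p : poly2 R) (z : R * R) : R :=
  meval (fun i : 'I_2 => if i == ord0 then z.1 else z.2) p.

(* Total degree, with the convention that the zero polynomial has degree 0. *)
Definition deg2 (R : nzRingType) (p : poly2 R) : nat := (msize p).-1.

End Bivariate.

From mathcomp Require Import all_classical all_reals all_analysis.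
Import Order.TTheory GRing.Theory Num.Theory.
Import numFieldNormedType.Exports.
Import Bivariate.

Local Open Scope classical_set_scope.
Local Open Scope ring_scope.

(* A planar piecewise polynomial vector field with discontinuity line
   {x = 0}: (Pp, Qp) acts on x > 0 and (Pm, Qm) on x < 0. *)
Record pwfield (R : realType) := PwField {
  Pp : poly2 R;
  Pm : poly2 R;
  Qp : poly2 R;
  Qm : poly2 R }.

Section PiecewiseFields.
Variable R : realType.
Implicit Types (Z : pwfield R) (z : R * R) (g : R -> R * R) (G : set (R * R)).

Definition degP Z : nat := maxn (deg2 (Pp Z)) (deg2 (Pm Z)).
Definition degQ Z : nat := maxn (deg2 (Qp Z)) (deg2 (Qm Z)).

Definition fieldp Z z : R * R := (eval2 (Pp Z) z, eval2 (Qp Z) z).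
Definition fieldm Z z : R * R := (eval2 (Pm Z) z, eval2 (Qm Z) z).

(* The Filippov set-valued extension of Z: on {x = 0} it is the segment
   joining the two one-sided fields. *)
Definition filippov Z z : set (R * R) :=
  if 0 < z.1 then [set fieldp Z z]
  else if z.1 < 0 then [set fieldm Z z]
  else [set w | exists2 s : R, 0 <= s <= 1 &
                w = s *: fieldp Z z + (1 - s) *: fieldm Z z].

(* Caratheodory solutions of z' \in filippov Z z: z is an indefinite Lebesgue
   integral of a locally integrable v (that is, z is locally absolutely
   continuous with derivative v almost everywhere). *)
Definition trajectory Z g : Prop :=
  exists v : R -> R * R,
    [/\ locally_integrable [set: R] (fun t => (v t).1),
        locally_integrable [set: R] (fun t => (v t).2),
        forall a b : R, a <= b ->
          (g b).1 - (g a).1 = \int[lebesgue_measure]_(t in `[a, b]) (v t).1 /\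
          (g b).2 - (g a).2 = \int[lebesgue_measure]_(t in `[a, b]) (v t).2 &
        {ae lebesgue_measure, forall t : R, filippov Z (g t) (v t)}].

Definition periodic_orbit Z G : Prop :=
  exists g, exists T : R,
    [/\ trajectory Z g,
        0 < T /\ (forall t : R, g (t + T) = g t),
        (exists s t : R, g s <> g t) &
        G = range g].

Definition limit_cycle Z G : Prop :=
  periodic_orbit Z G /\
  exists U : set (R * R),
    [/\ open U, G `<=` U &
        forall G', periodic_orbit Z G' -> G' `<=` U -> G' = G].

Definition disc_line : set (R * R) := [set z | z.1 = 0].

Definition crossing_point Z z : Prop :=
  disc_line z /\ 0 < eval2 (Pp Z) z * eval2 (Pm Z) z.

Definition crossing_limit_cycle Z G : Prop :=
  [/\ limit_cycle Z G,
      G `&` disc_line !=set0,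
      finite_set (G `&` disc_line) &
      forall z, (G `&` disc_line) z -> crossing_point Z z].

Definition pi_c Z : \bar R := counting [set G | crossing_limit_cycle Z G].

Definition Hc (n : nat) : \bar R :=
  ereal_sup [set pi_c Z | Z in [set Z | (degP Z <= n)%N /\ (degQ Z <= n)%N]].

End PiecewiseFields.

(* Main.v *)
(* Reflecting the left half-plane onto the right one turns a crossing cycle into a closed chain of passages
   through {x >= 0}, alternately of the right field A and of the reflected left field B, so its base point is
   a fixed point of a composition of passage maps. A window is a base interval on which such a chain exists
   and at whose ends the displacement has opposite signs; it contains a fixed point and survives small
   perturbations of the fields. Fixed points may fail to be isolated, but passage maps reverse the order, so
   under a translation of A by d along the line the displacement varies at least as fast as d. By Banach's
   indicatrix argument almost every translated system therefore has finitely many closed chains in each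
   window, and K disjoint windows give K crossing limit cycles of the same degree.

   First part: the piecewise Hamiltonian system A = (g(y), -1), B = (-g(y), 1), where g has degree at most n,
   has a centre at each of n/2 wells of the primitive of g. Perturbing B to (-g(y) - u rho(x), 1) with
   coefficients of rho of hierarchically decreasing size, the first order displacement changes sign n times
   in every well, which gives n(n/2) windows.

   Second part: K cycles yield at least K windows after a translation of one sign (an odd cycle survives
   for both signs, a semistable one splits in two for one of them). Multiplying A and B by affine functions
   that vanish on lines through (0, c), with c just above the highest crossing point, raises the degree by
   one and preserves the cycles; adding small constants creates one more window near (0, c). *)

Require Import Defs.
From mathcomp Require Import all_boot all_order all_algebra.

(** * Polynomial functions of two variables *)

From mathcomp Require boolp.
Import GRing.Theory.
Set Implicit Arguments.
Unset Strict Implicit.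
Unset Printing Implicit Defensive.
Local Open Scope ring_scope.

Module PolyFunctions.
From mathcomp Require Import mpoly.
Import Bivariate.

Section PolyFun.
Variable R : idomainType.
Implicit Types (z w : R * R) (f g : R * R -> R).

(** The fields enter as C^1 maps with locally Lipschitz derivatives, and for these the fixed points
    of a return map may accumulate; this is what the generic translation is for. It acts on one
    field only, since moving both would move the whole picture rigidly.

    A cycle may cross the line many times and could be counted in several windows. Chains therefore
    record, besides their ends, the open sets in which the passages run and a set [D] of admissible
    intermediate points. The set [D] of one window avoids the base intervals of the others, and this
    makes the cycles distinct. The open sets also carry information that holds only near a given
    cycle: that no other periodic orbit is close to it, and that an affine factor is positive along
    it.

    Filippov solutions have velocities only almost everywhere and may be non-unique, and a limit
    cycle must be isolated among all of them. Transversality at crossing points restores uniqueness,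
    through which the statements about trajectories near a cycle are obtained. *)

Definition pf (n : nat) f := exists p : poly2 R, (deg2 p <= n)%N /\ forall z, eval2 p z = f z.

Lemma pf_eval (p : poly2 R) : pf (deg2 p) (eval2 p).
Proof. by exists p. Qed.

Lemma pfW m n f : (m <= n)%N -> pf m f -> pf n f.
Proof. by move=> mn [p [pm pf]]; exists p; split=> //; exact: leq_trans mn. Qed.

Let pred_le k n : (k.-1 <= n)%N = (k <= n.+1)%N.
Proof. by case: k. Qed.

Lemma pf_cst n c : pf n (fun=> c).
Proof.
exists (c%:MP_[2]); split; last by move=> z; rewrite /eval2 mevalC.
by rewrite /deg2 pred_le mmeasureC; case: eqP.
Qed.

Lemma pfD n f g : pf n f -> pf n g -> pf n (fun z => f z + g z).
Proof.
move=> [p [pn pf]] [q [qn qf]]; exists ((p : {mpoly R[2]}) + q); split.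
  move: pn qn; rewrite /deg2 !pred_le => pn qn; apply: leq_trans (mmeasureD_le _ _ _) _.
  by rewrite geq_max pn.
by move=> z; rewrite -pf -qf /eval2 mevalD.
Qed.

Lemma pfM m n f g : pf m f -> pf n g -> pf (m + n) (fun z => f z * g z).
Proof.
move=> [p [pn pf]] [q [qn qf]]; exists ((p : {mpoly R[2]}) * q); split; last first.
  by move=> z; rewrite -pf -qf /eval2 mevalM.
(* [deg2] truncates at zero, and additivity of sizes requires nonzero factors, so zero factors are
   split off. *)
have [->|p0] := eqVneq p 0; first by rewrite mul0r /deg2 msize0.
have [->|q0] := eqVneq q 0; first by rewrite mulr0 /deg2 msize0.
move: pn qn; rewrite /deg2 msizeM//.
have := msize_poly_eq0 p; have := msize_poly_eq0 q.
rewrite (negbTE p0) (negbTE q0).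
by case: mmeasure => // a; case: mmeasure => // b _ _ /= h1 h2; rewrite addnS /= leq_add.
Qed.

Lemma pf_X : pf 1 fst.
Proof.
exists ('X_ord0 : {mpoly R[2]}); split.
  by rewrite /deg2 pred_le msizeX mdeg1.
by move=> z; rewrite /eval2 mevalXU eqxx.
Qed.

Lemma pf_Y : pf 1 snd.
Proof.
exists ('X_ord_max : {mpoly R[2]}); split.
  by rewrite /deg2 pred_le msizeX mdeg1.
by move=> z; rewrite /eval2 mevalXU.
Qed.

(** Induction over the support; the bound [i + j <= n] on the monomials lets the predicate itself
    carry a degree, as in [pf_affine]. *)
Lemma pf_ind (K : (R * R -> R) -> Prop) n f : pf n f ->
  (forall c, K (fun=> c)) -> (forall f g, K f -> K g -> K (fun z => f z + g z)) ->
  (forall i j c, (i + j <= n)%N -> K (fun z => c * (z.1 ^+ i * z.2 ^+ j))) -> K f.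
Proof.
move=> [p [pn pE]] K0 KD KM.
have -> : f = fun z => \sum_(m <- msupp p) p@_m *
    (z.1 ^+ m ord0 * z.2 ^+ m ord_max).
  apply/boolp.funext => z; rewrite -pE /eval2 mevalE.
  apply: eq_bigr => m _; rewrite big_ord_recl big_ord1.
  by rewrite (_ : lift ord0 ord0 = ord_max); last exact: val_inj.
have : all (fun m : 'X_{1..2} => (m ord0 + m ord_max <= n)%N) (msupp p).
  apply/allP => m /msize_mdeg_lt; rewrite mdegE big_ord_recl big_ord1.
  rewrite (_ : lift ord0 ord0 = ord_max); last exact: val_inj.
  move=> h.
  rewrite -ltnS; apply: leq_trans h _; move: pn; rewrite /deg2 pred_le; exact.
elim: (msupp p) => [_|m s IH /= /andP[mn /IH IHs]].
  have -> : (fun z => \sum_(i <- [::]) p@_i * (z.1 ^+ i ord0 * z.2 ^+ i ord_max)) = fun=> 0.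
    by apply/boolp.funext => z; rewrite big_nil.
  exact: K0.
have -> : (fun z => \sum_(i <- m :: s) p@_i * (z.1 ^+ i ord0 * z.2 ^+ i ord_max)) =
    fun z => p@_m * (z.1 ^+ m ord0 * z.2 ^+ m ord_max) +
      \sum_(i <- s) p@_i * (z.1 ^+ i ord0 * z.2 ^+ i ord_max).
  by apply/boolp.funext => z; rewrite big_cons.
by apply: KD => //; exact: KM.
Qed.

Lemma pf_affine n f (a b c d : R) : pf n f -> pf n (fun z => f (a * z.1 + b, c * z.2 + d)).
Proof.
move=> pnf; apply: (@pf_ind (fun f => pf n (fun z => f (a * z.1 + b, c * z.2 + d))) _ _ pnf).
- by move=> e; exact: pf_cst.
- by move=> g h; exact: pfD.
- move=> i j e ijn; apply: pfW ijn _.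
  have pX (h : R * R -> R) k : pf 1 h -> pf k (fun z => h z ^+ k).
    move=> ph; elim: k => [|k IH]; first exact: pf_cst.
    have -> : (fun z => h z ^+ k.+1) = fun z => h z * h z ^+ k by apply/boolp.funext => z; rewrite exprS.
    exact: (pfM ph IH).
  apply: (@pfM 0); first exact: pf_cst.
  apply: pfM; apply: pX; apply: pfD; try exact: pf_cst.
    by apply: (@pfM 0); [exact: pf_cst|exact: pf_X].
  by apply: (@pfM 0); [exact: pf_cst|exact: pf_Y].
Qed.

End PolyFun.

End PolyFunctions.

From HB Require Import structures.
From mathcomp Require Import all_boot all_order all_algebra.
From mathcomp Require Import all_classical all_reals all_analysis.
From mathcomp Require Import measurable_realfun.
From mathcomp Require Import ring lra.
Import Order.TTheory GRing.Theory Num.Theory.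
Import numFieldNormedType.Exports.
Set Implicit Arguments.
Unset Strict Implicit.
Unset Printing Implicit Defensive.
Local Open Scope classical_set_scope.
Local Open Scope ring_scope.
Import Bivariate PolyFunctions.

(** * Real functions of one variable *)

Section RealTools.
Variable R : realType.
Implicit Types (f g A : R -> R) (a b c d e t s : R).

Lemma cont_ed f t : {for t, continuous f} ->
  forall e, 0 < e -> exists2 d : R, 0 < d & forall s, `|s - t| < d -> `|f s - f t| < e.
Proof.
move=> cf e e0.
have /cvgrPdist_lt /(_ e e0) := cf.
move=> /nbhs_ballP[d /= d0 H]; exists d => // s sd.
rewrite distrC; apply: H; rewrite /ball /=.
by rewrite distrC.
Qed.

Lemma ed_cont f t :
  (forall e, 0 < e -> exists2 d : R, 0 < d & forall s, `|s - t| < d -> `|f s - f t| < e) ->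
  {for t, continuous f}.
Proof.
move=> H; apply/cvgrPdist_lt => e /H[d d0 Hd].
apply/nbhs_ballP; exists d => //= s sd.
by rewrite distrC; apply: Hd; rewrite distrC.
Qed.

Lemma is_derive_cont f t d : is_derive t 1 f d -> {for t, continuous f}.
Proof. by move=> [df _]; apply/differentiable_continuous/derivable1_diffP. Qed.

Lemma mvt_le f df a b c : a <= b -> continuous f ->
  (forall t, a < t < b -> is_derive t 1 f (df t)) ->
  (forall t, a < t < b -> df t <= c) -> f b - f a <= c * (b - a).
Proof.
rewrite le_eqVlt => /predU1P[<-|ab] cf Hd Hc; first by rewrite !subrr mulr0.
have Hd' x : x \in `]a, b[ -> is_derive x 1 f (df x) by rewrite in_itv /= => /Hd.
have [|x] := MVT ab Hd'; first exact: (continuous_subspaceT cf).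
rewrite in_itv /= => /Hc le ->.
  by rewrite ler_wpM2r// subr_ge0 ltW.
Qed.

Lemma mvt_ge f df a b c : a <= b -> continuous f ->
  (forall t, a < t < b -> is_derive t 1 f (df t)) ->
  (forall t, a < t < b -> c <= df t) -> c * (b - a) <= f b - f a.
Proof.
move=> ab cf Hd Hc.
have := @mvt_le (fun t => - f t) (fun t => - df t) a b (- c) ab.
have -> : - f b - - f a = - (f b - f a) by rewrite opprB opprK addrC.
rewrite mulNr lerN2; apply.
- by move=> t; apply: cvgN; apply: cf.
- by move=> t /Hd h; apply: is_deriveN.
- by move=> t /Hc; rewrite lerN2.
Qed.

Lemma mvt_abs f df a b c : a <= b -> continuous f ->
  (forall t, a < t < b -> is_derive t 1 f (df t)) ->
  (forall t, a < t < b -> `|df t| <= c) -> `|f b - f a| <= c * (b - a).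
Proof.
move=> ab cf Hd Hc; rewrite ler_norml; apply/andP; split.
  rewrite -mulNr; apply: mvt_ge Hd _ => // t /Hc.
  by rewrite ler_norml => /andP[].
apply: mvt_le Hd _ => // t /Hc.
by rewrite ler_norml => /andP[].
Qed.

Lemma mvt_lt f df a b : a < b -> continuous f ->
  (forall t, a < t < b -> is_derive t 1 f (df t)) ->
  (forall t, a < t < b -> 0 < df t) -> f a < f b.
Proof.
move=> ab cf Hd Hc.
have Hd' x : x \in `]a, b[ -> is_derive x 1 f (df x) by rewrite in_itv /= => /Hd.
have [|x] := MVT ab Hd'; first exact: (continuous_subspaceT cf).
rewrite in_itv /= => /Hc le E.
  by rewrite -subr_gt0 E mulr_gt0// subr_gt0.
Qed.

Lemma ivt f a b c : a <= b -> continuous f -> f a <= c <= f b ->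
  exists2 t, a <= t <= b & f t = c.
Proof.
move=> ab cf /andP[h1 h2].
have [||t] := @IVT R f a b c ab.
- exact: (continuous_subspaceT cf).
- by rewrite ge_min le_max h1 h2 orbT.
- by rewrite in_itv /= => tab <-; exists t.
Qed.

Lemma ivt_dec f a b c : a <= b -> continuous f -> f b <= c <= f a ->
  exists2 t, a <= t <= b & f t = c.
Proof.
move=> ab cf /andP[h1 h2].
have [||t] := @IVT R f a b c ab.
- exact: (continuous_subspaceT cf).
- by rewrite ge_min le_max h1 h2 orbT.
- by rewrite in_itv /= => tab <-; exists t.
Qed.

(** Extension by zero to the left of the origin makes the primitive continuous on all of R, so that
    curves on [[0, T]] need no one-sided notions. *)
Lemma antideriv f : continuous f ->
  exists A, [/\ forall t, t <= 0 -> A t = 0, continuous A &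
    forall t, 0 < t -> is_derive t 1 A (f t)].
Proof.
move=> cf.
(* Integrating from -1 puts the origin inside the interval, where the fundamental theorem
   applies. *)
pose F x := \int[lebesgue_measure]_(t in [set` Interval (BLeft (-1)) (BRight x)]) f t.
have HF t : -1 < t -> is_derive t 1 F (f t).
  move=> t1.
  have [] := @continuous_FTC1_closed R f (-1) t (t + 1).
  - by rewrite ltrDl.
  - apply: continuous_compact_integrable; first exact: segment_compact.
    exact: (continuous_subspaceT cf).
  - exact: t1.
  - exact: cf.
  move=> d e; apply: DeriveDef; first exact: d.
  by rewrite -derive1E; exact: e.
exists (fun t => F (Num.max t 0) - F 0); split.
- by move=> t t0; rewrite max_r// subrr.
- move=> t; apply: cvgB; last exact: cvg_cst.
  apply: (@continuous_comp _ _ _ (fun t => Num.max t 0) F).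
    by apply: continuous_max; [exact: cvg_id|exact: cvg_cst].
  apply: (is_derive_cont (HF _ _)).
  by rewrite lt_max; apply/orP; right; rewrite ltrN10.
- move=> t t0.
  have E : \forall s \near t, F s - F 0 = F (Num.max s 0) - F 0.
    near=> s; rewrite max_l//; apply/ltW; near: s.
    exact: lt_nbhsr.
  apply: near_eq_is_derive E _.
  rewrite -[f t]subr0; apply: is_deriveB; apply: HF.
  by apply: lt_trans t0; rewrite ltrN10.
Unshelve. all: by end_near. Qed.

End RealTools.

(* Discards the hypotheses [lra] cannot use, whose reification is very slow. *)
Ltac qlra := repeat match goal with H : ?T |- _ =>
    match type of T with Prop => lazymatch T with
      | is_true (@Order.le _ _ _ _) => fail
      | is_true (@Order.lt _ _ _ _) => fail
      | @eq _ _ _ => fail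
      | _ => clear H end end end; lra.

(** * Gronwall and Picard *)

Section Plane.
Variable R : realType.
Implicit Types (z w : R * R) (a b d e t s L M : R).

Lemma pnorm_le z e : (`|z| <= e) = (`|z.1| <= e) && (`|z.2| <= e).
Proof. by rewrite prod_normE ge_max. Qed.

Lemma pnorm_lt z e : (`|z| < e) = (`|z.1| < e) && (`|z.2| < e).
Proof. by rewrite prod_normE gt_max. Qed.

Lemma pnorm1 z : `|z.1| <= `|z|.
Proof. by rewrite prod_normE le_max lexx. Qed.

Lemma pnorm2 z : `|z.2| <= `|z|.
Proof. by rewrite prod_normE le_max lexx orbT. Qed.

(** Continuity is asked on all of R and the derivative only on the open interval: the mean value
    lemmas then apply without one-sided derivatives at the ends. *)
Definition curve_derive (g : R -> R * R) (dg : R -> R * R) (a b : R) :=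
  [/\ continuous (fun t => (g t).1), continuous (fun t => (g t).2) &
   forall t, a < t < b -> is_derive t 1 (fun t => (g t).1) (dg t).1 /\
                          is_derive t 1 (fun t => (g t).2) (dg t).2].

(** The max norm is not differentiable, so the squared Euclidean distance is used, with [r ^+ 2]
    added to absorb the inhomogeneous term. At the rate [4 * L + 2] the weighted quantity does not
    increase, because [4 L r^2 + 2 (m - r)^2 >= 0]. It starts below [3 r^2], whose root is below
    [2 r]. *)
Lemma gronwall g h dg dh (a b L r : R) : 0 <= L -> 0 <= r ->
  curve_derive g dg a b -> curve_derive h dh a b ->
  (forall t, a < t < b -> `|dh t - dg t| <= L * `|h t - g t| + r) ->
  `|h a - g a| <= r ->
  forall t, a <= t <= b -> `|h t - g t| <= 2 * r * expR ((4 * L + 2) * (t - a)).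
Proof.
move=> L0 r0 [cg1 cg2 dg12] [ch1 ch2 dh12] Hd H0 t /andP[at_ tb].
pose K := 4 * L + 2.
pose X t := (h t).1 - (g t).1; pose Y t := (h t).2 - (g t).2.
pose dX t := (dh t).1 - (dg t).1; pose dY t := (dh t).2 - (dg t).2.
pose S t := X t ^+ 2 + Y t ^+ 2 + r ^+ 2.
pose E t := expR (- K * (t - a)).
have DX s : a < s < b -> is_derive s 1 X (dX s).
  by move=> /[dup] /dg12[? _] /dh12[? _]; apply: is_deriveB.
have DY s : a < s < b -> is_derive s 1 Y (dY s).
  by move=> /[dup] /dg12[_ ?] /dh12[_ ?]; apply: is_deriveB.
have DE (s : R) : is_derive s 1 E (- K * E s).
  rewrite /E mulrC; apply: (@is_derive1_comp _ expR (fun s => - K * (s - a))).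
  by apply: is_derive_eq; rewrite subr0 scaler1 /GRing.scale/= ?mulr1.
have cX : continuous X by move=> s; apply: cvgB; [exact: ch1|exact: cg1].
have cY : continuous Y by move=> s; apply: cvgB; [exact: ch2|exact: cg2].
have cE : continuous E by move=> s; apply: is_derive_cont (DE s).
have key : S t * E t <= S a * E a.
  rewrite -subr_le0 -(mul0r (t - a)).
  apply: (@mvt_le R (fun s => S s * E s) (fun s => S s * (- K * E s) +
     E s * (2 * X s * dX s + 2 * Y s * dY s)) a t 0) => //.
  - move=> s; apply: cvgM; last exact: cE.
    apply: cvgD; last exact: cvg_cst.
    by apply: cvgD; apply: cvgM; (exact: cX || exact: cY).
  - move=> s /andP[as_ st]; have sb : a < s < b by rewrite as_ (lt_le_trans st tb).
    have ? := DX s sb; have ? := DY s sb; have ? := DE s.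
    apply: is_derive_eq; rewrite /GRing.scale/= /S; ring.
  - move=> s /andP[as_ st]; have sb : a < s < b by rewrite as_ (lt_le_trans st tb).
    have := Hd s sb; set m := `|h s - g s|.
    rewrite pnorm_le => /andP[/= h1 h2].
    have m0 : 0 <= m by rewrite normr_ge0.
    have X1 : `|X s| <= m by exact: (pnorm1 (h s - g s)).
    have Y1 : `|Y s| <= m by exact: (pnorm2 (h s - g s)).
    have XX : 2 * X s * dX s <= 2 * m * (L * m + r).
      apply: le_trans (ler_norm _) _; rewrite !normrM ger0_norm//.
      rewrite -!mulrA ler_pM2l//; apply: ler_pM => //.
    have YY : 2 * Y s * dY s <= 2 * m * (L * m + r).
      apply: le_trans (ler_norm _) _; rewrite !normrM ger0_norm//.
      rewrite -!mulrA ler_pM2l//; apply: ler_pM => //.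
    have mS : m ^+ 2 + r ^+ 2 <= S s.
      rewrite lerD2r /m prod_normE /= -/(X s) -/(Y s).
      have [?|?] := leP `|X s| `|Y s|; rewrite real_normK ?num_real//.
        by rewrite lerDr sqr_ge0.
      by rewrite lerDl sqr_ge0.
    have E0 : 0 < E s by rewrite expR_gt0.
    have -> : S s * (- K * E s) + E s * (2 * X s * dX s + 2 * Y s * dY s) =
       E s * (2 * X s * dX s + 2 * Y s * dY s - K * S s) by ring.
    rewrite pmulr_rle0// subr_le0.
    apply: le_trans (lerD XX YY) _.
    apply: (@le_trans _ _ (K * (m ^+ 2 + r ^+ 2))); last first.
      by rewrite ler_wpM2l// /K; lra.
    rewrite /K -subr_ge0.
    have -> : (4 * L + 2) * (m ^+ 2 + r ^+ 2) - (2 * m * (L * m + r) + 2 * m * (L * m + r))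
      = 4 * L * r ^+ 2 + 2 * (m - r) ^+ 2 by ring.
    by rewrite addr_ge0// mulr_ge0// ?sqr_ge0// mulr_ge0.
have Sa : S a <= 3 * r ^+ 2.
  move: H0; rewrite pnorm_le => /andP[/= h1 h2].
  have sq x : `|x| <= r -> x ^+ 2 <= r ^+ 2.
    by move=> xr; rewrite -[x ^+ 2]real_normK ?num_real// ler_sqr ?nnegrE.
  have := sq _ h1; have := sq _ h2; rewrite -/(X a) -/(Y a) /S; lra.
have Ea : E a = 1 by rewrite /E subrr mulr0 expR0.
pose F := expR (K * (t - a)).
have EF : E t * F = 1 by rewrite /E /F mulNr expRN mulVf// gt_eqF// expR_gt0.
have F1 : 1 <= F.
  by rewrite -expR0 ler_expR mulr_ge0 ?subr_ge0// /K; lra.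
have St : S t <= 3 * r ^+ 2 * F.
  rewrite (_ : S t = S t * E t * F); last by rewrite -mulrA EF mulr1.
  rewrite ler_wpM2r ?expR_ge0//.
  by apply: le_trans key _; rewrite Ea mulr1.
have b0 : 0 <= 2 * r * F by rewrite !mulr_ge0// expR_ge0.
have bd : S t <= (2 * r * F) ^+ 2.
  apply: le_trans St _.
  have -> : (2 * r * F) ^+ 2 = 3 * r ^+ 2 * F * F + r ^+ 2 * F ^+ 2 by ring.
  apply: ler_wpDr; first by rewrite mulr_ge0 ?sqr_ge0.
  by rewrite ler_peMr// !mulr_ge0 ?sqr_ge0// expR_ge0.
have sq x : x ^+ 2 <= (2 * r * F) ^+ 2 -> `|x| <= 2 * r * F.
  by rewrite -[x ^+ 2]real_normK ?num_real// ler_sqr ?nnegrE.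
rewrite pnorm_le /= -/(X t) -/(Y t); apply/andP; split; apply: sq; apply: le_trans bd.
  by rewrite /S -addrA lerDl addr_ge0 ?sqr_ge0.
by rewrite /S addrAC lerDr addr_ge0 ?sqr_ge0.
Qed.

Lemma lip_comp_cont (F : R * R -> R * R) (g : R -> R * R) L :
  0 < L -> (forall z w, `|F z - F w| <= L * `|z - w|) ->
  continuous (fun t => (g t).1) -> continuous (fun t => (g t).2) ->
  continuous (fun t => (F (g t)).1) /\ continuous (fun t => (F (g t)).2).
Proof.
move=> L0 HL c1 c2.
suff H t e : 0 < e -> exists2 d : R, 0 < d & forall s, `|s - t| < d -> `|F (g s) - F (g t)| < e.
  split=> t; apply: ed_cont => e /(H t)[d d0 Hd]; exists d => // s /Hd.
    by apply: le_lt_trans; exact: (pnorm1 (F (g s) - F (g t))).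
  by apply: le_lt_trans; exact: (pnorm2 (F (g s) - F (g t))).
move=> e0; have eL : 0 < e / L by rewrite divr_gt0.
have [d1 d10 H1] := cont_ed (c1 t) eL; have [d2 d20 H2] := cont_ed (c2 t) eL.
exists (Num.min d1 d2) => [|s]; first by rewrite lt_min d10.
rewrite lt_min => /andP[/H1 h1 /H2 h2].
apply: le_lt_trans (HL _ _) _; rewrite mulrC -ltr_pdivlMr//.
by rewrite pnorm_lt h1.
Qed.

Lemma squeeze_limit (v w : nat -> R) :
  (forall n, w n <= w n.+1) -> (forall n, v n.+1 <= v n) ->
  (forall n, w n <= v n) -> exists u, forall n, w n <= u <= v n.
Proof.
move=> hw1 hv1 hwv.
have hw m n : (m <= n)%N -> w m <= w n.
  move=> /subnK <-; elim: (n - m)%N => // d IH.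
  by apply: le_trans IH _; rewrite addSn.
have hv m n : (m <= n)%N -> v n <= v m.
  move=> /subnK <-; elim: (n - m)%N => // d IH.
  by apply: le_trans IH; rewrite addSn.
pose A := range w; exists (sup A) => n.
have wv m : w m <= v n.
  by case: (leqP m n) => mn; [apply: le_trans (hw _ _ mn) _; exact: hwv|
    apply: le_trans (hwv m) _; apply: hv; exact: ltnW].
apply/andP; split; last first.
  by apply: ge_sup => [|_ [m _ <-]]; [exists (w 0%N), 0%N|exact: wv].
apply: ub_le_sup; last by exists n.
by exists (v n) => _ [m _ <-]; exact: wv.
Qed.

(** The weight [exp(2 L t)] makes every iteration halve the distance on the whole half-line at once,
    so the solution is global and needs no continuation argument. *)
Theorem picard (F : R * R -> R * R) L z0 : 0 < L ->
  (forall z w, `|F z - F w| <= L * `|z - w|) ->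
  exists g, g 0 = z0 /\ forall b, curve_derive g (F \o g) 0 b.
Proof.
move=> L0 HL.
have [I HI] : exists I : (R -> R) -> (R -> R), forall f, continuous f ->
    [/\ forall t, t <= 0 -> I f t = 0, continuous (I f) &
      forall t, 0 < t -> is_derive t 1 (I f) (f t)].
  have [|I HI] := @choice (R -> R) (R -> R) (fun f A => continuous f ->
    [/\ forall t, t <= 0 -> A t = 0, continuous A &
      forall t, 0 < t -> is_derive t 1 A (f t)]); last by exists I.
  move=> f; have [cf|nf] := pselect (continuous f); last by exists (fun=> 0) => /nf.
  by have [A HA] := antideriv cf; exists A.
pose op (u : R -> R * R) := fun t => (z0.1 + I (fun s => (F (u s)).1) t,
                                    z0.2 + I (fun s => (F (u s)).2) t).
pose ct (u : R -> R * R) := continuous (fun t => (u t).1) /\ continuous (fun t => (u t).2).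
have op1 u : ct u -> [/\ ct (op u), forall t, t <= 0 -> op u t = z0 &
    forall b, curve_derive (op u) (F \o u) 0 b].
  move=> [cu1 cu2]; have [cF1 cF2] := lip_comp_cont L0 HL cu1 cu2.
  have [I10 I1c I1d] := HI _ cF1; have [I20 I2c I2d] := HI _ cF2.
  have c1 : continuous (fun t => (op u t).1).
    by move=> t; apply: cvgD; [exact: cvg_cst|exact: I1c].
  have c2 : continuous (fun t => (op u t).2).
    by move=> t; apply: cvgD; [exact: cvg_cst|exact: I2c].
  split=> // [t t0|b]; first by rewrite /op I10// I20// !addr0 -surjective_pairing.
  split=> // t /andP[t0 _]; split.
    have ? := I1d t t0; apply: is_derive_eq; exact: add0r.
  have ? := I2d t t0; apply: is_derive_eq; exact: add0r.
pose u n := iter n op (fun=> z0).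
have cu n : ct (u n).
  elim: n => [|n IH]; last by have [] := op1 _ IH.
  by split=> t; exact: cvg_cst.
have du n b : curve_derive (u n.+1) (F \o u n) 0 b by have [_ _] := op1 _ (cu n); apply.
have u0 n t : t <= 0 -> u n t = z0.
  by case: n => // n t0; have [_ + _] := op1 _ (cu n); apply.
pose M := `|F z0| / (2 * L); pose E (t : R) := expR (2 * L * t).
have M0 : 0 <= M by rewrite divr_ge0// mulr_ge0// ltW.
have E0 t : 0 <= E t by exact: expR_ge0.
have DE (k : R) (t : R) : is_derive t 1 (fun t => k * E t) (k * (2 * L) * E t).
  have H : is_derive t 1 E (2 * L * E t).
    rewrite mulrC; apply: (@is_derive1_comp _ expR (fun s => 2 * L * s)).
    by apply: is_derive_eq; rewrite /GRing.scale/= ?mulr1.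
  by apply: is_derive_eq; rewrite /GRing.scale/=; ring.
have cE (k : R) : continuous (fun t => k * E t) by move=> t; exact: is_derive_cont (DE k t).
have dd (f df : R -> R) (k : R) : 0 <= k -> continuous f -> f 0 = 0 ->
    (forall t, 0 < t -> is_derive t 1 f (df t)) ->
    (forall t, 0 < t -> `|df t| <= k * (2 * L) * E t) ->
    forall t, 0 <= t -> `|f t| <= k * E t.
  move=> k0 cf f0 Df Hf t t0; rewrite ler_norml; apply/andP; split.
    have : 0 * (t - 0) <= (f t + k * E t) - (f 0 + k * E 0).
      apply: (@mvt_ge R (fun t => f t + k * E t) (fun t => df t + k * (2 * L) * E t)) => //.
      - by move=> s; apply: cvgD; [exact: cf|exact: cE].
      - by move=> s /andP[s0 _]; have ? := Df s s0; have ? := DE k s; exact: is_deriveD.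
      - move=> s /andP[s0 _]; have := Hf s s0; rewrite ler_norml => /andP[+ _]; lra.
    rewrite mul0r f0; have := mulr_ge0 k0 (E0 0); lra.
  have : 0 * (t - 0) <= (k * E t - f t) - (k * E 0 - f 0).
    apply: (@mvt_ge R (fun t => k * E t - f t) (fun t => k * (2 * L) * E t - df t) 0 t 0 t0).
    - by move=> s; apply: cvgB; [exact: cE|exact: cf].
    - by move=> s /andP[s0 _]; have ? := Df s s0; have ? := DE k s; exact: is_deriveB.
    - move=> s /andP[s0 _]; have := Hf s s0; rewrite ler_norml => /andP[_]; lra.
  rewrite mul0r f0; have := mulr_ge0 k0 (E0 0); lra.
have pd (f df : R -> R * R) (k : R) : 0 <= k -> (forall b, curve_derive f df 0 b) -> f 0 = 0 ->
    (forall t, 0 < t -> `|df t| <= k * (2 * L) * E t) ->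
    forall t, 0 <= t -> `|f t| <= k * E t.
  move=> k0 Df f0 Hf t t0; rewrite pnorm_le.
  have [c1 c2 _] := Df 0.
  have DD s : 0 < s -> is_derive s 1 (fun t => (f t).1) (df s).1 /\
                       is_derive s 1 (fun t => (f t).2) (df s).2.
    by move=> s0; have [_ _] := Df (s + 1); apply; rewrite s0 ltrDl ltr01.
  apply/andP; split.
    apply: (@dd (fun t => (f t).1) (fun t => (df t).1)) => //; first by rewrite f0.
      by move=> s /DD[].
    by move=> s s0; apply: le_trans (pnorm1 _) (Hf _ s0).
  apply: (@dd (fun t => (f t).2) (fun t => (df t).2)) => //; first by rewrite f0.
    by move=> s /DD[].
  by move=> s s0; apply: le_trans (pnorm2 _) (Hf _ s0).
have cdB (f g df dg : R -> R * R) a b : curve_derive f df a b -> curve_derive g dg a b ->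
    curve_derive (fun t => f t - g t) (fun t => df t - dg t) a b.
  move=> [f1 f2 fd] [g1 g2 gd]; split.
  - by move=> t; apply: cvgB; [exact: f1|exact: g1].
  - by move=> t; apply: cvgB; [exact: f2|exact: g2].
  - by move=> t /[dup] /fd[? ?] /gd[? ?]; split; apply: is_deriveB.
pose k n := M * (2^-1) ^+ n.
have k0 n : 0 <= k n by rewrite mulr_ge0// exprn_ge0.
have kS n : k n.+1 * 2 = k n by rewrite /k exprSr -!mulrA mulVf ?mulr1.
have step n t : 0 <= t -> `|u n.+1 t - u n t| <= k n * E t.
  elim: n t => [|n IH] t t0.
    apply: (@pd (fun t => u 1%N t - u 0%N t) (fun t => F z0 - 0)) => //.
    - move=> b; apply: cdB; first exact: du.
      split; [by move=> ?; exact: cvg_cst|by move=> ?; exact: cvg_cst|].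
      by move=> s _; split; exact: is_derive_cst.
    - by rewrite !u0// subrr.
    - move=> s s0; rewrite subr0 /k expr0 mulr1 divfK ?mulf_neq0// ?gt_eqF//.
      rewrite ler_peMr// -expR0 ler_expR !mulr_ge0// ltW//.
  apply: (@pd (fun t => u n.+2 t - u n.+1 t) (fun t => F (u n.+1 t) - F (u n t))) => //.
  - by move=> b; apply: cdB; exact: du.
  - by rewrite !u0// subrr.
  - move=> s s0; apply: le_trans (HL _ _) _.
    by rewrite mulrA kS [k n * L]mulrC -mulrA ler_pM2l//; exact/IH/ltW.
(* For negative times all iterates equal [z0], hence the weight at [Num.max t 0]. *)
have lim t : exists z, forall n, `|u n t - z| <= 2 * k n * E (Num.max t 0).
  pose e := E (Num.max t 0); have e0 : 0 <= e by exact: E0.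
  have st n : `|u n.+1 t - u n t| <= k n * e.
    rewrite /e; have [t0|t0] := leP t 0; last exact/step/ltW.
    by rewrite !u0// subrr normr0 mulr_ge0.
  have mono (a : nat -> R) : (forall n, `|a n.+1 - a n| <= k n * e) ->
      exists z : R, forall n, `|a n - z| <= 2 * k n * e.
    move=> Ha.
    have [||n|z Hz] := @squeeze_limit (fun n => a n + 2 * k n * e) (fun n => a n - 2 * k n * e).
    - move=> n; have := Ha n; rewrite ler_norml -(kS n) => /andP[+ _]; nra.
    - move=> n; have := Ha n; rewrite ler_norml -(kS n) => /andP[_]; nra.
    - have := mulr_ge0 (k0 n) e0; lra.
    - exists z => n; have /andP[] := Hz n; rewrite ler_norml => h1 h2.
      by apply/andP; split; lra.
  have [n|z1 H1] := mono (fun n => (u n t).1).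
    by apply: le_trans (st n); exact: (pnorm1 (u n.+1 t - u n t)).
  have [n|z2 H2] := mono (fun n => (u n t).2).
    by apply: le_trans (st n); exact: (pnorm2 (u n.+1 t - u n t)).
  by exists (z1, z2) => n; rewrite pnorm_le /= H1 H2.
have [g Hg] := choice lim.
have small (B : R) e : 0 < e -> exists n, 2 * k n * B < e.
  move=> e0.
  have : (fun n => geometric (2 * M * B) 2^-1 n) @ \oo --> (0 : R).
    by apply: cvg_geometric; rewrite ger0_norm// invf_lt1// ltr1n.
  move=> /cvgrPdist_lt /(_ e e0)[N _ /(_ N (leqnn N))]; rewrite /= sub0r normrN => h.
  exists N; apply: le_lt_trans h; apply: le_trans (ler_norm _).
  by rewrite /k le_eqVlt; apply/orP; left; apply/eqP; ring.
have g0 t : t <= 0 -> g t = z0.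
  move=> t0; apply/eqP; rewrite eq_sym -subr_eq0 -normr_eq0 eq_le normr_ge0 andbT.
  apply/ler_addgt0Pl => e /(small (E (Num.max t 0)))[n /ltW hn]; rewrite addr0.
  by rewrite -(u0 n t)//; exact: le_trans (Hg t n) hn.
have gub (b t : R) n : 0 <= b -> t <= b -> `|u n t - g t| <= 2 * k n * E b.
  move=> b0 tb; apply: le_trans (Hg t n) _; rewrite ler_wpM2l//; first exact: mulr_ge0.
  by rewrite ler_expR ler_pM2l ?mulr_gt0// ge_max tb.
have cg : ct g.
  suff H t e : 0 < e -> exists2 d : R, 0 < d & forall s, `|s - t| < d -> `|g s - g t| < e.
    split=> t; apply: ed_cont => e /(H t)[d d0 Hd]; exists d => // s /Hd.
      by apply: le_lt_trans; exact: (pnorm1 (g s - g t)).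
    by apply: le_lt_trans; exact: (pnorm2 (g s - g t)).
  move=> e0; have e3 : 0 < e / 3 by rewrite divr_gt0.
  pose b := Num.max (t + 1) 0.
  have [n hn] := small (E b) _ e3.
  have b0 : 0 <= b by rewrite le_max lexx orbT.
  have tb : t + 1 <= b by rewrite le_max lexx.
  have [c1 c2] := cu n.
  have [d1 d10 H1] := cont_ed (c1 t) e3; have [d2 d20 H2] := cont_ed (c2 t) e3.
  exists (Num.min 1 (Num.min d1 d2)) => [|s]; first by rewrite !lt_min ltr01 d10.
  rewrite !lt_min => /and3P[s1 /H1 h1 /H2 h2].
  have sb : s <= b by apply: le_trans tb; move: s1; rewrite ltr_norml => /andP[_]; lra.
  have tb' : t <= b by apply: le_trans tb; rewrite lerDl.
  have -> : g s - g t = (u n s - u n t) - (u n s - g s) + (u n t - g t).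
    by ring.
  apply: le_lt_trans (ler_normD _ _) _.
  have := gub b t n b0 tb'; have := gub b s n b0 sb.
  have : `|u n s - u n t| < e / 3 by rewrite pnorm_lt h1.
  have := ler_normB (u n s - u n t) (u n s - g s); lra.
have [co1 co2 co3] := op1 g cg.
exists g; split; first exact: g0.
suff E1 : op g = g by move=> b; have := co3 b; rewrite E1.
apply/funext => t; have [t0|t0] := leP t 0; first by rewrite co2// g0.
apply/eqP; rewrite -subr_eq0 -normr_eq0 eq_le normr_ge0 andbT.
apply/ler_addgt0Pl => e e0; rewrite addr0.
have [n hn] := small (E t) e e0.
have h1 : `|u n.+1 t - op g t| <= k n * E t.
  apply: (@pd (fun t => u n.+1 t - op g t) (fun t => F (u n t) - F (g t))) => //; last exact: ltW.
  - by move=> b; apply: cdB; [exact: du|exact: co3].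
  - by rewrite u0// co2// subrr.
  - move=> s s0; apply: le_trans (HL _ _) _.
    rewrite (_ : k n * (2 * L) * E s = L * (2 * k n * E s)); last by ring.
    by have := Hg s n; rewrite max_l ?(ltW s0)// ler_pM2l.
have h2 : `|u n.+1 t - g t| <= k n * E t.
  by have := Hg t n.+1; rewrite max_l ?(ltW t0)// [2 * _]mulrC kS.
have -> : op g t - g t = (u n.+1 t - g t) - (u n.+1 t - op g t).
  by ring.
by have := ler_normB (u n.+1 t - g t) (u n.+1 t - op g t); lra.
Qed.

End Plane.

(** * Passages to the line {x = 0} *)

Section Passages.
Variable R : realType.
Implicit Types (z w : R * R) (e t s a b c d y L M m r : R) (F : R * R -> R * R) (g : R -> R * R)
  (V : set (R * R)).

(** Compactness in the form used below: a property that holds near each point with some margin, and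
    persists for smaller margins, holds with one margin on the whole interval. *)
Lemma unif_pos a b (Q : R -> R -> Prop) :
  (forall t d d', 0 < d' -> d' <= d -> Q d t -> Q d' t) ->
  (forall t, a <= t <= b -> exists2 d : R, 0 < d & forall s, a <= s <= b -> `|s - t| < d -> Q d s) ->
  exists2 d : R, 0 < d & forall t, a <= t <= b -> Q d t.
Proof.
move=> mono loc.
have /compact_near_coveringP cov : compact `[a, b] by exact: segment_compact.
have [t tab|] := cov R (0^'+) (fun d t => a <= t <= b -> Q d t) _.
  move: tab; rewrite /= in_itv /= => /loc[d d0 Hd].
  exists ([set s | `|s - t| < d], [set e | 0 < e < d]) => /=.
    split; first by apply/nbhs_ballP; exists d => //= s; rewrite /ball /= distrC.
    exists d => //= e; rewrite /= sub0r normrN => ed e0.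
    by rewrite e0 /= (le_lt_trans (ler_norm _) ed).
  by move=> [s e] /= [sd /andP[e0 ed]] sab; apply: mono (Hd s sab sd) => //; exact: ltW.
move=> d /= d0 H; exists (d / 2); first by rewrite divr_gt0.
move=> t tab; apply: (H (d / 2)) => //=.
- by rewrite sub0r normrN ger0_norm ?divr_ge0 ?ltW// ltr_pdivrMr// mulr_natr mulr2n ltrDr.
- by rewrite divr_gt0.
Qed.

Lemma curve_ed g t e : continuous (fun t => (g t).1) -> continuous (fun t => (g t).2) ->
  0 < e -> exists2 d : R, 0 < d & forall s, `|s - t| < d -> `|g s - g t| < e.
Proof.
move=> c1 c2 e0.
have [d1 d10 H1] := cont_ed (c1 t) e0; have [d2 d20 H2] := cont_ed (c2 t) e0.
exists (Num.min d1 d2) => [|s]; first by rewrite lt_min d10.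
by rewrite lt_min => /andP[/H1 h1 /H2 h2]; rewrite pnorm_lt h1.
Qed.

Lemma open_ball V z : open V -> V z -> exists2 e : R, 0 < e & forall w, `|w - z| < e -> V w.
Proof.
move=> oV Vz; have : nbhs z V by exact: open_nbhs_nbhs.
move=> /nbhs_ballP[e /= e0 He]; exists e => // w we; apply: He.
by rewrite -ball_normE /= distrC.
Qed.

Lemma pball_open z e : open [set w | `|w - z| < e].
Proof.
rewrite openE => w /= wz; apply/nbhs_ballP; exists (e - `|w - z|) => /=.
  by rewrite subr_gt0.
move=> u; rewrite -ball_normE /= => h.
rewrite (_ : u - z = (w - z) - (w - u)); last by ring.
by apply: le_lt_trans (ler_normB _ _) _; lra.
Qed.

Lemma tube g V a b : continuous (fun t => (g t).1) -> continuous (fun t => (g t).2) ->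
  open V -> (forall t, a <= t <= b -> V (g t)) ->
  exists2 d : R, 0 < d & forall t, a <= t <= b -> forall w, `|w - g t| < d -> V w.
Proof.
move=> c1 c2 oV Vg; apply: unif_pos => [t d d' _ dd' H w wd|t tab].
  by apply: H; exact: lt_le_trans wd dd'.
have [e e0 He] := open_ball oV (Vg t tab).
have e2 : 0 < e / 2 by rewrite divr_gt0.
have [d d0 Hd] := curve_ed t c1 c2 e2.
exists (Num.min d (e / 2)) => [|s _]; first by rewrite lt_min d0.
rewrite lt_min => /andP[/Hd sd _] w; rewrite lt_min => /andP[_ wd].
apply: He; rewrite (_ : w - g t = (w - g s) + (g s - g t)); last by ring.
by apply: le_lt_trans (ler_normD _ _) _; lra.
Qed.

Lemma curve_bounded g a b : continuous (fun t => (g t).1) -> continuous (fun t => (g t).2) ->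
  exists2 M : R, 0 < M & forall t, a <= t <= b -> `|g t| <= M.
Proof.
move=> c1 c2.
have [t d d' d0 dd' H|t tab|d d0 Hd] := @unif_pos a b (fun d t => `|g t| <= d^-1).
- by apply: le_trans H _; rewrite lef_pV2// posrE// (lt_le_trans d0).
- have [d d0 Hd] := curve_ed t c1 c2 ltr01.
  have M0 : 0 < `|g t| + 1 by rewrite ltr_wpDl.
  exists (Num.min d (`|g t| + 1)^-1); first by rewrite lt_min d0 invr_gt0.
  move=> s _; rewrite lt_min => /andP[/Hd gs _].
  have h : `|g s| <= `|g t| + 1.
    rewrite (_ : g s = (g s - g t) + g t); last by ring.
    by apply: le_trans (ler_normD _ _) _; lra.
  apply: le_trans h _; rewrite -[leLHS]invrK lef_pV2 ?posrE ?invr_gt0//.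
    by rewrite ge_min lexx orbT.
  by rewrite lt_min d0 invr_gt0.
- by exists d^-1 => //; rewrite invr_gt0.
Qed.

Lemma pos_min (f : R -> R) a b : continuous f -> (forall t, a <= t <= b -> 0 < f t) ->
  exists2 m : R, 0 < m & forall t, a <= t <= b -> m <= f t.
Proof.
move=> cf fp; apply: unif_pos => [t d d' _ dd' H|t tab]; first exact: le_trans dd' H.
have f2 : 0 < f t / 2 by rewrite divr_gt0// fp.
have [d d0 Hd] := cont_ed (cf t) f2.
exists (Num.min d (f t / 2)) => [|s _]; first by rewrite lt_min d0.
rewrite lt_min => /andP[/Hd + _]; rewrite ltr_norml => /andP[h _].
by rewrite ge_min; apply/orP; right; lra.
Qed.

Definition lipbox F := forall r : R, exists2 L : R, 0 < L &
  forall z w, `|z| <= r -> `|w| <= r -> `|F z - F w| <= L * `|z - w|.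

(** Composition with the retraction onto a box makes a field that is Lipschitz on boxes globally
    Lipschitz; solutions staying in the box are unaffected, so [picard] applies. *)
Definition clamp (r x : R) := Num.max (- r) (Num.min r x).
Definition clamp2 (r : R) z := (clamp r z.1, clamp r z.2).

Lemma clampE (r x : R) : `|x| <= r -> clamp r x = x.
Proof.
rewrite ler_norml /clamp => /andP[h1 h2].
by rewrite (min_r h2) max_r.
Qed.

Lemma clamp_le (r x : R) : 0 <= r -> `|clamp r x| <= r.
Proof.
move=> r0; rewrite ler_norml /clamp le_max lexx /= ge_max ge_min lexx /= andbT.
by rewrite (le_trans _ r0)// oppr_le0.
Qed.

Lemma clamp_lip (r x y : R) : 0 <= r -> `|clamp r x - clamp r y| <= `|x - y|.
Proof.
move=> r0; wlog xy : x y / x <= y.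
  move=> H; case: (leP x y) => [/H//|/ltW/H].
  by rewrite distrC => h; apply: le_trans h _; rewrite distrC.
rewrite [leRHS]distrC [leLHS]distrC [leRHS]ger0_norm ?subr_ge0//.
rewrite /clamp /Num.max /Num.min.
by repeat case: ifP => /=; rewrite ?ltNge => *; rewrite ler_norml; apply/andP; split; lra.
Qed.

Lemma clamp2E (r : R) z : `|z| <= r -> clamp2 r z = z.
Proof.
by rewrite pnorm_le /clamp2 => /andP[/clampE -> /clampE ->]; case: z.
Qed.

Lemma clamp2_le (r : R) z : 0 <= r -> `|clamp2 r z| <= r.
Proof. by move=> r0; rewrite pnorm_le /= !clamp_le. Qed.

Lemma clamp2_lip (r : R) z w : 0 <= r -> `|clamp2 r z - clamp2 r w| <= `|z - w|.
Proof.
move=> r0; rewrite pnorm_le /=.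
rewrite (le_trans (clamp_lip _ _ r0) (pnorm1 (z - w))).
by rewrite (le_trans (clamp_lip _ _ r0) (pnorm2 (z - w))).
Qed.

Lemma lipbox_clamp F (r : R) : 0 <= r -> lipbox F ->
  exists2 L : R, 0 < L & forall z w, `|F (clamp2 r z) - F (clamp2 r w)| <= L * `|z - w|.
Proof.
move=> r0 /(_ r)[L L0 HL]; exists L => // z w.
apply: le_trans (HL _ _ (clamp2_le _ r0) (clamp2_le _ r0)) _.
by rewrite ler_pM2l// clamp2_lip.
Qed.

(** The exit has to be transverse, and a start on the line has to point inwards. The degenerate case
    [T = 0] is kept because the tail of an arc, cut at its end, must again be an arc. *)
Record parc V F z y (T : R) g : Prop := Arc {
  arc_T : 0 <= T;
  arc_0 : g 0 = z;
  arc_end : g T = (0, y);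
  arc_D : curve_derive g (F \o g) 0 T;
  arc_pos : forall t, 0 < t < T -> 0 < (g t).1;
  arc_V : forall t, 0 <= t <= T -> V (g t);
  arc_exit : (F (0, y)).1 < 0;
  arc_start : [\/ T = 0, 0 < z.1 | z.1 = 0 /\ 0 < (F z).1] }.

Definition pass V F z y := exists T g, parc V F z y T g.

(** One number bounds the error and, through its inverse, fixes the box: these are basic
    neighbourhoods for uniform convergence on compact sets. *)
Definition fclose (r : R) F F' := forall z, `|z| <= r^-1 -> `|F' z - F z| <= r.

End Passages.

(** * Stability of passages under perturbation of the field *)

Section Perturbation.
Variable R : realType.
Implicit Types (z w : R * R) (e t s a b c d y L M m r : R) (F : R * R -> R * R) (g : R -> R * R)
  (V : set (R * R)).

Lemma curve_deriveS g dg a b c d : curve_derive g dg a b -> a <= c -> d <= b ->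
  curve_derive g dg c d.
Proof.
move=> [c1 c2 D] ac db; split=> // t /andP[h1 h2]; apply: D.
by rewrite (le_lt_trans ac h1) (lt_le_trans h2 db).
Qed.

Lemma curve_derive_eq g dg dh a b : curve_derive g dg a b ->
  (forall t, a < t < b -> dg t = dh t) -> curve_derive g dh a b.
Proof. by move=> [c1 c2 D] E; split=> // t /[dup] /D h /E <-. Qed.

Lemma curve_uniq F g h (T : R) : lipbox F -> g 0 = h 0 ->
  curve_derive g (F \o g) 0 T -> curve_derive h (F \o h) 0 T ->
  forall t, 0 <= t <= T -> g t = h t.
Proof.
move=> lF E0 Dg Dh t tT.
have [g1 g2 _] := Dg; have [h1 h2 _] := Dh.
have [M M0 HM] := curve_bounded 0 T g1 g2; have [N N0 HN] := curve_bounded 0 T h1 h2.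
have [L L0 HL] := lF (Num.max M N).
have := gronwall (ltW L0) (lexx 0) Dg Dh _ _ tT.
rewrite mulr0 mul0r E0 subrr normr0 => H.
apply/esym/eqP; rewrite -subr_eq0 -normr_eq0 eq_le normr_ge0 andbT; apply: H => // s /andP[s0 sT].
have sT' : 0 <= s <= T by rewrite !ltW.
by rewrite addr0; apply: HL; rewrite le_max ?HM ?HN ?orbT.
Qed.

Lemma lipbox_cont F z e : lipbox F -> 0 < e ->
  exists2 d : R, 0 < d & forall w, `|w - z| < d -> `|F w - F z| < e.
Proof.
move=> /(_ (`|z| + 1))[L L0 HL] e0.
exists (Num.min 1 (e / L)) => [|w]; first by rewrite lt_min ltr01 divr_gt0.
rewrite lt_min => /andP[w1 wL].
have wz : `|w| <= `|z| + 1.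
  rewrite (_ : w = (w - z) + z); last by ring.
  by apply: le_trans (ler_normD _ _) _; qlra.
apply: le_lt_trans (HL _ _ wz _) _; first by rewrite lerDl.
by rewrite mulrC -ltr_pdivlMr.
Qed.

(** A start on the line leaves no room for a distance bound: there positivity comes from the
    derivative up to some [s0], and afterwards from a positive minimum of the reference arc. The
    time [ta], within [d] of [T], leaves the rest to [end_phase]. *)
Lemma start_phase (x fx : R -> R) (T d : R) : 0 < T -> 0 < d -> continuous x -> continuous fx ->
  (forall t, 0 < t < T -> 0 < x t) -> 0 < x 0 \/ (x 0 = 0 /\ 0 < fx 0) ->
  exists ta k, [/\ 0 < ta < T, T - d < ta, 0 < k & forall h dh : R -> R, continuous h ->
    (forall t, 0 < t < ta -> is_derive t 1 h (dh t)) ->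
    (forall t, 0 <= t <= ta -> `|h t - x t| <= k) ->
    (forall t, 0 < t < ta -> `|dh t - fx t| <= k) -> 0 <= h 0 ->
    (forall t, 0 < t <= ta -> 0 < h t) /\ (0 < h 0 \/ k < fx 0)].
Proof.
move=> T0 d0 cx cfx xp St.
pose ta := Num.max (T / 2) (T - d / 2).
have taT : 0 < ta < T.
  by rewrite /ta lt_max gt_max; apply/andP; split; [apply/orP; left; qlra|apply/andP; split; qlra].
have dta : T - d < ta by rewrite /ta lt_max; apply/orP; right; qlra.
have [ta0 taT'] := andP taT.
case: St => [x0|[x0 fx0]].
  have [t tta|m m0 Hm] := @pos_min R x 0 ta cx.
    case: (eqVneq t 0) => [->//|tn0]; apply: xp.
    by move: tta => /andP[t0 tt]; rewrite lt_neqAle eq_sym tn0 t0 (le_lt_trans tt taT').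
  exists ta, (m / 2); split=> // [|h dh ch Dh hx _ h0]; first qlra.
  have H t : 0 <= t <= ta -> 0 < h t.
    by move=> tt; have := Hm _ tt; have := hx _ tt; rewrite ler_norml => /andP[]; qlra.
  split; first by move=> t /andP[t0 tt]; apply: H; rewrite (ltW t0).
  by left; apply: H; rewrite lexx ltW.
have fx2 : 0 < fx 0 / 2 by qlra.
have [sg sg0 Hsg] := cont_ed (cfx 0) fx2.
pose s0 := Num.min (sg / 2) ta.
have s00 : 0 < s0 by rewrite lt_min ta0 andbT; qlra.
have s0ta : s0 <= ta by rewrite ge_min lexx orbT.
have [t /andP[h1 h2]|m m0 Hm] := @pos_min R x s0 ta cx.
  by apply: xp; rewrite (lt_le_trans s00 h1) (le_lt_trans h2 taT').
exists ta, (Num.min (m / 2) (fx 0 / 4)); split=> // [|h dh ch Dh hx Hdh h0].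
  by rewrite lt_min; apply/andP; split; qlra.
split; last by right; rewrite gt_min; apply/orP; right; qlra.
move=> t /andP[t0 tt]; have [ts|st] := leP t s0; last first.
  have tt' : 0 <= t <= ta by rewrite (ltW t0).
  have tt'' : s0 <= t <= ta by rewrite (ltW st).
  have := Hm _ tt''; have := hx _ tt'.
  by rewrite le_min => /andP[]; rewrite ler_norml => /andP[]; qlra.
apply: le_lt_trans h0 _; apply: (@mvt_lt R h dh) => // s /andP[s0' st].
  by apply: Dh; rewrite s0' (lt_le_trans st).
have sta : 0 < s < ta by rewrite s0' (lt_le_trans st).
have := Hdh _ sta; rewrite le_min => /andP[_]; rewrite ler_norml => /andP[hs _].
have : `|s - 0| < sg.
  rewrite subr0 ger0_norm ?ltW//; apply: lt_le_trans st _; apply: le_trans ts _.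
  by rewrite ge_min; apply/orP; left; qlra.
by move=> /Hsg; rewrite ltr_norml => /andP[]; qlra.
Qed.

Lemma end_phase (h dh : R -> R) (ta tb : R) : ta <= tb -> continuous h ->
  (forall t, ta < t < tb -> is_derive t 1 h (dh t)) -> (forall t, ta < t < tb -> dh t < 0) ->
  0 <= h ta -> h tb < 0 ->
  exists T, [/\ ta <= T < tb, h T = 0 & forall t, ta <= t < T -> 0 < h t].
Proof.
move=> tab ch Dh dh0 ha hb.
have [|T /andP[h1 h2] hT] := @ivt_dec R h ta tb 0 tab ch; first by rewrite ha ltW.
have TB : T < tb by rewrite lt_neqAle h2 andbT; apply: contraPneq hT => ->; qlra.
exists T; split; rewrite ?h1// => t /andP[at_ tT].
rewrite -oppr_lt0 -[X in _ < X]oppr0 -hT.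
apply: (@mvt_lt R (fun t => - h t) (fun t => - dh t)) => //.
- by move=> s; apply: cvgN; exact: ch.
- move=> s /andP[ts sT]; have ? : is_derive s 1 h (dh s).
    by apply: Dh; rewrite (le_lt_trans at_ ts) (lt_trans sT TB).
  exact: is_deriveN.
- move=> s /andP[ts sT]; rewrite oppr_gt0; apply: dh0.
  by rewrite (le_lt_trans at_ ts) (lt_trans sT TB).
Qed.

(** The reference arc is continued past its exit by a clamped field, since perturbed arcs may leave
    later. Gronwall keeps the perturbed solution close up to [T + d]; the start and end phases then
    give positivity and an exit. *)
Lemma arc_perturb V F z0 (y1 e T : R) g : open V -> lipbox F -> parc V F z0 y1 T g -> 0 < e ->
  exists2 r : R, 0 < r & forall F', lipbox F' -> fclose r F F' -> forall z, `|z - z0| <= r ->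
    0 <= z.1 -> exists y T' h, [/\ `|y - y1| < e, `|T' - T| < e & parc V F' z y T' h].
Proof.
move=> oV lF [T0 g0 gT Dg gp gV Fe St] e0.
have [g1 g2 _] := Dg.
have [M M0 HM] := curve_bounded 0 T g1 g2.
pose r0 := M + 1; have r00 : 0 <= r0 by rewrite addr_ge0// ltW.
have [L L0 HL] := lipbox_clamp r00 lF.
have [G [G0 DG]] := picard z0 L0 HL.
have [G1 G2 _] := DG 0.
have EG t : 0 <= t <= T -> G t = g t.
  move=> tT; have DgT : curve_derive g ((F \o clamp2 r0) \o g) 0 T.
    apply: curve_derive_eq Dg _ => s /andP[s0 sT] /=; rewrite clamp2E//.
    by apply: le_trans (HM s _) _; rewrite ?(ltW s0) ?(ltW sT)// lerDl.
  have H0 : `|G 0 - g 0| <= 0 by rewrite G0 g0 subrr normr0.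
  have H : `|G t - g t| <= 0.
    have := gronwall (ltW L0) (lexx 0) DgT (DG T) _ H0 tT.
    by rewrite mulr0 mul0r; apply=> s _; rewrite addr0; exact: HL.
  by apply/eqP; rewrite -subr_eq0 -normr_eq0 eq_le normr_ge0 andbT.
pose FG t := (F (clamp2 r0 (G t))).1.
have cFG : continuous FG by have [] := lip_comp_cont L0 HL G1 G2.
have TT : 0 <= T <= T by rewrite lexx T0.
have GT : G T = (0, y1) by rewrite EG.
have MT t : 0 <= t <= T -> `|G t| <= M by move=> tT; rewrite EG// HM.
have [c c0 FGT] : exists2 c : R, 0 < c & FG T = - 3 * c.
  exists (- (F (0, y1)).1 / 3); first by qlra.
  rewrite /FG GT clamp2E; first by field.
  by rewrite -GT (le_trans (MT T _))// lerDl.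
have [v v0 Hv] : exists2 v : R, 0 < v & forall w, `|w - G T| < v -> V w.
  by apply: open_ball => //; rewrite EG//; apply: gV.
have m20 : 0 < Num.min (v / 2) (Num.min (1 / 2) (e / 2)) by rewrite !lt_min !divr_gt0.
have [d1 d10 Hd1] := curve_ed T G1 G2 m20.
have [d2 d20 Hd2] := cont_ed (cFG T) c0.
have [d [d0 dd1 dd2 de]] : exists d : R, [/\ 0 < d, d < d1, d < d2 & d < e].
  pose m := Num.min e (Num.min d1 d2).
  have m_0 : 0 < m by rewrite !lt_min e0 d10.
  have h0 : m <= e by rewrite !ge_min lexx.
  have h1 : m <= d1 by rewrite !ge_min lexx orbT.
  have h2 : m <= d2 by rewrite !ge_min lexx !orbT.
  by exists (m / 2); split; clear -m_0 h0 h1 h2; lra.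
pose GV t := [/\ `|G t| <= M + 1 / 2, FG t < - 2 * c, `|G t - G T| < v / 2 & `|G t - G T| < e / 2].
have HGV t : `|t - T| <= d -> GV t.
  move=> td; have := Hd1 t (le_lt_trans td dd1); rewrite !lt_min => /and3P[h1 h2 h3].
  split=> //.
    rewrite (_ : G t = (G t - G T) + G T); last by ring.
    by rewrite [leRHS]addrC; apply: le_trans (ler_normD _ _) _; apply: lerD; [exact: ltW|exact: MT].
  have := Hd2 t (le_lt_trans td dd2); rewrite FGT ltr_norml => /andP[_]; qlra.
(* For [T = 0] the start phase is empty and its constants are dummies. *)
have [ta [k [ta0 dta taT k0 Hk]]] : exists ta k, [/\ 0 <= ta, T - d <= ta, ta <= T, 0 < k &
   forall h dh : R -> R, continuous h ->
    (forall t, 0 < t < ta -> is_derive t 1 h (dh t)) ->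
    (forall t, 0 <= t <= ta -> `|h t - (G t).1| <= k) ->
    (forall t, 0 < t < ta -> `|dh t - FG t| <= k) -> 0 <= h 0 ->
    (forall t, 0 < t <= ta -> 0 < h t) /\ (0 < T -> 0 < ta /\ (0 < h 0 \/ k < FG 0))].
  move: T0; rewrite le_eqVlt => /predU1P[<-|T0].
    exists 0, 1; split=> //; first by rewrite sub0r oppr_le0 ltW.
    move=> h dh _ _ _ _ _; split=> [t|]; last by rewrite ltxx.
    by move=> /andP[a b]; have := lt_le_trans a b; rewrite ltxx.
  have [||ta [k [/andP[ta0 taT] dta k0 Hk]]] := @start_phase (fun t => (G t).1) FG T d T0 d0 G1 cFG.
  - move=> t /andP[t0 tT]; rewrite EG ?(ltW t0) ?(ltW tT)//.
    by apply: gp; rewrite t0.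
  - rewrite G0; case: St => [T00|z1|[z1 z2]]; first by rewrite T00 ltxx in T0.
      by left.
    right; split=> //; rewrite /FG G0 clamp2E//.
    by rewrite -g0 (le_trans (HM 0 _)) ?lexx ?(ltW T0)// lerDl.
  exists ta, k; split=> //; [exact: ltW|exact: ltW|exact: ltW|].
  by move=> h dh ch Dh hx Hdh h0; have [] := Hk h dh ch Dh hx Hdh h0.
have [u u0 Hu] : exists2 u : R, 0 < u & forall t, 0 <= t <= T -> forall w, `|w - G t| < u -> V w.
  by apply: tube => // t tT; rewrite EG//; apply: gV.
pose tb := T + d; pose K := 2 * expR ((4 * L + 2) * tb).
have K0 : 0 < K by rewrite mulr_gt0// expR_gt0.
have cd0 : 0 < c * d by exact: mulr_gt0.
have [m [m0 mk mu mv [me m2 mcd mc]]] : exists m : R, [/\ 0 < m, m <= k, m < u, m <= v / 2 &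
    [/\ m <= e / 2, m <= 1 / 2, m <= c * d & m <= c / 2]].
  pose m := Num.min (Num.min (Num.min k (u / 2)) (Num.min (v / 2) (e / 2)))
                  (Num.min (Num.min (1 / 2) (c * d)) (c / 2)).
  have mu : m <= u / 2 by rewrite !ge_min lexx !orbT.
  exists m; split; last by split; rewrite !ge_min lexx ?orbT.
  - by rewrite !lt_min k0 cd0 !divr_gt0.
  - by rewrite !ge_min lexx.
  - qlra.
  - by rewrite !ge_min lexx !orbT.
have [r [r_0 rK rKL rr0]] : exists r : R, [/\ 0 < r, r * K <= m, r + L * (r * K) <= m & r0 <= r^-1].
  have KL0 : 0 < K * L by exact: mulr_gt0.
  have KL : 0 < K * (L + 1) + 1 by clear -KL0 K0; lra.
  pose r := Num.min (m / (K * (L + 1) + 1)) (r0 + 1)^-1.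
  have r01 : 0 < r0 + 1 by rewrite ltr_wpDl.
  have r_0 : 0 < r by rewrite lt_min divr_gt0//= invr_gt0.
  have rm : r * (K * (L + 1) + 1) <= m by rewrite -ler_pdivlMr// ge_min lexx.
  exists r; split=> //.
  - by apply: le_trans rm; rewrite ler_pM2l//; clear -KL0; lra.
  - apply: le_trans rm; rewrite (_ : r + L * (r * K) = r * (K * L + 1)); last by ring.
    by rewrite ler_pM2l//; clear -K0; lra.
  - apply: (@le_trans _ _ (r0 + 1)); first by rewrite lerDl.
    by rewrite -[leLHS]invrK lef_pV2 ?posrE ?invr_gt0// ge_min lexx orbT.
exists r => // F' lF' clF z zz0 z0x.
have [L' L'0 HL'] := lipbox_clamp r00 lF'.
have [h [h0 Dh]] := picard z L'0 HL'.
have [h1 h2 _] := Dh 0.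
have FF t : `|(F' \o clamp2 r0 \o h) t - (F \o clamp2 r0 \o G) t| <= L * `|h t - G t| + r.
  rewrite /= (_ : F' (clamp2 r0 (h t)) - F (clamp2 r0 (G t)) =
     (F (clamp2 r0 (h t)) - F (clamp2 r0 (G t))) +
     (F' (clamp2 r0 (h t)) - F (clamp2 r0 (h t)))); last by ring.
  apply: le_trans (ler_normD _ _) _; apply: lerD; first exact: HL.
  by apply: clF; apply: le_trans (clamp2_le _ r00) _.
have hG t : 0 <= t <= tb -> `|h t - G t| <= m.
  move=> tb_; have ttb := andP tb_; apply: le_trans rK.
  have H0 : `|h 0 - G 0| <= r by rewrite h0 G0.
  apply: le_trans (gronwall (ltW L0) (ltW r_0) (DG tb) (Dh tb) (fun t _ => FF t) H0 tb_) _.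
  rewrite /K mulrA [r * 2]mulrC ler_pM2l ?mulr_gt0// ler_expR subr0.
  have L42 : 0 < 4 * L + 2 by clear -L0; lra.
  by rewrite (ler_pM2l L42) ttb.2.
have dhG t : 0 <= t <= tb -> `|(F' (clamp2 r0 (h t))).1 - FG t| <= m.
  move=> tb_; apply: le_trans (pnorm1 (F' (clamp2 r0 (h t)) - F (clamp2 r0 (G t)))) _.
  apply: le_trans (FF t) _; apply: le_trans rKL.
  rewrite addrC lerD2l ler_pM2l//; have := gronwall (ltW L0) (ltW r_0) (DG tb) (Dh tb) (fun t _ => FF t) _ tb_.
  rewrite h0 G0 => /(_ zz0) H; apply: le_trans H _.
  rewrite /K mulrA [r * 2]mulrC ler_pM2l ?mulr_gt0// ler_expR subr0.
  have L42 : 0 < 4 * L + 2 by clear -L0; lra.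
  by rewrite (ler_pM2l L42); case/andP: tb_.
have tatb : ta <= tb by rewrite /tb; clear -taT d0; lra.
have Dh1 b t : 0 < t < b -> is_derive t 1 (fun t => (h t).1) (F' (clamp2 r0 (h t))).1.
  by have [_ _ H] := Dh b; move=> /H[].
have [|||hp hst] := Hk (fun t => (h t).1) (fun t => (F' (clamp2 r0 (h t))).1) h1 (Dh1 ta).
- move=> t /andP[t0 tt]; apply: le_trans (pnorm1 (h t - G t)) _.
  by apply: le_trans (hG t _) mk; rewrite t0 (le_trans tt).
- move=> t /andP[t0 tt]; apply: le_trans (dhG t _) mk.
  by rewrite (ltW t0) (le_trans (ltW tt)).
- by rewrite h0.
have tabd t : ta <= t <= tb -> `|t - T| <= d.
  by move=> /andP[h3 h4]; rewrite ler_norml; apply/andP; split; rewrite /tb in h4; clear -h3 h4 dta; lra.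
have dneg t : ta <= t <= tb -> (F' (clamp2 r0 (h t))).1 < - c.
  move=> /[dup] tt /andP[h3 h4]; have [_ + _ _] := HGV t (tabd t tt).
  have := dhG t; rewrite (le_trans ta0 h3) h4 => /(_ isT); rewrite ler_norml => /andP[_].
  clear -mc c0; lra.
have Dtab t : ta < t < tb -> is_derive t 1 (fun t => (h t).1) (F' (clamp2 r0 (h t))).1.
  by move=> /andP[h3 h4]; apply: (Dh1 tb); rewrite (le_lt_trans ta0 h3).
have [|||T' [/andP[taT' T'b] hT' hpos]] := @end_phase (fun t => (h t).1) _ ta tb tatb h1 Dtab.
- by move=> t /andP[h3 h4]; apply: lt_trans (dneg t _) _; rewrite ?(ltW h3) ?(ltW h4)// oppr_lt0.
- move: ta0; rewrite le_eqVlt => /predU1P[<-|ta0]; first by rewrite h0.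
  by apply/ltW/hp; rewrite ta0 lexx.
(* A time [d] past the exit the reference is at depth at least [2 c d] while the error is at most
   [c d], so the perturbed curve has crossed. *)
- have GT2 : (G tb).1 <= - (2 * c) * d.
    have : (G tb).1 - (G T).1 <= - (2 * c) * (tb - T).
      have Ttb : T <= tb by rewrite /tb lerDl ltW.
      apply: (@mvt_le R (fun t => (G t).1) FG T tb _ Ttb G1).
        move=> t /andP[Tt tt]; have [_ _ H] := DG tb.
        by have [] := H t; rewrite ?tt ?(le_lt_trans T0 Tt).
      move=> t /andP[Tt tt]; have tt' : ta <= t <= tb by rewrite (le_trans taT (ltW Tt)) ltW.
      by have [_ + _ _] := HGV t (tabd t tt') => /ltW; rewrite mulNr.
    by rewrite GT /= subr0 (_ : tb - T = d)// /tb; ring.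
  have := hG tb; rewrite lexx andbT /tb => /(_ (addr_ge0 T0 (ltW d0))).
  move=> /(le_trans (pnorm1 _)) /=; rewrite ler_norml -/tb => /andP[_].
  clear -cd0 GT2 mcd; lra.
have T'0 : 0 <= T' by exact: le_trans taT'.
have T'T : `|T' - T| <= d by apply: tabd; rewrite taT' ltW.
have T't : 0 <= T' <= tb by rewrite T'0 ltW.
have hbd t : 0 <= t <= T' -> `|h t| <= r0.
  move=> /andP[t0 tt]; rewrite (_ : h t = (h t - G t) + G t); last by ring.
  apply: le_trans (ler_normD _ _) _.
  have h3 : `|h t - G t| <= m by apply: hG; rewrite t0 (le_trans tt (ltW T'b)).
  suff : `|G t| <= M + 1 / 2 by rewrite /r0; clear -h3 m2; lra.
  case/orP: (le_total t T) => [tT|Tt]; first by apply: le_trans (MT t _) _; rewrite ?t0 ?tT// lerDl divr_ge0.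
  have tt' : ta <= t <= tb by rewrite (le_trans taT Tt) (le_trans tt (ltW T'b)).
  by have [] := HGV t (tabd t tt').
have ch t : 0 <= t <= T' -> clamp2 r0 (h t) = h t by move=> /hbd/clamp2E.
have T'T' : 0 <= T' <= T' by rewrite T'0 lexx.
exists (h T').2, T', h; split; last first.
- split=> //.
  + by rewrite [LHS]surjective_pairing hT'.
  + by apply: curve_derive_eq (Dh T') _ => t /andP[t0 tt] /=; rewrite ch ?(ltW t0) ?ltW.
  + move=> t /andP[t0 tt]; case/orP: (le_total t ta) => tta; first by apply: hp; rewrite t0.
    by apply: hpos; rewrite tta.
  + move=> t /[dup] tt' /andP[t0 tt]; have hg : `|h t - G t| <= m.
      by apply: hG; rewrite t0 (le_trans tt (ltW T'b)).
    case/orP: (le_total t T) => [tT|Tt].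
      by apply: (Hu t); rewrite ?t0//; exact: le_lt_trans hg mu.
    apply: Hv; rewrite (_ : h t - G T = (h t - G t) + (G t - G T)); last by ring.
    apply: le_lt_trans (ler_normD _ _) _.
    have tt2 : ta <= t <= tb by rewrite (le_trans taT Tt) (le_trans tt (ltW T'b)).
    by have [_ _ + _] := HGV t (tabd t tt2); clear -hg mv; lra.
  + rewrite (_ : (0, (h T').2) = h T'); last by rewrite [RHS]surjective_pairing hT'.
    rewrite -(ch T')//; apply: lt_trans (dneg T' _) _; first by rewrite taT' ltW.
    by rewrite oppr_lt0.
  + have [Tn|Tp] : T <= 0 \/ 0 < T by move: T0; rewrite le_eqVlt => /predU1P[<-|]; [left|right].
      have T00 : T = 0 by apply/eqP; rewrite eq_le Tn T0.
      move: z0x; rewrite le_eqVlt => /predU1P[z00|zp]; last by constructor 2.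
      constructor 1; apply/eqP; rewrite eq_le T'0 andbT leNgt; apply/negP => T'p.
      have ta00 : ta = 0 by apply/eqP; rewrite eq_le ta0 andbT -T00.
      by have := hpos 0; rewrite ta00 lexx T'p h0 -z00 ltxx => /(_ isT).
    have [ta_0 [zp|kf]] := hst Tp; first by constructor 2; rewrite -h0.
    move: z0x; rewrite le_eqVlt => /predU1P[z00|zp]; last by constructor 2.
    constructor 3; split=> //.
    have := dhG 0; rewrite lexx (le_trans ta0 tatb) h0 => /(_ isT).
    rewrite -h0 ch ?lexx ?T'0// ler_norml => /andP[+ _].
    clear -kf mk; lra.
- exact: le_lt_trans T'T de.
- rewrite (_ : (h T').2 - y1 = ((h T' - G T') + (G T' - G T)).2); last first.
    by rewrite GT /=; ring.
  apply: le_lt_trans (pnorm2 _) _; apply: le_lt_trans (ler_normD _ _) _.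
  by have [_ _ _] := HGV T' T'T; have := hG T' T't; clear -me; lra.
Qed.

Lemma pass_perturb V F z0 (y1 e : R) : open V -> lipbox F -> pass V F z0 y1 -> 0 < e ->
  exists2 r : R, 0 < r & forall F', lipbox F' -> fclose r F F' -> forall z, `|z - z0| <= r ->
    0 <= z.1 -> exists2 y, `|y - y1| < e & pass V F' z y.
Proof.
move=> oV lF [T [g gA]] e0; have [r r0 H] := arc_perturb oV lF gA e0.
exists r => // F' lF' cF z zz z1; have [y [T' [h [ye _ hA]]]] := H F' lF' cF z zz z1.
by exists y => //; exists T', h.
Qed.

End Perturbation.

(** * Smooth functions *)

Section Smooth.
Variable R : realType.
Implicit Types (z w : R * R) (e t s a b c d y L M m r : R) (F : R * R -> R * R) (f fx fy : R * R -> R).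

Definition slip f := forall r : R, exists2 L : R, 0 < L &
  forall z w, `|z| <= r -> `|w| <= r -> `|f z - f w| <= L * `|z - w|.

Lemma slip_cst c : slip (fun=> c).
Proof. by move=> r; exists 1 => // z w _ _; rewrite subrr normr0 mul1r. Qed.

Lemma slip_bound f (r : R) : slip f -> exists2 M : R, 0 < M & forall z, `|z| <= r -> `|f z| <= M.
Proof.
move=> sf; have [r0|r0] := leP 0 r; last first.
  by exists 1 => // z zr; have := lt_le_trans r0 (le_trans (normr_ge0 z) (le_trans zr (lexx _))); rewrite ltxx.
have [L L0 HL] := sf r; exists (`|f 0| + L * r + 1).
  by rewrite ltr_wpDl// addr_ge0// mulr_ge0// ltW.
move=> z zr; rewrite (_ : f z = (f z - f 0) + f 0); last by ring.
have := HL z 0 zr; rewrite normr0 subr0 => /(_ r0) h1.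
have h2 : L * `|z| <= L * r by rewrite ler_pM2l.
by apply: le_trans (ler_normD _ _) _; lra.
Qed.

Lemma slipD f g : slip f -> slip g -> slip (fun z => f z + g z).
Proof.
move=> sf sg r; have [L L0 HL] := sf r; have [K K0 HK] := sg r.
exists (L + K) => [|z w zr wr]; first exact: addr_gt0.
rewrite (_ : _ - _ = (f z - f w) + (g z - g w)); last by ring.
by rewrite mulrDl; apply: le_trans (ler_normD _ _) _; apply: lerD; [exact: HL|exact: HK].
Qed.

Lemma slipM f g : slip f -> slip g -> slip (fun z => f z * g z).
Proof.
move=> sf sg r; have [L L0 HL] := sf r; have [K K0 HK] := sg r.
have [M M0 HM] := slip_bound r sf; have [N N0 HN] := slip_bound r sg.
exists (L * N + M * K) => [|z w zr wr]; first by rewrite addr_gt0// mulr_gt0.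
rewrite (_ : _ - _ = (f z - f w) * g z + f w * (g z - g w)); last by ring.
rewrite [leRHS]mulrDl; apply: le_trans (ler_normD _ _) _; rewrite !normrM; apply: lerD.
  by rewrite mulrAC; apply: ler_pM => //; [exact: HL|exact: HN].
by rewrite -mulrA; apply: ler_pM => //; [exact: HM|exact: HK].
Qed.

(** The gradient is encoded by the chain rule along curves, which is how it is used; this avoids
    total differentials of maps of the plane. *)
Definition grad f fx fy := forall (g : R -> R * R) t (d1 d2 : R),
  is_derive t 1 (fun t => (g t).1) d1 -> is_derive t 1 (fun t => (g t).2) d2 ->
  is_derive t 1 (fun t => f (g t)) (fx (g t) * d1 + fy (g t) * d2).

Definition smooth f := exists fx fy, [/\ grad f fx fy, slip fx & slip fy].

Lemma grad_taylor f fx fy (r C : R) z w : grad f fx fy -> `|z| <= r -> `|w| <= r ->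
  (forall u v, `|u| <= r -> `|v| <= r -> `|fx u - fx v| <= C * `|u - v|) ->
  (forall u v, `|u| <= r -> `|v| <= r -> `|fy u - fy v| <= C * `|u - v|) -> 0 <= C ->
  `|f w - f z - (fx z * (w - z).1 + fy z * (w - z).2)| <= 2 * C * `|w - z| ^+ 2.
Proof.
move=> G zr wr Hx Hy C0.
pose g (s : R) := (z.1 + s * (w - z).1, z.2 + s * (w - z).2).
have g1 s : is_derive s 1 (fun s => (g s).1) (w - z).1.
  by apply: is_derive_eq; rewrite /GRing.scale/=; ring.
have g2 s : is_derive s 1 (fun s => (g s).2) (w - z).2.
  by apply: is_derive_eq; rewrite /GRing.scale/=; ring.
have Dg s := G g s _ _ (g1 s) (g2 s).
pose k := fx z * (w - z).1 + fy z * (w - z).2.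
have DD s : is_derive s 1 (fun s => f (g s) - s * k) (fx (g s) * (w - z).1 + fy (g s) * (w - z).2 - k).
  by apply: is_derive_eq; rewrite /GRing.scale/=; ring.
have := @mvt_abs R (fun s => f (g s) - s * k) _ 0 1 (2 * C * `|w - z| ^+ 2) ler01 _ (fun s _ => DD s).
have -> : g 1 = w by rewrite /g !mul1r /=; case: (w) => a b /=; congr pair; ring.
have -> : g 0 = z by rewrite /g !mul0r !addr0; case: (z).
rewrite !mul1r !mul0r !subr0 mulr1 (_ : f w - k - f z = f w - f z - k); last by ring.
apply=> [s|s /andP[s0 s1]]; first exact: is_derive_cont (DD s).
have gr : `|g s| <= r.
  have e1 x x' : `|x| <= r -> `|x'| <= r -> `|x + s * (x' - x)| <= r.
    rewrite (_ : x + s * (x' - x) = (1 - s) * x + s * x'); last by ring.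
    move=> xr xr'; apply: le_trans (ler_normD _ _) _; rewrite !normrM.
    have s1' : 0 <= 1 - s by rewrite subr_ge0 ltW.
    rewrite (ger0_norm (ltW s0)) (ger0_norm s1').
    rewrite (_ : r = (1 - s) * r + s * r); last by ring.
    by apply: lerD; apply: ler_wpM2l => //; exact: ltW.
  by rewrite pnorm_le !e1//; apply: le_trans (pnorm1 _) _ || apply: le_trans (pnorm2 _) _.
have gz : `|g s - z| <= `|w - z|.
  rewrite (_ : g s - z = (s * (w - z).1, s * (w - z).2)); last first.
    by rewrite /g; case: (z) => z1 z2; congr pair => /=; ring.
  rewrite pnorm_le /= !normrM (ger0_norm (ltW s0)).
  have q (a b : R) : `|a| <= b -> s * `|a| <= b.
    by move=> ab; apply: le_trans ab; apply: ler_piMl => //; exact: ltW.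
  by rewrite !q// ?(pnorm1 (w - z)) ?(pnorm2 (w - z)).
rewrite /k (_ : _ - _ = (fx (g s) - fx z) * (w - z).1 + (fy (g s) - fy z) * (w - z).2); last by ring.
have bd (u v : R) : `|u| <= C * `|g s - z| -> `|v| <= `|w - z| -> `|u * v| <= C * `|w - z| ^+ 2.
  move=> hu hv; rewrite normrM expr2 mulrA; apply: ler_pM => //.
  by apply: le_trans hu _; rewrite ler_wpM2l.
rewrite (_ : 2 * C * `|w - z| ^+ 2 = C * `|w - z| ^+ 2 + C * `|w - z| ^+ 2); last by ring.
apply: le_trans (ler_normD _ _) _; apply: lerD; apply: bd.
- exact: Hx.
- exact: pnorm1.
- exact: Hy.
- exact: pnorm2.
Qed.

Lemma smooth_slip f : smooth f -> slip f.
Proof.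
move=> [fx [fy [G sx sy]]] r.
have [C1 C10 H1] := sx r; have [C2 C20 H2] := sy r.
have [M M0 HM] := slip_bound r sx; have [N N0 HN] := slip_bound r sy.
have C0 : 0 <= C1 + C2 by rewrite addr_ge0 ?ltW.
exists (2 * (C1 + C2) * (2 * `|r|) + (M + N)) => [|w z wr zr].
  by rewrite ltr_wpDl ?addr_gt0// !mulr_ge0.
have := grad_taylor G zr wr _ _ C0.
have h1 u v : `|u| <= r -> `|v| <= r -> `|fx u - fx v| <= (C1 + C2) * `|u - v|.
  by move=> ur vr; apply: le_trans (H1 u v ur vr) _; rewrite ler_wpM2r// lerDl ltW.
have h2 u v : `|u| <= r -> `|v| <= r -> `|fy u - fy v| <= (C1 + C2) * `|u - v|.
  by move=> ur vr; apply: le_trans (H2 u v ur vr) _; rewrite ler_wpM2r// lerDr ltW.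
move=> /(_ h1 h2) h.
have wz : `|w - z| <= 2 * `|r|.
  by apply: le_trans (ler_normB _ _) _; have := ler_norm r; lra.
have h3 : `|fx z * (w - z).1 + fy z * (w - z).2| <= (M + N) * `|w - z|.
  apply: le_trans (ler_normD _ _) _; rewrite mulrDl !normrM; apply: lerD; apply: ler_pM => //.
  - exact: HM.
  - exact: pnorm1.
  - exact: HN.
  - exact: pnorm2.
have h4 : 2 * (C1 + C2) * `|w - z| ^+ 2 <= 2 * (C1 + C2) * (2 * `|r|) * `|w - z|.
  by rewrite expr2 mulrA ler_wpM2r// ler_wpM2l// mulr_ge0.
rewrite (_ : f w - f z = (f w - f z - (fx z * (w - z).1 + fy z * (w - z).2)) +
  (fx z * (w - z).1 + fy z * (w - z).2)); last by ring.
by apply: le_trans (ler_normD _ _) _; rewrite mulrDl; lra.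
Qed.

Lemma smooth_cst c : smooth (fun=> c).
Proof.
exists (fun=> 0), (fun=> 0); split; try exact: slip_cst.
by move=> g t d1 d2 _ _; rewrite !mul0r addr0; exact: is_derive_cst.
Qed.

Lemma smooth_X : smooth fst.
Proof.
exists (fun=> 1), (fun=> 0); split; try exact: slip_cst.
by move=> g t d1 d2 h _; rewrite mul1r mul0r addr0.
Qed.

Lemma smooth_Y : smooth snd.
Proof.
exists (fun=> 0), (fun=> 1); split; try exact: slip_cst.
by move=> g t d1 d2 _ h; rewrite mul1r mul0r add0r.
Qed.

Lemma smoothD f g : smooth f -> smooth g -> smooth (fun z => f z + g z).
Proof.
move=> [fx [fy [Gf fxs fys]]] [gx [gy [Gg gxs gys]]].
exists (fun z => fx z + gx z), (fun z => fy z + gy z); split; try exact: slipD.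
move=> h t d1 d2 h1 h2; have ? := Gf h t d1 d2 h1 h2; have ? := Gg h t d1 d2 h1 h2.
by apply: is_derive_eq; ring.
Qed.

Lemma smoothM f g : smooth f -> smooth g -> smooth (fun z => f z * g z).
Proof.
move=> sf sg; have lf := smooth_slip sf; have lg := smooth_slip sg.
move: sf sg => [fx [fy [Gf fxs fys]]] [gx [gy [Gg gxs gys]]].
exists (fun z => fx z * g z + f z * gx z), (fun z => fy z * g z + f z * gy z).
split; try by apply: slipD; apply: slipM.
move=> h t d1 d2 h1 h2; have ? := Gf h t d1 d2 h1 h2; have ? := Gg h t d1 d2 h1 h2.
by apply: is_derive_eq; rewrite /GRing.scale/=; ring.
Qed.

Definition smoothf F := smooth (fun z => (F z).1) /\ smooth (fun z => (F z).2).

Lemma smoothf_lipbox F : smoothf F -> lipbox F.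
Proof.
move=> [/smooth_slip s1 /smooth_slip s2] r.
have [L L0 HL] := s1 r; have [K K0 HK] := s2 r.
exists (L + K) => [|z w zr wr]; first exact: addr_gt0.
rewrite pnorm_le /=; apply/andP; split.
  by apply: le_trans (HL z w zr wr) _; rewrite ler_wpM2r// lerDl ltW.
by apply: le_trans (HK z w zr wr) _; rewrite ler_wpM2r// lerDr ltW.
Qed.

Lemma pf_smooth n f : pf n f -> smooth f.
Proof.
move=> pnf; apply: pf_ind pnf _ _ _ => [c|g h|i j c _]; [exact: smooth_cst|exact: smoothD|].
apply: smoothM; first exact: smooth_cst.
have sX (h : R * R -> R) k : smooth h -> smooth (fun z => h z ^+ k).
  move=> ph; elim: k => [|k IH]; first exact: smooth_cst.
  have -> : (fun z => h z ^+ k.+1) = fun z => h z * h z ^+ k by apply/funext => z; rewrite exprS.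
  exact: smoothM.
by apply: smoothM; apply: sX; [exact: smooth_X|exact: smooth_Y].
Qed.

End Smooth.

(** * Uniqueness, scaling, reversal and reparametrisation of passages *)

Section PassageProperties.
Variable R : realType.
Implicit Types (z w : R * R) (e t s a b c d y L M m r : R) (F : R * R -> R * R) (g : R -> R * R)
  (V : set (R * R)).

(** A longer arc would be on the line at time [T] although its interior is positive; for [T = 0] the
    exit sign of one arc contradicts the start condition of the other. *)
Lemma parc_uniq V V' F z y y' (T T' : R) g g' : lipbox F ->
  parc V F z y T g -> parc V' F z y' T' g' ->
  [/\ T = T', y = y' & forall t, 0 <= t <= T -> g t = g' t].
Proof.
wlog TT : V V' y y' T T' g g' / T <= T'.
  move=> H lF h1 h2; have [TT|/ltW TT] := leP T T'; first exact: H h1 h2.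
  have [E1 E2 E3] := H _ _ _ _ _ _ _ _ TT lF h2 h1.
  by split=> // t tT; rewrite E3// E1.
move=> lF [T0 g0 gT Dg gp gV Fe St] [T'0 g'0 g'T Dg' gp' gV' Fe' St'].
have E t : 0 <= t <= T -> g t = g' t.
  apply: (curve_uniq lF) => //; first by rewrite g0 g'0.
  exact: curve_deriveS Dg' _ TT.
have TE : T = T'.
  apply/eqP; rewrite eq_le TT /= leNgt; apply/negP => T'T.
  have [T_0|T_0] := ltP 0 T.
    have := gp' T; rewrite T_0 T'T -E ?T0 ?lexx// gT /= ltxx => /(_ isT); by [].
  have T00 : T = 0 by apply/eqP; rewrite eq_le T_0 T0.
  have z0 : z = (0, y) by rewrite -g0 -gT T00.
  move: T'T; rewrite T00 => T'p; case: St' => [T'00|z1|[_ z1]].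
  - by move: T'p; rewrite T'00 ltxx.
  - by move: z1; rewrite z0 /= ltxx.
  - by move: z1; rewrite z0 => /(lt_trans Fe); rewrite ltxx.
split=> //; have := E T; rewrite T0 lexx gT TE g'T => /(_ isT); by case.
Qed.

Lemma pass_uniq V V' F z y y' : lipbox F -> pass V F z y -> pass V' F z y' -> y = y'.
Proof.
by move=> lF [T [g h]] [T' [g' h']]; have [] := parc_uniq lF h h'.
Qed.

Lemma passS V V' F z y : V `<=` V' -> pass V F z y -> pass V' F z y.
Proof.
move=> VV [T [g [T0 g0 gT Dg gp gV Fe St]]]; exists T, g; split=> // t /gV; exact: VV.
Qed.

Lemma pass_exit V F z y : pass V F z y -> (F (0, y)).1 < 0.
Proof. by case=> T [g []]. Qed.

(** Pull-back of [F] under [z |-> (0, c) + e z]. With [e = 1] it is a translation; with [e] small it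
    is the blow-up that produces the additional window. *)
Definition rescale (e c : R) F z :=
  let w := F (e * z.1, c + e * z.2) in (e^-1 * w.1, e^-1 * w.2).

Lemma pass_rescale V (e c : R) F z y : 0 < e -> pass V (rescale e c F) z y ->
  pass setT F (e * z.1, c + e * z.2) (c + e * y).
Proof.
move=> e0 [T [g [T0 g0 gT [g1 g2 Dg] gp gV Fe St]]].
exists T, (fun t => (e * (g t).1, c + e * (g t).2)); split=> //.
- by rewrite g0.
- by rewrite gT /= mulr0.
- split.
  + by move=> t; apply: cvgM; [exact: cvg_cst|exact: g1].
  + by move=> t; apply: cvgD; [exact: cvg_cst|apply: cvgM; [exact: cvg_cst|exact: g2]].
  + move=> t /Dg[D1 D2]; split; apply: is_derive_eq => /=;
      rewrite /GRing.scale/= ?mulr0 ?mul0r ?addr0 ?add0r mulrA mulfV ?mul1r// ?gt_eqF//.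
- by move=> t /gp h; rewrite /= mulr_gt0.
- by move: Fe; rewrite /rescale /= mulr0 pmulr_rlt0 ?invr_gt0.
- case: St => [->|z1|[z1 Fz]]; first by constructor 1.
    by constructor 2; rewrite /= mulr_gt0.
  constructor 3; rewrite /= z1 mulr0; split=> //.
  by move: Fz; rewrite /rescale /= z1 mulr0 pmulr_rgt0 ?invr_gt0.
Qed.

Lemma pass_rev V F y y1 : 0 < (F (0, y)).1 -> pass V F (0, y) y1 ->
  pass V (fun z => (- (F z).1, - (F z).2)) (0, y1) y.
Proof.
move=> Fy [T [g [T0 g0 gT [g1 g2 Dg] gp gV Fe St]]].
have ci (f : R -> R) : continuous f -> continuous (fun t => f (T - t)).
  move=> cf t; apply: (@continuous_comp _ _ _ (fun t => T - t) f); last exact: cf.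
  by apply: cvgB; [exact: cvg_cst|exact: cvg_id].
have di (f : R -> R) t (d : R) : is_derive (T - t) 1 f d -> is_derive t 1 (fun t => f (T - t)) (- d).
  move=> df; rewrite (_ : - d = d * -1); last by rewrite mulrN1.
  apply: (@is_derive1_comp _ f (fun t => T - t)).
  by apply: is_derive_eq; rewrite /=; ring.
exists T, (fun t => g (T - t)); split=> //.
- by rewrite subr0.
- by rewrite subrr g0.
- split; [exact: (ci (fun t => (g t).1))|exact: (ci (fun t => (g t).2))|].
  move=> t /andP[t0 tT]; have [] := Dg (T - t); first by rewrite subr_gt0 tT gtrBl.
  by move=> /(di (fun t => (g t).1)) h1 /(di (fun t => (g t).2)) h2.
- by move=> t /andP[t0 tT]; apply: gp; rewrite subr_gt0 tT gtrBl.
- by move=> t /andP[t0 tT]; apply: gV; rewrite subr_ge0 tT gerBl.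
- by rewrite /= oppr_lt0.
- by constructor 3; rewrite /= oppr_gt0.
Qed.

Lemma parc_lip V F z y (T : R) g : lipbox F -> parc V F z y T g ->
  exists2 M : R, 0 < M & forall s t, 0 <= s <= T -> 0 <= t <= T -> `|g s - g t| <= M * `|s - t|.
Proof.
move=> lF [T0 g0 gT [g1 g2 Dg] gp gV Fe St].
have [B B0 HB] := curve_bounded 0 T g1 g2; have [L L0 HL] := lF B.
pose M := L * B + `|F 0| + 1.
have M0 : 0 < M by rewrite ltr_wpDl// addr_ge0// mulr_ge0// ltW.
exists M => // s t.
wlog st : s t / s <= t.
  move=> H sT tT; have [/H|/ltW/H] := leP s t; first exact.
  by rewrite distrC [`|s - t|]distrC; apply.
move=> /andP[s0 sT] /andP[t0 tT].
rewrite distrC [`|s - t|]distrC (ger0_norm (_ : 0 <= t - s)) ?subr_ge0//.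
have FM u : s < u < t -> `|F (g u)| <= M.
  move=> /andP[su ut]; have gB : `|g u| <= B.
    by apply: HB; rewrite (le_trans s0 (ltW su)) (le_trans (ltW ut) tT).
  rewrite (_ : F (g u) = (F (g u) - F 0) + F 0); last by ring.
  have h : `|F (g u) - F 0| <= L * B.
    apply: le_trans (HL _ _ gB _) _; first by rewrite normr0 ltW.
    by rewrite subr0 ler_pM2l.
  by apply: le_trans (ler_normD _ _) _; rewrite /M; lra.
have Dst u : s < u < t -> 0 < u < T.
  by move=> /andP[su ut]; rewrite (le_lt_trans s0 su) (lt_le_trans ut tT).
rewrite pnorm_le; apply/andP; split.
  apply: (@mvt_abs R (fun t => (g t).1) (fun t => (F (g t)).1)) => //.
    by move=> u /Dst/Dg[].
  by move=> u /FM; apply: le_trans; exact: pnorm1.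
apply: (@mvt_abs R (fun t => (g t).2) (fun t => (F (g t)).2)) => //.
  by move=> u /Dst/Dg[].
by move=> u /FM; apply: le_trans; exact: pnorm2.
Qed.

(** A positive factor changes only the speed: the new arc is [g \o tau] with [tau' = m (g tau)], and
    [tau] reaches [T] because the factor is bounded below on the compact arc. *)
Lemma pass_mul V F (m : R * R -> R) z y : lipbox F -> slip m -> (forall z, V z -> 0 < m z) ->
  pass V F z y -> pass V (fun z => (m z * (F z).1, m z * (F z).2)) z y.
Proof.
move=> lF sm mV [T [g gA]]; have [M M0 HM] := parc_lip lF gA.
case: gA => T0 g0 gT [g1 g2 Dg] gp gV Fe St.
have VT : V (0, y) by rewrite -gT; apply: gV; rewrite T0 lexx.
have Vz : V z by rewrite -g0; apply: gV; rewrite T0 lexx.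
have Fe' : m (0, y) * (F (0, y)).1 < 0 by rewrite pmulr_rlt0// mV.
move: T0; rewrite le_eqVlt => /predU1P[T00|T0].
  exists 0, (fun=> z); split=> //.
  - by rewrite -gT -T00 g0.
  - split; try by move=> t; exact: cvg_cst.
    by move=> t /andP[t0 tt]; have := lt_trans t0 tt; rewrite ltxx.
  - by move=> t /andP[t0 tt]; have := lt_trans t0 tt; rewrite ltxx.
  - by constructor 1.
have TT : (0 : R) <= 0 <= T by rewrite lexx ltW.
have TT' : 0 <= T <= T by rewrite lexx ltW.
have [B B0 HB] := curve_bounded 0 T g1 g2; have [L L0 HL] := sm B.
(* Clamping the time to [[0, T]] makes the right-hand side of the equation for [tau] globally
   Lipschitz. *)
pose cl (s : R) := Num.max 0 (Num.min T s).
have clT s : 0 <= cl s <= T.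
  by rewrite /cl le_max lexx /= ge_max ge_min lexx ltW.
have clE s : 0 <= s <= T -> cl s = s.
  by move=> /andP[s0 sT]; rewrite /cl min_r// max_r.
have cllip s t : `|cl s - cl t| <= `|s - t|.
  wlog st : s t / s <= t.
    move=> H; have [/H//|/ltW/H] := leP s t.
    by rewrite distrC [`|t - s|]distrC.
  rewrite distrC [`|s - t|]distrC (ger0_norm (_ : 0 <= t - s)) ?subr_ge0//.
  rewrite /cl /Num.max /Num.min.
  clear -st T0.
  by repeat case: ifP => /=; rewrite ?ltNge => *; rewrite ler_norml; apply/andP; split; lra.
pose h s := m (g (cl s)).
have hlip s t : `|h s - h t| <= L * M * `|s - t|.
  have B1 := HB _ (clT s); have B2 := HB _ (clT t).
  apply: le_trans (HL _ _ B1 B2) _; rewrite -mulrA ler_pM2l//.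
  apply: le_trans (HM _ _ (clT s) (clT t)) _; rewrite ler_pM2l//.
have ch : continuous h.
  move=> t; apply: ed_cont => e e0; exists (e / (L * M)); first by rewrite divr_gt0// mulr_gt0.
  move=> s; rewrite ltr_pdivlMr ?mulr_gt0// mulrC.
  exact: le_lt_trans (hlip s t).
have hp s : 0 < h s by apply/mV/gV/clT.
have [c c0 Hc] : exists2 c : R, 0 < c & forall s, c <= h s.
  have [s _|c c0 Hc] := @pos_min R h 0 T ch; first exact: hp.
  exists c => // s; have := Hc _ (clT s); rewrite /h.
  by rewrite (clE (cl s))//; exact: clT.
have LM : 0 < L * M by rewrite mulr_gt0.
(* The scalar equation is solved as a planar one with zero second component. *)
have [|u [u0 Du]] := @picard R (fun z => (h z.1, 0)) (L * M) (0 : R * R) LM.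
  move=> v w; rewrite pnorm_le /= subrr normr0 mulr_ge0 ?(ltW LM)// andbT.
  by apply: le_trans (hlip _ _) _; rewrite ler_pM2l//; exact: (pnorm1 (v - w)).
pose tau t := (u t).1.
have [ctau _ _] := Du 0.
have Dtau t : 0 < t -> is_derive t 1 tau (h (tau t)).
  move=> t0; have [_ _ H] := Du (t + 1); have [] := H t; last by [].
  by rewrite t0 ltrDl ltr01.
have tau0 : tau 0 = 0 by rewrite /tau u0.
have tauc t : 0 <= t -> c * t <= tau t.
  move=> t0; have := @mvt_ge R tau (fun t => h (tau t)) 0 t c t0 ctau.
  rewrite tau0 !subr0; apply=> [s /andP[s0 _]|s _]; [exact: Dtau|exact: Hc].
have [S /andP[S0 _] tauS] : exists2 S, 0 <= S <= T / c & tau S = T.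
  have Tc : 0 <= T / c by rewrite divr_ge0// ltW.
  apply: ivt => //; rewrite tau0 (ltW T0) /=.
  by have := tauc _ Tc; rewrite mulrC divfK// gt_eqF.
have tau_lt s t : 0 <= s -> s < t -> tau s < tau t.
  move=> s0 st; apply: (@mvt_lt R tau (fun t => h (tau t))) => //.
  by move=> v /andP[sv _]; apply: Dtau; exact: le_lt_trans sv.
have S_0 : 0 < S.
  rewrite lt_neqAle S0 andbT; apply/eqP => S00.
  by move: T0; rewrite -tauS -S00 tau0 ltxx.
have taui t : 0 < t < S -> 0 < tau t < T.
  by move=> /andP[t0 tS]; rewrite -{1}tau0 -tauS !tau_lt// ltW.
have tauw t : 0 <= t <= S -> 0 <= tau t <= T.
  move=> /andP[]; rewrite le_eqVlt => /predU1P[<-|t0].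
    by move=> _; rewrite tau0 lexx ltW.
  rewrite le_eqVlt => /predU1P[->|tS]; first by rewrite tauS lexx ltW.
  by have /andP[h1 h2] := taui t (introT andP (conj t0 tS)); rewrite !ltW.
exists S, (g \o tau); split=> //.
- by rewrite /= tau0.
- by rewrite /= tauS.
- split.
  + by move=> t; apply: (@continuous_comp _ _ _ tau (fun t => (g t).1)); [exact: ctau|exact: g1].
  + by move=> t; apply: (@continuous_comp _ _ _ tau (fun t => (g t).2)); [exact: ctau|exact: g2].
  + move=> t tS; have tT := taui t tS; have [D1 D2] := Dg _ tT.
    have Dt : is_derive t 1 tau (m (g (tau t))).
      rewrite (_ : m (g (tau t)) = h (tau t)); first by apply: Dtau; case/andP: tS.
      by rewrite /h clE//; case/andP: tT => h1 h2; rewrite !ltW.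
    split; rewrite /= [_ * _]mulrC.
      exact: (@is_derive1_comp _ (fun t => (g t).1) tau).
    exact: (@is_derive1_comp _ (fun t => (g t).2) tau).
- by move=> t /taui/gp.
- by move=> t /tauw/gV.
- case: St => [T00|z1|[z1 z2]]; first by rewrite T00 ltxx in T0.
    by constructor 2.
  by constructor 3; rewrite /= mulr_gt0// mV.
Qed.

End PassageProperties.

(** * Passage maps reverse the order *)

Section Orientation.
Variable R : realType.
Implicit Types (z w : R * R) (e t s a b c d y L M m r : R) (F : R * R -> R * R) (g : R -> R * R)
  (V : set (R * R)).

Lemma slip_cont (f : R * R -> R) g : slip f -> continuous (fun t => (g t).1) ->
  continuous (fun t => (g t).2) -> continuous (fun t => f (g t)).
Proof.
move=> sf c1 c2 t; apply: ed_cont => e e0.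
have [L L0 HL] := sf (`|g t| + 1).
have m0 : 0 < Num.min 1 (e / L) by rewrite lt_min ltr01 divr_gt0.
have [d d0 Hd] := curve_ed t c1 c2 m0.
exists d => // s /Hd; rewrite lt_min => /andP[h1 h2].
apply: le_lt_trans (HL _ _ _ _) _.
- rewrite (_ : g s = (g s - g t) + g t); last by ring.
  by apply: le_trans (ler_normD _ _) _; qlra.
- by rewrite lerDl.
- by rewrite mulrC -ltr_pdivlMr.
Qed.

(** Nearby arcs may exit later than [T], and the comparison with them needs the reference solution a
    little beyond its own exit. *)
Lemma parc_extend V F z y (T : R) g : lipbox F -> parc V F z y T g ->
  exists G M d, [/\ 0 < d, 0 < M, (forall t, 0 <= t <= T -> G t = g t),
    curve_derive G (F \o G) 0 (T + d) & forall t, 0 <= t <= T + d -> `|G t| <= M].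
Proof.
move=> lF [T0 g0 gT Dg gp gV Fe St]; have [g1 g2 _] := Dg.
have [M M0 HM] := curve_bounded 0 T g1 g2.
pose r0 := M + 1; have r00 : 0 <= r0 by rewrite addr_ge0// ltW.
have [L L0 HL] := lipbox_clamp r00 lF.
have [G [G0 DG]] := picard z L0 HL.
have [G1 G2 _] := DG 0.
have EG t : 0 <= t <= T -> G t = g t.
  move=> tT; have DgT : curve_derive g ((F \o clamp2 r0) \o g) 0 T.
    apply: curve_derive_eq Dg _ => s /andP[s0 sT] /=; rewrite clamp2E//.
    by apply: le_trans (HM s _) _; rewrite ?(ltW s0) ?(ltW sT)// lerDl.
  have H0 : `|G 0 - g 0| <= 0 by rewrite G0 g0 subrr normr0.
  have H : `|G t - g t| <= 0.
    have := gronwall (ltW L0) (lexx 0) DgT (DG T) _ H0 tT.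
    by rewrite mulr0 mul0r; apply=> s _; rewrite addr0; exact: HL.
  by apply/eqP; rewrite -subr_eq0 -normr_eq0 eq_le normr_ge0 andbT.
have [d d0 Hd] := curve_ed T G1 G2 ltr01.
have bd t : 0 <= t <= T + d / 2 -> `|G t| <= r0.
  move=> /andP[t0 tT]; have [tT'|T't] := leP t T.
    have tT2 : 0 <= t <= T by rewrite t0.
    by rewrite EG// (le_trans (HM _ tT2))// lerDl.
  rewrite (_ : G t = (G t - G T) + G T); last by ring.
  apply: le_trans (ler_normD _ _) _; rewrite /r0 [leRHS]addrC; apply: lerD.
    by apply/ltW/Hd; rewrite ger0_norm ?subr_ge0 ?(ltW T't)//; qlra.
  by rewrite EG ?T0 ?lexx// HM// T0 lexx.
exists G, r0, (d / 2); split=> //; first by rewrite divr_gt0.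
  by rewrite /r0 ltr_wpDl// ltW.
apply: curve_derive_eq (DG _) _ => t /andP[t0 tT] /=.
by rewrite clamp2E// bd// (ltW t0) ltW.
Qed.

(* The cross product D of the displacement with the velocity satisfies D' = (div F) D up to
   quadratic terms, hence keeps its sign; this is what makes half-return maps decreasing. *)
Lemma cross_derive F G h Px Py Qx Qy (al : R -> R) t :
  grad (fun z => (F z).1) Px Py -> grad (fun z => (F z).2) Qx Qy ->
  is_derive t 1 (fun t => (G t).1) (F (G t)).1 -> is_derive t 1 (fun t => (G t).2) (F (G t)).2 ->
  is_derive t 1 (fun t => (h t).1) (F (h t)).1 -> is_derive t 1 (fun t => (h t).2) (F (h t)).2 ->
  is_derive t 1 al (Px (G t) + Qy (G t)) ->
  let w t := h t - G t in
  let rest f fx fy := f (h t) - f (G t) - (fx (G t) * (w t).1 + fy (G t) * (w t).2) in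
  is_derive t 1 (fun t => ((w t).1 * (F (G t)).2 - (w t).2 * (F (G t)).1) * expR (- al t))
   ((rest (fun z => (F z).1) Px Py * (F (G t)).2 - rest (fun z => (F z).2) Qx Qy * (F (G t)).1) *
     expR (- al t)).
Proof.
move=> gP gQ g1 g2 h1 h2 Dal w rest.
have ? := gP G t _ _ g1 g2; have ? := gQ G t _ _ g1 g2.
have : is_derive t 1 (fun t => expR (- al t)) (expR (- al t) * - (Px (G t) + Qy (G t))).
  exact: (@is_derive1_comp _ expR (fun t => - al t)).
by move=> ?; rewrite /w; apply: is_derive_eq; rewrite /GRing.scale/= /rest /w /=; ring.
Qed.

Lemma cross_rest_le (f fx fy : R * R -> R) M1 : grad f fx fy -> slip fx -> slip fy ->
  exists2 C : R, 0 < C & forall z w, `|z| <= M1 -> `|w| <= M1 ->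
    `|f w - f z - (fx z * (w - z).1 + fy z * (w - z).2)| <= C * `|w - z| ^+ 2.
Proof.
move=> gf sx sy; have [C1 C10 H1] := sx M1; have [C2 C20 H2] := sy M1.
have C0 : 0 < C1 + C2 by rewrite addr_gt0.
exists (2 * (C1 + C2)) => [|z w zM wM]; first by rewrite mulr_gt0.
apply: (grad_taylor gf zM wM) => [u v um vm|u v um vm|]; last exact: ltW.
  by apply: le_trans (H1 u v um vm) _; rewrite ler_wpM2r// lerDl ltW.
by apply: le_trans (H2 u v um vm) _; rewrite ler_wpM2r// lerDr ltW.
Qed.

Lemma sol_close F G M1 Tm : lipbox F -> 0 <= Tm -> curve_derive G (F \o G) 0 Tm ->
  (forall t, 0 <= t <= Tm -> `|G t| <= M1) ->
  exists2 K : R, 0 < K & forall h T', 0 <= T' <= Tm -> curve_derive h (F \o h) 0 T' ->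
    (forall t, 0 <= t <= T' -> `|h t| <= M1) ->
    forall t, 0 <= t <= T' -> `|h t - G t| <= K * `|h 0 - G 0|.
Proof.
move=> lF Tm0 DG GM; have [L L0 HL] := lF M1.
exists (2 * expR ((4 * L + 2) * Tm)) => [|h T' /andP[T'0 T'm] Dh hM t tT].
  by rewrite mulr_gt0// expR_gt0.
have DG' := curve_deriveS DG (lexx 0) T'm.
apply: le_trans (gronwall (ltW L0) (normr_ge0 (h 0 - G 0)) DG' Dh _ (lexx _) tT) _.
  move=> s /andP[s0 sT]; apply: le_trans (HL _ _ (hM _ _) (GM _ _)) _.
  - by rewrite !ltW.
  - by rewrite ltW// ltW// (lt_le_trans sT).
  - by rewrite lerDl.
have tTm : t <= Tm by case/andP: tT => _ /le_trans; apply.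
by rewrite subr0 mulrAC ler_wpM2r// ler_pM2l// ler_expR ler_pM2l// ltr_wpDl// mulr_ge0// ltW.
Qed.

(** Integration of [cross_derive]: with [al] the integrated divergence, [D exp(- al)] varies only by
    a term quadratic in the initial displacement. The factor [k] is [exp(al T')], bounded below
    uniformly in [T']. *)
Lemma cross_est F G M1 Tm : smoothf F -> 0 <= Tm -> curve_derive G (F \o G) 0 Tm ->
  (forall t, 0 <= t <= Tm -> `|G t| <= M1) ->
  exists2 C : R, 0 < C & forall h T', 0 <= T' <= Tm -> curve_derive h (F \o h) 0 T' ->
    (forall t, 0 <= t <= T' -> `|h t| <= M1) ->
    let w t := h t - G t in let D t := (w t).1 * (F (G t)).2 - (w t).2 * (F (G t)).1 in
    exists2 k : R, C^-1 <= k & `|D T' - D 0 * k| <= C * `|w 0| ^+ 2 /\ `|w T'| <= C * `|w 0|.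
Proof.
move=> sF Tm0 DG GM; have lF := smoothf_lipbox sF; have [G1 G2 DGt] := DG.
have [K K0 HK] := sol_close lF Tm0 DG GM.
have [[Px [Py [gP sPx sPy]]] [Qx [Qy [gQ sQx sQy]]]] := sF.
have [BP BP0 HBP] := slip_bound M1 (smooth_slip sF.1).
have [BQ BQ0 HBQ] := slip_bound M1 (smooth_slip sF.2).
have [C1 C10 HC1] := cross_rest_le M1 gP sPx sPy.
have [C2 C20 HC2] := cross_rest_le M1 gQ sQx sQy.
have cdiv : continuous (fun t => Px (G t) + Qy (G t)).
  by move=> t; apply: cvgD; exact: slip_cont.
have [al [al0 cal Dal]] := antideriv cdiv.
have [A A0 HA] : exists2 A : R, 0 < A & forall t, 0 <= t <= Tm -> `|al t| <= A.
  have c0' : continuous (fun t : R => (0 : R)) by move=> ?; exact: cvg_cst.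
  have [A A0 HA] := @curve_bounded R (fun t => (al t, 0)) 0 Tm cal c0'.
  by exists A => // t /HA; apply: le_trans; exact: (pnorm1 (al t, 0)).
pose a := expR A; have a0 : 0 < a by exact: expR_gt0.
pose S := (C1 * BQ + C2 * BP) * K ^+ 2 * a.
have S0 : 0 < S by rewrite !mulr_gt0// ?addr_gt0 ?mulr_gt0// exprn_gt0.
pose C := a + K + S * Tm * a.
have Sa0 : 0 <= S * Tm * a by apply: mulr_ge0; [apply: mulr_ge0 => //|]; exact: ltW.
have aC : a <= C by rewrite /C -addrA lerDl addr_ge0// ltW.
have KC : K <= C by rewrite /C addrAC lerDr addr_ge0// ltW.
have SC : S * Tm * a <= C by rewrite /C lerDr addr_ge0// ltW.
clearbody C; have C0 : 0 < C by exact: lt_le_trans aC.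
exists C => // h T' T'm Dh hM w D; exists (expR (al T')).
  have {HA} := HA T' T'm; rewrite ler_norml => /andP[A1 _].
  apply: (@le_trans _ _ a^-1); first by rewrite lef_pV2 ?posrE.
  by rewrite /a -expRN ler_expR.
have [h1 h2 Dht] := Dh; have [T'0 T'Tm] := andP T'm.
have HK' := HK h T' T'm Dh hM.
split; last first.
  by apply: le_trans (HK' T' _) _; rewrite ?T'0 ?lexx// ler_wpM2r.
pose E t := D t * expR (- al t).
have cE : continuous E.
  have cw1 : continuous (fun t => (w t).1) by move=> t; apply: cvgB; [exact: h1|exact: G1].
  have cw2 : continuous (fun t => (w t).2) by move=> t; apply: cvgB; [exact: h2|exact: G2].
  move=> t; apply: cvgM.
    apply: cvgB; apply: cvgM.
    - exact: cw1.
    - by apply: (@slip_cont (fun z => (F z).2)) => //; exact: smooth_slip sF.2.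
    - exact: cw2.
    - by apply: (@slip_cont (fun z => (F z).1)) => //; exact: smooth_slip sF.1.
  apply: (@continuous_comp _ _ _ (fun t => - al t) expR); last exact: continuous_expR.
  by apply: cvgN; exact: cal.
have ET : `|E T' - E 0| <= S * `|w 0| ^+ 2 * (T' - 0).
  apply: (mvt_abs T'0 cE) => [t /andP[t0 tT']|t /andP[t0 tT']].
    have [hh1 hh2] := Dht t (introT andP (conj t0 tT')).
    have [gg1 gg2] := DGt t (introT andP (conj t0 (lt_le_trans tT' T'Tm))).
    exact: (cross_derive gP gQ gg1 gg2 hh1 hh2 (Dal t t0)).
  have tT : 0 <= t <= T' by rewrite !ltW.
  have tTm : 0 <= t <= Tm by rewrite (ltW t0) ltW// (lt_le_trans tT').
  have hMt := hM _ tT; have GMt := GM _ tTm.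
  have wt : `|w t| ^+ 2 <= K ^+ 2 * `|w 0| ^+ 2.
    by rewrite -exprMn ler_sqr ?nnegrE ?mulr_ge0 ?(ltW K0)//; exact: HK'.
  have ea : expR (- al t) <= a.
    by have := HA t tTm; rewrite ler_norml => /andP[q _]; rewrite ler_expR lerNl.
  have p1 := HC1 _ _ GMt hMt; have p2 := HC2 _ _ GMt hMt.
  have p3 := HBP _ GMt; have p4 := HBQ _ GMt.
  rewrite normrM [`|expR _|]ger0_norm ?expR_ge0//.
  rewrite (_ : S * `|w 0| ^+ 2 = (C1 * BQ + C2 * BP) * (K ^+ 2 * `|w 0| ^+ 2) * a); last by rewrite /S; ring.
  apply: ler_pM => //.
  apply: le_trans (ler_normB _ _) _; rewrite !normrM.
  apply: (@le_trans _ _ ((C1 * BQ + C2 * BP) * `|w t| ^+ 2)); last first.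
    by rewrite ler_wpM2l// addr_ge0// mulr_ge0// ltW.
  rewrite mulrDl mulrAC [X in _ <= _ + X]mulrAC.
  by apply: lerD; apply: ler_pM.
have -> : D T' - D 0 * expR (al T') = (E T' - E 0) * expR (al T').
  have E0 : E 0 = D 0 by rewrite /E al0 ?lexx// oppr0 expR0 mulr1.
  rewrite E0 [RHS]mulrBl (_ : E T' * expR (al T') = D T' * (expR (- al T') * expR (al T'))).
    by rewrite -expRD addNr expR0 mulr1.
  by rewrite mulrA.
rewrite normrM [`|expR _|]ger0_norm ?expR_ge0//.
have ea : expR (al T') <= a.
  by have := HA T' T'm; rewrite ler_norml => /andP[_ q]; rewrite ler_expR.
apply: (@le_trans _ _ (S * `|w 0| ^+ 2 * Tm * a)).
  apply: ler_pM; rewrite ?expR_ge0//.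
  apply: le_trans ET _; rewrite subr0; apply: ler_wpM2l => //.
  by apply: mulr_ge0; [exact: ltW|exact: sqr_ge0].
rewrite (_ : S * `|w 0| ^+ 2 * Tm * a = S * Tm * a * `|w 0| ^+ 2); last by ring.
by rewrite ler_wpM2r// sqr_ge0.
Qed.

Lemma sol_lip F G M1 Tm : lipbox F -> curve_derive G (F \o G) 0 Tm ->
  (forall t, 0 <= t <= Tm -> `|G t| <= M1) ->
  exists2 b : R, 0 < b & forall s t, 0 <= s <= Tm -> 0 <= t <= Tm ->
   `|F (G s)| <= b /\ `|G s - G t| <= b * `|s - t|.
Proof.
move=> lF [G1 G2 DGt] GM; have [L L0 HL] := lF (Num.max M1 0).
pose b := L * `|M1| + `|F 0| + 1.
have b0 : 0 < b by rewrite ltr_wpDl// addr_ge0// mulr_ge0// ltW.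
have Fb s : 0 <= s <= Tm -> `|F (G s)| <= b.
  move=> /GM Gs; rewrite (_ : F (G s) = (F (G s) - F 0) + F 0); last by ring.
  have q : `|F (G s) - F 0| <= L * `|M1|.
    apply: le_trans (HL _ _ _ _) _; rewrite ?normr0 ?le_max ?lexx ?Gs ?orbT//.
    by rewrite subr0 ler_pM2l//; exact: le_trans Gs (ler_norm _).
  by apply: le_trans (ler_normD _ _) _; rewrite /b; clear -q; lra.
exists b => // s t sT tT; split; first exact: Fb.
wlog st : s t sT tT / s <= t.
  move=> H; have [/H|/ltW/H] := leP s t; first exact.
  by rewrite distrC [`|s - t|]distrC; apply.
move: sT tT => /andP[s0 sT] /andP[t0 tT].
rewrite distrC [`|s - t|]distrC (ger0_norm (_ : 0 <= t - s)) ?subr_ge0//.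
have st' u : s < u < t -> 0 < u < Tm.
  by move=> /andP[su ut]; rewrite (le_lt_trans s0 su) (lt_le_trans ut tT).
have st2 u : s < u < t -> `|F (G u)| <= b.
  by move=> /st'/andP[u0 uT]; apply: Fb; rewrite !ltW.
rewrite pnorm_le; apply/andP; split.
  apply: (@mvt_abs R (fun t => (G t).1) (fun t => (F (G t)).1)) => //.
    by move=> u /st'/DGt[].
  by move=> u /st2; apply: le_trans; exact: pnorm1.
apply: (@mvt_abs R (fun t => (G t).2) (fun t => (F (G t)).2)) => //.
  by move=> u /st'/DGt[].
by move=> u /st2; apply: le_trans; exact: pnorm2.
Qed.

(** Near a transverse exit the first coordinate is a clock of speed at least [c], so being early or
    late is measured by the distance to the line. *)
Lemma exit_time F G M1 Tm T y1 : lipbox F -> 0 <= T <= Tm -> curve_derive G (F \o G) 0 Tm ->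
  (forall t, 0 <= t <= Tm -> `|G t| <= M1) -> G T = (0, y1) -> (F (0, y1)).1 < 0 ->
  exists e c, [/\ 0 < e, 0 < c & forall T', 0 <= T' <= Tm -> `|T' - T| < e ->
    c * `|T' - T| <= `|(G T').1|].
Proof.
move=> lF /andP[T0 TTm] DG GM GT F1; have [G1 G2 DGt] := DG.
pose c := - (F (0, y1)).1 / 2; have c0 : 0 < c by rewrite /c; clear -F1; lra.
have [d d0 Hd] := lipbox_cont (0, y1) lF c0.
have [e e0 He] := curve_ed T G1 G2 d0.
exists e, c; split=> // T' /andP[T'0 T'm] T'e.
have PG t : `|t - T| < e -> (F (G t)).1 <= - c.
  move=> /He; rewrite GT => /Hd /(le_lt_trans (pnorm1 _)) /=.
  by rewrite ltr_norml /c => /andP[_]; clear; lra.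
have D1 t : 0 < t -> t < Tm -> is_derive t 1 (fun t => (G t).1) (F (G t)).1.
  by move=> t0 tT; have [] := DGt t (introT andP (conj t0 tT)).
move: T'e; rewrite ltr_norml => /andP[te1 te2].
have [TT'|T'T] := leP T T'.
  have := @mvt_le R (fun t => (G t).1) (fun t => (F (G t)).1) T T' (- c) TT' G1.
  rewrite GT /= subr0 => q.
  have {}q : (G T').1 <= - c * (T' - T).
    apply: q => t /andP[t1 t2].
      by apply: D1; [exact: le_lt_trans t1|exact: lt_le_trans T'm].
    by apply: PG; rewrite ger0_norm ?subr_ge0 ?(ltW t1)//; clear -t2 te2; lra.
  have q1 := ler_norm (- (G T').1); rewrite normrN in q1.
  by rewrite ger0_norm ?subr_ge0//; clear -q q1; lra.
have := @mvt_le R (fun t => (G t).1) (fun t => (F (G t)).1) T' T (- c) (ltW T'T) G1.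
rewrite GT /= sub0r => q.
have {}q : - (G T').1 <= - c * (T - T').
  apply: q => t /andP[t1 t2].
    by apply: D1; [exact: le_lt_trans t1|exact: lt_le_trans TTm].
  by apply: PG; rewrite distrC ger0_norm ?subr_ge0 ?(ltW t2)//; clear -t1 te1; lra.
have q1 := ler_norm (G T').1.
by rewrite distrC ger0_norm ?subr_ge0 ?(ltW T'T)//; clear -q q1; lra.
Qed.

(** Since [T' - T] is of the order of [w] by [exit_time], replacing the cross product at [T'] by the
    displacement on the line costs only products of two small quantities. *)
Lemma exit_est F G M1 Tm T y1 : lipbox F -> 0 <= T <= Tm -> curve_derive G (F \o G) 0 Tm ->
  (forall t, 0 <= t <= Tm -> `|G t| <= M1) -> G T = (0, y1) -> (F (0, y1)).1 < 0 ->
  exists e C, [/\ 0 < e, 0 < C & forall T' y2 w, 0 <= T' <= Tm -> `|T' - T| < e ->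
   w = (0, y2) - G T' -> `|- (y2 - y1) * (F (0, y1)).1 - (w.1 * (F (G T')).2 - w.2 * (F (G T')).1)| <= C * `|w| ^+ 2].
Proof.
move=> lF TTm DG GM GT F1; have [G1 G2 DGt] := DG.
have [L L0 HL] := lF M1; have [b b0 Hb] := sol_lip lF DG GM.
have [e [c [e0 c0 Hc]]] := exit_time lF TTm DG GM GT F1.
have [T0 TTm'] := andP TTm.
pose P1 := (F (0, y1)).1; pose Q1 := (F (0, y1)).2.
pose k := L * b * c^-1; have k0 : 0 < k by rewrite !mulr_gt0// invr_gt0.
exists e, (2 * k + 2 * b * k * c^-1); split=> //.
  by rewrite addr_gt0// !mulr_gt0// invr_gt0.
move=> T' y2 w T'm T'e wE; have T'c := Hc T' T'm T'e.
have [T'0 T'm'] := andP T'm.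
have wG : (G T').1 = - w.1 by rewrite wE /= sub0r opprK.
have TTw : `|T' - T| <= c^-1 * `|w|.
  rewrite mulrC ler_pdivlMr// mulrC; apply: le_trans T'c _.
  by rewrite wG normrN pnorm1.
have FL s : 0 <= s <= Tm -> `|s - T| <= `|T' - T| -> `|F (G s) - F (0, y1)| <= k * `|w|.
  move=> sT sTT; rewrite -GT; apply: le_trans (HL _ _ (GM _ sT) (GM _ TTm)) _.
  rewrite /k -!mulrA ler_pM2l//; apply: le_trans (Hb s T sT TTm).2 _.
  by rewrite ler_pM2l//; exact: le_trans sTT TTw.
(* [l] is the cross product of the position with the exit velocity; its derivative vanishes at [T],
   so its increment is quadratic too. *)
pose l t := (G t).1 * Q1 - (G t).2 * P1.
have -> : - (y2 - y1) * P1 - (w.1 * (F (G T')).2 - w.2 * (F (G T')).1) =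
   ((F (G T') - F (0, y1)).1 * w.2 - (F (G T') - F (0, y1)).2 * w.1) + (l T' - l T).
  by rewrite /l GT wE /P1 /Q1 /=; ring.
apply: le_trans (ler_normD _ _) _; rewrite [leRHS]mulrDl; apply: lerD.
  have q := FL T' T'm (lexx _).
  apply: le_trans (ler_normB _ _) _; rewrite !normrM.
  rewrite (_ : 2 * k * `|w| ^+ 2 = k * `|w| * `|w| + k * `|w| * `|w|); last by ring.
  by apply: lerD; apply: ler_pM => //; rewrite ?pnorm1 ?pnorm2//; apply: le_trans q; rewrite ?pnorm1 ?pnorm2.
have Fb := (Hb T T TTm TTm).1; rewrite GT in Fb.
have lb u v : 0 <= u -> u <= v -> v <= Tm -> `|u - T| <= `|T' - T| -> `|v - T| <= `|T' - T| ->
    `|l v - l u| <= 2 * b * (k * `|w|) * (v - u).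
  move=> u0 uv vT uTT vTT.
  have cl : continuous l.
    by move=> t; apply: cvgB; (apply: cvgM; last exact: cvg_cst); [exact: G1|exact: G2].
  apply: (mvt_abs uv cl (df := fun t => (F (G t)).1 * Q1 - (F (G t)).2 * P1)).
    move=> t /andP[ut tv]; have [|? ?] := DGt t.
      by rewrite (le_lt_trans u0 ut) (lt_le_trans tv vT).
    by apply: is_derive_eq; rewrite /GRing.scale/=; ring.
  move=> t /andP[ut tv].
  have tT' : 0 <= t <= Tm by rewrite (le_trans u0 (ltW ut)) (le_trans (ltW tv) vT).
  have tt : `|t - T| <= `|T' - T|.
    move: uTT vTT; rewrite !ler_norml => /andP[h1 h2] /andP[h3 h4].
    by apply/andP; split; clear -h1 h4 ut tv; lra.
  have q := FL t tT' tt.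
  rewrite (_ : _ - _ = (F (G t) - F (0, y1)).1 * Q1 - (F (G t) - F (0, y1)).2 * P1); last first.
    by rewrite /P1 /Q1 /=; ring.
  apply: le_trans (ler_normB _ _) _; rewrite !normrM.
  rewrite (_ : 2 * b * (k * `|w|) = k * `|w| * b + k * `|w| * b); last by ring.
  by apply: lerD; apply: ler_pM => //; (apply: le_trans (_ : _ <= _) _; [exact: pnorm1|] ||
    apply: le_trans (pnorm2 _) _).
have : `|l T' - l T| <= 2 * b * (k * `|w|) * `|T' - T|.
  have [TT'|T'T] := leP T T'.
    by rewrite [X in _ * X]ger0_norm ?subr_ge0//; apply: lb; rewrite ?subrr ?normr0.
  rewrite distrC [X in _ * X]distrC [X in _ * X]ger0_norm ?subr_ge0 ?(ltW T'T)//.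
  by apply: lb; rewrite ?subrr ?normr0// ltW.
move=> /le_trans; apply.
rewrite (_ : 2 * b * k * c^-1 * `|w| ^+ 2 = 2 * b * (k * `|w|) * (c^-1 * `|w|)); last by ring.
by apply: ler_wpM2l => //; apply: mulr_ge0; apply: mulr_ge0 => //; exact: ltW.
Qed.

Lemma sign_arith (de x P1 P0 Dm C k : R) : 0 < C -> 0 < P0 -> P1 < 0 -> de != 0 ->
  C^-1 <= k -> `|Dm - - (de * P0) * k| <= C * `|de| ^+ 2 ->
  `|- x * P1 - Dm| <= C * (C * `|de|) ^+ 2 -> (C + C ^+ 3) * `|de| * C < P0 -> de * x < 0.
Proof.
move=> C0 P00 P10 den Ck h1 h2 h3.
have de0 : 0 < `|de| by rewrite normr_gt0.
rewrite -(nmulr_lgt0 _ P10).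
have q1 : de * (- x * P1 - Dm) <= `|de| * (C * (C * `|de|) ^+ 2).
  by apply: le_trans (ler_norm _) _; rewrite normrM ler_pM2l.
have q2 : de * (Dm - - (de * P0) * k) <= `|de| * (C * `|de| ^+ 2).
  by apply: le_trans (ler_norm _) _; rewrite normrM ler_pM2l.
have q3 : (C + C ^+ 3) * `|de| < P0 * k.
  by apply: lt_le_trans (_ : P0 * C^-1 <= _); [rewrite ltr_pdivlMr|rewrite ler_pM2l].
have q4 : (C + C ^+ 3) * `|de| * `|de| ^+ 2 < P0 * k * `|de| ^+ 2.
  by rewrite ltr_pM2r// exprn_gt0.
rewrite [in X in _ < X]real_normK ?num_real// in q4.
have e1 : `|de| * (C * (C * `|de|) ^+ 2) + `|de| * (C * `|de| ^+ 2) =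
   (C + C ^+ 3) * `|de| * `|de| ^+ 2 by ring.
by clear -q1 q2 q4 e1; nra.
Qed.

(** On the line the cross product is minus the displacement times the first velocity component. It
    keeps its sign along the passage, whereas that component changes from positive at the entry to
    negative at the exit. *)
Lemma pass_dec_loc V F y y1 : smoothf F -> pass V F (0, y) y1 -> 0 < (F (0, y)).1 ->
  exists2 r : R, 0 < r & forall y' y1', `|y' - y| <= r -> y' != y -> pass V F (0, y') y1' ->
    (y' - y) * (y1' - y1) < 0.
Proof.
move=> sF [T [g gA]] Fy; have lF := smoothf_lipbox sF.
have [G [M [d [d0 M0 EG DG GM]]]] := parc_extend lF gA.
have [T0 g0 gT _ _ _ Fe _] := gA.
have Tm0 : 0 <= T + d by rewrite addr_ge0// ltW.
have TTm : 0 <= T <= T + d by rewrite T0 lerDl ltW.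
have GT : G T = (0, y1) by rewrite EG ?T0 ?lexx.
have G0 : G 0 = (0, y) by rewrite EG ?lexx.
pose M1 := M + 1.
have GM1 t : 0 <= t <= T + d -> `|G t| <= M1 by move=> /GM/le_trans; apply; rewrite lerDl.
have gA1 : parc [set w | `|w - 0| < M1] F (0, y) y1 T g.
  case: gA => [? ? ? ? ? _ ? ?]; split=> // t /andP[t0 tT] /=; rewrite subr0 -EG ?t0//.
  have tTd : 0 <= t <= T + d by rewrite t0 (le_trans tT)// lerDl ltW.
  by apply: le_lt_trans (GM _ tTd) _; rewrite ltrDl.
have [C1 C10 HC1] := cross_est sF Tm0 DG GM1.
have [e [C2 [e0 C20 HC2]]] := exit_est lF TTm DG GM1 GT Fe.
have m0 : 0 < Num.min d e by rewrite lt_min d0.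
have [r r0 Hr] := arc_perturb (@pball_open R 0 M1) lF gA1 m0.
pose C := C1 + C2; have C0 : 0 < C by rewrite addr_gt0.
have CC : 0 < (C + C ^+ 3) * C by rewrite !mulr_gt0// addr_gt0// exprn_gt0.
pose rr := Num.min r ((F (0, y)).1 / (2 * ((C + C ^+ 3) * C))).
exists rr => [|y' y1' yr yn [T1 [h1 hA1]]]; first by rewrite lt_min r0 divr_gt0// mulr_gt0.
have [yr1 yr2] := andP (etrans (esym (le_min _ _ _)) yr).
have yy : (0, y') - (0, y) = (0, y' - y) :> R * R by congr pair; rewrite /= subrr.
have nyy : `|(0, y') - (0, y) : R * R| = `|y' - y|.
  by rewrite yy prod_normE /= normr0 max_r.
have [|||y2 [T' [h [_ TT' hA]]]] := Hr F lF _ (0, y').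
- by move=> w _; rewrite subrr normr0 ltW.
- by rewrite nyy.
- by [].
have [_ E _] := parc_uniq lF hA1 hA; rewrite {}E; clear hA1 Hr.
case: hA => T'0 h0 hT' Dh _ hV _ _.
move: TT'; rewrite lt_min => /andP[TT'd TT'e].
have T'm : 0 <= T' <= T + d.
  by rewrite T'0; move: TT'd; rewrite ltr_norml => /andP[_]; clear; lra.
have hM t : 0 <= t <= T' -> `|h t| <= M1 by move=> /hV /=; rewrite subr0 => /ltW.
have [k Ck [hD hw]] := HC1 h T' T'm Dh hM.
have := HC2 T' y2 (h T' - G T') T'm TT'e; rewrite -hT' => /(_ erefl).
move: hD hw; rewrite h0 G0 nyy yy /= mul0r sub0r => hD hw hE.
apply: (sign_arith (C := C) (k := k) C0 Fy Fe _ _ _ _ _).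
- by rewrite subr_eq0.
- by apply: le_trans Ck; rewrite lef_pV2 ?posrE// /C lerDl ltW.
- by apply: le_trans hD _; rewrite ler_wpM2r ?sqr_ge0// /C lerDl ltW.
- apply: le_trans hE _; apply: ler_pM; rewrite ?sqr_ge0 ?(ltW C20)// ?/C ?lerDr ?(ltW C10)//.
  rewrite ler_sqr ?nnegrE ?mulr_ge0 ?(addr_ge0 (ltW C10) (ltW C20))//.
  by apply: le_trans hw _; rewrite ler_wpM2r// lerDl ltW.
- rewrite mulrAC; move: yr2; rewrite ler_pdivlMr; last exact: mulr_gt0.
  move=> yr2.
  by clear -yr2 Fy; lra.
Qed.

End Orientation.

(** * Chains of passages *)

Section Chains.
Variable R : realType.
Implicit Types (z w : R * R) (e t s a b c d y p q L M r u v : R) (F A B : R * R -> R * R)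
  (V VA VB : set (R * R)) (D : set R).

Definition hpass V F y y' := 0 < (F (0, y)).1 /\ pass V F (0, y) y'.

(** [n] counts the intermediate points, so there are [n + 1] passages, and a closed chain is a
    closed orbit only for odd [n]. The fields swap roles at each step; [D] restricts only the
    intermediate points, never the two ends. *)
Fixpoint chain A B VA VB D (n : nat) y y' : Prop :=
  if n is m.+1 then exists y1, [/\ hpass VA A y y1, D y1 & chain B A VB VA D m y1 y']
  else hpass VA A y y'.

Lemma hpass_uniq V V' F y y1 y2 : lipbox F -> hpass V F y y1 -> hpass V' F y y2 -> y1 = y2.
Proof. by move=> lF [_ h1] [_ h2]; exact: pass_uniq lF h1 h2. Qed.

Lemma chain_uniq A B VA VB VA' VB' D D' n y y1 y2 : lipbox A -> lipbox B ->
  chain A B VA VB D n y y1 -> chain A B VA' VB' D' n y y2 -> y1 = y2.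
Proof.
elim: n A B VA VB VA' VB' y => [|n IH] A B VA VB VA' VB' y lA lB /=; first exact: hpass_uniq.
move=> [u [h1 _ c1]] [v [h2 _ c2]]; move: c1; rewrite (hpass_uniq lA h1 h2) => c1.
exact: IH c1 c2.
Qed.

Lemma hpassS V V' F y y' : V `<=` V' -> hpass V F y y' -> hpass V' F y y'.
Proof. by move=> VV [h /(passS VV)]. Qed.

Lemma chainS A B VA VB VA' VB' D D' n y y' : VA `<=` VA' -> VB `<=` VB' -> D `<=` D' ->
  chain A B VA VB D n y y' -> chain A B VA' VB' D' n y y'.
Proof.
move=> hA hB hD; elim: n A B VA VB VA' VB' hA hB y => [|n IH] A B VA VB VA' VB' hA hB y /=.
  exact: hpassS.
by move=> [u [h1 h2 h3]]; exists u; split; [exact: hpassS h1|exact: hD|exact: IH h3].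
Qed.

Lemma fcloseW r r' F F' : 0 < r -> r <= r' -> fclose r F F' -> fclose r' F F'.
Proof.
move=> r0 rr H z zr; have r'0 := lt_le_trans r0 rr.
have zr' : `|z| <= r^-1 by apply: le_trans zr _; rewrite lef_pV2 ?posrE.
exact: le_trans (H z zr') rr.
Qed.

Lemma fclose_id r F : 0 < r -> fclose r F F.
Proof. by move=> r0 z _; rewrite subrr normr0 ltW. Qed.

Lemma hpass_perturb V F y0 y1 e : open V -> lipbox F -> hpass V F y0 y1 -> 0 < e ->
  exists2 r : R, 0 < r & forall F', lipbox F' -> fclose r F F' -> forall y, `|y - y0| <= r ->
    exists2 y', `|y' - y1| < e & hpass V F' y y'.
Proof.
move=> oV lF [F0 ps] e0; have [r r0 Hr] := pass_perturb oV lF ps e0.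
have F2 : 0 < (F (0, y0)).1 / 2 by rewrite divr_gt0.
have [d d0 Hd] := lipbox_cont (0, y0) lF F2.
pose m := Num.min r (Num.min (d / 2) (Num.min ((F (0, y0)).1 / 4) (`|y0| + d / 2)^-1)).
have yd : 0 < `|y0| + d / 2 by rewrite ltr_wpDl// divr_gt0.
exists m => [|F' lF' cF y]; first by rewrite !lt_min r0 invr_gt0 yd !divr_gt0.
have m0 : 0 < m by rewrite !lt_min r0 invr_gt0 yd !divr_gt0.
move=> ym; have [yr yd2] : `|y - y0| <= r /\ `|y - y0| <= d / 2.
  by move: ym; rewrite !le_min => /and3P[].
have mr : m <= r by rewrite ge_min lexx.
have mF : m <= (F (0, y0)).1 / 4 by rewrite !ge_min lexx !orbT.
have yy : `|(0, y) - (0, y0) : R * R| = `|y - y0|.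
  by rewrite prod_normE /= subrr normr0 max_r.
have yr' : `|(0, y) - (0, y0) : R * R| <= r by rewrite yy.
have [y' h1 h2] := Hr F' lF' (fcloseW m0 mr cF) (0, y) yr' (lexx _).
exists y' => //; split=> //.
have h3 : `|F (0, y) - F (0, y0)| < (F (0, y0)).1 / 2.
  by apply: Hd; rewrite yy; apply: le_lt_trans yd2 _; rewrite ltr_pdivrMr// ltr_pMr// ltr1n.
have h4 : `|F' (0, y) - F (0, y)| <= m.
  apply: cF; apply: (@le_trans _ _ (`|y0| + d / 2)).
    rewrite prod_normE /= normr0 max_r// (_ : y = y0 + (y - y0)); last by ring.
    by apply: le_trans (ler_normD _ _) _; rewrite lerD2l.
  by rewrite -[leLHS]invrK lef_pV2 ?posrE ?invr_gt0// !ge_min lexx !orbT.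
have := le_lt_trans (pnorm1 _) h3; have := le_trans (pnorm1 _) h4.
by clear -mF F2; rewrite /= ler_norml ltr_norml => /andP[? ?] /andP[? ?]; lra.
Qed.

Lemma chain_perturb A B VA VB D n y0 y1 e : open VA -> open VB -> open D -> lipbox A -> lipbox B ->
  chain A B VA VB D n y0 y1 -> 0 < e ->
  exists2 r : R, 0 < r & forall A' B', lipbox A' -> lipbox B' -> fclose r A A' -> fclose r B B' ->
    forall y, `|y - y0| <= r -> exists2 y', `|y' - y1| < e & chain A' B' VA VB D n y y'.
Proof.
move=> + + oD; elim: n A B VA VB y0 => [|n IH] A B VA VB y0 oA oB lA lB /=.
  move=> h e0; have [r r0 H] := hpass_perturb oA lA h e0.
  by exists r => // A' B' lA' _ cA _; exact: H.
move=> [u [h Du ch]] e0.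
have [r r0 Hr] := IH B A VB VA u oB oA lB lA ch e0.
have [d d0 Hd] : exists2 d : R, 0 < d & forall v, `|v - u| < d -> D v.
  have /nbhs_ballP[d /= d0 Hd] : nbhs u D by exact: open_nbhs_nbhs.
  by exists d => // v vd; apply: Hd; rewrite /ball /= distrC.
have m0 : 0 < Num.min r d by rewrite lt_min r0.
have [r' r'0 Hr'] := hpass_perturb oA lA h m0.
have mm : 0 < Num.min r r' by rewrite lt_min r0.
exists (Num.min r r') => // A' B' lA' lB' cA cB y yr.
have [||v vu hv] := Hr' A' lA' _ y.
- by apply: fcloseW cA => //; rewrite ge_min lexx orbT.
- by apply: le_trans yr _; rewrite ge_min lexx orbT.
move: vu; rewrite lt_min => /andP[vr vd].
have [||y' h1 h2] := Hr B' A' lB' lA' _ _ v (ltW vr).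
- by apply: fcloseW cB => //; rewrite ge_min lexx.
- by apply: fcloseW cA => //; rewrite ge_min lexx.
by exists y' => //; exists v; split=> //; exact: Hd.
Qed.

Lemma local_dec (f : R -> R) u v : u < v ->
  (forall y, u <= y <= v -> exists2 r : R, 0 < r & forall y', u <= y' <= v -> `|y' - y| <= r ->
     y' != y -> (y' - y) * (f y' - f y) < 0) -> f v < f u.
Proof.
move=> uv loc.
pose S := [set t | u <= t <= v /\ forall s, u < s <= t -> f s < f u].
have Su : S u.
  by split=> [|s /andP[h1 h2]]; [rewrite lexx ltW|have := lt_le_trans h1 h2; rewrite ltxx].
have hS : has_sup S by split; [exists u|exists v => t [/andP[]]].
pose w := sup S.
have wu : u <= w by apply: ub_le_sup; case: hS.
have wv : w <= v by apply: ge_sup => [|t [/andP[]]//]; exists u.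
have below s : u < s < w -> f s < f u.
  move=> /andP[us sw]; have e0 : 0 < w - s by rewrite subr_gt0.
  have [t [tv Ht] wt] := sup_adherent e0 hS.
  by apply: Ht; rewrite us ltW//; move: wt; rewrite -/w; clear; lra.
have uwv : u <= w <= v by rewrite wu.
have [r r0 Hr] := loc w uwv.
have fw : u < w -> f w < f u.
  move=> uw; pose s := Num.max (w - r) ((u + w) / 2).
  have sw : s < w by rewrite gt_max; apply/andP; split; clear -r0 uw; lra.
  have us : u < s by rewrite lt_max; apply/orP; right; clear -uw; lra.
  have wrs : w - r <= s by rewrite le_max lexx.
  apply: lt_trans (below s _); last by rewrite us.
  have := Hr s; rewrite (ltW us) (le_trans (ltW sw) wv) lt_eqF//.
  rewrite ler0_norm ?subr_le0 ?(ltW sw)// => /(_ isT) H.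
  have {H}: (s - w) * (f s - f w) < 0 by apply: H => //; clear -wrs; lra.
  by rewrite nmulr_rlt0 ?subr_lt0// subr_gt0.
move: wv; rewrite le_eqVlt => /predU1P[wE|wv]; first by rewrite -wE fw// wE.
pose t := Num.min (w + r) v.
have wt : w < t by rewrite lt_min wv andbT ltrDl.
have tv : t <= v by rewrite ge_min lexx orbT.
have trw : t <= w + r by rewrite ge_min lexx.
suff : S t by move=> /(ub_le_sup hS.2); rewrite leNgt -/w wt.
split=> [|s /andP[us st]]; first by rewrite (le_trans wu (ltW wt)).
have fwu : f w <= f u.
  by move: wu; rewrite le_eqVlt => /predU1P[<-//|/fw/ltW].
have [sw|ws|sE] := ltgtP s w; first by apply: below; rewrite us.
  apply: lt_le_trans fwu; have := Hr s; rewrite (le_trans wu (ltW ws)) (le_trans st tv) (gt_eqF ws).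
  rewrite ger0_norm ?subr_ge0 ?(ltW ws)// => /(_ isT) H.
  have {H}: (s - w) * (f s - f w) < 0 by apply: H => //; clear -st trw; lra.
  by rewrite pmulr_rlt0 ?subr_gt0// subr_lt0.
by rewrite sE; apply: fw; rewrite -sE.
Qed.

Lemma pass_dec V F u v u' v' : smoothf F -> u < v ->
  (forall y, u <= y <= v -> exists y', hpass V F y y') ->
  hpass V F u u' -> hpass V F v v' -> v' < u'.
Proof.
move=> sF uv H hu hv; have lF := smoothf_lipbox sF.
have [f Hf] : exists f, forall y, u <= y <= v -> hpass V F y (f y).
  have [|f Hf] := @choice R R (fun y y' => u <= y <= v -> hpass V F y y'); last by exists f.
  move=> y; have [/H[y' ?]|n] := pselect (u <= y <= v); first by exists y'.
  by exists 0 => /n.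
rewrite (hpass_uniq lF hu (Hf u _)) ?lexx ?(ltW uv)//.
rewrite (hpass_uniq lF hv (Hf v _)) ?lexx ?(ltW uv)//.
apply: local_dec uv _ => y yuv; have [Fy py] := Hf y yuv.
have [r r0 Hr] := pass_dec_loc sF py Fy; exists r => // y' y'uv y'r yy'.
by apply: Hr => //; have [] := Hf y' y'uv.
Qed.

Definition shiftf d F z := F (z.1, z.2 - d).

Lemma hpass_shift V d F y y' : hpass V (shiftf d F) y y' -> hpass setT F (y - d) (y' - d).
Proof.
move=> [Fy ps]; split; first exact: Fy.
have E : rescale 1 (- d) F = shiftf d F.
  apply/funext => z; rewrite /rescale /shiftf invr1 !mul1r [- d + _]addrC.
  by rewrite -surjective_pairing.
have := @pass_rescale R V 1 (- d) F (0, y) y' ltr01.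
by rewrite E !mul1r /= ![- d + _]addrC; apply.
Qed.

Lemma lipbox_shift d F : lipbox F -> lipbox (shiftf d F).
Proof.
move=> lF r; have [L L0 HL] := lF (r + `|d|); exists L => // z w zr wr.
have s z' : `|z'| <= r -> `|(z'.1, z'.2 - d)| <= r + `|d|.
  rewrite !pnorm_le /= => /andP[h1 h2]; apply/andP; split.
    by apply: le_trans h1 _; rewrite lerDl.
  by apply: le_trans (ler_normB _ _) _; rewrite lerD2r.
apply: le_trans (HL _ _ (s _ zr) (s _ wr)) _; rewrite ler_pM2l//.
rewrite pnorm_le /= (_ : z.2 - d - (w.2 - d) = z.2 - w.2); last by ring.
by rewrite (pnorm1 (z - w)) (pnorm2 (z - w)).
Qed.

Lemma fclose_shift F d r : 0 < r -> lipbox F ->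
  exists2 e : R, 0 < e & forall d', `|d' - d| <= e -> fclose r (shiftf d F) (shiftf d' F).
Proof.
move=> r0 lF; have [L L0 HL] := lF (r^-1 + `|d| + 1).
exists (Num.min 1 (r / L)) => [|d']; first by rewrite lt_min ltr01 divr_gt0.
rewrite le_min => /andP[d1 dL] z zr.
have dd : `|d'| <= `|d| + 1.
  rewrite (_ : d' = (d' - d) + d); last by ring.
  by rewrite [leRHS]addrC; apply: le_trans (ler_normD _ _) _; rewrite lerD2r.
have s e : `|e| <= `|d| + 1 -> `|(z.1, z.2 - e)| <= r^-1 + `|d| + 1.
  move=> ed; move: zr; rewrite !pnorm_le /= => /andP[h1 h2]; apply/andP; split.
    by apply: le_trans h1 _; rewrite -addrA lerDl addr_ge0.
  by apply: le_trans (ler_normB _ _) _; rewrite -addrA lerD.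
apply: le_trans (HL _ _ (s _ dd) (s _ _)) _; first by rewrite lerDl.
rewrite mulrC -ler_pdivlMr//; apply: le_trans dL.
rewrite pnorm_le /= subrr normr0 normr_ge0 /=.
by rewrite (_ : z.2 - d' - (z.2 - d) = - (d' - d)) ?normrN//; ring.
Qed.

End Chains.

(** * Monotone dependence of chains on translations *)

Section Comparison.
Variable R : realType.
Implicit Types (e t s c d p : R) (F A B : R * R -> R * R)
  (V VA VB : set (R * R)) (D : set R).

Lemma shiftf0 F : shiftf 0 F = F.
Proof. by apply/funext => z; rewrite /shiftf subr0 -surjective_pairing. Qed.

Lemma hpass_path_cont V F (a y y' : R -> R) : open V -> lipbox F -> continuous a -> continuous y ->
  (forall s, hpass V (shiftf (a s) F) (y s) (y' s)) -> continuous y'.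
Proof.
move=> oV lF ca cy H s; apply: ed_cont => e e0.
have [r r0 Hr] := hpass_perturb oV (lipbox_shift (a s) lF) (H s) e0.
have [e1 e10 He1] := fclose_shift (a s) r0 lF.
have [d1 d10 Hd1] := cont_ed (ca s) e10; have [d2 d20 Hd2] := cont_ed (cy s) r0.
exists (Num.min d1 d2) => [|s']; first by rewrite lt_min d10.
rewrite lt_min => /andP[/Hd1 h1 /Hd2 h2].
have [y2 h3 h4] := Hr _ (lipbox_shift (a s') lF) (He1 _ (ltW h1)) _ (ltW h2).
by rewrite (hpass_uniq (lipbox_shift (a s') lF) (H s') h4).
Qed.

(** In coordinates moving with the field the entry is [y - a]. By the intermediate value theorem the
    path covers every entry between the two compared ones, so passages exist on that whole interval
    and [pass_dec] applies. *)
Lemma hpass_cmp V F (a y y' : R -> R) s0 s1 : open V -> smoothf F -> continuous a -> continuous y ->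
  (forall s, hpass V (shiftf (a s) F) (y s) (y' s)) ->
  y s0 - a s0 < y s1 - a s1 -> y' s1 - a s1 < y' s0 - a s0.
Proof.
move=> oV sF ca cy H yy; have lF := smoothf_lipbox sF.
have H' s := hpass_shift (H s).
apply: pass_dec sF yy _ (H' s0) (H' s1) => x xx.
have cu : continuous (fun s => y s - a s) by move=> s; apply: cvgB; [exact: cy|exact: ca].
have [s <-] : exists s, y s - a s = x.
  have [s01|/ltW s10] := leP s0 s1.
    by have [s _ sx] := ivt s01 cu xx; exists s.
  by have [s _ sx] := ivt_dec s10 cu xx; exists s.
by exists (y' s - a s).
Qed.

Lemma hpass_cmp_eq V F (a y y' : R -> R) s0 s1 : lipbox F ->
  (forall s, hpass V (shiftf (a s) F) (y s) (y' s)) ->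
  y s0 - a s0 = y s1 - a s1 -> y' s1 - a s1 = y' s0 - a s0.
Proof.
move=> lF H yy; have := hpass_shift (H s0); rewrite yy => h0.
exact: hpass_uniq lF (hpass_shift (H s1)) h0.
Qed.

Lemma chain_first A B VA VB D n (a b y z : R -> R) : open VA -> lipbox A -> continuous a ->
  continuous y -> (forall s, chain (shiftf (a s) A) (shiftf (b s) B) VA VB D n.+1 (y s) (z s)) ->
  exists q : R -> R, [/\ continuous q, forall s, hpass VA (shiftf (a s) A) (y s) (q s),
    forall s, D (q s) & forall s, chain (shiftf (b s) B) (shiftf (a s) A) VB VA D n (q s) (z s)].
Proof.
move=> oA lA ca cy H; have [q Hq] := choice H; exists q.
have h1 s : hpass VA (shiftf (a s) A) (y s) (q s) by have [] := Hq s.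
split=> //; first exact: hpass_path_cont h1.
  by move=> s; have [] := Hq s.
by move=> s; have [] := Hq s.
Qed.

(* Passages reverse the order, so [s |-> z s - y s] moves against the relative shift of the
   two fields: this is the monotonicity of rotated families. *)
Lemma chain_cmp A B VA VB D n (a b y z : R -> R) s0 s1 : open VA -> open VB -> smoothf A ->
  smoothf B -> continuous a -> continuous b -> continuous y ->
  (forall s, chain (shiftf (a s) A) (shiftf (b s) B) VA VB D n (y s) (z s)) ->
  if odd n then a s0 <= a s1 -> b s0 = b s1 ->
    (y s1 <= y s0 -> z s1 <= z s0) /\ (y s1 < y s0 -> z s1 < z s0)
  else a s0 = a s1 -> b s0 <= b s1 ->
    (y s0 <= y s1 -> z s1 <= z s0) /\ (y s0 < y s1 -> z s1 < z s0).
Proof.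
elim: n A B VA VB a b y => [|n IH] A B VA VB a b y oA oB sA sB ca cb cy H /=.
  move=> aE _; have lt : y s0 < y s1 -> z s1 < z s0.
    move=> yy; have := @hpass_cmp _ _ a y z s0 s1 oA sA ca cy H.
    by rewrite aE ltrD2r yy ltrD2r; apply.
  split=> //; rewrite le_eqVlt => /predU1P[yE|/lt/ltW//].
  have := @hpass_cmp_eq _ _ a y z s0 s1 (smoothf_lipbox sA) H.
  by rewrite aE yE => /(_ erefl) /addIr ->.
have [q [cq Hq _ Hc]] := chain_first oA (smoothf_lipbox sA) ca cy H.
have := IH B A VB VA b a q oB oA sB sA cb ca cq Hc.
have cmp := @hpass_cmp _ _ a y q _ _ oA sA ca cy Hq.
have cmpE := @hpass_cmp_eq _ _ a y q s0 s1 (smoothf_lipbox sA) Hq.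
case: (odd n) => /=; [move=> {}IH aE bb|move=> {}IH aa bE].
  have [h1 h2] := IH bb (aE).
  have lt : y s0 < y s1 -> q s1 < q s0.
    by move=> yy; have := cmp s0 s1; rewrite aE ltrD2r yy ltrD2r; apply.
  split; last by move=> /lt/h2.
  rewrite le_eqVlt => /predU1P[yE|/lt/ltW]; last exact: h1.
  by apply: h1; have := cmpE; rewrite aE yE => /(_ erefl) /addIr ->.
have [h1 h2] := IH bE aa.
have lt : y s1 < y s0 -> q s0 < q s1.
  move=> yy; have : q s0 - a s0 < q s1 - a s1 by apply: cmp; rewrite ltr_leB.
  by clear -aa; lra.
split; last by move=> /lt/h2.
rewrite le_eqVlt => /predU1P[yE|/lt/ltW]; last exact: h1.
apply: h1; move: aa; rewrite le_eqVlt => /predU1P[aE|aa].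
  by have := cmpE; rewrite aE yE => /(_ erefl) /addIr ->.
have : q s0 - a s0 < q s1 - a s1 by apply: cmp; rewrite yE ltrD2l ltrN2.
by clear -aa; lra.
Qed.

(** It makes segments into paths defined on all of R and constant outside [[0, 1]], so that
    existence of chains can be asked for every parameter. *)
Definition ramp (s : R) := Num.max 0 (Num.min 1 s).

Lemma ramp01 s : 0 <= ramp s <= 1.
Proof. by rewrite /ramp le_max lexx /= ge_max ler01 ge_min lexx. Qed.

Lemma cont_ramp : continuous ramp.
Proof.
move=> t; apply: continuous_max; first exact: cvg_cst.
by apply: continuous_min; [exact: cvg_cst|exact: cvg_id].
Qed.

Definition lpath (u v : R) s := u + (v - u) * ramp s.

Lemma lpath0 u v : lpath u v 0 = u.
Proof. by rewrite /lpath /ramp min_r// maxxx mulr0 addr0. Qed.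

Lemma lpath1 u v : lpath u v 1 = v.
Proof. by rewrite /lpath /ramp minxx max_r// mulr1 addrC subrK. Qed.

Lemma cont_lpath u v : continuous (lpath u v).
Proof.
move=> t; apply: cvgD; first exact: cvg_cst.
by apply: cvgM; [exact: cvg_cst|exact: cont_ramp].
Qed.

Lemma lpath_in u v a b s : a <= u <= b -> a <= v <= b -> a <= lpath u v s <= b.
Proof.
move=> /andP[h1 h2] /andP[h3 h4]; have /andP[r0 r1] := ramp01 s.
rewrite /lpath (_ : u + (v - u) * ramp s = (1 - ramp s) * u + ramp s * v); last by ring.
have r1' : 0 <= 1 - ramp s by rewrite subr_ge0.
apply/andP; split.
  rewrite (_ : a = (1 - ramp s) * a + ramp s * a); last by ring.
  by apply: lerD; apply: ler_wpM2l.
rewrite (_ : b = (1 - ramp s) * b + ramp s * b); last by ring.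
by apply: lerD; apply: ler_wpM2l.
Qed.

Section Rectangle.
Variables (A B : R * R -> R * R) (VA VB : set (R * R)) (D : set R) (n : nat) (al be da db : R).
Hypotheses (oA : open VA) (oB : open VB) (sA : smoothf A) (sB : smoothf B) (on : odd n).
Hypothesis rect : forall y d : R, al <= y <= be -> da <= d <= db ->
  exists z : R, chain (shiftf d A) B VA VB D n y z.

Lemma rect_path p p' d d' : al <= p <= be -> al <= p' <= be -> da <= d <= db -> da <= d' <= db ->
  exists z q : R -> R, [/\ continuous q,
    forall s, hpass VA (shiftf (lpath d d' s) A) (lpath p p' s) (q s) &
    forall s, chain B (shiftf (lpath d d' s) A) VB VA D n.-1 (q s) (z s)] /\
    forall s, chain (shiftf (lpath d d' s) A) B VA VB D n (lpath p p' s) (z s).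
Proof.
move=> pI pI' dI dI'.
have [z Hz] := choice (fun s => rect (lpath_in s pI pI') (lpath_in s dI dI')).
exists z; case: n on Hz => // m _ Hz.
have Hz' s : chain (shiftf (lpath d d' s) A) (shiftf 0 B) VA VB D m.+1 (lpath p p' s) (z s).
  by rewrite shiftf0.
have [q [cq Hq _ Hc]] := chain_first oA (smoothf_lipbox sA) (@cont_lpath d d') (@cont_lpath p p') Hz'.
exists q; split=> //; split=> // s; have := Hc s; by rewrite shiftf0.
Qed.

(** Raising [d] lowers the entry relative to [A], hence raises the first crossing point by more than
    the shift; the remaining odd number of passages reverses this. *)
Lemma rect_shift p d d' (z z' : R) : al <= p <= be -> da <= d <= db -> da <= d' <= db -> d < d' ->
  chain (shiftf d A) B VA VB D n p z -> chain (shiftf d' A) B VA VB D n p z' -> z' < z.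
Proof.
move=> pI dI dI' dd h h'.
have [f [q [[cq Hq Hc] Hz]]] := rect_path pI pI dI dI'.
have lA := lipbox_shift _ (smoothf_lipbox sA); have lB := smoothf_lipbox sB.
have e0 : z = f 0 by have := Hz 0; rewrite !lpath0; exact: chain_uniq (lA _) lB h.
have e1 : z' = f 1 by have := Hz 1; rewrite !lpath1; exact: chain_uniq (lA _) lB h'.
have Hc' s : chain (shiftf 0 B) (shiftf (lpath d d' s) A) VB VA D n.-1 (q s) (f s).
  by rewrite shiftf0.
have c0 : continuous (fun _ : R => 0 : R) by move=> ?; exact: cvg_cst.
have := @chain_cmp _ _ _ _ _ _ _ _ _ _ 0 1 oB oA sB sA c0 (@cont_lpath d d') cq Hc'.
have -> : odd n.-1 = false by case: n on => // m /= /negbTE.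
rewrite lpath0 lpath1 => /(_ erefl (ltW dd))[_]; rewrite e0 e1; apply.
have := @hpass_cmp _ _ _ _ _ 1 0 oA sA (@cont_lpath d d') (@cont_lpath p p) Hq.
rewrite !lpath0 !lpath1 ltrD2l ltrN2 dd => /(_ isT); lra.
Qed.

Lemma rect_incr p p' d (z z' : R) : al <= p <= be -> al <= p' <= be -> da <= d <= db -> p < p' ->
  chain (shiftf d A) B VA VB D n p z -> chain (shiftf d A) B VA VB D n p' z' -> z < z'.
Proof.
move=> pI pI' dI pp h h'.
have [f [q [[cq Hq Hc] Hz]]] := rect_path pI pI' dI dI.
have lA := lipbox_shift _ (smoothf_lipbox sA); have lB := smoothf_lipbox sB.
have e0 : z = f 0 by have := Hz 0; rewrite !lpath0; exact: chain_uniq (lA _) lB h.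
have e1 : z' = f 1 by have := Hz 1; rewrite !lpath1; exact: chain_uniq (lA _) lB h'.
have Hz' s : chain (shiftf (lpath d d s) A) (shiftf 0 B) VA VB D n (lpath p p' s) (f s).
  by rewrite shiftf0.
have c0 : continuous (fun _ : R => 0 : R) by move=> ?; exact: cvg_cst.
have := @chain_cmp _ _ _ _ _ _ _ _ _ _ 1 0 oA oB sA sB (@cont_lpath d d) c0 (@cont_lpath p p') Hz'.
by rewrite on !lpath0 !lpath1 => /(_ (lexx _) erefl)[_]; rewrite e0 e1; apply.
Qed.

(* With [w := p - q], [q] the first crossing point of the closed chain through [p], the set of
   pairs [(w, d)] is the graph of a 1-Lipschitz function. *)
Lemma rect_lip p p' d d' (q q' : R) : al <= p <= be -> al <= p' <= be -> da <= d <= db -> da <= d' <= db ->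
  hpass VA (shiftf d A) p q -> chain B (shiftf d A) VB VA D n.-1 q p ->
  hpass VA (shiftf d' A) p' q' -> chain B (shiftf d' A) VB VA D n.-1 q' p' ->
  `|d - d'| <= `|(p - q) - (p' - q')| /\ (d = d' -> p < p' -> p - q < p' - q').
Proof.
wlog dd : p p' d d' q q' / d <= d' => [H|] pI pI' dI dI' h1 h2 h1' h2'.
  have [dd|/ltW dd] := leP d d'; first exact: H.
  have [g1 g2] := H p' p d' d q' q dd pI' pI dI' dI h1' h2' h1 h2.
  rewrite distrC [leRHS]distrC; split=> // dE.
  move=> pp; have [] := H p p' d d' q q' _ pI pI' dI dI' h1 h2 h1' h2'; first by rewrite dE.
  by move=> _; apply.
have [f [k [[ck Hk Hc] Hz]]] := rect_path pI pI' dI dI'.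
have lA := lipbox_shift _ (smoothf_lipbox sA); have lB := smoothf_lipbox sB.
have q0 : k 0 = q by have := Hk 0; rewrite !lpath0 => h; exact: hpass_uniq (lA _) h h1.
have q1 : k 1 = q' by have := Hk 1; rewrite !lpath1 => h; exact: hpass_uniq (lA _) h h1'.
have e0 : f 0 = p by have := Hc 0; rewrite !lpath0 q0 => h; exact: chain_uniq lB (lA _) h h2.
have e1 : f 1 = p' by have := Hc 1; rewrite !lpath1 q1 => h; exact: chain_uniq lB (lA _) h h2'.
have Hc' s : chain (shiftf 0 B) (shiftf (lpath d d' s) A) VB VA D n.-1 (k s) (f s).
  by rewrite shiftf0.
have c0 : continuous (fun _ : R => 0 : R) by move=> ?; exact: cvg_cst.
have := @chain_cmp _ _ _ _ _ _ _ _ _ _ 0 1 oB oA sB sA c0 (@cont_lpath d d') ck Hc'.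
have -> : odd n.-1 = false by case: n on => // m /= /negbTE.
rewrite !lpath0 !lpath1 q0 q1 e0 e1 => /(_ erefl dd)[t1 t2].
have c10 := @hpass_cmp _ _ _ _ _ 1 0 oA sA (@cont_lpath d d') (@cont_lpath p p') Hk.
have c01 := @hpass_cmp _ _ _ _ _ 0 1 oA sA (@cont_lpath d d') (@cont_lpath p p') Hk.
rewrite !lpath0 !lpath1 q0 q1 in c10 c01.
split.
  rewrite distrC (ger0_norm (_ : 0 <= d' - d)) ?subr_ge0//.
  (* In each case [p] and [q] move in opposite directions (possibly not at all), so their moves add
     up in [p - q]. *)
  have [lt|ge] := ltP (p' - d') (p - d).
    have qq := c10 lt; have pp : p' < p by apply: t2; lra.
    by rewrite ger0_norm; lra.
  have [qq|qq] := ltP q' q.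
    by rewrite ler0_norm; lra.
  by have pp := t1 qq; rewrite ger0_norm; lra.
by move=> dE pp; have qq := c01; rewrite dE ltrD2r pp in qq; have := qq isT; lra.
Qed.

End Rectangle.
End Comparison.

(** * Generic translations have finitely many closed chains *)

Section GenericFibres.
Variable R : realType.
Notation mu := (@lebesgue_measure R).

Lemma seq_pos_lb (l : seq R) : (forall x, x \in l -> 0 < x) ->
  exists2 e : R, 0 < e & forall x, x \in l -> e < x.
Proof.
elim: l => [_|x l IH H]; first by exists 1.
have [|e e0 He] := IH; first by move=> y yl; apply: H; rewrite inE yl orbT.
have x0 : 0 < x by apply: H; rewrite inE eqxx.
exists (Num.min e (x / 2)) => [|y]; first by rewrite lt_min e0 divr_gt0.
rewrite inE gt_min => /predU1P[->|/He -> //]; apply/orP; right.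
by rewrite ltr_pdivrMr// ltr_pMr// ltr1n.
Qed.

(** Points more than [h] apart lie in different cells of length [h], so each contributes its own
    indicator. *)
Lemma cell_count (h k : R) (n : nat) (s : seq R) (J : 'I_n -> set R) d : uniq s ->
  (forall v w, v \in s -> w \in s -> v != w -> h < `|v - w|) ->
  (forall w, w \in s -> exists i : 'I_n, J i d /\ h * i%:R <= w + k <= h * i.+1%:R) ->
  (size s)%:R <= \sum_(i < n) (\1_(J i) d : R).
Proof.
case: n J => [|n] J us gap H.
  by case: s us gap H => [|x s] _ _ H; rewrite ?big_ord0//; have [[]] := H x (mem_head _ _).
have /choice[f Hf] : forall w, exists i : 'I_n.+1, w \in s -> J i d /\ h * i%:R <= w + k <= h * i.+1%:R.
  by move=> w; have [/H[i Hi]|_] := boolP (w \in s); [exists i|exists ord0].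
have uf : uniq (map f s).
  rewrite map_inj_in_uniq// => v w vs ws fvw; apply/eqP/negPn/negP => /(gap _ _ vs ws).
  have [_ /andP[]] := Hf v vs; have [_ /andP[]] := Hf w ws; rewrite fvw -natr1 mulrDr mulr1.
  by move=> ? ? ? ?; apply/negP; rewrite -leNgt ler_norml; apply/andP; split; lra.
apply: (@le_trans _ _ (\sum_(i in map f s) (\1_(J i) d : R))).
  rewrite -big_uniq//= big_map big_seq (eq_bigr (fun=> 1)).
    by rewrite -big_seq big_const_seq count_predT iter_addr_0 lexx.
  by move=> w /Hf[Jd _]; rewrite indicE mem_set.
by rewrite big_mkcond; apply: ler_sum => i _; case: ifP => // _; rewrite indicE.
Qed.

Lemma cell_ex (h k w : R) (n : nat) : 0 < h -> `|w| <= k -> 2 * k = h * n.+1%:R ->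
  exists i : 'I_n.+1, h * i%:R <= w + k <= h * i.+1%:R.
Proof.
move=> h0; rewrite ler_norml => /andP[w1 w2] hn.
have wk : 0 <= (w + k) / h by rewrite divr_ge0// ?(ltW h0)//; lra.
have /andP[i1 i2] := truncn_itv wk.
move: i1 i2; rewrite ler_pdivlMr// ltr_pdivrMr// ![_ * h]mulrC.
set i := Num.truncn _ => i1 i2.
have [iN|iN] := ltnP i n.+1; first by exists (Ordinal iN); rewrite i1 ltW.
exists ord_max => /=; rewrite -hn; apply/andP; split; last by lra.
apply: le_trans i1; rewrite ler_pM2l// ler_nat; exact: leq_trans iN.
Qed.

Lemma limn_einfE (u : (\bar R)^nat) : limn_einf u = ereal_sup (range (einfs u)).
Proof. by rewrite limn_einf_lim; apply/cvg_lim => //; exact: cvg_einfs_sup. Qed.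

Lemma limn_einf_le (u : (\bar R)^nat) M : (forall n, (u n <= M)%E) -> (limn_einf u <= M)%E.
Proof.
move=> uM; rewrite limn_einfE; apply: ge_ereal_sup => _ [n _ <-].
by apply: le_trans (uM n); apply: ereal_inf_lbound; exists n => //=.
Qed.

Lemma limn_einf_ge (u : (\bar R)^nat) M N : (forall n, (N <= n)%N -> (M <= u n)%E) ->
  (M <= limn_einf u)%E.
Proof.
move=> uM; rewrite limn_einfE; apply: le_ereal_sup_tmp; exists (einfs u N); first by exists N.
by apply: le_ereal_inf_tmp => _ [n /= Nn <-]; exact: uM.
Qed.

(* Banach's indicatrix argument: cover [-k, k] by n cells of length 2k/n; the images of the
   cells have total length at most 4k for every n, so by Fatou almost every point is covered
   a bounded number of times for infinitely many n. *)
Lemma lip_fibre (S : R -> R -> Prop) (k : R) : 0 < k ->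
  (forall w w' d d', S w d -> S w' d' -> `|d - d'| <= `|w - w'|) ->
  {ae mu, forall d, finite_set [set w | `|w| <= k /\ S w d]}.
Proof.
move=> k0 lip.
pose h (n : nat) := 2 * k / n.+1%:R.
have h0 n : 0 < h n by rewrite divr_gt0// mulr_gt0.
have hE n : h n * n.+1%:R = 2 * k by rewrite /h divfK// pnatr_eq0.
pose ce n (i : 'I_n.+1) := [set d | exists2 w, S w d & h n * i%:R <= w + k <= h n * i.+1%:R].
pose c n i := get (@ce n i).
(* The image of a cell need not be measurable; by the Lipschitz bound it lies in an interval of
   radius [h n] about any of its points, and [get] picks one. *)
pose J n (i : 'I_n.+1) : set R := if `[< ce n i !=set0 >] then `[c n i - h n, c n i + h n]%classic else set0.
have Jc n i d : ce n i d -> J n i d.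
  move=> cd; have ne : ce n i !=set0 by exists d.
  rewrite /J; case: asboolP => // _ /=; have := @getI _ (ce n i) d cd.
  rewrite -/(c n i) => -[w Sw /andP[w1 w2]]; case: cd => w' Sw' /andP[w1' w2'].
  have : `|c n i - d| <= h n.
    apply: le_trans (lip _ _ _ _ Sw Sw') _; rewrite ler_norml; move: w2 w2'; rewrite -natr1 !mulrDr !mulr1 => w2 w2'.
    by apply/andP; split; clear -w1 w2 w1' w2'; lra.
  by rewrite in_itv /= ler_norml => /andP[? ?]; apply/andP; split; lra.
have mJ n i : measurable (J n i) by rewrite /J; case: asboolP => _; [exact: measurable_itv|exact: measurable0].
have muJ n i : (mu (J n i) <= (2 * h n)%:E)%E.
  rewrite /J; case: asboolP => _; last by rewrite measure0 lee_fin mulr_ge0// ltW.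
  rewrite lebesgue_measure_itv /= lte_fin; case: ifP => _; last by rewrite lee_fin mulr_ge0// ltW.
  by rewrite lee_fin; lra.
have mi n i : measurable_fun setT (\1_(J n i) : measurableTypeR R -> R).
  by apply: measurable_indic; exact: mJ.
pose f n (d : measurableTypeR R) : \bar R := (\sum_(i < n.+1) \1_(J n i) d)%:E.
have mf n : measurable_fun setT (f n).
  apply/measurable_EFinP; apply: (@measurable_sum _ _ _ setT _ (index_enum 'I_n.+1) (fun i => \1_(J n i))).
  exact: mi.
have f0 n d : (0 <= f n d)%E by rewrite lee_fin sumr_ge0.
have If n : (\int[mu]_(x in setT) f n x <= (4 * k)%:E)%E.
  under eq_integral do rewrite /f -sumEFin.
  rewrite ge0_integral_sum//.
  - apply: (@le_trans _ _ (\sum_(i < n.+1) (2 * h n)%:E)%E).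
      apply: lee_sum => i _; by rewrite (integral_indic mu measurableT (mJ n i)) setIT; exact: muJ.
    rewrite sumEFin lee_fin sumr_const card_ord -mulrnAr -[h n *+ _]mulr_natr hE; lra.
  - by move=> i; apply/measurable_EFinP; exact: mi.
have fat := fatou mu measurableT mf (fun n x _ => f0 n x).
have lim_le : (limn_einf (fun n => \int[mu]_(x in setT) f n x) <= (4 * k)%:E)%E.
  exact: limn_einf_le.
pose g x := limn_einf (f^~ x).
have g0 x : (0 <= g x)%E.
  by apply: (@limn_einf_ge _ _ 0).
have ig : mu.-integrable setT g.
  apply/integrableP; split.
    apply: (emeasurable_fun_cvg (fun n x => einfs (f^~ x) n)) => [n|x _].
      exact: measurable_fun_einfs.
    by rewrite /g limn_einfE; exact: cvg_einfs_sup.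
  under eq_integral do rewrite gee0_abs//.
  by rewrite (le_lt_trans (le_trans fat lim_le))// ltry.
have := integrable_ae measurableT ig; apply: filterS => d /(_ I) gd.
apply: contrapT => /infinite_set_fsetP inf.
(* An infinite fibre contains finite subsets of every size, which fine enough cells separate; so the
   lower limit would exceed every [C]. *)
suff gC (C : nat) : (C%:R%:E <= g d)%E.
  move: gd; rewrite fin_numElt => /andP[_ gy].
  move: (gC); case: (g d) gy => [r _| |] //; last by move=> _ /(_ 0%N).
  move=> /(_ (Num.truncn r).+1); rewrite lee_fin.
  by rewrite leNgt truncnS_gt.
have [B BW CB] := inf C.
pose s : seq R := finmap.enum_fset B.
have us : uniq s by apply: finmap.fset_uniq.
have sW w : w \in s -> `|w| <= k /\ S w d by move=> ws; apply: BW.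
have [e e0 He] : exists2 e : R, 0 < e & forall v w, v \in s -> w \in s -> v != w -> e < `|v - w|.
  have [|e e0 He] := @seq_pos_lb [seq `|p.1 - p.2| | p <- [seq (v, w) | v <- s, w <- s] & p.1 != p.2].
    by move=> x /mapP[[v w]]; rewrite mem_filter /= => /andP[vw _] ->; rewrite normr_gt0 subr_eq0.
  exists e => // v w vs ws vw; apply: He; apply/mapP; exists (v, w) => //.
  by rewrite mem_filter /= vw; apply/allpairsP; exists (v, w).
apply: (@limn_einf_ge _ _ (Num.truncn (2 * k / e))) => n Nn; rewrite lee_fin.
have hn : h n < e.
  rewrite /h ltr_pdivrMr ?ltr0n// [e * _]mulrC -ltr_pdivrMr//.
  apply: lt_le_trans (truncnS_gt (2 * k / e)) _.
  by rewrite ler_nat ltnS.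
apply: (@le_trans _ _ (size s)%:R); first by rewrite ler_nat.
apply: (@cell_count (h n) k) => // [v w vs ws /(He v w vs ws)|w /sW[wk Sw]]; first exact: lt_trans.
have [i Hi] := cell_ex (h0 n) wk (esym (hE n)).
by exists i; split=> //; apply: Jc; exists w.
Qed.

End GenericFibres.

(** * Windows and isolated closed chains *)

Section Windows.
Variable R : realType.
Implicit Types (e t s c d p y : R) (F A B : R * R -> R * R) (V VA VB : set (R * R)) (D : set R).
Notation mu := (@lebesgue_measure R).

Lemma chain_path_cont A B VA VB D n (a y y' : R -> R) : open VA -> open VB -> open D ->
  lipbox A -> lipbox B -> continuous a -> continuous y ->
  (forall s, chain (shiftf (a s) A) B VA VB D n (y s) (y' s)) -> continuous y'.
Proof.
move=> oA oB oD lA lB ca cy H s; apply: ed_cont => e e0.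
have [r r0 Hr] := chain_perturb oA oB oD (lipbox_shift (a s) lA) lB (H s) e0.
have [e1 e10 He1] := fclose_shift (a s) r0 lA.
have [d1 d10 Hd1] := cont_ed (ca s) e10; have [d2 d20 Hd2] := cont_ed (cy s) r0.
exists (Num.min d1 d2) => [|s']; first by rewrite lt_min d10.
rewrite lt_min => /andP[/Hd1 h1 /Hd2 h2].
have [y2 h3 h4] := Hr _ _ (lipbox_shift (a s') lA) lB (He1 _ (ltW h1)) (fclose_id B r0) _ (ltW h2).
by rewrite (chain_uniq (lipbox_shift (a s') lA) lB (H s') h4).
Qed.

Lemma chain_itv_perturb A B VA VB D n a b : open VA -> open VB -> open D -> lipbox A -> lipbox B ->
  (forall y, a <= y <= b -> exists z : R, chain A B VA VB D n y z) ->
  exists2 r : R, 0 < r & forall A' B', lipbox A' -> lipbox B' -> fclose r A A' -> fclose r B B' ->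
    forall y, a <= y <= b -> exists z : R, chain A' B' VA VB D n y z.
Proof.
move=> oA oB oD lA lB ex.
have [|y yI|r r0 Hr] := @unif_pos R a b (fun r y => forall A' B', lipbox A' -> lipbox B' ->
    fclose r A A' -> fclose r B B' -> exists z : R, chain A' B' VA VB D n y z).
- move=> t d d' d'0 dd H A' B' lA' lB' cA cB; apply: H => //; exact: fcloseW cA || exact: fcloseW cB.
- have [z hz] := ex y yI; have [r r0 Hr] := chain_perturb oA oB oD lA lB hz ltr01.
  exists r => // s sI sr A' B' lA' lB' hA hB.
  by have [z' _ hz'] := Hr A' B' lA' lB' hA hB s (ltW sr); exists z'.
- by exists r => // A' B' lA' lB' cA cB y yI; exact: Hr.
Qed.

Definition window A B VA VB D n (al be : R) := [/\ al < be, odd n,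
  forall y, al <= y <= be -> exists z : R, chain A B VA VB D n y z &
  exists za zb : R, [/\ chain A B VA VB D n al za, chain A B VA VB D n be zb &
    (za - al) * (zb - be) < 0]].

Lemma sign_near (x y : R) : x * y < 0 -> exists2 e : R, 0 < e & forall x' y' : R,
  `|x' - x| < e -> `|y' - y| < e -> x' * y' < 0.
Proof.
wlog x0 : x y / x < 0 => [H xy|xy].
  have : x != 0 by apply: contraTneq xy => ->; rewrite mul0r ltxx.
  rewrite neq_lt => /orP[x0|x0]; first exact: H.
  have [||e e0 He] := H (- x) (- y); rewrite ?oppr_lt0 ?mulrNN//.
  exists e => // x' y' hx hy; rewrite -mulrNN; apply: He.
    by rewrite -opprD normrN.
  by rewrite -opprD normrN.
have y0 : 0 < y by rewrite -(nmulr_rlt0 _ x0).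
exists (Num.min (- x) y) => [|x' y']; first by rewrite lt_min oppr_gt0 x0.
rewrite !lt_min => /andP[hx _] /andP[_ hy]; move: hx hy.
rewrite !ltr_norml => /andP[_ hx] /andP[hy _].
by rewrite nmulr_rlt0; lra.
Qed.

Lemma window_perturb A B VA VB D n al be : open VA -> open VB -> open D -> lipbox A -> lipbox B ->
  window A B VA VB D n al be ->
  exists2 r : R, 0 < r & forall A' B', lipbox A' -> lipbox B' -> fclose r A A' -> fclose r B B' ->
    window A' B' VA VB D n al be.
Proof.
move=> oA oB oD lA lB [ab on ex [za [zb [ca cb sg]]]].
have [e e0 He] := sign_near sg.
have [ra ra0 Ha] := chain_perturb oA oB oD lA lB ca e0.
have [rb rb0 Hb] := chain_perturb oA oB oD lA lB cb e0.
have [r r0 Hr] := chain_itv_perturb oA oB oD lA lB ex.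
have m0 : 0 < Num.min r (Num.min ra rb) by rewrite !lt_min r0 ra0.
exists (Num.min r (Num.min ra rb)) => // A' B' lA' lB' cA cB.
have [c1 c2 c3] : [/\ Num.min r (Num.min ra rb) <= r, Num.min r (Num.min ra rb) <= ra &
   Num.min r (Num.min ra rb) <= rb] by rewrite !ge_min !lexx !orbT.
split=> // [y yI|].
  by apply: Hr => //; [exact: fcloseW cA|exact: fcloseW cB].
have [|za' ha ca'] := Ha A' B' lA' lB' (fcloseW m0 c2 cA) (fcloseW m0 c2 cB) al.
  by rewrite subrr normr0 ltW.
have [|zb' hb cb'] := Hb A' B' lA' lB' (fcloseW m0 c3 cA) (fcloseW m0 c3 cB) be.
  by rewrite subrr normr0 ltW.
exists za', zb'; split=> //; apply: He.
  by rewrite (_ : _ - _ - _ = za' - za) //; ring.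
by rewrite (_ : _ - _ - _ = zb' - zb) //; ring.
Qed.

Lemma window_shift A B VA VB D n al be : open VA -> open VB -> open D -> lipbox A -> lipbox B ->
  window A B VA VB D n al be ->
  exists2 e : R, 0 < e & forall d, `|d| <= e -> window (shiftf d A) B VA VB D n al be.
Proof.
move=> oA oB oD lA lB w; have [r r0 Hr] := window_perturb oA oB oD lA lB w.
have [e e0 He] := fclose_shift 0 r0 lA; exists e => // d de.
apply: Hr => //; [exact: lipbox_shift| |exact: fclose_id].
by have := He d; rewrite subr0 shiftf0; apply.
Qed.

(** Isolated only among closed chains of the same length with the same [VA], [VB], [D]; isolation
    among all periodic orbits is the content of [isolated_clc]. *)
Definition isolated_cycle A B VA VB D n p := chain A B VA VB D n p p /\ exists2 e : R, 0 < e & forall q, `|q - p| < e -> chain A B VA VB D n q q -> q = p.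

Lemma window_fixed A B VA VB D n al be : open VA -> open VB -> open D -> lipbox A -> lipbox B ->
  window A B VA VB D n al be -> exists p, al < p < be /\ chain A B VA VB D n p p.
Proof.
move=> oA oB oD lA lB [ab on ex [za [zb [ca cb sg]]]].
have aI : al <= al <= be by rewrite lexx ltW.
have bI : al <= be <= be by rewrite lexx ltW.
have [z Hz] := choice (fun s => ex _ (lpath_in s aI bI)).
have {}Hz s : chain (shiftf ((fun=> 0 : R) s) A) B VA VB D n (lpath al be s) (z s).
  by rewrite shiftf0.
have cz : continuous (fun s => z s).
  apply: chain_path_cont oA oB oD lA lB _ (@cont_lpath _ al be) Hz.
  by move=> ?; exact: cvg_cst.
have cd : continuous (fun s => z s - lpath al be s).
  by move=> s; apply: cvgB; [exact: cz|exact: cont_lpath].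
have z0 : z 0 = za.
  by have := Hz 0; rewrite shiftf0 lpath0 => h; exact: chain_uniq lA lB h ca.
have z1 : z 1 = zb.
  by have := Hz 1; rewrite shiftf0 lpath1 => h; exact: chain_uniq lA lB h cb.
have [s /eqP sE] : exists s, z s - lpath al be s = 0.
  move: sg; have [x0|x0|->] := ltgtP (za - al) 0; last by rewrite mul0r ltxx.
    rewrite nmulr_rlt0// => y0.
    have [|s _ sE] := @ivt R _ 0 1 0 ler01 cd; first by rewrite lpath0 lpath1 z0 z1 !ltW.
    by exists s.
  rewrite pmulr_rlt0// => y0.
  have [|s _ sE] := @ivt_dec R _ 0 1 0 ler01 cd; first by rewrite lpath0 lpath1 z0 z1 !ltW.
  by exists s.
have pE : chain A B VA VB D n (lpath al be s) (lpath al be s).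
  by have := Hz s; rewrite shiftf0; move: sE; rewrite subr_eq0 => /eqP ->.
exists (lpath al be s); split=> //; have /andP[] := lpath_in s aI bI.
rewrite !le_eqVlt => /predU1P[E|->] /predU1P[E'|->] //; exfalso; move: sg.
- have ab' : al = be by rewrite E E'.
  by rewrite ab' ltxx in ab.
- move: pE; rewrite -E => /(chain_uniq lA lB ca) ->; by rewrite subrr mul0r ltxx.
- move: pE; rewrite E' => /(chain_uniq lA lB cb) ->; by rewrite subrr mulr0 ltxx.
Qed.

Definition pq_set A B VA VB D n al be w d := exists p q : R, [/\ al <= p <= be, w = p - q,
  hpass VA (shiftf d A) p q & chain B (shiftf d A) VB VA D n.-1 q p].

Lemma pq_split A B VA VB D n p : odd n -> chain A B VA VB D n p p ->
  exists q : R, hpass VA A p q /\ chain B A VB VA D n.-1 q p.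
Proof. by case: n => // n _ [q [h _ c]]; exists q. Qed.

(** Only finitely many bounded values of [p - q] occur, so closed chains close to the given one
    share its value. But this value is strictly increasing in [p] for fixed [d], by [rect_lip]. *)
Lemma fin_fibre_isolated A B VA VB D n al be d e p : open VA -> open VB -> smoothf A ->
  smoothf B -> (forall d', `|d'| <= e -> window (shiftf d' A) B VA VB D n al be) -> `|d| <= e ->
  (forall k : nat, finite_set [set w | `|w| <= k%:R /\ pq_set A B VA VB D n al be w d]) ->
  al < p < be -> chain (shiftf d A) B VA VB D n p p ->
  isolated_cycle (shiftf d A) B VA VB D n p.
Proof.
move=> oA oB sA sB win de fin pI pc; split=> //.
have on : odd n by have [] := win d de.
have lAd := lipbox_shift d (smoothf_lipbox sA).
have rect y d' : al <= y <= be -> - e <= d' <= e -> exists z : R, chain (shiftf d' A) B VA VB D n y z.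
  by move=> yI; rewrite -ler_norml => /win[_ _ ex _]; exact: ex.
have dI : - e <= d <= e by rewrite -ler_norml.
have [q [hq cq]] := pq_split on pc.
have [r1 r10 Hr1] := hpass_perturb oA lAd hq ltr01.
pose k := (Num.truncn (`|p - q| + r1 + 1)).+1.
have [l Wl] : exists l : seq R, [set w | `|w| <= k%:R /\ pq_set A B VA VB D n al be w d] = [set` l].
  by have /finite_seqP[l ->] := fin k; exists l.
have [|e1 e10 He1] := @seq_pos_lb R [seq `|w - (p - q)| | w <- l & w != p - q].
  by move=> x /mapP[w]; rewrite mem_filter => /andP[wn _] ->; rewrite normr_gt0 subr_eq0.
have e12 : 0 < e1 / 2 by rewrite divr_gt0.
have [r2 r20 Hr2] := hpass_perturb oA lAd hq e12.
have [pa pb] := andP pI.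
pose m := Num.min (Num.min r1 r2) (Num.min (e1 / 2) (Num.min (p - al) (be - p))).
exists m; first by rewrite !lt_min r10 r20 e12 !subr_gt0 pa.
move=> p' p'm c'; have [q' [hq' cq']] := pq_split on c'.
have [[m1 m2] [m3 m4 m5]] : (`|p' - p| < r1 /\ `|p' - p| < r2) /\ [/\ `|p' - p| < e1 / 2,
   `|p' - p| < p - al & `|p' - p| < be - p].
  by move: p'm; rewrite !lt_min => /and3P[/andP[-> ->] -> /andP[-> ->]].
have pI' : al <= p' <= be.
  by move: m4 m5; rewrite !ltr_norml => /andP[h1 _] /andP[_ h2]; apply/andP; split; clear -h1 h2; lra.
have pI1 : al <= p <= be by rewrite !ltW.
have qq1 : `|q' - q| < 1.
  have [q2 h1 h2] := Hr1 _ lAd (fclose_id _ r10) p' (ltW m1).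
  by rewrite (hpass_uniq lAd hq' h2).
have qq2 : `|q' - q| < e1 / 2.
  have [q2 h1 h2] := Hr2 _ lAd (fclose_id _ r20) p' (ltW m2).
  by rewrite (hpass_uniq lAd hq' h2).
have wE : p' - q' = p - q.
  apply/eqP/negPn/negP => wn.
  have : `|(p' - q') - (p - q)| < e1.
    rewrite (_ : _ - _ - _ = (p' - p) - (q' - q)); last by ring.
    by apply: le_lt_trans (ler_normB _ _) _; clear -m3 qq2; lra.
  apply/negP; rewrite -leNgt ltW//; apply: He1; apply/mapP; exists (p' - q') => //.
  rewrite mem_filter wn /=.
  suff : [set` l] (p' - q') by [].
  rewrite -Wl; split; last by exists p', q'.
  apply: ltW; apply: lt_le_trans (ltW (truncnS_gt _)).
  rewrite (_ : p' - q' = (p - q) + (p' - p) - (q' - q)); last by ring.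
  by apply: le_lt_trans (ler_normB _ _) _; have := ler_normD (p - q) (p' - p); clear -m1 qq1; lra.
have inc := rect_lip oA oB sA sB on rect.
have [pp|pp|//] := ltgtP p' p.
  by have [_ /(_ erefl pp)] := inc p' p d d q' q pI' pI1 dI dI hq' cq' hq cq; rewrite wE ltxx.
by have [_ /(_ erefl pp)] := inc p p' d d q q' pI1 pI' dI dI hq cq hq' cq'; rewrite wE ltxx.
Qed.

Lemma ae_pick (P : R -> Prop) e : 0 < e -> {ae mu, forall d, P d} -> exists2 d, `|d| < e & P d.
Proof.
move=> e0 [N [mN N0 HN]]; apply: contrapT => H.
pose I : set R := `]- e, e[%classic.
have : (mu I <= mu N)%E.
  apply: le_measure; rewrite ?inE//; first exact: measurable_itv.
  move=> d /=; rewrite /I /= in_itv /= => dI; apply: HN => /= Pd; apply: H.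
  by exists d => //; rewrite ltr_norml.
have ee : - e < e by lra.
rewrite N0 /I lebesgue_measure_itv /= lte_fin ee -EFinD lee_fin.
by apply/negP; rewrite -ltNge; lra.
Qed.

Lemma generic_shift A B (K : nat) (VA VB : nat -> set (R * R)) (D : nat -> set R) (n : nat -> nat)
    (al be : nat -> R) e : 0 < e -> smoothf A -> smoothf B ->
  (forall j, (j < K)%N -> [/\ open (VA j), open (VB j), open (D j) &
    window A B (VA j) (VB j) (D j) (n j) (al j) (be j)]) ->
  exists2 d, `|d| < e & forall j, (j < K)%N -> exists p, al j < p < be j /\
    isolated_cycle (shiftf d A) B (VA j) (VB j) (D j) (n j) p.
Proof.
move=> e0 sA sB H; have lA := smoothf_lipbox sA; have lB := smoothf_lipbox sB.
have [e1 e10 He1] : exists2 e1 : R, 0 < e1 & forall j, (j < K)%N -> forall d, `|d| <= e1 ->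
    window (shiftf d A) B (VA j) (VB j) (D j) (n j) (al j) (be j).
  elim: K H => [|K IH] H; first by exists 1.
  have [j jK|e1 e10 He1] := IH; first by apply: H; exact: ltnW.
  have [oA oB oD w] := H K (ltnSn _).
  have [e2 e20 He2] := window_shift oA oB oD lA lB w.
  exists (Num.min e1 e2) => [|j jK d]; first by rewrite lt_min e10.
  rewrite le_min => /andP[d1 d2].
  move: jK; rewrite ltnS leq_eqVlt => /predU1P[->|jK]; first exact: He2.
  exact: He1.
pose S j w d := (j < K)%N /\ `|d| <= e1 /\ pq_set A B (VA j) (VB j) (D j) (n j) (al j) (be j) w d.
have Sae j k : {ae mu, forall d, finite_set [set w | `|w| <= k.+1%:R /\ S j w d]}.
  apply: lip_fibre => [|w w' d d' [jK [de [p [q [pI -> h c]]]]] [_ [de' [p' [q' [pI' -> h' c']]]]]].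
    by rewrite ltr0n.
  have [oA oB oD _] := H j jK.
  have [_ on _ _] := He1 j jK d de.
  have rect y d0 : al j <= y <= be j -> - e1 <= d0 <= e1 ->
      exists z : R, chain (shiftf d0 A) B (VA j) (VB j) (D j) (n j) y z.
    by move=> yI; rewrite -ler_norml => /(He1 j jK)[_ _ ex _]; exact: ex.
  rewrite !ler_norml in de de'.
  by have [] := rect_lip oA oB sA sB on rect pI pI' de de' h c h' c'.
have Sae2 : {ae mu, forall d, forall j k, finite_set [set w | `|w| <= k.+1%:R /\ S j w d]}.
  by apply: ae_foralln => j; apply: ae_foralln => k; exact: Sae.
have m0 : 0 < Num.min e e1 by rewrite lt_min e0.
have [d] := ae_pick m0 Sae2; rewrite lt_min => /andP[de de1] fin; exists d => // j jK.
have [oA oB oD _] := H j jK.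
have [p [pI pc]] := window_fixed oA oB oD (lipbox_shift d lA) lB (He1 j jK d (ltW de1)).
exists p; split=> //.
apply: (fin_fibre_isolated oA oB sA sB (He1 j jK)  (ltW de1) _ pI pc) => k.
apply: sub_finite_set (fin j k) => w [wk hw]; split; last by split=> //; split=> //; exact: ltW.
by apply: le_trans wk _; rewrite ler_nat.
Qed.

End Windows.

(** * Trajectories of the folded system *)

Section Integrals.
Variable R : realType.
Implicit Types (f g h : R -> R) (a b c t s : R).
Notation mu := (@lebesgue_measure R).

Lemma loc_integrable_itv f a b : locally_integrable [set: R] f -> mu.-integrable `[a, b] (EFin \o f).
Proof.
move=> [mf _ fi]; apply/integrableP; split.
  by apply/measurable_EFinP; apply: measurable_funTS.
by apply: fi => //; exact: segment_compact.
Qed.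

Lemma int_cst a b c : a <= b -> \int[mu]_(t in `[a, b]) c = c * (b - a).
Proof.
move=> ab; rewrite Rintegral_cst//; congr (c * _).
have E : lebesgue_measure (`[a, b]%classic : set R) = (b - a)%:E; last first.
  by rewrite -[RHS]/(fine (b - a)%:E) -E.
rewrite lebesgue_measure_itv /= lte_fin; by case: ltP => [//|ba]; have -> : b = a; [apply/eqP; rewrite eq_le ab ba|rewrite subrr].

Qed.

Lemma int_bounds f a b c d : a <= b -> locally_integrable [set: R] f -> c <= d ->
  {ae mu, forall t, a <= t <= b -> c <= f t <= d} ->
  c * (b - a) <= \int[mu]_(t in `[a, b]) f t <= d * (b - a).
Proof.
move=> ab lf cd ae.
(* Truncation turns bounds valid almost everywhere into bounds valid everywhere without changing the
   integral. *)
pose k t := Num.max c (Num.min (f t) d).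
have kcd t : c <= k t <= d by rewrite /k le_max lexx /= ge_max cd ge_min lexx orbT.
have [mf _ _] := lf.
have mk : measurable_fun setT k.
  by apply: measurable_maxr; [exact: measurable_cst|apply: measurable_minr => //; exact: measurable_cst].
have lt : (mu `[a, b]%classic < +oo)%E.
  by rewrite lebesgue_measure_itv /=; case: ifP => _; rewrite ?ltry.
have ik : mu.-integrable `[a, b] (EFin \o k).
  apply: measurable_bounded_integrable => //; first exact: measurable_funTS.
  exists (`|c| + `|d|); split; first exact: num_real.
  move=> x xcd t _; have /andP[k1 k2] := kcd t; apply/ltW/(le_lt_trans _ xcd).
  have := ler_norm (- c); have := ler_norm d; rewrite normrN ler_norml => h1 h2.
  have := normr_ge0 c; have := normr_ge0 d; move=> h3 h4.
  by apply/andP; split; lra.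
have ic (x : R) : mu.-integrable `[a, b] (EFin \o (fun=> x)).
  apply: measurable_bounded_integrable => //.
  exists `|x|; split; first exact: num_real.
  by move=> y xy t _; apply/ltW.
have -> : \int[mu]_(t in `[a, b]) f t = \int[mu]_(t in `[a, b]) k t.
  rewrite /Rintegral; congr fine; apply: ae_eq_integral => //.
  - by apply/measurable_EFinP; apply: measurable_funTS.
  - by apply/measurable_EFinP; apply: measurable_funTS.
  - move: ae; apply: (@filterS _ _ (ae_filter_ringOfSetsType mu)) => t H /=; rewrite in_itv /= => tab; congr EFin.
    by have /andP[c1 c2] := H tab; rewrite /k min_l// max_r.
rewrite -!int_cst//; apply/andP; split; apply: le_Rintegral => // t _; by have /andP[] := kcd t.
Qed.

Lemma int_split f a b c : a <= b -> b <= c -> locally_integrable [set: R] f ->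
  \int[mu]_(t in `[a, c]) f t = \int[mu]_(t in `[a, b]) f t + \int[mu]_(t in `[b, c]) f t.
Proof.
move=> ab bc lf; have ic := loc_integrable_itv a c lf.
have := Rintegral_itvB (x := b) ic.
rewrite !bnd_simp Rintegral_itv_obnd_cbnd; last first.
  by apply: integrableS (loc_integrable_itv b c lf) => //; exact: subset_itv_oc_cc.
by move=> /(_ ab bc)/eqP; rewrite subr_eq addrC => /eqP.
Qed.

Lemma int_cont f h a b : locally_integrable [set: R] f ->
  (forall t, a < t < b -> h t = \int[mu]_(s in `[a, t]) f s) ->
  forall t, a < t < b -> {for t, continuous h}.
Proof.
move=> lf E t tab; have ab : a < b by case/andP: tab; exact: lt_trans.
have := parameterized_integral_continuous (ltW ab) (loc_integrable_itv a b lf).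
move=> /(continuous_within_itvP _ ab)[H _ _].
have tab' : t \in `]a, b[ by rewrite in_itv.
have Ht := H t tab'.
have : h x @[x --> t] --> h t; last by [].
rewrite E//; apply: cvg_trans Ht.
apply: near_eq_cvg; have : \forall s \near t, s \in `]a, b[ by exact: near_in_itvoo.
by apply: filterS => s; rewrite in_itv /= => sab; rewrite E.
Qed.

Lemma int_derive f a t : locally_integrable [set: R] f -> a < t -> {for t, continuous f} ->
  is_derive t 1 (fun s => \int[mu]_(u in `[a, s]) f u) (f t).
Proof.
move=> lf at_ cf; have tt : t < t + 1 by rewrite ltrDl.
have [d1 d2] := continuous_FTC1_closed tt (loc_integrable_itv a (t + 1) lf) at_ cf.
by apply: DeriveDef; [exact: d1|rewrite -derive1E; exact: d2].
Qed.

End Integrals.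

(** * Filippov solutions versus classical solutions *)

Section Trajectories.
Variable R : realType.
Implicit Types (z w : R * R) (a b c d e t s u y T : R) (F A B : R * R -> R * R) (g h : R -> R * R).
Notation mu := (@lebesgue_measure R).

Definition mir z : R * R := (- z.1, z.2).
Definition fold F z : R * R := mir (F (mir z)).

Lemma mirK z : mir (mir z) = z.
Proof. by rewrite /mir /= opprK -surjective_pairing. Qed.

Lemma foldK F : fold (fold F) = F.
Proof. by apply/funext => z; rewrite /fold !mirK. Qed.

(* [A] acts on the right half plane and the left field is [fold B]; exchanging the two half
   planes then amounts to exchanging [A] and [B]. *)
Definition fil A B z : set (R * R) :=
  if 0 < z.1 then [set A z]
  else if z.1 < 0 then [set fold B z]
  else [set w | exists2 s : R, 0 <= s <= 1 & w = s *: A z + (1 - s) *: fold B z].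

Definition traj A B g : Prop :=
  exists v : R -> R * R,
    [/\ locally_integrable [set: R] (fun t => (v t).1),
        locally_integrable [set: R] (fun t => (v t).2),
        forall a b : R, a <= b ->
          (g b).1 - (g a).1 = \int[lebesgue_measure]_(t in `[a, b]) (v t).1 /\
          (g b).2 - (g a).2 = \int[lebesgue_measure]_(t in `[a, b]) (v t).2 &
        {ae lebesgue_measure, forall t : R, fil A B (g t) (v t)}].

Lemma trajectory_traj (Z : pwfield R) : trajectory Z = traj (fieldp Z) (fold (fieldm Z)).
Proof. by rewrite /traj /fil foldK. Qed.

Lemma fil_mir A B z w : fil A B z w -> fil B A (mir z) (mir w).
Proof.
rewrite /fil /mir /= oppr_gt0 oppr_lt0.
have [z0 /= ->|z0 /= ->|z0 [s /andP[s0 s1] ->]] := ltgtP z.1 0.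
- by rewrite -/(mir (fold B z)) -/(mir z) /fold mirK.
- by rewrite -/(mir z) /fold mirK.
exists (1 - s); first by rewrite subr_ge0 s1 gerBl.
rewrite subKr -/(mir z) (_ : fold A (mir z) = mir (A z)); last by rewrite /fold mirK.
by apply: injective_projections; rewrite /fold /mir /GRing.scale /=; ring.
Qed.

Lemma traj_mir A B g : traj A B g -> traj B A (mir \o g).
Proof.
move=> [v [l1 l2 H ae]]; exists (mir \o v); split=> //.
- exact: (locally_integrableN l1).
- move=> a b ab; have [H1 H2] := H a b ab; split=> //=.
  rewrite (_ : _ - _ = - ((g b).1 - (g a).1)); last by ring.
  rewrite H1 -mulN1r -RintegralZl//; last exact: (loc_integrable_itv a b l1).
  by apply: eq_Rintegral => t _; rewrite mulN1r.
- by apply: (@filterS _ _ (ae_filter_ringOfSetsType mu)) ae => t; exact: fil_mir.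
Qed.

Lemma traj_cont A B g : traj A B g ->
  continuous (fun t => (g t).1) /\ continuous (fun t => (g t).2).
Proof.
move=> [v [l1 l2 H _]].
have tI (t : R) : t - 1 < t < t + 1 by rewrite ltrBlDr !ltrDl ltr01.
have cont (f w : R -> R) : locally_integrable [set: R] w ->
    (forall a b, a <= b -> f b - f a = \int[mu]_(t in `[a, b]) w t) -> continuous f.
  move=> lw E t; have c : {for t, continuous (fun s => f s - f (t - 1))}.
    by apply: int_cont lw _ _ (tI t) => s /andP[ts _]; apply: E; exact: ltW.
  rewrite (_ : f = fun s => (f s - f (t - 1)) + f (t - 1)); last first.
    by apply/funext => s; rewrite subrK.
  by apply: cvgD; [exact: c|exact: cvg_cst].
split; [apply: cont l1 _|apply: cont l2 _]; by move=> a b /H[].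
Qed.

Lemma traj_bound A B g a b c d : traj A B g -> a <= b -> c <= d ->
  ((forall t w, a <= t <= b -> fil A B (g t) w -> c <= w.1 <= d) ->
    c * (b - a) <= (g b).1 - (g a).1 <= d * (b - a)) /\
  ((forall t w, a <= t <= b -> fil A B (g t) w -> c <= w.2 <= d) ->
    c * (b - a) <= (g b).2 - (g a).2 <= d * (b - a)).
Proof.
move=> [v [l1 l2 H ae]] ab cd; have [-> ->] := H a b ab.
split=> K; apply: int_bounds => //.
  by apply: (@filterS _ _ (ae_filter_ringOfSetsType mu)) ae => t vt tab; exact: (K t (v t)).
by apply: (@filterS _ _ (ae_filter_ringOfSetsType mu)) ae => t vt tab; exact: (K t (v t)).
Qed.

Lemma cont_loc_integrable (f : R -> R) : continuous f -> locally_integrable [set: R] f.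
Proof.
move=> cf; split; [exact: continuous_measurable_fun|exact: openT|] => K _ cK.
have /integrableP[_ //] : mu.-integrable K (EFin \o f).
by apply: continuous_compact_integrable => //; exact: continuous_subspaceT.
Qed.

Lemma int_ae_eq (f h : R -> R) a b : locally_integrable [set: R] f ->
  locally_integrable [set: R] h -> {ae mu, forall t, a <= t <= b -> f t = h t} ->
  \int[mu]_(t in `[a, b]) f t = \int[mu]_(t in `[a, b]) h t.
Proof.
move=> [mf _ _] [mh _ _] ae; rewrite /Rintegral; congr fine; apply: ae_eq_integral => //.
- by apply/measurable_EFinP; apply: measurable_funTS.
- by apply/measurable_EFinP; apply: measurable_funTS.
- apply: (@filterS _ _ (ae_filter_ringOfSetsType mu)) ae => t H /=; rewrite in_itv /= => tab.
  by rewrite H.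
Qed.

Lemma int_repr_derive (f h : R -> R) a b t : continuous f -> a < t < b ->
  (forall s, a < s < b -> h s = h a + \int[mu]_(u in `[a, s]) f u) -> is_derive t 1 h (f t).
Proof.
move=> cf /andP[at_ tb] E.
apply: (@near_eq_is_derive _ _ _ (fun s => h a + \int[mu]_(u in `[a, s]) f u)).
  have N : \forall s \near t, s \in `]a, b[ by apply: near_in_itvoo; rewrite in_itv /= at_.
  by apply: filterS N => s; rewrite in_itv /= => sab; rewrite (E s).
pose I s := \int[mu]_(u in `[a, s]) f u.
have D : is_derive t 1 I (f t) := int_derive (cont_loc_integrable cf) at_ (cf t).
rewrite -[fun s => _]/(fun s => h a + I s); clearbody I.
by apply: (is_derive_eq (is_deriveD (is_derive_cst (h a) t 1) D)); rewrite add0r.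
Qed.

Lemma lipbox_ed F g t e : lipbox F -> continuous (fun t => (g t).1) ->
  continuous (fun t => (g t).2) -> 0 < e ->
  exists2 d : R, 0 < d & forall s, `|s - t| < d -> `|F (g s) - F (g t)| < e.
Proof.
move=> lF c1 c2 e0; have [d d0 Hd] := lipbox_cont (g t) lF e0.
by have [r r0 Hr] := curve_ed t c1 c2 d0; exists r => // s /Hr; exact: Hd.
Qed.

Lemma lipbox_comp_cont F g : lipbox F -> continuous (fun t => (g t).1) ->
  continuous (fun t => (g t).2) ->
  continuous (fun t => (F (g t)).1) /\ continuous (fun t => (F (g t)).2).
Proof.
move=> lF c1 c2; split=> t; apply: ed_cont => e e0.
  have [d d0 Hd] := lipbox_ed t lF c1 c2 e0; exists d => // s /Hd.
  by apply: le_lt_trans; exact: (pnorm1 (F (g s) - F (g t))).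
have [d d0 Hd] := lipbox_ed t lF c1 c2 e0; exists d => // s /Hd.
by apply: le_lt_trans; exact: (pnorm2 (F (g s) - F (g t))).
Qed.

Lemma lipbox_fold F : lipbox F -> lipbox (fold F).
Proof.
have nm z : `|mir z| = `|z| by rewrite !prod_normE /= normrN.
have mD z w : mir z - mir w = mir (z - w) by congr pair; rewrite /= opprD.
move=> lF r; have [L L0 HL] := lF r; exists L => // z w zr wr.
by rewrite /fold mD nm; apply: le_trans (HL _ _ _ _) _; rewrite ?mD ?nm.
Qed.

(** In the open half-plane the velocity equals the continuous function [A \o g] almost everywhere,
    so the integral representation can be differentiated. *)
Lemma traj_smooth A B g a b : lipbox A -> traj A B g -> (forall t, a < t < b -> 0 < (g t).1) ->
  forall t, a < t < b -> is_derive t 1 (fun t => (g t).1) (A (g t)).1 /\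
    is_derive t 1 (fun t => (g t).2) (A (g t)).2.
Proof.
move=> lA tg gp t /andP[at_ tb]; have [c1 c2] := traj_cont tg.
have [cA1 cA2] : continuous (fun t => (A (g t)).1) /\ continuous (fun t => (A (g t)).2).
  exact: lipbox_comp_cont.
case: tg => v [l1 l2 H ae].
(* The representation is started inside [(a, b)], since nothing is known at [a] itself. *)
pose a' := (a + t) / 2; have [aa' a't] : a < a' /\ a' < t by rewrite /a'; split; lra.
have ti : a' < t < b by rewrite a't.
have vA s : a' < s < b -> {ae mu, forall u, a' <= u <= s -> v u = A (g u)}.
  move=> /andP[a's sb]; apply: (@filterS _ _ (ae_filter_ringOfSetsType mu)) ae => u + /andP[u1 u2].
  by rewrite /fil gp// (lt_le_trans aa' u1) (le_lt_trans u2 sb).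
split.
  apply: (@int_repr_derive (fun t => (A (g t)).1) _ a' b) => // s /[dup] /vA sv /andP[a's _].
  apply/eqP; rewrite addrC -subr_eq; apply/eqP; rewrite (H _ _ (ltW a's)).1.
  apply: int_ae_eq => //; first exact: cont_loc_integrable.
  by apply: (@filterS _ _ (ae_filter_ringOfSetsType mu)) sv => u /[apply] ->.
apply: (@int_repr_derive (fun t => (A (g t)).2) _ a' b) => // s /[dup] /vA sv /andP[a's _].
apply/eqP; rewrite addrC -subr_eq; apply/eqP; rewrite (H _ _ (ltW a's)).2.
apply: int_ae_eq => //; first exact: cont_loc_integrable.
by apply: (@filterS _ _ (ae_filter_ringOfSetsType mu)) sv => u /[apply] ->.
Qed.

Definition flows F g t := is_derive t 1 (fun t => (g t).1) (F (g t)).1 /\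
  is_derive t 1 (fun t => (g t).2) (F (g t)).2.

Definition regular A B g t := 0 < (g t).1 /\ flows A g t \/ (g t).1 < 0 /\ flows (fold B) g t.

(** A measurable selection of the Filippov set, which on the line takes the end [A] of the
    segment. *)
Definition vsel A B z := if 0 <= z.1 then A z else fold B z.

Lemma const_on (f : R -> R) a b : a < b -> {within `[a, b], continuous f} ->
  (forall t, a < t < b -> is_derive t 1 f 0) -> f b = f a.
Proof.
move=> ab cf df; have dM t : t \in `]a, b[ -> is_derive t 1 f ((fun=> 0 : R) t) by rewrite in_itv; exact: df.
by have [t _ /eqP] := MVT ab dM cf; rewrite mul0r subr_eq0 => /eqP.
Qed.

(** Exceptional times are isolated. The difference with the indefinite integral is continuous with
    zero derivative off them, hence constant across each of them, hence differentiable there as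
    well. *)
Lemma int_of_derive (f h : R -> R) a b : a <= b -> locally_integrable [set: R] f -> continuous h ->
  (forall t, exists2 e : R, 0 < e & forall s, 0 < `|s - t| < e ->
    {for s, continuous f} /\ is_derive s 1 h (f s)) ->
  h b - h a = \int[mu]_(t in `[a, b]) f t.
Proof.
move=> ab lf ch H; pose c := a - 1; pose k t := h t - \int[mu]_(u in `[c, t]) f u.
have kcont s t : c <= s -> s <= t -> {within `[s, t], continuous k}.
  move=> cs st; have ct := le_trans cs st.
  have P := parameterized_integral_continuous ct (loc_integrable_itv c t lf).
  have {}P : {within `[s, t], continuous (fun x => parameterized_integral mu c x f)}.
    by apply: continuous_subspaceW P => u /=; rewrite !in_itv /= => /andP[/(le_trans cs) -> ->].
  by move=> u; apply: cvgB; [exact: (continuous_subspaceT ch)|exact: P].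
have kd s e t : 0 < `|s - t| < e -> (forall s, 0 < `|s - t| < e ->
    {for s, continuous f} /\ is_derive s 1 h (f s)) -> c < s -> is_derive s 1 k 0.
  move=> st He cs; have [cfs dh] := He s st.
  have dI := int_derive lf cs cfs.
  by rewrite /k; apply: is_derive_eq; rewrite subrr.
have kl t : c < t -> is_derive t 1 k 0.
  move=> ct; have [e e0 He] := H t.
  have D : is_derive t 1 (cst (k t) : R -> R) 0 by exact: is_derive_cst.
  apply: near_eq_is_derive D.
  have N : \forall s \near t, s \in `]Num.max c (t - e), t + e[.
    by apply: near_in_itvoo; rewrite in_itv /= gt_max ct ltrDl e0 gtrBl e0.
  apply: filterS N => s; rewrite in_itv /= gt_max => /andP[/andP[cs ts] st].
  have [ts'|st'|->//] := ltgtP s t.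
    apply: const_on => //; first by apply: kcont; exact: ltW.
    move=> u /andP[su ut]; apply: (kd u e t) => //; last exact: lt_trans su.
    by rewrite normr_gt0 subr_eq0 lt_eqF//= ltr0_norm ?subr_lt0//; lra.
  apply/esym/const_on => //; first by apply: kcont; exact: ltW.
  move=> u /andP[su ut]; apply: (kd u e t) => //; last exact: lt_trans su.
  by rewrite normr_gt0 subr_eq0 gt_eqF//= gtr0_norm ?subr_gt0//; lra.
have ca : c < a by rewrite /c; lra.
have : k b = k a.
  move: ab; rewrite le_eqVlt => /predU1P[->//|ab]; apply: const_on => //.
    by apply: kcont; exact: ltW.
  by move=> t /andP[at_ _]; apply: kl; exact: lt_trans at_.
by rewrite /k (int_split (ltW ca) ab lf); lra.
Qed.

Lemma vsel_fil A B z : fil A B z (vsel A B z).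
Proof.
rewrite /fil /vsel; case: ltgtP => //= z0.
by exists 1; rewrite ?ler01 ?lexx// subrr scale1r scale0r addr0.
Qed.

Lemma if_loc_integrable (f h k : R -> R) : continuous f -> continuous h -> continuous k ->
  locally_integrable [set: R] (fun t => if 0 <= k t then f t else h t).
Proof.
move=> cf ch ck.
have m : measurable_fun setT (fun t => if 0 <= k t then f t else h t).
  apply: measurable_fun_ifT; [|exact: continuous_measurable_fun..].
  by apply: measurable_fun_ler; [exact: measurable_cst|exact: continuous_measurable_fun].
split=> //; first exact: openT.
move=> K _ cK; have mK : measurable K by exact: compact_measurable.
pose l t := `|f t| + `|h t|.
have cl : continuous l by move=> t; apply: cvgD; apply: cvg_norm; [exact: cf|exact: ch].
have [_ _ /(_ K (@subsetT _ _) cK)] := cont_loc_integrable cl; apply: le_lt_trans.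
apply: ge0_le_integral => //.
- apply/measurable_EFinP; apply: measurableT_comp => //; exact: measurable_funTS.
- apply/measurable_EFinP; apply: measurableT_comp => //; apply: measurable_funTS.
  exact: continuous_measurable_fun.
- move=> t _; rewrite lee_fin; apply: le_trans (ler_norm _); rewrite /l.
  by case: ifP => _; [rewrite lerDl|rewrite lerDr].
Qed.

Lemma vsel_near A B g t (F := if 0 < (g t).1 then A else fold B) : continuous (fun t => (g t).1) ->
  (g t).1 != 0 -> \forall s \near t, F (g s) = vsel A B (g s).
Proof.
move=> c1 g0; have g0' : 0 < `|(g t).1| by rewrite normr_gt0.
have [d d0 Hd] := cont_ed (c1 t) g0'.
have N : \forall s \near t, s \in `]t - d, t + d[.
  by apply: near_in_itvoo; rewrite in_itv /= gtrBl ltrDl d0.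
apply: filterS N => s; rewrite in_itv /= => sd.
have {sd} : `|s - t| < d by rewrite ltr_distl.
move=> /Hd; rewrite /vsel /F; case: ifP => [gt0|/negbT].
  by rewrite (gtr0_norm gt0) ltr_norml => /andP[h _]; rewrite ifT//; lra.
rewrite -leNgt => gl0; rewrite (ler0_norm gl0) ltr_norml => /andP[_ h].
by rewrite ifF//; apply/negbTE; rewrite -ltNge; lra.
Qed.

Lemma regular_vsel A B g t : lipbox A -> lipbox B -> continuous (fun t => (g t).1) ->
  continuous (fun t => (g t).2) -> regular A B g t ->
  [/\ flows (vsel A B) g t, {for t, continuous (fun t => (vsel A B (g t)).1)} &
   {for t, continuous (fun t => (vsel A B (g t)).2)}].
Proof.
move=> lA lB c1 c2 reg; pose F := if 0 < (g t).1 then A else fold B.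
have lF : lipbox F by rewrite /F; case: ifP => // _; exact: lipbox_fold.
have [fl g0] : flows F g t /\ (g t).1 != 0.
  case: reg => -[h fl]; first by rewrite /F h gt_eqF.
  by rewrite /F ltNge (ltW h)/= lt_eqF.
have N := @vsel_near A B g t c1 g0; rewrite -/F in N.
have E : F (g t) = vsel A B (g t) := nbhs_singleton N.
have [cF1 cF2] := lipbox_comp_cont lF c1 c2.
split; first by case: fl; rewrite /flows E.
  have : (vsel A B (g x)).1 @[x --> t] --> (vsel A B (g t)).1; last by [].
  rewrite -E; apply: cvg_trans (cF1 t); apply: near_eq_cvg.
  by apply: filterS N => s ->.
have : (vsel A B (g x)).2 @[x --> t] --> (vsel A B (g t)).2; last by [].
rewrite -E; apply: cvg_trans (cF2 t); apply: near_eq_cvg.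
by apply: filterS N => s ->.
Qed.

Lemma regular_traj A B g : lipbox A -> lipbox B -> continuous (fun t => (g t).1) ->
  continuous (fun t => (g t).2) ->
  (forall t, exists2 e : R, 0 < e & forall s, 0 < `|s - t| < e -> regular A B g s) -> traj A B g.
Proof.
move=> lA lB c1 c2 H; exists (vsel A B \o g).
have [cA1 cA2] := lipbox_comp_cont lA c1 c2.
have [cB1 cB2] := lipbox_comp_cont (lipbox_fold lB) c1 c2.
have l1 : locally_integrable [set: R] (fun t => ((vsel A B \o g) t).1).
  rewrite (_ : (fun t => _) = fun t => if 0 <= (g t).1 then (A (g t)).1 else (fold B (g t)).1).
    exact: if_loc_integrable.
  by apply/funext => t /=; rewrite /vsel; case: ifP.
have l2 : locally_integrable [set: R] (fun t => ((vsel A B \o g) t).2).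
  rewrite (_ : (fun t => _) = fun t => if 0 <= (g t).1 then (A (g t)).2 else (fold B (g t)).2).
    exact: if_loc_integrable.
  by apply/funext => t /=; rewrite /vsel; case: ifP.
split=> //; last by apply: aeW => t; exact: vsel_fil.
move=> a b ab; split; [apply: (int_of_derive ab l1 c1) => t|apply: (int_of_derive ab l2 c2) => t].
  have [e e0 He] := H t; exists e; [exact: e0|move=> s /He reg].
  by have [[]] := regular_vsel lA lB c1 c2 reg.
have [e e0 He] := H t; exists e; [exact: e0|move=> s /He reg].
by have [[]] := regular_vsel lA lB c1 c2 reg.
Qed.

End Trajectories.

Arguments mir {R} z.

(** * Chains as paths that every trajectory follows *)

Section ChainPaths.
Variable R : realType.
Implicit Types (z w : R * R) (a b c d e s t u x y T : R) (F A B : R * R -> R * R) (g h : R -> R * R)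
  (V VA VB : set (R * R)) (D : set R) (l ts : seq R).

Lemma first_zero (f : R -> R) a b e : continuous f -> 0 < e ->
  (forall s, a < s <= a + e -> 0 < f s) -> a < b -> f b <= 0 ->
  exists c, [/\ a < c <= b, f c = 0 & forall s, a < s < c -> 0 < f s].
Proof.
move=> cf e0 fp ab fb.
pose S := [set s | a < s <= b /\ f s <= 0].
have hS : has_inf S.
  by split; [exists b; split; rewrite ?ab ?lexx|exists a => s [/andP[/ltW]]].
pose c := inf S.
have ec : a + e <= c.
  apply: lb_le_inf; first by case: hS.
  move=> s [/andP[as_ _] fs]; rewrite leNgt; apply/negP => sae.
  by have := fp s; rewrite as_ (ltW sae) => /(_ isT); rewrite ltNge fs.
have ac : a < c by lra.
have cb : c <= b by apply: ge_inf; [case: hS|split; rewrite ?ab ?lexx].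
have pos s : a < s < c -> 0 < f s.
  move=> /andP[as_ sc]; rewrite ltNge; apply/negP => fs.
  have : S s by split=> //; rewrite as_ (le_trans (ltW sc) cb).
  by move=> /(ge_inf hS.2); rewrite leNgt -/c sc.
exists c; split=> //; first by rewrite ac.
have [fc|fc|//] := ltgtP (f c) 0; exfalso.
  have fc' : 0 < - f c by rewrite oppr_gt0.
  have [d d0 Hd] := cont_ed (cf c) fc'.
  pose s := Num.max (c - d / 2) ((a + c) / 2).
  have sc : s < c by rewrite /s gt_max; apply/andP; split; lra.
  have as_ : a < s by rewrite /s lt_max; apply/orP; right; lra.
  have sd : c - d / 2 <= s by rewrite /s le_max lexx.

  have {}H : `|f s - f c| < - f c by apply: Hd; rewrite ltr0_norm ?subr_lt0//; lra.
  by have := pos s; rewrite as_ sc => /(_ isT); move: H; rewrite ltr_norml => /andP[_]; lra.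
have [d d0 Hd] := cont_ed (cf c) fc.
have [s [sI fs] sd] := inf_adherent d0 hS; have cs := ge_inf hS.2 (conj sI fs : S s).
have : `|f s - f c| < f c.
  by apply: Hd; rewrite ger0_norm ?subr_ge0//; move: sd; rewrite -/c; lra.
by rewrite ltr_norml => /andP[]; lra.
Qed.

Lemma fil_bound A B z w c d : fil A B z w -> c <= (A z).1 <= d -> c <= (fold B z).1 <= d ->
  c <= w.1 <= d.
Proof.
rewrite /fil; case: ifP => _; first by move=> ->.
case: ifP => _; first by move=> ->.
move=> [s /andP[s0 s1] ->].
rewrite -[(_ + _).1]/(s * (A z).1 + (1 - s) * (fold B z).1).
move: (A z).1 (fold B z).1 => p q /andP[a1 a2] /andP[b1 b2].
have s1' : 0 <= 1 - s by rewrite subr_ge0.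
by apply/andP; split; nra.
Qed.

Lemma pnorm1B z w : `|z.1 - w.1| <= `|z - w|.
Proof. exact: (pnorm1 (z - w)). Qed.

(** Where both fields point to the right, so does the whole Filippov segment, and this persists
    nearby: a solution can neither slide nor turn back, whatever its velocity selection. *)
Lemma enter A B g t0 : lipbox A -> lipbox B -> traj A B g ->
  0 < (A (g t0)).1 -> 0 < (fold B (g t0)).1 ->
  exists2 e : R, 0 < e & forall s t, t0 - e <= s -> s < t -> t <= t0 + e -> (g s).1 < (g t).1.
Proof.
move=> lA lB tg pA pB; have [c1 c2] := traj_cont tg.
pose a := (A (g t0)).1; pose b := (fold B (g t0)).1.
pose c := Num.min (a / 2) (b / 2).
have c0 : 0 < c by rewrite lt_min !divr_gt0.
have [ca cb] : c <= a / 2 /\ c <= b / 2 by rewrite !ge_min !lexx orbT.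
have [d1 d10 Hd1] := lipbox_ed t0 lA c1 c2 c0.
have [d2 d20 Hd2] := lipbox_ed t0 (lipbox_fold lB) c1 c2 c0.
pose e := Num.min d1 d2 / 2.
have m0 : 0 < Num.min d1 d2 by rewrite lt_min d10.
have [m1 m2] : Num.min d1 d2 <= d1 /\ Num.min d1 d2 <= d2 by rewrite !ge_min !lexx orbT.
exists e => [|s t es st te]; first by rewrite divr_gt0.
have near u : s <= u <= t -> `|u - t0| < d1 /\ `|u - t0| < d2.
  move=> /andP[su ut]; rewrite !ltr_norml /e in es te *.
  by split; apply/andP; split; clear -es st te su ut m1 m2 m0; lra.
have cab : c <= 2 * (a + b) by lra.
have [K _] := traj_bound tg (ltW st) cab.
have : c * (t - s) <= (g t).1 - (g s).1 <= 2 * (a + b) * (t - s).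
  apply: K => u w /near[/Hd1 h1 /Hd2 h2] fw.
  have := le_lt_trans (pnorm1B _ _) h1; have := le_lt_trans (pnorm1B _ _) h2.
  rewrite -/a -/b !ltr_norml => /andP[i1 i2] /andP[i3 i4].
  by apply: fil_bound fw _ _; apply/andP; split; clear -i1 i2 i3 i4 ca cb c0; lra.
by move=> /andP[h _]; rewrite -subr_gt0; apply: lt_le_trans h; rewrite mulr_gt0// subr_gt0.
Qed.

Lemma curve_shift F g t0 T : continuous (fun t => (g t).1) -> continuous (fun t => (g t).2) ->
  (forall t, t0 < t < t0 + T -> flows F g t) ->
  curve_derive (fun s => g (t0 + s)) (F \o (fun s => g (t0 + s))) 0 T.
Proof.
move=> c1 c2 fl.
have ci (f : R -> R) : continuous f -> continuous (fun s => f (t0 + s)).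
  move=> cf s; apply: (@continuous_comp _ _ _ (fun s => t0 + s) f); last exact: cf.
  by apply: cvgD; [exact: cvg_cst|exact: cvg_id].
have di (f : R -> R) s (k : R) : is_derive (t0 + s) 1 f k -> is_derive s 1 (fun s => f (t0 + s)) k.
  move=> D; have D1 : is_derive s 1 (fun s => t0 + s) (1 : R).
    apply: (is_derive_eq (is_deriveD (is_derive_cst t0 s 1) (is_derive_id s 1))).
    by rewrite add0r.
  by have := is_derive1_comp D D1; rewrite mulr1.
split; [exact: (ci (fun t => (g t).1))|exact: (ci (fun t => (g t).2))|].
move=> s /andP[s0 sT]; have [|d1 d2] := fl (t0 + s); first by rewrite ltrDl s0 ltrD2l.
by split; [exact: (di (fun t => (g t).1))|exact: (di (fun t => (g t).2))].
Qed.

(** After the start the trajectory is in the open half-plane, where it solves a locally Lipschitz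
    equation; a first return to the line before [T] would put a zero inside the arc. Transversality
    thus restores forward uniqueness. *)
Lemma follow_arc A B V g t0 z y T h : lipbox A -> lipbox B -> traj A B g -> g t0 = z ->
  parc V A z y T h -> (z.1 = 0 -> 0 < (fold B z).1) -> forall s, 0 <= s <= T -> g (t0 + s) = h s.
Proof.
move=> lA lB tg gz [T0 h0 hT Dh hp hV He St] zB; have [c1 c2] := traj_cont tg.
have [T00|T00] := eqVneq T 0.
  by move=> s; rewrite T00 -eq_le => /eqP <-; rewrite addr0 h0.
have T_0 : 0 < T by rewrite lt_neqAle eq_sym T00.
have [e e0 He'] : exists2 e : R, 0 < e & forall s, t0 < s <= t0 + e -> 0 < (g s).1.
  have pos : 0 < z.1 -> exists2 e : R, 0 < e & forall s, t0 < s <= t0 + e -> 0 < (g s).1.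
    move=> z0; rewrite -gz in z0; have [d d0 Hd] := cont_ed (c1 t0) z0.
    exists (d / 2) => [|s /andP[ts st]]; first by rewrite divr_gt0.
    have : `|(g s).1 - (g t0).1| < (g t0).1.
      by apply: Hd; rewrite ger0_norm ?subr_ge0 ?(ltW ts)//; lra.
    by rewrite ltr_norml => /andP[]; lra.
  case: St => [TE|/pos//|[z0 Az]]; first by rewrite TE eqxx in T00.
  have Bz := zB z0; rewrite -gz in Az Bz z0.
  have [e e0 He'] := enter lA lB tg Az Bz.
  exists e => // s /andP[ts st]; rewrite -z0; apply: He' => //; lra.
have uq T' : 0 <= T' <= T -> (forall s, t0 < s < t0 + T' -> 0 < (g s).1) ->
    forall s, 0 <= s <= T' -> g (t0 + s) = h s.
  move=> /andP[T'0 T'T] gp; apply: (curve_uniq lA).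
  - by rewrite addr0 gz h0.
  - by apply: curve_shift => // t tI; apply: (traj_smooth lA tg gp).
  - by apply: curve_deriveS Dh _ _.
apply: (uq T) => [|s /andP[ts st]]; first by rewrite T0 lexx.
rewrite ltNge; apply/negP => gs.
have [c [/andP[tc cs] gc gpos]] := first_zero c1 e0 He' ts gs.
have cT : c - t0 < T by lra.
have := uq (c - t0); rewrite subrKC subr_ge0 (ltW tc) (ltW cT) => /(_ isT gpos (c - t0)).
rewrite subrKC subr_ge0 (ltW tc) lexx => /(_ isT) gh.
by have := hp (c - t0); rewrite subr_gt0 tc cT -gh gc ltxx => /(_ isT).
Qed.

Definition crossing A B x := 0 < (A (0, x)).1 * (fold B (0, x)).1.

Lemma crossing_mir A B x : crossing B A x = crossing A B x.
Proof. by rewrite /crossing /fold /mir /= oppr0 mulrN mulrN mulrC. Qed.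

(** The geometric content of a chain: [l] lists its intermediate crossing points, [ts] the finitely
    many times at which the equation may fail, and [cp_follow] is the forward uniqueness needed to
    identify periodic orbits. *)
Record cpath A B VA VB D y y' T h l : Prop := CPath {
  cp_T : 0 < T;
  cp_0 : h 0 = (0, y);
  cp_end : h T = (0, y');
  cp_c1 : continuous (fun t => (h t).1);
  cp_c2 : continuous (fun t => (h t).2);
  cp_reg : exists ts, forall s, 0 < s < T -> s \notin ts -> regular A B h s;
  cp_V : forall s, 0 <= s <= T -> VA (h s) \/ VB (mir (h s));
  cp_line : forall s, 0 <= s <= T -> (h s).1 = 0 -> (h s).2 \in [:: y, y' & l];
  cp_l : forall x, x \in l -> D x /\ crossing A B x;
  cp_nz : exists s, 0 < s < T /\ (h s).1 != 0;
  cp_follow : crossing A B y -> forall g t0, traj A B g -> g t0 = (0, y) ->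
    forall s, 0 <= s <= T -> g (t0 + s) = h s }.

Lemma regular_mir A B g t : regular B A g t -> regular A B (mir \o g) t.
Proof.
have N F : flows F g t -> flows (fold F) (mir \o g) t.
  move=> [d1 d2]; split; last by rewrite /fold /= -/(mir (g t)) mirK.
  apply: (is_derive_eq (is_deriveN d1)).
  by rewrite /fold /= -/(mir (g t)) mirK.
rewrite /regular /= oppr_gt0 oppr_lt0 => -[[h fl]|[h fl]]; [right|left]; split=> //; first exact: N.
by have := N _ fl; rewrite foldK.
Qed.

Lemma mir_line y : mir (0, y) = (0, y). Proof. by rewrite /mir /= oppr0. Qed.

Lemma cpath_mir A B VA VB D y y' T h l : cpath B A VB VA D y y' T h l ->
  cpath A B VA VB D y y' T (mir \o h) l.
Proof.
move=> [T0 h0 hT c1 c2 [ts reg] hV hl ll [s [sI sn]] fo]; split=> //.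
- by rewrite /= h0 mir_line.
- by rewrite /= hT mir_line.
- by move=> t; apply: cvgN; exact: c1.
- by exists ts => t tI tn; apply: regular_mir; exact: reg.
- by move=> t tI; rewrite /= mirK; have [] := hV t tI; [right|left].
- by move=> t tI /= /eqP; rewrite oppr_eq0 => /eqP; exact: hl.
- by move=> x /ll; rewrite crossing_mir.
- by exists s; split=> //; rewrite oppr_eq0.
- move=> cr g t0 tg g0 t tI; rewrite -crossing_mir in cr.
  have := fo cr (mir \o g) t0 (traj_mir tg).
  by rewrite /= g0 mir_line => /(_ erefl t tI) <-; rewrite mirK.
Qed.

Lemma parc_cpath A B VA VB D y y' T h : lipbox A -> lipbox B -> 0 < (A (0, y)).1 ->
  parc VA A (0, y) y' T h -> cpath A B VA VB D y y' T h [::].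
Proof.
move=> lA lB Ay hA; have [T0 h0 hT [c1 c2 Dh] hp hV He St] := hA.
have T_0 : 0 < T.
  rewrite lt_neqAle T0 andbT eq_sym; apply/eqP => TE.
  by move: hT; rewrite TE h0 => -[yy]; move: He; rewrite -yy ltNge (ltW Ay).
have T2 : 0 < T / 2 < T by apply/andP; split; lra.
split=> //.
- by exists [::] => s sI _; left; split; [exact: hp|exact: Dh].
- by move=> s /hV; left.
- move=> s /andP[]; rewrite le_eqVlt => /predU1P[<- _ _|s0]; first by rewrite h0 mem_head.
  rewrite le_eqVlt => /predU1P[-> _|sT hs]; first by rewrite hT !inE eqxx orbT.
  by have := hp s; rewrite s0 sT hs ltxx => /(_ isT).
- by exists (T / 2); split=> //; rewrite gt_eqF// hp.
- move=> cr g t0 tg g0; apply: (follow_arc lA lB tg g0 hA) => _.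
  by move: cr; rewrite /crossing pmulr_rgt0.
Qed.

Definition glue h1 h2 T t := if t <= T then h1 t else h2 (t - T).

Lemma cont_glue (f k : R -> R) T : continuous f -> continuous k -> f T = k 0 ->
  continuous (fun t => if t <= T then f t else k (t - T)).
Proof.
move=> cf ck fk t; apply: ed_cont => e e0.
have [tT|Tt|->] := ltgtP t T.
- have [d d0 Hd] := cont_ed (cf t) e0; have Tt : 0 < T - t by rewrite subr_gt0.
  exists (Num.min d (T - t)) => [|s]; first by rewrite lt_min d0.
  rewrite lt_min => /andP[/Hd + st]; rewrite ifT//.
  by move: st; rewrite ltr_norml => /andP[_]; lra.
- have [d d0 Hd] := cont_ed (ck (t - T)) e0; have tT : 0 < t - T by rewrite subr_gt0.
  exists (Num.min d (t - T)) => [|s]; first by rewrite lt_min d0.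
  rewrite lt_min => /andP[sd st]; rewrite ifF.
    by apply: Hd; rewrite (_ : _ - _ = s - t)//; ring.
  by apply/negbTE; rewrite -ltNge; move: st; rewrite ltr_norml => /andP[]; lra.
- have [d1 d10 Hd1] := cont_ed (cf T) e0; have [d2 d20 Hd2] := cont_ed (ck 0) e0.
  exists (Num.min d1 d2) => [|s]; first by rewrite lt_min d10.
  rewrite lt_min => /andP[s1 s2]; case: (leP s T) => sT; first exact: Hd1.
  by rewrite fk; apply: Hd2; rewrite subr0.
Qed.

Lemma regular_shift A B h c t : regular A B h (t - c) -> regular A B (fun s => h (s - c)) t.
Proof.
have D (f : R -> R) (k : R) : is_derive (t - c) 1 f k -> is_derive t 1 (fun s => f (s - c)) k.
  move=> D; have D1 : is_derive t 1 (fun s => s - c) (1 : R).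
    apply: (is_derive_eq (is_deriveB (is_derive_id t 1) (is_derive_cst c t 1))).
    by rewrite subr0.
  by have := @is_derive1_comp _ f (fun s => s - c) t k 1 D D1; rewrite mulr1.
have S F : flows F h (t - c) -> flows F (fun s => h (s - c)) t.
  by move=> [d1 d2]; split; [exact: (D (fun t => (h t).1))|exact: (D (fun t => (h t).2))].
by move=> [[h1 fl]|[h1 fl]]; [left|right]; split=> //; exact: S.
Qed.

Lemma regular_near A B g h a b t : a < t < b -> (forall s, a < s < b -> g s = h s) ->
  regular A B h t -> regular A B g t.
Proof.
move=> tI gh; have N : \forall s \near t, h s = g s.
  have : \forall s \near t, s \in `]a, b[ by apply: near_in_itvoo; rewrite in_itv.
  by apply: filterS => s; rewrite in_itv /= => /gh.
have E := gh t tI.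
have S F : flows F h t -> flows F g t.
  rewrite /flows E => -[d1 d2]; split.
    by apply: near_eq_is_derive d1; apply: filterS N => s ->.
  by apply: near_eq_is_derive d2; apply: filterS N => s ->.
by rewrite /regular E => -[[h1 fl]|[h1 fl]]; [left|right]; split=> //; exact: S.
Qed.

Lemma cpath_cat A B VA VB D y y1 y' T1 T2 h1 h2 l1 l2 :
  cpath A B VA VB D y y1 T1 h1 l1 -> cpath A B VA VB D y1 y' T2 h2 l2 ->
  D y1 -> crossing A B y1 ->
  cpath A B VA VB D y y' (T1 + T2) (glue h1 h2 T1) (y1 :: l1 ++ l2).
Proof.
move=> [T10 h10 h1T c11 c12 [ts1 reg1] V1 L1 l1D [s1 [sI1 sn1]] f1].
move=> [T20 h20 h2T c21 c22 [ts2 reg2] V2 L2 l2D _ f2] Dy cr1.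
have g1 s : s <= T1 -> glue h1 h2 T1 s = h1 s by rewrite /glue => ->.
have g2 s : T1 <= s -> glue h1 h2 T1 s = h2 (s - T1).
  rewrite le_eqVlt => /predU1P[<-|sT]; first by rewrite g1// subrr h20 h1T.
  by rewrite /glue leNgt sT.
split.
- exact: addr_gt0.
- by rewrite g1 ?(ltW T10).
- by rewrite g2 ?lerDl ?(ltW T20)// addrC addKr.
- rewrite (_ : (fun t => _) = fun t => if t <= T1 then (h1 t).1 else (h2 (t - T1)).1).
    by apply: (@cont_glue (fun t => (h1 t).1) (fun t => (h2 t).1)) => //; rewrite h1T h20.
  by apply/funext => t; rewrite /glue; case: ifP.
- rewrite (_ : (fun t => _) = fun t => if t <= T1 then (h1 t).2 else (h2 (t - T1)).2).
    by apply: (@cont_glue (fun t => (h1 t).2) (fun t => (h2 t).2)) => //; rewrite h1T h20.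
  by apply/funext => t; rewrite /glue; case: ifP.
- exists (T1 :: ts1 ++ [seq s + T1 | s <- ts2]) => s /andP[s0 sT].
  rewrite inE negb_or mem_cat negb_or => /and3P[sT1 n1 n2].
  have [sl|sg|sE] := ltgtP s T1; last by rewrite sE eqxx in sT1.
    apply: (@regular_near _ _ _ h1 0 T1); rewrite ?s0//.
      by move=> u /andP[_ uT]; apply: g1; exact: ltW.
    by apply: reg1 => //; rewrite s0.
  apply: (@regular_near _ _ _ (fun s => h2 (s - T1)) T1 (T1 + T2)); rewrite ?sg//.
    by move=> u /andP[uT _]; apply: g2; exact: ltW.
  apply/regular_shift/reg2; first by apply/andP; split; lra.
  by apply: contra n2 => sn; apply/mapP; exists (s - T1); rewrite ?subrK.
- move=> s /andP[s0 sT]; have [sl|sg] := leP s T1; first by rewrite g1//; apply: V1; rewrite s0.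
  by rewrite g2 ?(ltW sg)//; apply: V2; apply/andP; split; lra.
- move=> s /andP[s0 sT]; have [sl|sg] := leP s T1.
    rewrite g1// => /L1; rewrite s0 sl => /(_ isT).
    by rewrite !inE mem_cat => /or3P[] ->; rewrite ?orbT.
  rewrite g2 ?(ltW sg)// => /L2 H.
  have {H} := H _; rewrite !inE mem_cat => H.
  have /H/or3P[] : 0 <= s - T1 <= T2 by apply/andP; split; lra.
  + by move=> ->; rewrite !orbT.
  + by move=> ->; rewrite !orbT.
  + by move=> ->; rewrite !orbT.
- by move=> x; rewrite inE mem_cat => /predU1P[->//|/orP[/l1D|/l2D]].
- move/andP: sI1 => [sI1 sI2]; exists s1; rewrite g1 ?(ltW sI2)//; split=> //.
  by rewrite sI1; lra.
- move=> cr g t0 tg g0 s /andP[s0 sT]; have [sl|sg] := leP s T1.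
    by rewrite g1//; apply: f1 => //; rewrite s0.
  have gT : g (t0 + T1) = (0, y1) by rewrite -h1T; apply: f1 => //; rewrite (ltW T10) lexx.
  rewrite g2 ?(ltW sg)// -(f2 cr1 g _ tg gT).
    by congr g; ring.
  by apply/andP; split; lra.
Qed.

Lemma chain_start A B VA VB D n y y' : chain A B VA VB D n y y' -> 0 < (A (0, y)).1.
Proof. by case: n => [[]|n [y1 [[]]]]. Qed.

Lemma chain_exit A B VA VB D n y y' : chain A B VA VB D n y y' ->
  if odd n then (B (0, y')).1 < 0 else (A (0, y')).1 < 0.
Proof.
elim: n A B VA VB y => [|n IH] A B VA VB y /=; first by case=> _ /pass_exit.
by move=> [y1 [_ _ /IH]]; case: (odd n).
Qed.

Lemma chain_cpath A B VA VB D n y y' : lipbox A -> lipbox B -> chain A B VA VB D n y y' ->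
  exists T h l, cpath A B VA VB D y y' T h l.
Proof.
elim: n A B VA VB y => [|n IH] A B VA VB y lA lB /=.
  by move=> [Ay [T [h hA]]]; exists T, h, [::]; exact: parc_cpath.
move=> [y1 [[Ay hp] Dy1 ch]]; have Ay1 := pass_exit hp; have By1 := chain_start ch.
have [T2 [h2 [l2 /cpath_mir H2]]] := IH _ _ _ _ _ lB lA ch.
have [T1 [h1 hA]] := hp; have H1 := parc_cpath VB D lA lB Ay hA.
exists (T1 + T2), (glue h1 (mir \o h2) T1), (y1 :: [::] ++ l2); apply: cpath_cat => //.
rewrite /crossing /fold mir_line /= nmulr_rgt0//.
by rewrite oppr_lt0.
Qed.

End ChainPaths.

(** * Closed chains and crossing limit cycles *)

Section PeriodicExtension.
Variable R : realType.
Implicit Types (z w : R * R) (a b c d e s t u x y T : R) (F A B : R * R -> R * R) (g h : R -> R * R)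
  (V VA VB : set (R * R)) (D : set R) (l ts : seq R).

Definition per h T t := h (t - (Num.floor (t / T))%:~R * T).

Lemma per_floor t T : 0 < T -> exists n : int, n%:~R * T <= t < (n%:~R + 1) * T.
Proof.
move=> T0; exists (Num.floor (t / T)); have /andP[h1 h2] := floor_itv (t / T).
by rewrite -ler_pdivlMr// h1 -ltr_pdivrMr//; rewrite intrD in h2.
Qed.

Lemma perE h T (n : int) t : 0 < T -> h T = h 0 -> n%:~R * T <= t <= (n%:~R + 1) * T ->
  per h T t = h (t - n%:~R * T).
Proof.
move=> T0 hT; have key (m : int) s : m%:~R * T <= s < (m%:~R + 1) * T ->
    per h T s = h (s - m%:~R * T).
  move=> /andP[m1 m2]; rewrite /per (@floor_def _ _ m)//.
  by rewrite intrD ler_pdivlMr// ltr_pdivrMr// m1.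
move=> /andP[n1]; rewrite le_eqVlt => /predU1P[->|n2]; last by apply: key; rewrite n1.
have E : ((n + 1)%:~R : R) = n%:~R + 1 by rewrite intrD.
rewrite (key (n + 1)) ?E ?lexx ?ltr_pM2r ?ltrDl ?ltr01//.
by rewrite subrr -hT; congr h; ring.
Qed.

Lemma per_add h T t : 0 < T -> h T = h 0 -> per h T (t + T) = per h T t.
Proof.
move=> T0 hT; have [n /andP[n1 n2]] := per_floor t T0.
rewrite (@perE h T n t)// ?n1 ?(ltW n2)// (@perE h T (n + 1) (t + T))//.
  by rewrite intrD; congr h; ring.
by rewrite intrD; apply/andP; split; lra.
Qed.

Lemma per_id h T t : 0 < T -> h T = h 0 -> 0 <= t <= T -> per h T t = h t.
Proof.
by move=> T0 hT tI; rewrite (@perE h T 0)// ?mul0r ?subr0// add0r mul1r.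
Qed.

Lemma per_in h T t : 0 < T -> h T = h 0 -> exists2 s, 0 <= s <= T & per h T t = h s.
Proof.
move=> T0 hT; have [n /andP[n1 n2]] := per_floor t T0; exists (t - n%:~R * T).
  by apply/andP; split; lra.
by rewrite (@perE h T n t)// n1 ltW.
Qed.

(** Locally the periodic extension is two translates of [h] glued at a multiple [a] of the period;
    as [a <= t < a + T], the time [t] is either a junction or inside one copy. *)
Lemma per_glue h T t : 0 < T -> h T = h 0 -> exists a, [/\ a - T < t < a + T, a <= t &
  forall s, a - T <= s <= a + T ->
    per h T s = if s <= a then h (s - (a - T)) else h (s - a)].
Proof.
move=> T0 hT; have [n /andP[n1 n2]] := per_floor t T0; exists (n%:~R * T); split=> //.
  by apply/andP; split; lra.
move=> s /andP[s1 s2]; case: leP => sn.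
  rewrite (@perE h T (n - 1))//; first by rewrite intrB; congr h; ring.
  by rewrite intrB; apply/andP; split; lra.
by rewrite (@perE h T n)// (ltW sn)/=; lra.
Qed.

Lemma per_cont (f : R -> R) (k : R -> R) T : 0 < T -> continuous f -> f T = f 0 ->
  (forall t, exists a, [/\ a - T < t < a + T, a <= t &
    forall s, a - T <= s <= a + T -> k s = if s <= a then f (s - (a - T)) else f (s - a)]) ->
  continuous k.
Proof.
move=> T0 cf fT H t; have [a [/andP[a1 a2] _ E]] := H t.
have cs : continuous (fun s => f (s - (a - T))).
  move=> s; apply: (@continuous_comp _ _ _ (fun s => s - (a - T)) f); last exact: cf.
  by apply: cvgB; [exact: cvg_id|exact: cvg_cst].
have C := @cont_glue R (fun s => f (s - (a - T))) f a cs cf _ t.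
have {}C : {for t, continuous (fun s => if s <= a then f (s - (a - T)) else f (s - a))}.
  by apply: C; rewrite subKr.
have : k x @[x --> t] --> k t; last by [].
rewrite E ?(ltW a1) ?(ltW a2)//; apply: cvg_trans C; apply: near_eq_cvg.
have N : \forall s \near t, s \in `]a - T, a + T[ by apply: near_in_itvoo; rewrite in_itv /= a1.
by apply: filterS N => s; rewrite in_itv /= => /andP[s1 s2]; rewrite E// !ltW.
Qed.

Lemma seq_gap ts u : exists2 e : R, 0 < e & forall x, x \in ts -> x != u -> e < `|x - u|.
Proof.
have [|e e0 He] := @seq_pos_lb R [seq `|x - u| | x <- ts & x != u].
  by move=> y /mapP[x]; rewrite mem_filter => /andP[xu _] ->; rewrite normr_gt0 subr_eq0.
by exists e => // x xs xu; apply/He/mapP; exists x => //; rewrite mem_filter xu.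
Qed.

Lemma per_traj A B VA VB D p T h l : lipbox A -> lipbox B -> cpath A B VA VB D p p T h l ->
  traj A B (per h T).
Proof.
move=> lA lB [T0 h0 hT c1 c2 [ts reg] _ _ _ _ _].
have hT0 : h T = h 0 by rewrite hT h0.
have c1' : continuous (fun t => (per h T t).1).
  apply: (per_cont T0 c1) => [|t]; first by rewrite hT0.
  have [a [a1 a2 E]] := per_glue t T0 hT0; exists a; split=> // s /E ->; by case: ifP.
have c2' : continuous (fun t => (per h T t).2).
  apply: (per_cont T0 c2) => [|t]; first by rewrite hT0.
  have [a [a1 a2 E]] := per_glue t T0 hT0; exists a; split=> // s /E ->; by case: ifP.
apply: regular_traj => // t; have [a [/andP[a1 a2] at_ E]] := per_glue t T0 hT0.
have [e1 e10 H1] := seq_gap ts (t - a); have [e2 e20 H2] := seq_gap ts T.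
have right s : a < s < a + T -> s - a \notin ts -> regular A B (per h T) s.
  move=> sI sn; apply: (@regular_near _ _ _ _ (fun s => h (s - a)) a (a + T)) => //.
    by move=> u /andP[au uT]; rewrite E ?(ltW uT) ?ifF// ?andbT; [apply/negbTE; rewrite -ltNge|lra].
  by apply/regular_shift/reg => //; move: sI => /andP[? ?]; apply/andP; split; lra.
have left s : a - T < s < a -> s - (a - T) \notin ts -> regular A B (per h T) s.
  move=> sI sn; apply: (@regular_near _ _ _ _ (fun s => h (s - (a - T))) (a - T) a) => //.
    by move=> u /andP[au ua]; rewrite E ?(ltW au) ?ifT ?(ltW ua)//=; lra.
  by apply/regular_shift/reg => //; move: sI => /andP[? ?]; apply/andP; split; lra.
(* At a junction, [t] is time 0 of the right copy and time [T] of the left one, and the exceptional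
   times near both have to be avoided. *)
move: at_; rewrite le_eqVlt => /predU1P[aE|at_].
  exists (Num.min (Num.min e1 e2) T); first by rewrite !lt_min e10 e20.
  move=> s; rewrite !lt_min => /andP[s0 /andP[/andP[s1 s2] sT]].
  have [st|ts_|sE] := ltgtP s t; last by rewrite sE subrr normr0 ltxx in s0.
    apply: left; first by move: sT; rewrite ltr_norml => /andP[]; rewrite aE => *; apply/andP; split; lra.
    apply/negP => /H2; rewrite (_ : _ - _ - T = s - t); last by rewrite -aE; ring.
    have -> /= : s - (a - T) != T by apply/eqP; move: st; rewrite aE; lra.
    by move=> /(_ isT); rewrite ltNge (ltW s2).
  apply: right; first by move: sT; rewrite ltr_norml => /andP[_]; rewrite aE => *; apply/andP; split; lra.
  apply/negP => /H1; rewrite (_ : _ - _ - _ = s - t); last by ring.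
  have -> /= : s - a != t - a by apply/eqP; move: ts_; lra.
  by move=> /(_ isT); rewrite ltNge (ltW s1).
exists (Num.min e1 (Num.min (t - a) (a + T - t))); first by rewrite !lt_min e10 !subr_gt0 at_.
move=> s; rewrite !lt_min => /andP[s0 /and3P[s1 s2 s3]].
apply: right; first by move: s2 s3; rewrite !ltr_norml => /andP[? ?] /andP[? ?]; apply/andP; split; lra.
apply/negP => /H1; rewrite (_ : _ - _ - _ = s - t); last by ring.
have -> /= : s - a != t - a.
  by apply/eqP => st; move: s0; rewrite (_ : s - t = 0) ?normr0 ?ltxx//; lra.
by move=> /(_ isT); rewrite ltNge (ltW s1).
Qed.

Lemma chain_follow A B VA VB D n y y' g t0 : lipbox A -> lipbox B -> chain A B VA VB D n y y' ->
  crossing A B y -> traj A B g -> g t0 = (0, y) -> exists2 T : R, 0 < T & g (t0 + T) = (0, y').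
Proof.
move=> lA lB /(chain_cpath lA lB)[T [h [l [T0 _ hT _ _ _ _ _ _ _ fo]]]] cr tg g0.
by exists T => //; rewrite (fo cr g t0 tg g0) ?hT// lexx ltW.
Qed.

Lemma chain_crossing A B VA VB D n y y' : chain A B VA VB D n y y' -> (B (0, y)).1 < 0 -> crossing A B y.
Proof.
by move=> /chain_start Ay By; rewrite /crossing /fold mir_line /= mulr_gt0// oppr_gt0.
Qed.

Lemma neg_near F (x : R) : lipbox F -> (F (0, x)).1 < 0 -> exists2 e : R, 0 < e &
  forall z, `|z - (0, x)| < e -> (F z).1 < 0.
Proof.
move=> lF Fx; have F0 : 0 < - (F (0, x)).1 by rewrite oppr_gt0.
have [d d0 Hd] := lipbox_cont (0, x) lF F0; exists d => // z /Hd h.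
have := le_lt_trans (pnorm1B _ _) h; rewrite ltr_norml => /andP[_]; lra.
Qed.

Lemma parc_tail V F z y T h s : parc V F z y T h -> 0 <= s <= T -> parc V F (h s) y (T - s) (fun t => h (s + t)).
Proof.
move=> hA /andP[s0 sT]; have [T0 h0 hT [c1 c2 Dh] hp hV He St] := hA; split=> //.
- by rewrite subr_ge0.
- by rewrite addr0.
- by rewrite addrC subrK.
- apply: curve_shift => // t; rewrite addrC subrK => /andP[st tT].
  by apply: Dh; rewrite (le_lt_trans s0 st).
- by move=> t /andP[t0 tT]; apply: hp; apply/andP; split; lra.
- by move=> t /andP[t0 tT]; apply: hV; apply/andP; split; lra.
- move: s0; rewrite le_eqVlt => /predU1P[<-|s0]; first by rewrite subr0 h0.
  move: sT; rewrite le_eqVlt => /predU1P[->|sT]; first by rewrite subrr; constructor 1.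
  by constructor 2; apply: hp; rewrite s0.
Qed.

Lemma pos_near F z : lipbox F -> 0 < (F z).1 -> exists2 e : R, 0 < e &
  forall w, `|w - z| < e -> 0 < (F w).1.
Proof.
move=> lF Fx; have [d d0 Hd] := lipbox_cont z lF Fx; exists d => // w /Hd h.
have := le_lt_trans (pnorm1B _ _) h; rewrite ltr_norml => /andP[]; lra.
Qed.

Lemma mir_norm z w : `|mir z - mir w| = `|z - w|.
Proof. by rewrite !prod_normE /= -opprD normrN. Qed.

Lemma line_norm x y : `|((0, x) - (0, y) : R * R)| = `|x - y|.
Proof. by rewrite prod_normE /= subrr normr0 max_r. Qed.

Lemma pass_follow A B V g t y : lipbox A -> lipbox B -> traj A B g -> pass V A (g t) y ->
  ((g t).1 = 0 -> 0 < (fold B (g t)).1) -> exists t', g t' = (0, y).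
Proof.
move=> lA lB tg [T [h hA]] zB; have fo := follow_arc lA lB tg erefl hA zB.
by case: hA => T0 _ hT _ _ _ _ _; exists (t + T); rewrite fo ?hT// lexx T0.
Qed.

Lemma reach_arc A B VA y y1 T h g0 t0 s e : lipbox A -> lipbox B -> parc VA A (0, y) y1 T h ->
  (B (0, y)).1 < 0 -> traj A B g0 -> g0 t0 = (0, y) -> 0 <= s <= T -> 0 < e ->
  exists2 r : R, 0 < r & forall g t, traj A B g -> `|g t - g0 (t0 + s)| < r ->
    (s = 0 -> 0 <= (g t).1) -> (s = T -> 0 <= (g t).1) ->
    exists t' y'', g t' = (0, y'') /\ `|y'' - y1| < e.
Proof.
move=> lA lB hA By tg0 g00 sI e0.
have fB : 0 < (fold B (0, y)).1 by rewrite /fold mir_line /= oppr_gt0.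
have -> : g0 (t0 + s) = h s by apply: (follow_arc lA lB tg0 g00 hA).
have [r r0 Hr] := pass_perturb openT lA
  (passS (@subsetT _ _) (ex_intro _ _ (ex_intro _ _ (parc_tail hA sI)))) e0.
have go g t : traj A B g -> `|g t - h s| <= r -> 0 <= (g t).1 ->
    ((g t).1 = 0 -> 0 < (fold B (g t)).1) -> exists t' y'', g t' = (0, y'') /\ `|y'' - y1| < e.
  move=> tg gt gt0 gB; have [y'' h1 h2] := Hr A lA (fclose_id _ r0) (g t) gt gt0.
  by have [t' gt'] := pass_follow lA lB tg h2 gB; exists t', y''.
have [_ h0 hT _ hp _ _ _] := hA; have [s0 sT] := andP sI.
(* At the exit a nearby point on the line is its own arrival: no arc need start there. *)
have [sTE|sT'] := eqVneq s T.
  exists (Num.min r e) => [|g t tg]; first by rewrite lt_min r0.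
  rewrite lt_min => /andP[/ltW gr ge] _ /(_ sTE) gt0.
  have [g1|g1] := eqVneq (g t).1 0; last by apply: (go _ _ tg gr gt0) => /eqP; rewrite (negbTE g1).
  exists t, (g t).2; split; first by rewrite -g1 -surjective_pairing.
  apply: le_lt_trans ge; rewrite sTE hT; exact: (pnorm2 (g t - (0, y1))).
have [s00|s0'] := eqVneq s 0.
  have [d d0 Hd] := pos_near (lipbox_fold lB) fB.
  exists (Num.min r d) => [|g t tg]; first by rewrite lt_min r0.
  rewrite lt_min => /andP[/ltW gr gd] /(_ s00) gt0 _.
  by apply: (go _ _ tg gr gt0) => _; apply: Hd; rewrite -h0 -s00.
have hs : 0 < (h s).1 by apply: hp; rewrite !lt_neqAle s0 sT eq_sym s0' sT'.
exists (Num.min r (h s).1) => [|g t tg]; first by rewrite lt_min r0.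
rewrite lt_min => /andP[/ltW gr gh] _ _.
have gt0 : 0 < (g t).1.
  by have := le_lt_trans (pnorm1B _ _) gh; rewrite ltr_norml => /andP[]; lra.
by apply: (go _ _ tg gr (ltW gt0)) => gE; rewrite gE ltxx in gt0.
Qed.

(* Every point of a chain has a neighbourhood all of whose trajectories arrive near the end of
   the chain; at the two ends only the side on which the chain lies is controlled. *)
Lemma reach A B VA VB D n y y' g0 t0 : lipbox A -> lipbox B -> chain A B VA VB D n y y' ->
  (B (0, y)).1 < 0 -> traj A B g0 -> g0 t0 = (0, y) -> exists2 T : R, 0 < T &
   [/\ g0 (t0 + T) = (0, y'), forall g t, traj A B g -> g t = (0, y) ->
    forall s, 0 <= s <= T -> g (t + s) = g0 (t0 + s) & forall s e, 0 <= s <= T -> 0 < e -> exists2 r : R, 0 < r &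
    forall g t, traj A B g -> `|g t - g0 (t0 + s)| < r -> (s = 0 -> 0 <= (g t).1) ->
      (s = T -> if odd n then (g t).1 <= 0 else 0 <= (g t).1) ->
      exists t' y'', g t' = (0, y'') /\ `|y'' - y'| < e].
Proof.
elim: n A B VA VB y g0 t0 => [|n IH] A B VA VB y g0 t0 lA lB /= ch By tg0 g00.
  have cr := chain_crossing (ch : chain A B VA VB D 0 y y') By.
  case: ch => Ay [T [h hA]].
  have [T0 _ hT _ _ _ _ _ _ _ fo] := parc_cpath VB D lA lB Ay hA.
  exists T => //; split; first by rewrite (fo cr g0 t0 tg0 g00) ?hT// lexx ltW.
    by move=> g t tg gt s sI; rewrite (fo cr g t tg gt)// (fo cr g0 t0 tg0 g00).
  by move=> s e; exact: reach_arc hA By tg0 g00.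
case: ch => y1 [[Ay [T1 [h hA]]] Dy1 ch].
have cr : crossing A B y by rewrite /crossing /fold mir_line /= mulr_gt0// oppr_gt0.
have [T10 _ hT _ _ _ _ _ _ _ fo] := parc_cpath VB D lA lB Ay hA.
have Ay1 : (A (0, y1)).1 < 0 by case: hA.
have g01 : g0 (t0 + T1) = (0, y1) by rewrite (fo cr g0 t0 tg0 g00) ?hT// lexx ltW.
have [|T2 T20 [g02 f2 H2]] := IH B A VB VA y1 (mir \o g0) (t0 + T1) lB lA ch Ay1 (traj_mir tg0).
  by rewrite /= g01 mir_line.
exists (T1 + T2); first exact: addr_gt0.
split; first by rewrite addrA -[LHS]mirK; move: g02 => /= ->; rewrite mir_line.
  move=> g t tg gt s /andP[s0 sT]; have [sT1|T1s] := leP s T1.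
    have sI : 0 <= s <= T1 by rewrite s0.
    by rewrite (fo cr g t tg gt)// (fo cr g0 t0 tg0 g00).
  have gT1 : g (t + T1) = (0, y1) by rewrite (fo cr g t tg gt) ?hT// lexx ltW.
  have := f2 (mir \o g) (t + T1) (traj_mir tg); rewrite /= gT1 mir_line => /(_ erefl (s - T1)) E.
  have sI : 0 <= s - T1 <= T2 by apply/andP; split; clear -T1s sT; lra.
  have := E sI; rewrite (_ : t + T1 + _ = t + s); last by ring.
  rewrite (_ : t0 + T1 + _ = t0 + s); last by ring.
  by move=> E'; rewrite -[LHS]mirK E' mirK.
move=> s e /andP[s0 sT] e0.
have chT : chain B A setT setT setT n y1 y' by apply: chainS ch.
have [r2 r20 Hr2] := chain_perturb openT openT openT lB lA chT e0.
have [d d0 Hd] := neg_near lA Ay1.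
have m0 : 0 < Num.min r2 d by rewrite lt_min r20.
have arc : s <= T1 -> exists2 r : R, 0 < r & forall g t, traj A B g -> `|g t - g0 (t0 + s)| < r ->
    (s = 0 -> 0 <= (g t).1) -> (s = T1 -> 0 <= (g t).1) ->
    exists t' y'', g t' = (0, y'') /\ `|y'' - y'| < e.
  move=> sT1; have sI : 0 <= s <= T1 by rewrite s0.
  have [r r0 Hr] := reach_arc lA lB hA By tg0 g00 sI m0.
  exists r => // g t tg gr c1 c2; have [t' [y2 [gt' y2y1]]] := Hr g t tg gr c1 c2.
  move: y2y1; rewrite lt_min => /andP[/ltW y2r y2d].
  have [y3 y3y' ch3] := Hr2 B A lB lA (fclose_id _ r20) (fclose_id _ r20) y2 y2r.
  have Ay2 : (A (0, y2)).1 < 0 by apply: Hd; rewrite line_norm.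
  have [|T3 _ g3] := chain_follow lB lA ch3 (chain_crossing ch3 Ay2) (traj_mir tg) (t0 := t').
    by rewrite /= gt' mir_line.
  by exists (t' + T3), y3; split=> //; rewrite -[LHS]mirK; move: g3 => /= ->; rewrite mir_line.
have rest : T1 <= s -> exists2 r : R, 0 < r & forall g t, traj A B g ->
    `|g t - g0 (t0 + s)| < r -> (s = T1 -> (g t).1 <= 0) ->
    (s = T1 + T2 -> if ~~ odd n then (g t).1 <= 0 else 0 <= (g t).1) ->
    exists t' y'', g t' = (0, y'') /\ `|y'' - y'| < e.
  move=> sT1; have sI : 0 <= s - T1 <= T2 by apply/andP; split; lra.
  have [r r0 Hr] := H2 (s - T1) e sI e0; exists r => // g t tg gr c1 c2.
  have [|||t' [y2 [gt' y2y1]]] := Hr (mir \o g) t (traj_mir tg).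
  - by rewrite /= mir_norm (_ : _ + (s - T1) = t0 + s)//; ring.
  - by move=> sE; rewrite /= oppr_ge0; apply: c1; clear -sE; lra.
  - move=> sE; have /c2 : s = T1 + T2 by clear -sE; lra.
    by case: (odd n) => /= H; rewrite ?oppr_le0 ?oppr_ge0.
  by exists t', y2; split=> //; rewrite -[LHS]mirK; move: gt' => /= ->; rewrite mir_line.
(* At the junction the first arc controls the right side and the rest of the chain the left side, so
   a full neighbourhood is covered. *)
have [sT1|T1s|sE] := ltgtP s T1.
- have [r r0 Hr] := arc (ltW sT1); exists r => // g t tg gr c1 _.
  by apply: Hr tg gr c1 _ => sE; rewrite sE ltxx in sT1.
- have [r r0 Hr] := rest (ltW T1s); exists r => // g t tg gr _ c2.
  by apply: Hr tg gr _ c2 => sE; rewrite sE ltxx in T1s.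
- have [|r1 r10 Hr1] := arc; first by rewrite sE.
  have [|r3 r30 Hr3] := rest; first by rewrite sE.
  exists (Num.min r1 r3) => [|g t tg]; first by rewrite lt_min r10.
  rewrite lt_min => /andP[gr1 gr3] c1 c2; have [g1|/ltW g1] := leP 0 (g t).1.
    exact: Hr1 tg gr1 c1 _.
  exact: Hr3 tg gr3 _ c2.
Qed.

End PeriodicExtension.

(** * From isolated closed chains to crossing limit cycles *)

Section CyclesFromChains.
Variable R : realType.
Implicit Types (z w : R * R) (a b c d e s t u x y p q T : R) (F A B : R * R -> R * R) (g h : R -> R * R)
  (V VA VB : set (R * R)) (D : set R) (l ts : seq R) (G : set (R * R)).

Definition porbit A B G := exists g T, [/\ traj A B g, 0 < T /\ (forall t, g (t + T) = g t),
  (exists s t, g s <> g t) & G = range g].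

Definition lcycle A B G := porbit A B G /\ exists U : set (R * R),
  [/\ open U, G `<=` U & forall G', porbit A B G' -> G' `<=` U -> G' = G].

Definition clc A B G := [/\ lcycle A B G, G `&` @disc_line R !=set0,
  finite_set (G `&` @disc_line R) &
  forall z, (G `&` @disc_line R) z -> disc_line z /\ 0 < (A z).1 * (fold B z).1].

Lemma clcE (Z : pwfield R) G : crossing_limit_cycle Z G = clc (fieldp Z) (fold (fieldm Z)) G.
Proof.
by rewrite /clc /lcycle /porbit foldK -trajectory_traj.
Qed.

Lemma mono_limit (q : nat -> R) p d : (forall k, `|q k - p| <= d) ->
  (forall k, q k <= q k.+1) \/ (forall k, q k.+1 <= q k) ->
  exists2 u, `|u - p| <= d & forall e, 0 < e -> exists N, forall k, (N <= k)%N -> `|q k - u| < e.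
Proof.
wlog inc : q p / forall k, q k <= q k.+1 => [H|] qd mono.
  case: mono => [inc|dec]; first by apply: (H q) => //; left.
  have [|||u ud Hu] := H (fun k => - q k) (- p).
  - by move=> k; rewrite lerN2.
  - by move=> k; rewrite -opprD normrN.
  - by left=> j; rewrite lerN2.
  exists (- u); first by rewrite -normrN opprD !opprK; move: ud; rewrite opprK.
  by move=> e /Hu[N HN]; exists N => k /HN; rewrite -opprD normrN opprK.
have hq k : p - d <= q k <= p + d by have := qd k; rewrite ler_norml => /andP[? ?]; apply/andP; split; lra.
have hS : has_sup (range q).
  by split; [exists (q 0%N), 0%N|exists (p + d) => _ [k _ <-]; have /andP[] := hq k].
pose u := sup (range q).
have qu k : q k <= u by apply: ub_le_sup; [case: hS|exists k].
have up : u <= p + d.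
  by apply: ge_sup; [exists (q 0%N), 0%N|move=> _ [k _ <-]; have /andP[] := hq k].
exists u.
  by have /andP[h1 h2] := hq 0%N; have h3 := qu 0%N; rewrite ler_norml; apply/andP; split; lra.
move=> e e0; have [_ [N _ <-] Nu] := sup_adherent e0 hS; exists N => k Nk.
have qNk : q N <= q k.
  rewrite -(subnKC Nk); elim: (k - N)%N => [|j IH]; first by rewrite addn0.
  by rewrite addnS; exact: le_trans IH (inc _).
by rewrite ler0_norm ?subr_le0//; move: Nu; rewrite -/u; lra.
Qed.

(** [next] is a relation because the return map is only partially defined. Monotonicity makes the
    orbit converge, and continuity makes its limit a fixed point, which can only be [p]. *)
Lemma monotone_iter (next : R -> R -> Prop) (q : nat -> R) p d :
  (forall k, `|q k - p| <= d) -> (forall k, next (q k) (q k.+1)) ->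
  (forall x x' y y', `|x - p| <= d -> `|x' - p| <= d -> x < x' -> next x y -> next x' y' -> y < y') ->
  (forall x y y', next x y -> next x y' -> y = y') ->
  (forall x, `|x - p| <= d -> exists y, next x y /\ forall e, 0 < e -> exists2 r, 0 < r &
     forall x' y', `|x' - x| < r -> next x' y' -> `|y' - y| < e) ->
  (forall x, `|x - p| <= d -> next x x -> x = p) ->
  forall e, 0 < e -> exists k, `|q k - p| < e.
Proof.
move=> qd qn inc fn ct fix1.
have incw k : q k <= q k.+1 -> q k.+1 <= q k.+2.
  rewrite le_eqVlt => /predU1P[E|lt]; last exact/ltW/(inc _ _ _ _ (qd k) (qd k.+1) lt).
  by have := qn k.+1; rewrite -E => h; rewrite (fn _ _ _ h (qn k)) -E.
have decw k : q k.+1 <= q k -> q k.+2 <= q k.+1.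
  rewrite le_eqVlt => /predU1P[E|lt]; last exact/ltW/(inc _ _ _ _ (qd k.+1) (qd k) lt).
  by have := qn k.+1; rewrite E => h; rewrite (fn _ _ _ h (qn k)) E.
have [|u ud Hu] := mono_limit qd.
  by have [h|/ltW h] := leP (q 0%N) (q 1%N); [left; elim=> // k; exact: incw|right; elim=> // k; exact: decw].
have [y [uy Hy]] := ct u ud.
have yu : y = u.
  apply/eqP/negPn/negP => yu; have yu0 : 0 < `|y - u| / 2 by rewrite divr_gt0// normr_gt0 subr_eq0.
  have [r r0 Hr] := Hy _ yu0.
  have [N1 H1] := Hu _ r0; have [N2 H2] := Hu _ yu0.
  pose k := maxn N1 N2.
  have h1 := Hr (q k) (q k.+1) (H1 k (leq_maxl _ _)) (qn k).
  have h2 := H2 k.+1 (leqW (leq_maxr _ _)).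
  have : `|y - u| <= `|q k.+1 - u| + `|q k.+1 - y|.
    rewrite (_ : y - u = (q k.+1 - u) - (q k.+1 - y)); last by ring.
    exact: ler_normB.
  lra.
move=> e /Hu[N HN]; exists N; rewrite -(fix1 u ud); first exact: HN.
by rewrite -{2}yu.
Qed.

Lemma periodn g T n t : (forall t, g (t + T) = g t) -> g (t + n%:R * T) = g t.
Proof.
move=> P; elim: n => [|n IH]; first by rewrite mul0r addr0.
by rewrite -natr1 mulrDl mul1r addrA P.
Qed.

Lemma period_late g T t c : 0 < T -> (forall t, g (t + T) = g t) -> exists2 s, c <= s & g s = g t.
Proof.
move=> T0 P; pose n := (Num.truncn ((c - t) / T)).+1.
exists (t + n%:R * T); last exact: periodn.
have := ltW (truncnS_gt ((c - t) / T)); rewrite ler_pdivrMr// -/n; lra.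
Qed.

Lemma period_in g T t : 0 < T -> (forall t, g (t + T) = g t) -> exists2 s, 0 <= s <= T & g s = g t.
Proof.
move=> T0 P; have [u u0 <-] := period_late t 0 T0 P.
have /andP[n1 n2] := truncn_itv (divr_ge0 u0 (ltW T0)).
set n := Num.truncn _ in n1 n2; exists (u - n%:R * T); last by rewrite -(periodn n _ P) subrK.
rewrite ler_pdivlMr// in n1; rewrite ltr_pdivrMr// -natr1 in n2.
by apply/andP; split; lra.
Qed.

(** Uniqueness forces the trajectory to retrace [h] over each interval of length [T] after [t0], and
    its period carries every other time there. *)
Lemma orbit_range A B p T h g t0 T' : 0 < T -> h T = (0, p) ->
  (forall g t, traj A B g -> g t = (0, p) -> forall s, 0 <= s <= T -> g (t + s) = h s) ->
  traj A B g -> g t0 = (0, p) -> 0 < T' -> (forall t, g (t + T') = g t) ->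
  range g = h @` [set s | 0 <= s <= T].
Proof.
move=> T0 hT fo tg g0 T'0 P.
have gk k : g (t0 + k%:R * T) = (0, p).
  elim: k => [|k IH]; first by rewrite mul0r addr0.
  by rewrite -natr1 mulrDl mul1r addrA (fo g _ tg IH) ?hT// lexx ltW.
apply/seteqP; split=> [_ [t _ <-]|_ [s sI <-]]; last first.
  by exists (t0 + s) => //; apply: fo.
have [s st <-] := period_late t t0 T'0 P.
have s0 : 0 <= s - t0 by rewrite subr_ge0.
have /andP[n1 n2] := truncn_itv (divr_ge0 s0 (ltW T0)).
set n := Num.truncn _ in n1 n2; exists (s - t0 - n%:R * T).
  rewrite ler_pdivlMr// in n1; rewrite ltr_pdivrMr// -natr1 in n2.
  by rewrite /=; apply/andP; split; lra.
rewrite -(fo g _ tg (gk n)); first by congr g; ring.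
rewrite ler_pdivlMr// in n1; rewrite ltr_pdivrMr// -natr1 in n2.
by apply/andP; split; lra.
Qed.

Lemma cpath_porbit A B VA VB D p T h l : lipbox A -> lipbox B -> cpath A B VA VB D p p T h l ->
  porbit A B (range (per h T)) /\ forall t, VA (per h T t) \/ VB (mir (per h T t)).
Proof.
move=> lA lB H; have [T0 h0 hT _ _ _ hV _ _ [s [/andP[s0 sT] hs]] _] := H.
have hT0 : h T = h 0 by rewrite hT h0.
split=> [|t]; last by have [u uI ->] := per_in t T0 hT0; exact: hV.
exists (per h T), T; split=> //.
- exact: per_traj H.
- by split=> // t; exact: per_add.
- exists s, 0; rewrite !per_id ?lexx ?(ltW s0) ?(ltW sT) ?(ltW T0)// h0 => E.
  by move: hs; rewrite E eqxx.
Qed.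

Lemma chain_incr A B VA VB D n al be p p' (y y' : R) : open VA -> open VB -> smoothf A -> smoothf B ->
  odd n -> (forall y, al <= y <= be -> exists z : R, chain A B VA VB D n y z) ->
  al <= p <= be -> al <= p' <= be -> p < p' -> chain A B VA VB D n p y ->
  chain A B VA VB D n p' y' -> y < y'.
Proof.
move=> oA oB sA sB on ex pI pI' pp c c'.
have rect y0 d : al <= y0 <= be -> 0 <= d <= 0 -> exists z : R, chain (shiftf d A) B VA VB D n y0 z.
  move=> yI d0; have -> : d = 0 by apply/eqP; rewrite eq_le andbC.
  by rewrite shiftf0; exact: ex.
by apply: (@rect_incr R A B VA VB D n al be 0 0 oA oB sA sB on rect p p' 0); rewrite ?lexx ?shiftf0.
Qed.

Lemma open_balls (U : set (R * R)) :
  (forall z, U z -> exists2 e, 0 < e & forall w, `|w - z| < e -> U w) -> open U.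
Proof.
move=> H; rewrite openE => z /H[e e0 He]; apply/nbhs_ballP; exists e => //= w.
by rewrite -ball_normE /= distrC; exact: He.
Qed.

(** The range of a periodic curve is compact, hence closed: otherwise the distance to [(0, p)] would
    have a positive minimum over a period. *)
Lemma recurrence g T p : continuous (fun t => (g t).1) -> continuous (fun t => (g t).2) ->
  0 < T -> (forall t, g (t + T) = g t) ->
  (forall e, 0 < e -> exists q, range g (0, q) /\ `|q - p| < e) -> range g (0, p).
Proof.
move=> c1 c2 T0 P H; apply: contrapT => ng.
pose f t := `|(g t).1| + `|(g t).2 - p|.
have cf : continuous f.
  move=> t; apply: cvgD; apply: cvg_norm; first exact: c1.
  by apply: cvgB; [exact: c2|exact: cvg_cst].
have [t _|m m0 Hm] := @pos_min R f 0 T cf.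
  rewrite lt_neqAle addr_ge0// andbT eq_sym paddr_eq0// !normr_eq0 subr_eq0.
  apply/negP => /andP[/eqP g1 /eqP g2]; apply: ng; exists t => //.
  by rewrite [LHS]surjective_pairing g1 g2.
have [q [[t _ gt] qp]] := H m m0; have [s sI gs] := period_in t T0 P.
have := Hm s sI; rewrite /f gs gt /= normr0 add0r => mq.
by have := le_lt_trans mq qp; rewrite ltxx.
Qed.

(* A trajectory staying near the cycle returns near [p] forever; the increasing return map makes
   its successive traces on the line converge to a fixed point, which has to be [p]. *)
Lemma attracted A B VA VB D n p de ro g T t0 q0 : open VA -> open VB -> open D -> smoothf A ->
  smoothf B -> odd n -> chain A B VA VB D n p p ->
  (forall q, `|q - p| <= de -> [/\ (B (0, q)).1 < 0,
     exists2 q', `|q' - p| <= ro & chain A B VA VB D n q q' &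
     chain A B VA VB D n q q -> q = p]) ->
  traj A B g -> 0 < T -> (forall t, g (t + T) = g t) ->
  (forall x, range g (0, x) -> `|x - p| < de \/ ro < `|x - p|) ->
  g t0 = (0, q0) -> `|q0 - p| < de -> range g (0, p).
Proof.
move=> oA oB oD sA sB on ch Hq tg T0 P line g0 q0p.
have lA := smoothf_lipbox sA; have lB := smoothf_lipbox sB; have [c1 c2] := traj_cont tg.
have step q : range g (0, q) /\ `|q - p| <= de ->
    exists q', (range g (0, q') /\ `|q' - p| <= de) /\ chain A B VA VB D n q q'.
  move=> [[t _ gt] qd]; have [Bq [q' q'r ch'] _] := Hq q qd.
  have [T1 _ gT1] := chain_follow lA lB ch' (chain_crossing ch' Bq) tg gt.
  have rq' : range g (0, q') by exists (t + T1).
  exists q'; split=> //; split=> //; case: (line q' rq') => [/ltW//|].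
  by rewrite ltNge q'r.
have [nx Hnx] : exists nx : R -> R, forall q, range g (0, q) /\ `|q - p| <= de ->
    (range g (0, nx q) /\ `|nx q - p| <= de) /\ chain A B VA VB D n q (nx q).
  have [|nx Hnx] := @choice R R (fun q q' => range g (0, q) /\ `|q - p| <= de ->
    (range g (0, q') /\ `|q' - p| <= de) /\ chain A B VA VB D n q q'); last by exists nx.
  move=> q; have [/step[q' ?]|nq] := pselect (range g (0, q) /\ `|q - p| <= de); first by exists q'.
  by exists 0.
pose q k := iter k nx q0.
have Qk k : range g (0, q k) /\ `|q k - p| <= de.
  by elim: k => [|k IH]; [split; [exists t0|exact: ltW]|exact: (Hnx _ IH).1].
apply: (recurrence c1 c2 T0 P) => e e0.
have ex y : p - de <= y <= p + de -> exists z : R, chain A B VA VB D n y z.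
  move=> /andP[y1 y2]; have yd : `|y - p| <= de by rewrite ler_norml; apply/andP; split; lra.
  by have [_ [z _ hz] _] := Hq y yd; exists z.
have cI x : `|x - p| <= de -> p - de <= x <= p + de.
  by rewrite ler_norml => /andP[? ?]; apply/andP; split; lra.
have [||||||k qk] := @monotone_iter (chain A B VA VB D n) q p de _ _ _ _ _ _ e e0.
- by move=> k; have [] := Qk k.
- by move=> k; exact: (Hnx _ (Qk k)).2.
- move=> x x' y y' /cI xI /cI xI' xx; exact: chain_incr oA oB sA sB on ex xI xI' xx.
- by move=> x y y'; exact: chain_uniq.
- move=> x xd; have [_ [y _ hy] _] := Hq x xd; exists y; split=> // e' e'0.
  have [r r0 Hr] := chain_perturb oA oB oD lA lB hy e'0.
  exists r => // x' y' xx hy'.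
  have [y2 h1 h2] := Hr A B lA lB (fclose_id _ r0) (fclose_id _ r0) x' (ltW xx).
  by rewrite (chain_uniq lA lB hy' h2).
- by move=> x xd; have [] := Hq x xd.
by exists (q k); split=> //; have [] := Qk k.
Qed.

(** Isolation among closed chains of one type has to become isolation among all periodic orbits. A
    periodic orbit in a thin tube arrives near [p] by [reach]; its traces near [p] cannot drift
    away, so [attracted] makes it pass through [p]. *)
Lemma isolated_clc A B VA VB D n p : open VA -> open VB -> open D -> smoothf A -> smoothf B ->
  odd n -> isolated_cycle A B VA VB D n p ->
  exists G, [/\ clc A B G, G (0, p) & forall x, G (0, x) -> x = p \/ D x].
Proof.
move=> oA oB oD sA sB on [ch [ei ei0 iso]].
have lA := smoothf_lipbox sA; have lB := smoothf_lipbox sB.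
have Bp : (B (0, p)).1 < 0 by have := chain_exit ch; rewrite on.
have cr := chain_crossing ch Bp.
have [T [h [l H]]] := chain_cpath lA lB ch.
have [T0 h0 hT _ _ _ _ hl lD _ fo] := H; have {}fo := fo cr.
have hT0 : h T = h 0 by rewrite hT h0.
have tg0 := per_traj lA lB H.
have [po _] := cpath_porbit lA lB H.
have g00 : per h T 0 = (0, p) by rewrite per_id ?h0// lexx ltW.
have P0 t : per h T (t + T) = per h T t by exact: per_add.
move: (per h T) tg0 po g00 P0 => g0 tg0 po g00 P0.
have RE := orbit_range T0 hT fo tg0 g00 T0 P0.
have line x : range g0 (0, x) -> x = p \/ x \in l.
  rewrite RE => -[s sI hs]; have := hl s sI; rewrite hs => /(_ erefl).
  by rewrite !inE => /or3P[/eqP|/eqP|]; [left|left|right].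
exists (range g0); split; last 2 first.
- by exists 0.
- by move=> x /line[->|/lD[]]; [left|right].
split; last 3 first.
- by exists (0, p); split=> //; exists 0.
- apply: (@sub_finite_set _ _ ((fun x => (0, x)) @` [set` p :: l])); last exact/finite_image/finite_seq.
  move=> [z1 z2] [Gz]; rewrite /disc_line /= => z0; rewrite z0 in Gz *.
  by exists z2 => //=; rewrite inE; case: (line _ Gz) => [->|->]; rewrite ?eqxx ?orbT.
- move=> [z1 z2] [Gz]; rewrite /disc_line /= => z0; rewrite z0 in Gz *; split=> //.
  by case: (line _ Gz) => [->//|/lD[]].
split=> //.
have [ro ro0 Hro] := seq_gap l p.
have ro2 : 0 < ro / 2 by rewrite divr_gt0.
have [r1 r10 Hr1] := chain_perturb oA oB oD lA lB ch ro2.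
have [d2 d20 Hd2] := neg_near lB Bp.
pose de := Num.min (Num.min r1 (d2 / 2)) (Num.min (ei / 2) (ro / 2)).
have de0 : 0 < de by rewrite !lt_min r10 ro2 !divr_gt0.
have Hq q : `|q - p| <= de -> [/\ (B (0, q)).1 < 0,
     exists2 q', `|q' - p| <= ro / 2 & chain A B VA VB D n q q' &
     chain A B VA VB D n q q -> q = p].
  rewrite !le_min => /andP[/andP[q1 q2] /andP[q3 _]]; split.
  - by apply: Hd2; rewrite line_norm; lra.
  - have [q' h1 h2] := Hr1 A B lA lB (fclose_id _ r10) (fclose_id _ r10) q q1.
    by exists q' => //; exact: ltW.
  - by apply: iso; lra.
have [T2 T20 [gT2 f2 Hre]] := reach lA lB ch Bp tg0 g00.
rewrite add0r in gT2.
have RE2 : range g0 = g0 @` [set s | 0 <= s <= T2].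
  apply: (orbit_range T20 gT2 _ tg0 g00 T0 P0) => g t tg gt s sI.
  by rewrite (f2 g t tg gt s sI) add0r.
(* The last clause leaves a gap around [p] on the line: a trace within [de] returns within [ro / 2],
   and inside the tube this means within [de] again. *)
pose good s r := [/\ 0 < r, forall g t, traj A B g -> `|g t - g0 s| < r ->
    exists t' q, g t' = (0, q) /\ `|q - p| < de &
  forall x, `|(0, x) - g0 s| < r -> `|x - p| < de \/ ro / 2 < `|x - p|].
have reach2 s : 0 <= s <= T2 -> exists2 r, 0 < r & forall g t, traj A B g -> `|g t - g0 s| < r ->
    exists t' q, g t' = (0, q) /\ `|q - p| < de.
  move=> sI; have z0 : 0 <= (0 : R) <= T2 by rewrite lexx ltW.
  have zT : 0 <= T2 <= T2 by rewrite lexx ltW.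
  have [ra ra0 Ha] := Hre 0 de z0 de0; have [rb rb0 Hb] := Hre T2 de zT de0.
  rewrite addr0 g00 in Ha; rewrite add0r gT2 on in Hb.
  have ends : exists2 r, 0 < r & forall g t, traj A B g -> `|g t - (0, p)| < r ->
      exists t' q, g t' = (0, q) /\ `|q - p| < de.
    exists (Num.min ra rb) => [|g t tg]; first by rewrite lt_min ra0.
    rewrite lt_min => /andP[ga gb]; have [g1|/ltW g1] := leP 0 (g t).1.
      by apply: (Ha g t tg ga) => // T2E; move: T20; rewrite -T2E ltxx.
    by apply: (Hb g t tg gb) => // T2E; move: T20; rewrite T2E ltxx.
  have [->|s0] := eqVneq s 0; first by rewrite g00.
  have [->|sT] := eqVneq s T2; first by rewrite gT2.
  have [r r0 Hr] := Hre s de sI de0; rewrite add0r in Hr.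
  by exists r => // g t tg gr; apply: (Hr g t tg gr) => /eqP; rewrite ?(negbTE s0) ?(negbTE sT).
have goodP s : 0 <= s <= T2 -> exists r, good s r.
  move=> sI; have [r r0 Hr] := reach2 s sI.
  have [rl rl0 Hl] : exists2 r, 0 < r & forall x, `|(0, x) - g0 s| < r ->
      `|x - p| < de \/ ro / 2 < `|x - p|.
    have [gs|gs] := eqVneq (g0 s).1 0; last first.
      exists `|(g0 s).1| => [|x xs]; first by rewrite normr_gt0.
      by have := le_lt_trans (pnorm1B _ _) xs; rewrite /= sub0r normrN ltxx.
    have gE : g0 s = (0, (g0 s).2) by rewrite -gs -surjective_pairing.
    exists (Num.min de (ro / 2)) => [|x]; first by rewrite lt_min de0.
    have [|sp|sl] := line (g0 s).2; first by rewrite -gE; exists s.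
      by rewrite gE line_norm sp lt_min => /andP[]; left.
    have [sp|sp] := eqVneq (g0 s).2 p; first by rewrite gE line_norm sp lt_min => /andP[]; left.
    have := Hro _ sl sp; rewrite gE line_norm /= => h1; rewrite lt_min => /andP[_ h2]; right.
    have := ler_normB (x - p) (x - (g0 s).2).
    by rewrite (_ : x - p - (x - (g0 s).2) = (g0 s).2 - p); [clear -h1 h2; lra|ring].
  exists (Num.min r rl); split; first by rewrite lt_min r0.
    by move=> g t tg; rewrite lt_min => /andP[gr _]; exact: Hr gr.
  by move=> x; rewrite lt_min => /andP[_]; exact: Hl.
exists [set z | exists s r, [/\ 0 <= s <= T2, good s r & `|z - g0 s| < r]]; split.
- apply: open_balls => z [s [r [sI gsr zr]]]; exists (r - `|z - g0 s|); first by rewrite subr_gt0.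
  move=> w wz; exists s, r; split=> //.
  rewrite (_ : w - g0 s = (w - z) + (z - g0 s)); last by ring.
  by apply: le_lt_trans (ler_normD _ _) _; lra.
- rewrite RE2 => _ [s sI <-]; have [r gr] := goodP s sI; exists s, r; split=> //.
  by rewrite subrr normr0; case: gr.
move=> _ [g [T' [tg [T'0 P'] _ ->]]] GU.
have /GU[s [r [sI gsr gr]]] : range g (g 0) by exists 0.
have [t1 [q0 [gt1 q0p]]] : exists t' q, g t' = (0, q) /\ `|q - p| < de.
  by case: gsr => _ Hg _; exact: Hg tg gr.
have [t _ gt] : range g (0, p).
  apply: (attracted oA oB oD sA sB on ch Hq tg T'0 P' _ gt1 q0p) => x /GU[s' [r' [_ [_ _ Hx] xr]]].
  exact: Hx.
by rewrite (orbit_range T0 hT fo tg gt T'0 P').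
Qed.

End CyclesFromChains.

(** * From crossing limit cycles to closed chains *)

Section ChainsFromCycles.
Variable R : realType.
Implicit Types (z w : R * R) (a b c d e s t u x y p q T : R) (F A B : R * R -> R * R) (g h : R -> R * R)
  (V VA VB U G : set (R * R)) (D : set R) (l ts : seq R).

Lemma chain_cat A B VA VB D n m y y1 y2 : chain A B VA VB D n y y1 -> D y1 ->
  (if odd n then chain A B VA VB D m y1 y2 else chain B A VB VA D m y1 y2) ->
  chain A B VA VB D (n + m.+1) y y2.
Proof.
elim: n A B VA VB y => [|n IH] A B VA VB y /=; first by move=> h Dy c; exists y1.
move=> [u [h Du c]] Dy c2; exists u; split=> //; apply: IH c Dy _.
by case: (odd n) c2.
Qed.

(** Periodicity forces a first return to the line. The fields cannot point to the right there, since
    by [enter] the first coordinate would have been negative just before. *)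
Lemma step_arc A B g t0 x T' : lipbox A -> lipbox B -> traj A B g -> 0 < T' ->
  (forall t, g (t + T') = g t) -> (forall y, range g (0, y) -> crossing A B y) ->
  g t0 = (0, x) -> 0 < (A (0, x)).1 ->
  exists y t1, [/\ g t1 = (0, y), hpass (range g) A x y & 0 < (B (0, y)).1].
Proof.
move=> lA lB tg T'0 P cr g0 Ax; have [c1 c2] := traj_cont tg.
have cx : crossing A B x by apply: cr; exists t0.
have Bx : 0 < (fold B (0, x)).1 by move: cx; rewrite /crossing pmulr_rgt0.
have [||e e0 He] := @enter R A B g t0 lA lB tg; rewrite ?g0//.
have pos s : t0 < s <= t0 + e -> 0 < (g s).1.
  move=> /andP[ts se]; have := He t0 s; rewrite g0; apply=> //.
  by rewrite gerBl ltW.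
have b0 : t0 < t0 + T' by rewrite ltrDl.
have [|c [/andP[tc cb] gc gpos]] := first_zero c1 e0 pos b0; first by rewrite P g0.
have gcE : g c = (0, (g c).2) by rewrite -gc -surjective_pairing.
have cc : crossing A B (g c).2 by apply: cr; exists c.
have Ac : (A (0, (g c).2)).1 < 0.
  rewrite ltNge le_eqVlt; apply/negP => /predU1P[A0|Ac]; first by rewrite /crossing -A0 mul0r ltxx in cc.
  have Bc : 0 < (fold B (0, (g c).2)).1 by move: cc; rewrite /crossing pmulr_rgt0.
  rewrite -gcE in Ac Bc; have [e1 e10 He1] := enter lA lB tg Ac Bc.
  pose s := Num.max (c - e1) ((t0 + c) / 2).
  have sc : s < c by rewrite /s gt_max; apply/andP; split; lra.
  have ts : t0 < s by rewrite /s lt_max; apply/orP; right; lra.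
  have se : c - e1 <= s by rewrite /s le_max lexx.
  have := He1 s c se sc; rewrite lerDl (ltW e10) gc => /(_ isT).
  by have := gpos s; rewrite ts sc => /(_ isT) h1 h2; have := lt_trans h1 h2; rewrite ltxx.
exists (g c).2, c; split=> //; last first.
  by move: cc; rewrite /crossing nmulr_rgt0// /fold mir_line /= oppr_lt0.
split=> //; exists (c - t0), (fun s => g (t0 + s)); split=> //.
- by rewrite subr_ge0 ltW.
- by rewrite addr0.
- by rewrite subrKC.
- apply: curve_shift => // t; rewrite subrKC; exact: traj_smooth lA tg gpos t.
- by move=> t /andP[t1 t2]; apply: gpos; apply/andP; split; lra.
- by constructor 3.
Qed.

Lemma pigeon (q : nat -> R) l : (forall k, q k \in l) -> exists i m, q i = q (i + m.+1)%N.
Proof.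
move=> ql; have : ~~ uniq [seq q k | k <- iota 0 (size l).+1].
  apply/negP => /uniq_leq_size H; have /H : {subset [seq q k | k <- iota 0 (size l).+1] <= l}.
    by move=> x /mapP[k _ ->].
  by rewrite size_map size_iota ltnn.
move=> /(uniqPn 0)[i [j [ij]]]; rewrite size_map size_iota => jl.
have il := ltn_trans ij jl; rewrite !(nth_map 0%N) ?size_iota// !nth_iota// !add0n => E.
by exists i, (j - i.+1)%N; rewrite addnS -addSn subnKC.
Qed.

(** Minimality of the period keeps the base point from recurring inside the closed chain, so that
    the intermediate points can be asked to differ from it. *)
Lemma pigeon_min (q : nat -> R) l : (forall k, q k \in l) -> exists i m, q i = q (i + m.+1)%N /\
  forall k, (k < m)%N -> q (i + k.+1)%N != q i.
Proof.
move=> /pigeon[i0 [m0 E0]].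
have ex : exists m, `[< exists i, q i = q (i + m.+1)%N >] by exists m0; apply/asboolP; exists i0.
case: (ex_minnP ex) => m /asboolP[i E] min; exists i, m; split=> // k km.
apply/eqP => Ek; have := min k; rewrite leqNgt km => /(_ _)/negP; apply => //.
by apply/asboolP; exists i.
Qed.

Lemma porbit_eq A B VA VB D n p G G' : lipbox A -> lipbox B -> odd n ->
  chain A B VA VB D n p p -> porbit A B G -> porbit A B G' -> G (0, p) -> G' (0, p) -> G = G'.
Proof.
move=> lA lB on ch; have Bp : (B (0, p)).1 < 0 by have := chain_exit ch; rewrite on.
have [T [h [l [T0 _ hT _ _ _ _ _ _ _ fo]]]] := chain_cpath lA lB ch.
have {}fo := fo (chain_crossing ch Bp).
move=> [g [S [tg [S0 P] _ ->]]] [g' [S' [tg' [S'0 P'] _ ->]]] [t _ gt] [t' _ gt'].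
by rewrite (orbit_range T0 hT fo tg gt S0 P) (orbit_range T0 hT fo tg' gt' S'0 P').
Qed.

Lemma clc_chain A B G : lipbox A -> lipbox B -> clc A B G -> exists p n,
  [/\ odd n, G (0, p), chain A B G [set z | G (mir z)] [set x | G (0, x) /\ x != p] n p p &
  exists U e, [/\ open U, G `<=` U, 0 < e & forall q, `|q - p| < e ->
    chain A B U [set z | U (mir z)] setT n q q -> q = p]].
Proof.
move=> lA lB [[po [U [oU GU HU]]] [z [Gz zl]] fin cr].
have [l Hl] : exists l : seq R, [set x | G (0, x)] = [set` l].
  apply/finite_seqP; apply: (@sub_finite_set _ _ (snd @` (G `&` @disc_line R))); last exact: finite_image.
  by move=> x /= Gx; exists (0, x).
have Gl x : G (0, x) -> x \in l.
  by move=> Gx; have : [set x | G (0, x)] x by []; rewrite Hl.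
have GE : exists2 g, traj A B g & exists T, [/\ 0 < T, forall t, g (t + T) = g t & G = range g].
  by case: po => g [T [tg [T0 P] _ ->]]; exists g => //; exists T.
case: GE => g tg [S [S0 P GE]].
have crG y : range g (0, y) -> crossing A B y.
  by rewrite -GE => Gy; have [] := cr (0, y); first by split.
have Pm t : (mir \o g) (t + S) = (mir \o g) t by rewrite /= P.
have crM y : range (mir \o g) (0, y) -> crossing B A y.
  move=> [t _ /= gt]; rewrite crossing_mir; apply: crG; exists t => //.
  by rewrite -[LHS]mirK gt mir_line.
have tm := traj_mir tg.
have MG : range (mir \o g) `<=` [set z | G (mir z)].
  by move=> _ [t _ <-] /=; rewrite mirK GE; exists t.
have stepB y t0 : g t0 = (0, y) -> 0 < (B (0, y)).1 -> exists x t1,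
    [/\ g t1 = (0, x), hpass [set z | G (mir z)] B y x & 0 < (A (0, x)).1].
  move=> gt By; have gt' : (mir \o g) t0 = (0, y) by rewrite /= gt mir_line.
  have [x [t1 [g1 hp Ax]]] := step_arc lB lA tm S0 Pm crM gt' By.
  exists x, t1; split=> //; first by rewrite -[LHS]mirK; move: g1 => /= ->; rewrite mir_line.
  exact: hpassS MG _.
(* The crossing points at which the cycle enters the right half-plane; two passages lead from one to
   the next. The points in between, in [D0], have the opposite sign and cannot equal a base
   point. *)
pose rp x := G (0, x) /\ 0 < (A (0, x)).1.
pose D0 := [set y | G (0, y) /\ (A (0, y)).1 < 0].
have dstep x : rp x -> exists x', rp x' /\ chain A B G [set z | G (mir z)] D0 1 x x'.
  move=> [Gx Ax]; have [t0 _ gt] : range g (0, x) by rewrite -GE.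
  have [y [t1 [g1 hp By]]] := step_arc lA lB tg S0 P crG gt Ax.
  have [x' [t2 [g2 hp2 Ax']]] := stepB y t1 g1 By.
  exists x'; split; first by split=> //; rewrite GE; exists t2.
  exists y; split=> //; first by rewrite GE.
  split; first by rewrite GE; exists t1.
  by case: hp => _ /pass_exit.
have [x0 rx0] : exists x, rp x.
  have zE : z = (0, z.2) by rewrite [LHS]surjective_pairing zl.
  have [_] := cr z (conj Gz zl); have [t0 _ gt] : range g z by rewrite -GE.
  have [Az|Az] := ltP 0 (A z).1; first by exists z.2; rewrite /rp -zE.
  move=> Bz; have Az' : (A z).1 < 0.
    by rewrite lt_neqAle Az andbT; apply/eqP => A0; rewrite A0 mul0r ltxx in Bz.
  have By : 0 < (B (0, z.2)).1.
    by move: Bz; rewrite nmulr_rgt0// zE /fold mir_line /= oppr_lt0.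
  rewrite zE in gt; have [x [t1 [g1 _ Ax]]] := stepB _ _ gt By.
  by exists x; split=> //; rewrite GE; exists t1.
have [nx Hnx] : exists nx : R -> R, forall x, rp x -> rp (nx x) /\
    chain A B G [set z | G (mir z)] D0 1 x (nx x).
  have [|nx Hnx] := @choice R R (fun x x' => rp x -> rp x' /\
     chain A B G [set z | G (mir z)] D0 1 x x'); last by exists nx.
  by move=> x; have [/dstep[x' ?]|nr] := pselect (rp x); [exists x'|exists 0].
pose q k := iter k nx x0.
have rq k : rp (q k) by elim: k => [|k IH]//; exact: (Hnx _ IH).1.
have cq k : chain A B G [set z | G (mir z)] D0 1 (q k) (q k.+1) by exact: (Hnx _ (rq k)).2.
have [i [m [qi qmin]]] : exists i m, q i = q (i + m.+1)%N /\
    forall k, (k < m)%N -> q (i + k.+1)%N != q i.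
  by apply: (@pigeon_min q l) => k; apply: Gl; have [] := rq k.
pose p := q i; pose D := [set x | G (0, x) /\ x != p].
have D0D : D0 `<=` D.
  move=> y [Gy Ay]; split=> //; apply/eqP => yp; move: Ay; rewrite yp ltNge => /negP; apply.
  by apply: ltW; have [] := rq i.
have cD k : chain A B G [set z | G (mir z)] D 1 (q k) (q k.+1) by apply: chainS (cq k).
have chk k : (k <= m)%N -> chain A B G [set z | G (mir z)] D (k.*2).+1 p (q (i + k.+1)%N).
  elim: k => [_|k IH km]; first by rewrite addn1; exact: cD.
  have -> : (k.+1.*2).+1 = ((k.*2).+1 + 2)%N by rewrite doubleS addn2.
  apply: chain_cat (IH (ltnW km)) _ _.
    by split; [have [] := rq (i + k.+1)%N|exact: qmin].
  have -> : odd k.*2.+1 by rewrite /= odd_double.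
  by rewrite (addnS i k.+1); exact: cD.
exists p, (m.*2).+1; split.
- by rewrite /= odd_double.
- by have [] := rq i.
- by have := chk m (leqnn m); rewrite -qi.
(* A closed chain inside [U] is a periodic orbit inside [U], hence [G] itself; its base point is one
   of the finitely many in [l], and only [p] is that close. *)
have [e e0 He] := seq_gap l p; exists U, e; split=> // y yp ch.
have [T [h [l' H]]] := chain_cpath lA lB ch.
have [po' hU] := cpath_porbit lA lB H; have [T0 h0 hT _ _ _ _ _ _ _ _] := H.
have E : range (per h T) = G.
  by apply: HU => // _ [t _ <-]; case: (hU t) => //=; rewrite mirK.
have Gy : G (0, y).
  by rewrite -E; exists 0 => //; rewrite per_id ?h0 ?hT// lexx ltW.
by apply/eqP/negPn/negP => /(He _ (Gl _ Gy)); rewrite ltNge (ltW yp).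
Qed.

End ChainsFromCycles.

(** * Disjoint windows give limit cycles *)

Section Counting.
Variable R : realType.
Implicit Types (z w : R * R) (d e x p q : R) (F A B : R * R -> R * R) (V VA VB U G : set (R * R)).

Definition pfield n F := pf n (fun z => (F z).1) /\ pf n (fun z => (F z).2).

Lemma pfield_smooth n F : pfield n F -> smoothf F.
Proof. by move=> [/pf_smooth ? /pf_smooth ?]. Qed.

Lemma pfield_shift n d F : pfield n F -> pfield n (shiftf d F).
Proof.
have E z : (z.1, z.2 - d) = (1 * z.1 + 0, 1 * z.2 + - d) by rewrite !mul1r addr0.
move=> [h1 h2]; split.
  rewrite (_ : (fun z => _) = fun z => (F (1 * z.1 + 0, 1 * z.2 + - d)).1).
    exact: (pf_affine 1 0 1 (- d) h1).
  by apply/funext => z; rewrite /shiftf E.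
rewrite (_ : (fun z => _) = fun z => (F (1 * z.1 + 0, 1 * z.2 + - d)).2).
  exact: (pf_affine 1 0 1 (- d) h2).
by apply/funext => z; rewrite /shiftf E.
Qed.

Lemma pfield_fold n F : pfield n F -> pfield n (fold F).
Proof.
have E z : mir z = (- 1 * z.1 + 0, 1 * z.2 + 0) by rewrite /mir mul1r mulN1r !addr0.
move=> [h1 h2]; split.
  rewrite (_ : (fun z => _) = fun z => - 1 * (F (- 1 * z.1 + 0, 1 * z.2 + 0)).1).
    by rewrite -[n]add0n; apply: pfM; [exact: pf_cst|exact: (pf_affine (-1) 0 1 0 h1)].
  by apply/funext => z; rewrite -E mulN1r.
rewrite (_ : (fun z => _) = fun z => (F (- 1 * z.1 + 0, 1 * z.2 + 0)).2).
  exact: (pf_affine (-1) 0 1 0 h2).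
by apply/funext => z; rewrite -E.
Qed.

Lemma pwfield_of n A B : pfield n A -> pfield n B -> exists Z : pwfield R,
  [/\ (degP Z <= n)%N, (degQ Z <= n)%N, fieldp Z = A & fold (fieldm Z) = B].
Proof.
move=> [[p1 [d1 e1]] [p2 [d2 e2]]] /pfield_fold[[p3 [d3 e3]] [p4 [d4 e4]]].
exists (PwField p1 p3 p2 p4); split.
- by rewrite /degP geq_max /= d1.
- by rewrite /degQ geq_max /= d2.
- by apply/funext => z; rewrite /fieldp /= e1 e2 -surjective_pairing.
- rewrite -[RHS]foldK; congr fold; apply/funext => z.
  by rewrite /fieldm /= e3 e4 -surjective_pairing.
Qed.

Lemma pfield_of n (Z : pwfield R) : (degP Z <= n)%N -> (degQ Z <= n)%N ->
  pfield n (fieldp Z) /\ pfield n (fold (fieldm Z)).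
Proof.
rewrite /degP /degQ !geq_max => /andP[h1 h2] /andP[h3 h4]; split.
  by split; [exact: pfW h1 (pf_eval _)|exact: pfW h3 (pf_eval _)].
by apply: pfield_fold; split; [exact: pfW h2 (pf_eval _)|exact: pfW h4 (pf_eval _)].
Qed.

Lemma counting_ge (T : choiceType) (S : set T) K (f : nat -> T) :
  (forall j, (j < K)%N -> S (f j)) -> (forall i j, (i < K)%N -> (j < K)%N -> f i = f j -> i = j) ->
  (K%:R%:E <= counting S :> \bar R)%E.
Proof.
move=> Sf inj; rewrite /counting; case: asboolP => fS; last by rewrite leey.
rewrite lee_fin ler_nat -[leqLHS](size_iota 0) -(size_map f); apply: uniq_leq_size.
  rewrite map_inj_in_uniq ?iota_uniq// => i j; rewrite !mem_iota /= => iK jK; exact: inj.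
by move=> x /mapP[j]; rewrite mem_iota /= => jK ->; rewrite in_fset_set// inE; exact: Sf.
Qed.

Lemma counting_fin (T : choiceType) (x0 : T) (S : set T) : (counting S < +oo :> \bar R)%E ->
  exists K (f : nat -> T), [/\ (counting S <= K%:R%:E :> \bar R)%E,
    forall j, (j < K)%N -> S (f j) &
    forall i j, (i < K)%N -> (j < K)%N -> f i = f j -> i = j].
Proof.
rewrite /counting; case: asboolP => fS // _.
set s := finmap.enum_fset (fset_set S).
have us : uniq s by apply: finmap.fset_uniq.
exists (size s), (nth x0 s); split=> // [j js|i j si sj /eqP].
  by have := mem_nth x0 js; rewrite /s in_fset_set// inE.
by rewrite nth_uniq// => /eqP.
Qed.

(** If two windows gave the same cycle, the base point in one would be either the base point or an
    intermediate point of the other; disjoint intervals and the condition on [D] exclude both. *)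
Lemma windows_cycles A B m (K : nat) (VA VB : nat -> set (R * R)) (D : nat -> set R) (n : nat -> nat)
    (al be : nat -> R) e : 0 < e -> pfield m A -> pfield m B ->
  (forall j, (j < K)%N -> [/\ open (VA j), open (VB j), open (D j) &
    window A B (VA j) (VB j) (D j) (n j) (al j) (be j)]) ->
  (forall i j, (i < K)%N -> (j < K)%N -> i != j -> (be i <= al j \/ be j <= al i) /\
    forall x, al i < x < be i -> ~ D j x) ->
  exists2 d, `|d| < e & exists G : nat -> set (R * R),
    (forall j, (j < K)%N -> clc (shiftf d A) B (G j)) /\
    forall i j, (i < K)%N -> (j < K)%N -> G i = G j -> i = j.
Proof.
move=> e0 pA pB win disj; have sA := pfield_smooth pA; have sB := pfield_smooth pB; have [d de H] := generic_shift e0 sA sB win; exists d => //.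
have sAd := pfield_smooth (pfield_shift d pA).
have /choice[G HG] : forall j, exists G, (j < K)%N -> clc (shiftf d A) B G /\
    exists p, [/\ al j < p < be j, G (0, p) & forall x, G (0, x) -> x = p \/ D j x].
  move=> j; have [jK|_] := ltnP j K; last by exists set0.
  have [oA oB oD [_ on _ _]] := win j jK; have [p [pI iso]] := H j jK.
  have [G [cG Gp Gx]] := isolated_clc oA oB oD sAd sB on iso.
  by exists G => _; split=> //; exists p.
exists G; split=> [j /HG[]//|i j iK jK Gij]; apply/eqP/negPn/negP => ij.
have [dis Dj] := disj i j iK jK ij.
have [_ [p [pI Gp _]]] := HG i iK; have [_ [q [qI _ Gq]]] := HG j jK.
move: Gp; rewrite Gij => /Gq[pq|]; last exact: Dj.
by move: pI qI; rewrite pq => /andP[p1 p2] /andP[q1 q2]; case: dis; lra.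
Qed.

Lemma Hc_windows A B m (K : nat) (VA VB : nat -> set (R * R)) (D : nat -> set R) (n : nat -> nat)
    (al be : nat -> R) : pfield m A -> pfield m B ->
  (forall j, (j < K)%N -> [/\ open (VA j), open (VB j), open (D j) &
    window A B (VA j) (VB j) (D j) (n j) (al j) (be j)]) ->
  (forall i j, (i < K)%N -> (j < K)%N -> i != j -> (be i <= al j \/ be j <= al i) /\
    forall x, al i < x < be i -> ~ D j x) ->
  (K%:R%:E <= Hc R m)%E.
Proof.
move=> pA pB win disj.
have [d _ [G [cG Ginj]]] := windows_cycles ltr01 pA pB win disj.
have [Z [dP dQ ZA ZB]] := pwfield_of (pfield_shift d pA) pB.
apply: (@le_trans _ _ (pi_c Z)); last by apply: ereal_sup_ubound; exists Z.
apply: (counting_ge (f := G)) => // j jK /=.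
by rewrite clcE ZA ZB; exact: cG.
Qed.

End Counting.

(** * A window near a new line of singular points *)

Section NewWindow.
Variable R : realType.
Implicit Types (z w W : R * R) (a b c d e k m q r s t u v x y p T : R) (F A B : R * R -> R * R)
  (g h : R -> R * R) (V VA VB U : set (R * R)) (D : set R).

Lemma expR_gt1D s : 0 < s -> 1 + s < expR s.
Proof. by move=> s0; apply: expR_gt1Dx; rewrite gt_eqF. Qed.

Lemma expR_1B s : 0 < s -> (1 - s) * expR s < 1.
Proof.
move=> s0; have hn : 1 - s < expR (- s) by apply: expR_gt1Dx; rewrite oppr_eq0 gt_eqF.
have := expRxMexpNx_1 s; rewrite mulrC => E.
by rewrite -[ltRHS]E ltr_pM2r ?expR_gt0.
Qed.

(* By strict convexity of exp the graph lies below its chords. *)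
Lemma chord s t : 0 < t < s -> s * (expR t - 1) < t * (expR s - 1).
Proof.
move=> /andP[t0 ts]; pose f u := u * (expR s - 1) - s * (expR u - 1).
have df u : is_derive u 1 f ((expR s - 1) - s * expR u).
  by rewrite /f; apply: is_derive_eq; rewrite /GRing.scale/=; ring.
have cf : continuous f by move=> u; exact: is_derive_cont.
have s0 : 0 < s by exact: lt_trans ts.
rewrite -subr_gt0 -/(f t) ltNge; apply/negP => ft.
have df1 u : u \in `]0, t[ -> is_derive u 1 f ((expR s - 1) - s * expR u) by [].
have df2 u : u \in `]t, s[ -> is_derive u 1 f ((expR s - 1) - s * expR u) by [].
have [u1] := MVT t0 df1 (continuous_subspaceT cf).
have [u2] := MVT ts df2 (continuous_subspaceT cf).
rewrite !in_itv /= => /andP[tu2 u2s] E2 /andP[u10 u1t] E1.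
have f0 : f 0 = 0 by rewrite /f expR0; ring.
have fs : f s = 0 by rewrite /f; ring.
have h1 : (expR s - 1) - s * expR u1 <= 0.
  by rewrite -(pmulr_lle0 _ (_ : 0 < t - 0)) ?subr_gt0// -E1 f0 subr0.
have h2 : 0 <= (expR s - 1) - s * expR u2.
  by rewrite -(pmulr_lge0 _ (_ : 0 < s - t)) ?subr_gt0// -E2 fs sub0r oppr_ge0.
have : s * expR u1 < s * expR u2 by rewrite ltr_pM2l// ltr_expR (lt_trans u1t).
lra.
Qed.

(* Linear field whose line of zeros of [x'] is y - m x = d; along it y - m x grows
   exponentially. *)
Definition wedge m v q d k z : R * R :=
  (- (z.2 - m * z.1 - d) * v, - (z.2 - m * z.1 - d) * q + k * (m * v - q)).

(** With [d] as origin and [k] as unit, this is the entry height of the passage of [wedge] that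
    climbs by [s]. Along it [y - m x - d = k (K exp(a t) - 1)] with [K = s / (exp s - 1)] and
    [a = m v - q]. *)
Definition gapf s := s / (expR s - 1) - 1.

Lemma gapf_lt0 s : 0 < s -> -1 < gapf s < 0.
Proof.
move=> s0; have h := expR_gt1D s0; have p : 0 < expR s - 1 by lra.
rewrite /gapf ltrBDr addNr divr_gt0//= subr_lt0 ltr_pdivrMr// mul1r; lra.
Qed.

Lemma gapf_exit s : 0 < s -> 0 < gapf s + s.
Proof.
move=> s0; have h := expR_gt1D s0; have p : 0 < expR s - 1 by lra.
have E : gapf s * (expR s - 1) = s - (expR s - 1) by rewrite /gapf mulrBl divfK ?gt_eqF// mul1r.
rewrite -(pmulr_lgt0 _ p) mulrDl E.
have := expR_1B s0.
by lra.
Qed.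

(** The linear field is integrated explicitly. [X] vanishes at the times 0 and [s / a] by the choice
    of [K], and is positive in between by [chord]. *)
Lemma wedge_pass m v q d k s : 0 < v -> 0 < k -> 0 < m * v - q -> 0 < s ->
  hpass setT (wedge m v q d k) (d + k * gapf s) (d + k * (gapf s + s)).
Proof.
move=> v0 k0 a0 s0; pose a := m * v - q; have h := expR_gt1D s0.
have p : 0 < expR s - 1 by lra.
pose K := s / (expR s - 1).
have Kp : K * (expR s - 1) = s by rewrite /K divfK// gt_eqF.
have e0K : gapf s = K - 1 by [].
have [_ eneg] := andP (gapf_lt0 s0); have ee := gapf_exit s0.
pose X t := v * k / a * (a * t - K * (expR (a * t) - 1)).
pose Y t := d + k * (K * expR (a * t) - 1) + m * X t.
have aE : m * v = a + q by rewrite /a subrK.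
have an : a != 0 by rewrite gt_eqF.
have dexp t : is_derive t 1 (fun t => expR (a * t)) (a * expR (a * t)).
  have D1 : is_derive t 1 (fun t => a * t) a.
    by apply: is_derive_eq; rewrite /GRing.scale /=; ring.
  by have := @is_derive1_comp R expR (fun t => a * t) t _ _ (is_derive_expR (a * t)) D1; rewrite mulrC.
have dX t : is_derive t 1 X (v * k * (1 - K * expR (a * t))).
  have ? := dexp t; rewrite /X; apply: is_derive_eq; rewrite /GRing.scale /=.
  by field.
have dY t : is_derive t 1 Y (k * (K * (a * expR (a * t))) + m * (v * k * (1 - K * expR (a * t)))).
  have ? := dexp t; have ? := dX t; rewrite /Y; apply: is_derive_eq; rewrite /GRing.scale /=.
  by ring.
have start : 0 < (wedge m v q d k (0, d + k * gapf s)).1.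
  rewrite /wedge /= mulr0 subr0 addrC addKr mulr_gt0// oppr_gt0.
  by rewrite pmulr_rlt0.
split=> //; exists (s / a), (fun t => (X t, Y t)); split=> //.
- by rewrite divr_ge0// ltW.
- have X0 : X 0 = 0 by rewrite /X mulr0 expR0; ring.
  by rewrite X0 /Y X0 mulr0 expR0 e0K; congr pair; ring.
- have asE : a * (s / a) = s by rewrite mulrC divfK.
  have X1 : X (s / a) = 0 by rewrite /X asE Kp; ring.
  rewrite X1 /Y X1 asE mulr0 addr0; congr pair; congr (_ + _ * _).
  rewrite e0K (_ : K * expR s = K * (expR s - 1) + K); last by ring.
  by rewrite Kp; ring.
- split.
  + by move=> t; exact: (is_derive_cont (dX t)).
  + by move=> t; exact: (is_derive_cont (dY t)).
  + move=> t _ /=; have E : Y t - m * X t - d = k * (K * expR (a * t) - 1) by rewrite /Y; ring.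
    split; [have := dX t|have := dY t]; rewrite E.
      by congr is_derive; ring.
    by congr is_derive; rewrite /a; ring.
- move=> t /andP[t0 tT] /=; rewrite /X mulr_gt0//; first by rewrite divr_gt0// mulr_gt0.
  have at0 : 0 < a * t by rewrite mulr_gt0.
  have ats : a * t < s by rewrite mulrC -ltr_pdivlMr.
  by rewrite subr_gt0 -(ltr_pM2r p) [ltLHS]mulrAC Kp; apply: chord; rewrite at0.
- by rewrite /wedge /= mulr0 subr0 addrC addKr pmulr_llt0// oppr_lt0 mulr_gt0.
- by constructor 3.
Qed.

Lemma wedge_smooth m v q d k : pfield 1 (wedge m v q d k).
Proof.
have pl c1 c2 c3 : pf 1 (fun z : R * R => c1 * z.1 + c2 * z.2 + c3).
  apply: pfD; last exact: pf_cst.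
  by apply: pfD; apply: (@pfM R 0 1) => //; [exact: pf_cst|exact: pf_X|exact: pf_cst|exact: pf_Y].
split.
  rewrite (_ : (fun z => _) = fun z => (m * v) * z.1 + (- v) * z.2 + d * v); first exact: pl.
  by apply/funext => z; rewrite /wedge /=; ring.
rewrite (_ : (fun z => _) = fun z => (m * q) * z.1 + (- q) * z.2 + (d * q + k * (m * v - q))).
  exact: pl.
by apply/funext => z; rewrite /wedge /=; ring.
Qed.

Definition nega F z : R * R := (- (F z).1, - (F z).2).

(** Entry heights of the right wedge with [d = 1], [k = 4] for the climbs 4 and 1/8, chosen so that
    [al < -1] and [be > 0]. *)
Let al := 1 + 4 * gapf 4.
Let be := 1 + 4 * gapf 8^-1.

(** The left field is a wedge traversed backwards, descending from [gapf s' + s'] to [gapf s'], a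
    value in (-1, 0). The displacement is therefore positive at [al] and negative at [be]. *)
Lemma wedge_window m v q m' v' q' : 0 < v -> 0 < m * v - q -> 0 < v' -> 0 < m' * v' - q' ->
  window (wedge m v q 1 4) (nega (wedge m' v' q' 0 1)) setT setT [set y | 1 < y] 1 al be.
Proof.
move=> v0 a0 v'0 a'0.
have i8 : 0 < 8^-1 :> R by rewrite invr_gt0.
have h4 : 9 < expR 4 :> R.
  have h2 : 3 < expR 2 :> R by have := @expR_gt1D 2 (ltr0n _ _); lra.
  have -> : expR 4 = expR 2 * expR 2 :> R by rewrite -expRD; congr expR; lra.
  by nra.
have h8 : expR 8^-1 - 1 < 6^-1 :> R.
  by have := expR_1B i8; lra.
have p8 : 0 < expR 8^-1 - 1 :> R by have := expR_gt1D i8; lra.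
have al1 : al < -1.
  rewrite /al /gapf; have : 4 / (expR 4 - 1) < 2^-1 :> R by rewrite ltr_pdivrMr; lra.
  by lra.
have be0 : 0 < be.
  rewrite /be /gapf; have : 3 / 4 < 8^-1 / (expR 8^-1 - 1) :> R by rewrite ltr_pdivlMr//; lra.
  by lra.
have ex y : al <= y <= be -> exists s, [/\ 0 < s & y = 1 + 4 * gapf s].
  move=> /andP[y1 y2]; pose w := (y - 1) / 4 + 1.
  have w4 : 4 / (expR 4 - 1) <= w by move: y1; rewrite /al /gapf /w; lra.
  have w8 : w <= 8^-1 / (expR 8^-1 - 1) by move: y2; rewrite /be /gapf /w; lra.
  pose f s := s - w * (expR s - 1).
  have cf : continuous f.
    by move=> s; apply: (@is_derive_cont _ _ _ (1 - w * expR s)); rewrite /f; apply: is_derive_eq;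
      rewrite /GRing.scale /=; ring.
  have le84 : 8^-1 <= 4 :> R by lra.
  have [|s /andP[s8 s4] fs] := @ivt_dec R f 8^-1 4 0 le84 cf.
    rewrite /f subr_le0 subr_ge0 -ler_pdivrMr; last by lra.
    by rewrite w4 -ler_pdivlMr.
  have s0 : 0 < s by lra.
  have p : 0 < expR s - 1 by have := expR_gt1D s0; lra.
  exists s; split=> //; have ws : w = s / (expR s - 1).
    by apply/eqP; rewrite eq_sym; apply/eqP; apply: canLR (mulfK (lt0r_neq0 p)) _; move: fs; rewrite /f; lra.
  by rewrite /gapf -ws /w; field.
have chn s : 0 < s -> exists s', 0 < s' /\
    chain (wedge m v q 1 4) (nega (wedge m' v' q' 0 1)) setT setT [set y | 1 < y] 1 (1 + 4 * gapf s) (gapf s').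
  move=> s0; pose u := 1 + 4 * (gapf s + s); have es := gapf_exit s0.
  have p : 0 < expR s - 1 by have := expR_gt1D s0; lra.
  have E : gapf s * (expR s - 1) = s - (expR s - 1) by rewrite /gapf mulrBl divfK ?gt_eqF// mul1r.
  have [em _] := andP (gapf_lt0 s0).
  (* A zero [t] of [f] is a climb of the left wedge ending at the height [u] reached by the right
     one. *)
  pose f t := (t - 1 - u) * (expR t - 1) + t.
  have cf : continuous f.
    by move=> t; apply: (@is_derive_cont _ _ _ ((t - 1 - u) * expR t + (expR t - 1) + 1)); rewrite /f;
      apply: is_derive_eq; rewrite /GRing.scale /=; ring.
  have su : s <= 1 + u by rewrite /u; lra.
  have [|s' /andP[ss' s'u] fs'] := @ivt R f s (1 + u) 0 su cf.
    apply/andP; split; last by rewrite /f; lra.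
    rewrite /f (_ : _ + s = (gapf s + s - u) * (expR s - 1)); last first.
      by lra.
    by rewrite pmulr_lle0// /u; lra.
  have s'0 : 0 < s' by lra.
  have p' : 0 < expR s' - 1 by have := expR_gt1D s'0; lra.
  have E' : gapf s' * (expR s' - 1) = s' - (expR s' - 1) by rewrite /gapf mulrBl divfK ?gt_eqF// mul1r.
  have us : u = gapf s' + s'.
    apply: (mulIf (lt0r_neq0 p')); move: fs' E'; rewrite /f; clear; clearbody u; lra.
  exists s'; split=> //; exists u; split.
  - exact: wedge_pass.
  - by rewrite /= /u; lra.
  - have [Bs Bp] := @wedge_pass m' v' q' 0 1 s' v'0 ltr01 a'0 s'0.
    rewrite !mul1r !add0r -us in Bs Bp.
    split; last exact: pass_rev Bs Bp.
    by rewrite /nega /= oppr_gt0; exact: pass_exit Bp.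
split=> //; first by lra.
  by move=> y /ex[s [s0 ->]]; have [s' [_ c]] := chn s s0; exists (gapf s').
have [s4 [s40 c4]] := chn 4 (ltr0n _ _); have [s8 [s80 c8]] := chn 8^-1 i8.
exists (gapf s4), (gapf s8); split=> //.
have /andP[h41 _] := gapf_lt0 s40; have /andP[_ h82] := gapf_lt0 s80.
rewrite pmulr_rlt0; first by rewrite -/be; lra.
by rewrite -/al; lra.
Qed.

Lemma wedge_window_bounds : -3 < al /\ be < 1.
Proof.
have i8 : 0 < 8^-1 :> R by rewrite invr_gt0.
have /andP[h1 _] := @gapf_lt0 4 (ltr0n _ _); have /andP[_ h2] := gapf_lt0 i8.
by rewrite /al /be; split; lra.
Qed.

Definition tilt (l : R * R -> R) F e W z : R * R := (l z * (F z).1 + e * W.1, l z * (F z).2 + e * W.2).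

Definition ell c m z : R := c - z.2 + m * z.1.

Lemma pf_ell c m : pf 1 (ell c m).
Proof.
rewrite /ell; apply: pfD; last by apply: (@pfM R 0 1) => //; [exact: pf_cst|exact: pf_X].
rewrite (_ : (fun z => _) = fun z => c + (-1) * z.2); last by apply/funext => z; rewrite mulN1r.
by apply: pfD; [exact: pf_cst|apply: (@pfM R 0 1) => //; [exact: pf_cst|exact: pf_Y]].
Qed.

Lemma pfield_tilt n c m F e W : pfield n F -> pfield n.+1 (tilt (ell c m) F e W).
Proof.
by move=> [h1 h2]; split; apply: pfD; (try exact: pf_cst); rewrite -add1n; apply: pfM => //; exact: pf_ell.
Qed.

Lemma lipbox_rescale e c F : lipbox F -> lipbox (rescale e c F).
Proof.
move=> lF r; have [L L0 HL] := lF (`|e| * r + `|c|).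
exists (`|e^-1| * (L * `|e|) + 1) => [|z w zr wr].
  by rewrite ltr_pwDr// !mulr_ge0// ltW.
have s (x : R * R) : `|x| <= r -> `|(e * x.1, c + e * x.2)| <= `|e| * r + `|c|.
  rewrite !pnorm_le /= => /andP[h1 h2]; apply/andP; split.
    by rewrite normrM; apply: (@le_trans _ _ (`|e| * r)); [rewrite ler_wpM2l|rewrite lerDl].
  by apply: le_trans (ler_normD _ _) _; rewrite addrC lerD2r normrM ler_wpM2l.
have E (x y : R * R) : `|(e * x.1, c + e * x.2) - (e * y.1, c + e * y.2)| <= `|e| * `|x - y|.
  rewrite pnorm_le /= -mulrBr opprD addrACA subrr add0r -mulrBr !normrM.
  by rewrite !ler_wpM2l// ?(pnorm1 (x - y)) ?(pnorm2 (x - y)).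
have H := le_trans (HL _ _ (s z zr) (s w wr)) (ler_wpM2l (ltW L0) (E z w)).
apply: (@le_trans _ _ (`|e^-1| * (L * (`|e| * `|z - w|)))); last first.
  by rewrite !mulrA mulrDl mul1r lerDl.
rewrite pnorm_le /= -!mulrBr !normrM; apply/andP; split; apply: ler_wpM2l => //.
  exact: le_trans (pnorm1B _ _) H.
exact: le_trans (pnorm2 (_ - _)) H.
Qed.

Lemma hpass_rescale V e c F y y' : 0 < e -> hpass V (rescale e c F) y y' ->
  hpass setT F (c + e * y) (c + e * y').
Proof.
move=> e_0 [Fy ps]; split; last by have := pass_rescale e_0 ps; rewrite /= mulr0.
by move: Fy; rewrite /rescale /= mulr0 pmulr_rgt0// invr_gt0.
Qed.

Lemma chain_rescale A B VA VB D n e c y y' : 0 < e ->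
  chain (rescale e c A) (rescale e c B) VA VB D n y y' ->
  chain A B setT setT [set c + e * x | x in D] n (c + e * y) (c + e * y').
Proof.
move=> e_0; elim: n A B VA VB y => [|n IH] A B VA VB y /=; first exact: hpass_rescale.
move=> [u [h Du ch]]; exists (c + e * u); split; first exact: hpass_rescale h.
  by exists u.
exact: IH ch.
Qed.

Lemma window_rescale A B VA VB D n e c (a b : R) : 0 < e ->
  window (rescale e c A) (rescale e c B) VA VB D n a b ->
  window A B setT setT [set c + e * x | x in D] n (c + e * a) (c + e * b).
Proof.
move=> e_0 [ab on ex [za [zb [ca cb sg]]]]; split=> //.
- by rewrite ltrD2l ltr_pM2l.
- move=> y /andP[y1 y2]; have [|z hz] := ex ((y - c) / e).
    by rewrite ler_pdivlMr// ler_pdivrMr//; apply/andP; split; lra.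
  exists (c + e * z); have := chain_rescale e_0 hz.
  by rewrite mulrC divfK ?gt_eqF// subrKC.
- exists (c + e * za), (c + e * zb); split; [exact: chain_rescale ca|exact: chain_rescale cb|].
  rewrite (_ : _ * _ = e ^+ 2 * ((za - a) * (zb - b))); last by ring.
  by rewrite pmulr_rlt0// exprn_gt0.
Qed.

Lemma lipbox_nega F : lipbox F -> lipbox (nega F).
Proof.
move=> lF r; have [L L0 HL] := lF r; exists L => // z w zr wr.
have -> : nega F z - nega F w = - (F z - F w) by congr pair; rewrite /= opprD.
by rewrite normrN; exact: HL.
Qed.

(** At scale [e] near [(0, c)] the factor [ell c m] is [e] times a linear form, [F] is nearly
    constant and the added term is [e] times [W]; dividing by [e] leaves a linear field with [F]
    frozen at [(0, c)]. *)
Lemma rescale_tilt_close F c m W r : lipbox F -> 0 < r -> exists2 e1, 0 < e1 & forall e, 0 < e <= e1 ->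
  fclose r (fun z => (- (z.2 - m * z.1) * (F (0, c)).1 + W.1, - (z.2 - m * z.1) * (F (0, c)).2 + W.2))
    (rescale e c (tilt (ell c m) F e W)).
Proof.
move=> lF r0; have i0 : 0 < r^-1 by rewrite invr_gt0.
have [L L0 HL] := lF (r^-1 + `|c|).
pose K := (1 + `|m|) * r^-1 * L * r^-1.
have K0 : 0 < K by rewrite !mulr_gt0// ltr_pwDl.
exists (Num.min 1 (r / K)) => [|e]; first by rewrite lt_min ltr01 divr_gt0.
rewrite le_min => /and3P[e_0 e1 eK] z zr.
have [z1 z2] := andP (etrans (esym (pnorm_le _ _)) zr).
pose w : R * R := (e * z.1, c + e * z.2).
have zb : `|z.2 - m * z.1| <= (1 + `|m|) * r^-1.
  apply: le_trans (ler_normB _ _) _; rewrite mulrDl mul1r lerD// normrM.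
  by rewrite ler_wpM2l.
have ez x : `|x| <= r^-1 -> `|e * x| <= r^-1.
  move=> xr; rewrite normrM gtr0_norm//; apply: le_trans xr.
  by rewrite ler_piMl.
have wb : `|w| <= r^-1 + `|c|.
  rewrite pnorm_le /=; apply/andP; split.
    by apply: le_trans (ez _ z1) _; rewrite lerDl.
  by apply: le_trans (ler_normD _ _) _; rewrite addrC lerD2r ez.
have cb : `|(0, c) : R * R| <= r^-1 + `|c|.
  by rewrite pnorm_le /= normr0 addr_ge0 ?(ltW i0)//= lerDr ltW.
have Fd : `|F w - F (0, c)| <= L * (e * r^-1).
  apply: le_trans (HL _ _ wb cb) _; rewrite ler_pM2l// pnorm_le /= subr0 addrC addKr !normrM.
  by rewrite (gtr0_norm e_0) !ler_pM2l// z1.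
have key (x : R) : `|x| <= `|F w - F (0, c)| -> `|- (z.2 - m * z.1) * x| <= r.
  move=> xF; rewrite normrM normrN; apply: (@le_trans _ _ ((1 + `|m|) * r^-1 * (L * (e * r^-1)))).
    by apply: ler_pM => //; exact: le_trans Fd.
  rewrite [leLHS](_ : _ = e * K); last by rewrite /K; ring.
  by rewrite -ler_pdivlMr.
have en : e != 0 by rewrite gt_eqF.
rewrite pnorm_le /rescale /tilt /ell -/w; apply/andP; split.
  rewrite (_ : (_ - _).1 = - (z.2 - m * z.1) * ((F w).1 - (F (0, c)).1)); last first.
    by rewrite /w /=; field.
  by apply: key; exact: pnorm1B.
rewrite (_ : (_ - _).2 = - (z.2 - m * z.1) * ((F w).2 - (F (0, c)).2)); last first.
  by rewrite /w /=; field.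
by apply: key; exact: (pnorm2 (_ - _)).
Qed.

Lemma new_window A B n c mA mB : pfield n A -> pfield n B ->
  0 < (A (0, c)).1 -> (B (0, c)).1 < 0 ->
  0 < mA * (A (0, c)).1 - (A (0, c)).2 -> 0 < mB * - (B (0, c)).1 - - (B (0, c)).2 ->
  exists WA WB, exists2 e1, 0 < e1 & forall e, 0 < e <= e1 ->
    window (tilt (ell c mA) A e WA) (tilt (ell c mB) B e WB) setT setT
      [set c + e * x | x in [set y | 1 < y]] 1 (c + e * al) (c + e * be).
Proof.
move=> pA pB A0 B0 aA aB.
have lA := smoothf_lipbox (pfield_smooth pA); have lB := smoothf_lipbox (pfield_smooth pB).
pose v := (A (0, c)).1; pose q := (A (0, c)).2.
pose v' := - (B (0, c)).1; pose q' := - (B (0, c)).2.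
have v'0 : 0 < v' by rewrite oppr_gt0.
(* The constants for which the blow-up limits are the two fields of [wedge_window]. *)
pose WA : R * R := (v, q + 4 * (mA * v - q)); pose WB : R * R := (0, - (mB * v' - q')).
have EA : wedge mA v q 1 4 = fun z => (- (z.2 - mA * z.1) * (A (0, c)).1 + WA.1,
    - (z.2 - mA * z.1) * (A (0, c)).2 + WA.2).
  by apply/funext => z; rewrite /wedge /WA -/v -/q; congr pair; rewrite /=; ring.
have EB : nega (wedge mB v' q' 0 1) = fun z => (- (z.2 - mB * z.1) * (B (0, c)).1 + WB.1,
    - (z.2 - mB * z.1) * (B (0, c)).2 + WB.2).
  by apply/funext => z; rewrite /nega /wedge /WB /v' /q'; congr pair; rewrite /=; ring.
have win := wedge_window A0 aA v'0 aB.
have oD : open [set y : R | 1 < y] by exact: open_gt.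
have lWA : lipbox (wedge mA v q 1 4).
  by apply/smoothf_lipbox/pfield_smooth; exact: wedge_smooth.
have lWB : lipbox (nega (wedge mB v' q' 0 1)).
  by apply/lipbox_nega/smoothf_lipbox/pfield_smooth; exact: wedge_smooth.
have [r r0 Hr] := window_perturb openT openT oD lWA lWB win.
have [e2 e20 H2] := rescale_tilt_close c mA WA lA r0.
have [e3 e30 H3] := rescale_tilt_close c mB WB lB r0.
exists WA, WB, (Num.min e2 e3) => [|e]; first by rewrite lt_min e20.
rewrite le_min => /and3P[e_0 ee2 ee3].
apply: window_rescale => //; apply: Hr.
- by apply/lipbox_rescale/smoothf_lipbox; apply: pfield_smooth; exact: pfield_tilt pA.
- by apply/lipbox_rescale/smoothf_lipbox; apply: pfield_smooth; exact: pfield_tilt pB.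
- by rewrite EA; apply: H2; rewrite e_0.
- by rewrite EB; apply: H3; rewrite e_0.
Qed.

End NewWindow.

(** * Splitting the given cycles *)

Section Splitting.
Variable R : realType.
Implicit Types (z w : R * R) (d e r s t x y p q : R) (F A B : R * R -> R * R)
  (V VA VB U G : set (R * R)) (D : set R).

Record cell := Cell { cVA : set (R * R); cVB : set (R * R); cD : set R; cn : nat; ca : R; cb : R }.

Definition cwin A B (c : cell) := window A B (cVA c) (cVB c) (cD c) (cn c) (ca c) (cb c).

Definition cdisj (c c' : cell) := (cb c <= ca c' \/ cb c' <= ca c) /\
  forall x, ca c < x < cb c -> ~ cD c' x.

Definition cells (Q : cell -> Prop) (m : nat) (C : nat -> cell) :=
  (forall i, (i < m)%N -> Q (C i)) /\
  (forall i j, (i < m)%N -> (j < m)%N -> i != j -> cdisj (C i) (C j)).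

Lemma cells_cat (Q Q' : cell -> Prop) m m' C C' : cells Q m C -> cells Q' m' C' ->
  (forall c c', Q c -> Q' c' -> cdisj c c' /\ cdisj c' c) ->
  cells (fun c => Q c \/ Q' c) (m + m') (fun i => if (i < m)%N then C i else C' (i - m)%N).
Proof.
move=> [q1 d1] [q2 d2] qq.
have sub i : (m <= i)%N -> (i < m + m')%N -> (i - m < m')%N.
  by move=> mi im; rewrite ltn_subLR.
split=> [i im|i j im jm ij].
  by case: ltnP => h; [left; exact: q1|right; apply: q2; exact: sub].
case: ltnP => hi; case: ltnP => hj.
- exact: d1.
- by apply: (qq _ _ _ _).1; [exact: q1|apply: q2; exact: sub].
- by apply: (qq _ _ _ _).2; [exact: q1|apply: q2; exact: sub].
- apply: d2; try exact: sub.
  by apply: contra ij => /eqP E; rewrite -(subnK hi) -(subnK hj) E.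
Qed.

Lemma cellsW (Q Q' : cell -> Prop) m C : (forall c, Q c -> Q' c) -> cells Q m C -> cells Q' m C.
Proof. by move=> QQ [h1 h2]; split=> // i /h1/QQ. Qed.

(* [sg] is 1 or -1: the windows persist for small shifts of that sign. *)
Definition shifted A B (sg : R) (c : cell) := exists2 e, 0 < e & forall d, 0 < d <= e ->
  cwin (shiftf (sg * d) A) B c.

Lemma isolated_split A B VA VB D n p r0 : open VA -> open VB -> open D -> smoothf A -> smoothf B ->
  odd n -> isolated_cycle A B VA VB D n p -> 0 < r0 -> (forall x, `|x - p| < r0 -> ~ D x) ->
  let Q sg c := [/\ shifted A B sg c, [/\ cVA c = VA, cVB c = VB & cD c = D],
    p - r0 <= ca c & cb c <= p + r0] in
  exists m C m' C', [/\ cells (Q 1) m C, cells (Q (-1)) m' C' & (2 <= m + m')%N].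
Proof.
move=> oA oB oD sA sB on [ch [ei ei0 iso]] r00 Dn Q.
have lA := smoothf_lipbox sA; have lB := smoothf_lipbox sB.
have [r1 r10 Hr1] := chain_perturb oA oB oD lA lB ch ltr01.
pose r := Num.min (Num.min r0 r1) (ei / 2).
have r_0 : 0 < r by rewrite !lt_min r00 r10 divr_gt0.
have [rr0 rr1 rei] : [/\ r <= r0, r <= r1 & r <= ei / 2] by rewrite !ge_min !lexx !orbT.
clearbody r.
have [e1 e10 He1] := fclose_shift 0 r10 lA; rewrite shiftf0 in He1.
have ex d y : `|d| <= e1 -> p - r <= y <= p + r -> exists z : R, chain (shiftf d A) B VA VB D n y z.
  move=> de /andP[y1 y2]; have [|||z _ hz] := Hr1 (shiftf d A) B (lipbox_shift d lA) lB _ _ y.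
  - by apply: He1; rewrite subr0.
  - exact: fclose_id.
  - by rewrite ler_norml; apply/andP; split; clear -y1 y2 rr1; lra.
  by exists z.
have rect y d : p - r <= y <= p + r -> - e1 <= d <= e1 -> exists z : R, chain (shiftf d A) B VA VB D n y z.
  by move=> yI dI; apply: ex => //; rewrite ler_norml.
have sgn s : `|s| = r -> exists2 e, 0 < e & exists u, [/\ u != 0, chain A B VA VB D n (p + s) (p + s + u) &
    forall d, `|d| <= e -> exists v, chain (shiftf d A) B VA VB D n (p + s) (p + s + v) /\ 0 < u * v].
  move=> sr; have sI : p - r <= p + s <= p + r.
    by move: (ler_norm s) (ler_norm (- s)); rewrite normrN sr => h h'; apply/andP; split; clear -h h'; lra.
  have n0 : `|0 : R| <= e1 by rewrite normr0 ltW.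
  have [z hz] := ex 0 _ n0 sI; rewrite shiftf0 in hz.
  have u0 : z - (p + s) != 0.
    apply/eqP => /eqP; rewrite subr_eq0 => /eqP zE; rewrite zE in hz.
    have pE : p + s = p by apply: iso hz; rewrite addrC addKr sr; clear -rei ei0; lra.
    by move: sr; rewrite (_ : s = 0) ?normr0; clear -pE r_0; lra.
  have nu0 : 0 < `|z - (p + s)| by rewrite normr_gt0.
  have [r2 r20 Hr2] := chain_perturb oA oB oD lA lB hz nu0.
  have [e2 e20 He2] := fclose_shift 0 r20 lA; rewrite shiftf0 in He2.
  exists e2 => //; exists (z - (p + s)); split=> //; first by rewrite subrKC.
  move=> d de; have [|||v vz hv] := Hr2 (shiftf d A) B (lipbox_shift d lA) lB _ _ (p + s).
  - by apply: He2; rewrite subr0.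
  - exact: fclose_id.
  - by rewrite subrr normr0 ltW.
  exists (v - (p + s)); rewrite subrKC; split=> //.
  have [u1|u1] := ltP 0 (z - (p + s)).
    rewrite mulr_gt0//; move: vz; rewrite (gtr0_norm u1) ltr_norml => /andP[]; clear; lra.
  have {}u1 : z - (p + s) < 0 by rewrite lt_neqAle u0.
  by rewrite nmulr_rgt0//; move: vz; rewrite (ltr0_norm u1) ltr_norml => /andP[_]; clear; lra.
have [er er0 [ur [urn cr Hr]]] := sgn r (gtr0_norm r_0).
have [|el el0 [ul [uln cl Hl]]] := sgn (- r); first by rewrite normrN gtr0_norm.
pose e := Num.min e1 (Num.min er el).
have e_0 : 0 < e by rewrite !lt_min e10 er0.
have [ee1 eer eel] : [/\ e <= e1, e <= er & e <= el] by rewrite !ge_min !lexx !orbT.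
clearbody e.
have pI : p - r <= p <= p + r by apply/andP; split; clear -r_0; lra.
(* A shift moves the return of [p] strictly, downwards for a positive and upwards for a negative
   one, while the displacements at [p - r] and [p + r] keep the signs of [ul] and [ur]. *)
have mid d : 0 < d <= e -> exists v v', [/\ chain (shiftf d A) B VA VB D n p (p - v),
    chain (shiftf (- d) A) B VA VB D n p (p + v'), 0 < v & 0 < v'].
  move=> /andP[d0 de]; have dI : - e1 <= d <= e1 by apply/andP; split; clear -d0 de e10 ee1; lra.
  have dI' : - e1 <= - d <= e1 by apply/andP; split; clear -d0 de e10 ee1; lra.
  have zI : - e1 <= 0 <= e1 by apply/andP; split; clear -e10; lra.
  have [z hz] := rect p d pI dI; have [z' hz'] := rect p (- d) pI dI'.
  have c0 : chain (shiftf 0 A) B VA VB D n p p by rewrite shiftf0.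
  have h1 := @rect_shift R A B VA VB D n _ _ _ _ oA oB sA sB on rect p 0 d p z pI zI dI d0 c0 hz.
  have nd : - d < 0 by rewrite oppr_lt0.
  have h2 := @rect_shift R A B VA VB D n _ _ _ _ oA oB sA sB on rect p (- d) 0 z' p pI dI' zI nd hz' c0.
  by exists (p - z), (z' - p); rewrite subKr subrKC; split=> //; rewrite subr_gt0.
pose mk a b := Cell VA VB D n a b.
have mkQ sg a b : p - r <= a -> b <= p + r -> a < b -> `|sg| = 1 -> (forall d, 0 < d <= e -> exists u v,
    [/\ chain (shiftf (sg * d) A) B VA VB D n a (a + u), chain (shiftf (sg * d) A) B VA VB D n b (b + v) &
    u * v < 0]) -> Q sg (mk a b).
  move=> ar br ab sg1 H; split=> //=; [|clear -ar rr0; lra|clear -br rr0; lra].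
  exists e => // d dI; have [d0 de] := andP dI; split=> //=.
    move=> y /andP[ya yb]; apply: rect; first by rewrite (le_trans ar ya) (le_trans yb br).
    by rewrite -ler_norml normrM sg1 mul1r gtr0_norm// (le_trans de).
  have [u [v [hu hv uv]]] := H d dI; exists (a + u), (b + v); split=> //.
  by rewrite (addrC a) (addrC b) !addrK.
have dabs sg d : `|sg| = 1 -> 0 < d <= e -> `|sg * d| <= er /\ `|sg * d| <= el.
  by move=> s1 /andP[d0 de]; rewrite normrM s1 mul1r gtr0_norm//; split; exact: le_trans de _.
have n1 : `|1 : R| = 1 by rewrite normr1.
have nN1 : `|-1 : R| = 1 by rewrite normrN1.
have [ulr|ulr] : ul * ur < 0 \/ 0 <= ul * ur by case: ltP; [left|right].
  have one sg : `|sg| = 1 -> cells (Q sg) 1 (fun=> mk (p - r) (p + r)).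
    move=> s1; split=> [i _|i j]; last by rewrite !ltnS !leqn0 => /eqP -> /eqP ->.
    apply: (mkQ sg _ _ (lexx _) (lexx _) _ s1); first by clear -r_0; lra.
    move=> d dI; have [d1 d2] := dabs sg d s1 dI.
    have [u [hu uu]] := Hl _ d2; have [v [hv vv]] := Hr _ d1.
    by exists u, v; split=> //; clear -uu vv ulr; nra.
  by exists 1%N, (fun=> mk (p - r) (p + r)), 1%N, (fun=> mk (p - r) (p + r)); split=> //; exact: one.
(* When [ul] and [ur] have the same sign, the shift that gives [p] the other sign creates a window
   on each side of [p]. *)
have two sg : `|sg| = 1 -> (forall d, 0 < d <= e -> exists v,
    chain (shiftf (sg * d) A) B VA VB D n p (p + v) /\ v * ul < 0) ->
    cells (Q sg) 2 (fun i => if i == 0%N then mk (p - r) p else mk p (p + r)).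
  move=> s1 H; split=> [i i2|i j i2 j2 ij].
    have vr d v : 0 < d <= e -> v * ul < 0 -> v * ur < 0.
      move=> _ vu; have uu : 0 < ul * ur by rewrite lt_neqAle ulr andbT eq_sym mulf_neq0.
      by clear -vu uu; nra.
    have [pl pr] : p - r < p /\ p < p + r by clear -r_0; split; lra.
    case: ifP => _.
      apply: (mkQ sg _ _ (lexx _) (ltW pr) pl s1) => d dI; have [d1 d2] := dabs sg d s1 dI.
      have [u [hu uu]] := Hl _ d2; have [v [hv vv]] := H d dI.
      by exists u, v; split=> //; clear -uu vv; nra.
    apply: (mkQ sg _ _ (ltW pl) (lexx _) pr s1) => d dI; have [d1 d2] := dabs sg d s1 dI.
    have [u [hu uu]] := Hr _ d1; have [v [hv vv]] := H d dI; have vv' := vr d v dI vv.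
    by exists v, u; split=> //; clear -uu vv'; nra.
  split.
    by move: ij; case: i i2 => [|[|i]]; case: j j2 => [|[|j]] //= _ _ _; [left|right].
  move=> x; have Dx : p - r < x < p + r -> ~ D x.
    by move=> /andP[x1 x2]; apply: Dn; rewrite ltr_norml; apply/andP; split; clear -x1 x2 rr0; lra.
  by case: i {i2 ij} => [|i] /= /andP[x1 x2]; case: j {j2} => [|j] /=; apply: Dx; apply/andP; split; clear -x1 x2 r_0; lra.
have none sg : cells (Q sg) 0 (fun=> mk p p) by split.
have [u0|u0] : 0 < ul \/ ul <= 0 by case: ltP; [left|right].
  exists 2%N, (fun i => if i == 0%N then mk (p - r) p else mk p (p + r)), 0%N, (fun=> mk p p).
  split=> //; apply: two => // d dI; have [v [_ [hv _ v0 _]]] := mid d dI.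
  by exists (- v); rewrite mul1r; split=> //; clear -u0 v0; nra.
have {}u0 : ul < 0 by rewrite lt_neqAle uln.
exists 0%N, (fun=> mk p p), 2%N, (fun i => if i == 0%N then mk (p - r) p else mk p (p + r)).
split=> //; apply: two => // d dI; have [_ [v' [_ hv _ v0]]] := mid d dI.
by exists v'; rewrite mulN1r; split=> //; clear -u0 v0; nra.
Qed.

End Splitting.

(** * Adding a window to given ones *)

Section OneMoreCycle.
Variable R : realType.
Implicit Types (z w W : R * R) (c d e r s t x y p q : R) (F A B : R * R -> R * R)
  (V VA VB U G : set (R * R)) (D : set R).

Lemma fin_pos (P : nat -> R -> Prop) K :
  (forall i e e', 0 < e' -> e' <= e -> P i e -> P i e') ->
  (forall i, (i < K)%N -> exists2 e, 0 < e & P i e) ->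
  exists2 e, 0 < e & forall i, (i < K)%N -> P i e.
Proof.
move=> mono; elim: K => [|K IH] H; first by exists 1.
have [i iK|e e0 He] := IH; first by apply: H; exact: ltnW.
have [e' e'0 He'] := H K (ltnSn _).
have m0 : 0 < Num.min e e' by rewrite lt_min e0.
exists (Num.min e e') => // i; rewrite ltnS leq_eqVlt => /predU1P[->|iK].
  by apply: mono He' => //; rewrite ge_min lexx orbT.
by apply: mono (He i iK) => //; rewrite ge_min lexx.
Qed.

Lemma hpass_right V F y y' : hpass V F y y' -> hpass (V `&` [set z | 0 <= z.1]) F y y'.
Proof.
move=> [Fy [T [g [T0 g0 gT Dg gp gV Fe St]]]]; split=> //; exists T, g; split=> // t tI.
split; first exact: gV; move: tI => /= /andP[].
rewrite le_eqVlt => /predU1P[<- _|t0]; first by rewrite g0.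
rewrite le_eqVlt => /predU1P[->|tT]; first by rewrite gT.
by apply/ltW/gp; rewrite t0.
Qed.

(** The affine factors are known to be positive only on the part of a cycle in [0 <= z.1], so the
    regions are cut down to that half-plane. *)
Lemma chain_right A B VA VB D n y y' : chain A B VA VB D n y y' ->
  chain A B (VA `&` [set z | 0 <= z.1]) (VB `&` [set z | 0 <= z.1]) D n y y'.
Proof.
elim: n A B VA VB y => [|n IH] A B VA VB y /=; first exact: hpass_right.
by move=> [u [/hpass_right h Du /IH c]]; exists u.
Qed.

Lemma open_mir U : open U -> open [set z | U (mir z)].
Proof.
move=> oU; apply: open_balls => z /= Uz; have [e e0 He] := open_ball oU Uz.
by exists e => // w wz; apply: He; rewrite mir_norm.
Qed.

Lemma porbit_mir A B G : porbit A B G -> porbit B A [set z | G (mir z)].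
Proof.
move=> [g [T [tg [T0 P] [s [t st]] ->]]]; exists (mir \o g), T; split.
- exact: traj_mir.
- by split=> // u /=; rewrite P.
- by exists s, t => /= E; apply: st; rewrite -[LHS]mirK E mirK.
- apply/seteqP; split=> [z [u _ gu]|_ [u _ <-]]; last by exists u => //=; rewrite mirK.
  by exists u => //=; rewrite gu mirK.
Qed.

Lemma clc_mir A B G : clc A B G -> clc B A [set z | G (mir z)].
Proof.
move=> [[po [U [oU GU HU]]] ne fin cr].
have E : [set z | G (mir z)] `&` @disc_line R = G `&` @disc_line R.
  apply/seteqP; split=> -[z1 z2] [Gz]; rewrite /disc_line /= => z0; move: Gz; rewrite z0 /= ?mir_line //.
split; rewrite ?E//.
  split; first exact: porbit_mir.
  exists [set z | U (mir z)]; split=> [|z /GU//|G' po' G'U]; first exact: open_mir.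
  have <- : [set z | G' (mir z)] = G.
    by apply: HU; [exact: porbit_mir|move=> z /= /G'U /=; rewrite mirK].
  by apply/seteqP; split=> z /=; rewrite mirK.
move=> [z1 z2] Gz; have [zl b] := cr _ Gz; have z10 : z1 = 0 := zl; split=> //.
by rewrite {}z10 in b *; rewrite -/(crossing B A z2) crossing_mir.
Qed.

(** Where the cycle is off the line [{x = 0}] a large slope [m] dominates, and near that line the
    bound [y < c] suffices. The margin of [unif_pos] is the inverse slope. *)
Lemma ell_pos A B G c : porbit A B G -> (forall y, G (0, y) -> y < c) ->
  exists m0, forall m, m0 <= m -> forall z, G z -> 0 <= z.1 -> 0 < ell c m z.
Proof.
move=> [g [T [tg [T0 P] _ GE]]] Gc; have [c1 c2] := traj_cont tg.
have [t d d' d'0 dd H g1|t tI|d d0 Hd] := @unif_pos R 0 T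
    (fun d t => 0 <= (g t).1 -> 0 < c - (g t).2 + d^-1 * (g t).1).
- apply: lt_le_trans (H g1) _; rewrite lerD2l ler_wpM2r// lef_pV2 ?posrE//.
  exact: lt_le_trans dd.
- have [g1|g1|g1] := ltgtP (g t).1 0.
  + have n0 : 0 < - (g t).1 by rewrite oppr_gt0.
    have [d d0 Hd] := cont_ed (c1 t) n0; exists d => // s _ /Hd.
    by rewrite ltr_norml => /andP[_ h] h'; lra.
  + have n0 : 0 < (g t).1 / 2 by rewrite divr_gt0.
    have [d1 d10 Hd1] := cont_ed (c1 t) n0; have [d2 d20 Hd2] := cont_ed (c2 t) ltr01.
    pose k := (g t).1 / 2 / (`|(g t).2 - c| + 2).
    have k1 : 0 < `|(g t).2 - c| + 2 by rewrite ltr_wpDl.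
    have k0 : 0 < k by rewrite divr_gt0.
    exists (Num.min k (Num.min d1 d2)) => [|s _]; first by rewrite !lt_min k0 d10.
    rewrite !lt_min => /and3P[_ /Hd1 s1 /Hd2 s2] _.
    move: s1 s2; rewrite !ltr_norml => /andP[s1 _] /andP[_ s2].
    have h1 : (g t).1 / 2 < (g s).1 by lra.
    have h2 : (g t).2 - c <= `|(g t).2 - c| := ler_norm _.
    set e := Num.min k _; have ek : e <= k by rewrite ge_min lexx.
    have e0 : 0 < e by rewrite !lt_min k0 d10.
    have : `|(g t).2 - c| + 2 <= e^-1 * (g s).1.
      rewrite mulrC ler_pdivlMr//; apply: le_trans (ltW h1).
      by rewrite mulrC -ler_pdivlMr.
    lra.
  + have n0 : 0 < c - (g t).2.
      by rewrite subr_gt0; apply: Gc; rewrite GE -g1; exists t => //; rewrite -surjective_pairing.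
    have [d d0 Hd] := cont_ed (c2 t) n0; exists d => // s _ /Hd.
    rewrite ltr_norml => /andP[_ h] gs; rewrite ltr_pwDl ?mulr_ge0 ?invr_ge0 ?(ltW d0)//; lra.
exists d^-1 => m dm z; rewrite GE => -[t _ <-] g1; have [s sI gs] := period_in t T0 P.
rewrite -gs in g1 *; apply: lt_le_trans (Hd s sI g1) _.
by rewrite /ell lerD2l ler_wpM2r.
Qed.

Lemma ell_pos_fin A B K (G : nat -> set (R * R)) c : (forall j, (j < K)%N -> porbit A B (G j)) ->
  (forall j y, (j < K)%N -> G j (0, y) -> y < c) ->
  exists m0, forall m, m0 <= m -> forall j z, (j < K)%N -> G j z -> 0 <= z.1 -> 0 < ell c m z.
Proof.
elim: K => [|K IH] po Gc; first by exists 0.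
have [j jK|j y jK|m1 H1] := IH; [by apply: po; exact: ltnW|by apply: Gc; exact: ltnW|].
have [m2 H2] := ell_pos (po K (ltnSn _)) (fun y => Gc K y (ltnSn _)).
exists (Num.max m1 m2) => m; rewrite ge_max => /andP[mm1 mm2] j z.
by rewrite ltnS leq_eqVlt => /predU1P[->|jK]; [exact: H2|exact: H1].
Qed.

Lemma hpass_mul V F (l : R * R -> R) y y' : lipbox F -> slip l -> (forall z, V z -> 0 < l z) ->
  hpass V F y y' -> hpass V (tilt l F 0 0) y y'.
Proof.
move=> lF sl lV [Fy ps]; have E : tilt l F 0 0 = fun z => (l z * (F z).1, l z * (F z).2).
  by apply/funext => z; rewrite /tilt !mul0r !addr0.
have Vy : V (0, y).
  by case: ps => T [g [T0 g0 _ _ _ gV _ _]]; rewrite -g0; apply: gV; rewrite lexx.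
by rewrite E; split; [rewrite /= mulr_gt0// lV|exact: pass_mul].
Qed.

Lemma chain_mul A B (l l' : R * R -> R) VA VB D n y y' : lipbox A -> lipbox B -> slip l -> slip l' ->
  (forall z, VA z -> 0 < l z) -> (forall z, VB z -> 0 < l' z) -> chain A B VA VB D n y y' ->
  chain (tilt l A 0 0) (tilt l' B 0 0) VA VB D n y y'.
Proof.
elim: n A B l l' VA VB y => [|n IH] A B l l' VA VB y lA lB sl sl' pl pl' /=; first exact: hpass_mul.
move=> [u [h Du c]]; exists u; split=> //; first exact: hpass_mul.
exact: IH.
Qed.

Lemma window_mul A B (l l' : R * R -> R) VA VB D n a b : lipbox A -> lipbox B -> slip l -> slip l' ->
  (forall z, VA z -> 0 < l z) -> (forall z, VB z -> 0 < l' z) -> window A B VA VB D n a b ->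
  window (tilt l A 0 0) (tilt l' B 0 0) VA VB D n a b.
Proof.
move=> lA lB sl sl' pl pl' [ab on ex [za [zb [c1 c2 sg]]]]; split=> //.
  by move=> y /ex[z hz]; exists z; exact: chain_mul.
by exists za, zb; split=> //; exact: chain_mul.
Qed.

Lemma tilt_close (l : R * R -> R) F W r : 0 < r -> exists2 e1, 0 < e1 & forall e, 0 < e <= e1 ->
  fclose r (tilt l F 0 0) (tilt l F e W).
Proof.
move=> r0; have W1 : 0 < `|W| + 1 by rewrite ltr_wpDl.
exists (r / (`|W| + 1)) => [|e /andP[e0 er] z _]; first exact: divr_gt0.
rewrite (_ : _ - _ = (e * W.1, e * W.2)); last by congr pair; rewrite /tilt /= !mul0r; ring.
rewrite ler_pdivlMr// in er; rewrite pnorm_le /= !normrM gtr0_norm//.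
have h (x : R) : `|x| <= `|W| -> e * `|x| <= r.
  by move=> xW; apply: le_trans er; rewrite ler_pM2l//; lra.
by rewrite !h ?(pnorm1 W) ?(pnorm2 W).
Qed.

Lemma open_ballsR D : (forall x, D x -> exists2 e, 0 < e & forall y, `|y - x| < e -> D y) -> open D.
Proof.
move=> H; rewrite openE => x /H[e e0 He]; apply/nbhs_ballP; exists e => //= y.
by rewrite /ball /= distrC; exact: He.
Qed.

Lemma last_index i K : (i < K.+1)%N -> (i < K)%N = false -> i = K.
Proof. by rewrite ltnS leq_eqVlt => /predU1P[//|->]. Qed.

(** One set [D] serves all given cycles: it stays below the new window and away from every base
    point, so that no chain meets the window of another. *)
Definition avoid K (p : nat -> R) h c1 : set R :=
  [set x | x < c1 /\ forall i, (i < K)%N -> h < `|x - p i|].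

Lemma open_avoid K (p : nat -> R) h c1 : open (avoid K p h c1).
Proof.
apply: open_ballsR => x [xc Hx].
have [i e e' _ ee H y ye|i iK|e e0 He] := @fin_pos (fun i e => forall y, `|y - x| < e -> h < `|y - p i|) K.
- by apply: H; exact: lt_le_trans ee.
- exists (`|x - p i| - h) => [|y yx]; first by rewrite subr_gt0; exact: Hx.
  have := ler_normB (y - p i) (y - x); rewrite (_ : y - p i - (y - x) = x - p i); last by ring.
  lra.
exists (Num.min e (c1 - x)) => [|y]; first by rewrite lt_min e0 subr_gt0.
rewrite lt_min => /andP[ye yc]; split; first by move: yc; rewrite ltr_norml => /andP[_]; lra.
by move=> i iK; exact: He.
Qed.

(* The fields are multiplied by affine functions vanishing on lines through (0, c), positive along the
   windows; a small constant added to them creates a further window near (0, c). *)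
Lemma add_window A B n c c1 mA mB (K : nat) (C : nat -> cell R) : pfield n A -> pfield n B ->
  0 < (A (0, c)).1 -> (B (0, c)).1 < 0 ->
  0 < mA * (A (0, c)).1 - (A (0, c)).2 -> 0 < mB * - (B (0, c)).1 - - (B (0, c)).2 -> c1 < c ->
  cells (fun k => [/\ cwin A B k, [/\ open (cVA k), open (cVB k) & open (cD k)],
    (forall z, cVA k z -> 0 < ell c mA z), (forall z, cVB k z -> 0 < ell c mB z) &
    cb k <= c1 /\ forall x, cD k x -> x < c1]) K C ->
  (K.+1%:R%:E <= Hc R n.+1)%E.
Proof.
move=> pA pB A0 B0 aA aB cc1 [HC dC].
have lA := smoothf_lipbox (pfield_smooth pA); have lB := smoothf_lipbox (pfield_smooth pB).
have [WA [WB [e1 e10 new]]] := new_window pA pB A0 B0 aA aB.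
have [al3 be1] := wedge_window_bounds R.
have sell m : slip (ell c m) by exact: smooth_slip (pf_smooth (pf_ell c m)).
have lT F m e W k : pfield k F -> lipbox (tilt (ell c m) F e W).
  by move=> pF; apply/smoothf_lipbox/pfield_smooth; exact: pfield_tilt pF.
have [i e e' e'0 ee H u /andP[u0 ue]|i iK|e2 e20 old] := @fin_pos (fun i e => forall u, 0 < u <= e ->
    cwin (tilt (ell c mA) A u WA) (tilt (ell c mB) B u WB) (C i)) K.
- by apply: H; rewrite u0 (le_trans ue).
- have [win [oVA oVB oD] lVA lVB _] := HC i iK.
  have win2 := window_mul lA lB (sell mA) (sell mB) lVA lVB win.
  have [r r0 Hr] := window_perturb oVA oVB oD (lT _ _ _ _ _ pA) (lT _ _ _ _ _ pB) win2.
  have [u1 u10 H1] := tilt_close (ell c mA) A WA r0; have [u2 u20 H2] := tilt_close (ell c mB) B WB r0.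
  exists (Num.min u1 u2) => [|u]; first by rewrite lt_min u10.
  rewrite le_min => /and3P[u0 uu1 uu2]; apply: Hr.
  + exact: lT pA.
  + exact: lT pB.
  + by apply: H1; rewrite u0.
  + by apply: H2; rewrite u0.
(* Since [-3] is a lower bound for the left end in units of [e], a scale of at most a third of
   [c - c1] places the new window above [c1]. *)
pose e := Num.min (Num.min e1 e2) ((c - c1) / 3).
have e0 : 0 < e by rewrite !lt_min e10 e20 divr_gt0// subr_gt0.
have [ee1 ee2 ee3] : [/\ e <= e1, e <= e2 & e <= (c - c1) / 3] by rewrite !ge_min !lexx !orbT.
have c1al : c1 < c + e * (1 + 4 * gapf 4).
  by have : e * -3 < e * (1 + 4 * gapf 4) by [rewrite ltr_pM2l]; lra.
pose k0 := Cell setT setT [set c + e * x | x in [set y | 1 < y]] 1 (c + e * (1 + 4 * gapf 4))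
  (c + e * (1 + 4 * gapf 8^-1)).
pose C' i := if (i < K)%N then C i else k0.
have wk0 : cwin (tilt (ell c mA) A e WA) (tilt (ell c mB) B e WB) k0 by apply: new; rewrite e0.
have cwC i : (i < K.+1)%N -> cwin (tilt (ell c mA) A e WA) (tilt (ell c mB) B e WB) (C' i).
  by move=> _; rewrite /C'; case: ifP => // iK; apply: (old i iK); rewrite e0.
have oD0 : open (cD k0).
  apply: open_ballsR => _ [x /= x1 <-]; exists (e * (x - 1)) => [|y]; first by rewrite mulr_gt0// subr_gt0.
  rewrite ltr_norml => /andP[h _]; exists ((y - c) / e); last by rewrite mulrC divfK ?gt_eqF// subrKC.
  by rewrite /= ltr_pdivlMr//; lra.
apply: (@Hc_windows R (tilt (ell c mA) A e WA) (tilt (ell c mB) B e WB) n.+1 K.+1 (fun i => cVA (C' i))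
  (fun i => cVB (C' i)) (fun i => cD (C' i)) (fun i => cn (C' i)) (fun i => ca (C' i)) (fun i => cb (C' i))).
- exact: pfield_tilt.
- exact: pfield_tilt.
- move=> i iK; have := cwC i iK; rewrite /C'; case: ifP => [/HC[_ [? ? ?] _ _ _]|_] w; split=> //; exact: openT.
- move=> i j iK jK ij; rewrite /C'; case: ifP => iK'; case: ifP => jK'.
  + exact: dC.
  + have [_ _ _ _ [ck Dk]] := HC i iK'; split; first by left=> /=; lra.
    move=> x /andP[_ xb] [y /= y1 E].
    by have : e * 1 < e * y by [rewrite ltr_pM2l]; lra.
  + have [_ _ _ _ [ck Dk]] := HC j jK'; split; first by right=> /=; lra.
    by move=> x /= /andP[xa _] /Dk; lra.
  + by move: ij; rewrite (last_index iK iK') (last_index jK jK') eqxx.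
Qed.

End OneMoreCycle.

(** * One more cycle in the next degree *)

Section PartTwo.
Variable R : realType.
Implicit Types (z w W : R * R) (c d e r s t x y p q : R) (F A B : R * R -> R * R)
  (V VA VB U G : set (R * R)) (D : set R).

Lemma seq_max (l : seq R) : l != [::] -> exists2 x, x \in l & forall y, y \in l -> y <= x.
Proof.
elim: l => // x l IH _; have [->|/IH[u ul Hu]] := eqVneq l [::].
  by exists x; rewrite ?mem_head// => y; rewrite inE => /eqP ->.
have [xu|/ltW ux] := leP x u.
  by exists u; rewrite ?inE ?ul ?orbT// => y /predU1P[->|/Hu].
exists x; rewrite ?mem_head// => y; rewrite inE => /predU1P[->//|/Hu yu].
exact: le_trans yu ux.
Qed.

Lemma clc_lines A B K (G : nat -> set (R * R)) : (forall j, (j < K)%N -> clc A B (G j)) ->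
  exists l : seq R, forall x, (x \in l) = `[< exists2 j, (j < K)%N & G j (0, x) >].
Proof.
move=> cG; have fin : finite_set (\bigcup_(j in `I_K) [set x | G j (0, x)]).
  apply: bigcup_finite; first exact: finite_II.
  move=> j /= jK; have [_ _ fin _] := cG j jK.
  by apply: sub_finite_set (finite_image snd fin) => x /= Gx; exists (0, x).
have /finite_seqP[l Hl] := fin; exists l => x; apply/idP/asboolP => [xl|[j jK Gx]].
  have : [set` l] x by [].
  by rewrite -Hl => -[j jK Gx]; exists j.
by have : [set` l] x by rewrite -Hl; exists j.
Qed.

Lemma shifted_cells A B sg c mA (Q : cell R -> Prop) m C :
  lipbox A -> `|sg| = 1 -> 0 < (A (0, c)).1 -> 0 <= mA -> 0 < mA * (A (0, c)).1 - (A (0, c)).2 ->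
  cells Q m C -> (forall k, Q k -> shifted A B sg k) ->
  exists A', [/\ exists d, A' = shiftf d A, 0 < (A' (0, c)).1, 0 < mA * (A' (0, c)).1 - (A' (0, c)).2 &
    forall i, (i < m)%N -> cwin A' B (C i)].
Proof.
move=> lA s1 A0 m0 aA [HC _] HQ.
have [i e e' e'0 ee H d /andP[d0 de]|i im|e e0 He] := @fin_pos R (fun i e => forall d, 0 < d <= e ->
    cwin (shiftf (sg * d) A) B (C i)) m.
- by apply: H; rewrite d0 (le_trans de).
- by have [e e0 He] := HQ _ (HC i im); exists e.
pose k := Num.min (A (0, c)).1 ((mA * (A (0, c)).1 - (A (0, c)).2) / (mA + 1)).
have m1 : 0 < mA + 1 by lra.
have k0 : 0 < k by rewrite lt_min A0 divr_gt0.
have [k1 k2] : k <= (A (0, c)).1 /\ k <= (mA * (A (0, c)).1 - (A (0, c)).2) / (mA + 1).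
  by rewrite !ge_min !lexx orbT.
rewrite ler_pdivlMr// in k2.
have [r r0 Hr] := lipbox_cont (0, c) lA k0.
pose d := Num.min e (r / 2).
have d0 : 0 < d by rewrite lt_min e0 divr_gt0.
have [de dr] : d <= e /\ d <= r / 2 by rewrite !ge_min !lexx orbT.
exists (shiftf (sg * d) A); split.
- by exists (sg * d).
- rewrite /shiftf /=; have h : `|A (0, c - sg * d) - A (0, c)| < k.
    apply: Hr; rewrite line_norm addrC addKr normrN normrM s1 mul1r gtr0_norm//; lra.
  have := le_lt_trans (pnorm1B _ _) h; rewrite ltr_norml => /andP[]; lra.
- rewrite /shiftf /=; have h : `|A (0, c - sg * d) - A (0, c)| < k.
    apply: Hr; rewrite line_norm addrC addKr normrN normrM s1 mul1r gtr0_norm//; lra.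
  have := le_lt_trans (pnorm1B _ _) h; have := le_lt_trans (pnorm2 (_ - _)) h.
  move: (A (0, c)) (A (0, c - sg * d)) k2 => u w /= k2.
  rewrite !ltr_norml => /andP[_ h2] /andP[h1 _]; clear -k2 h1 h2 m0 k0; nra.
- by move=> i im; apply: He => //; rewrite d0.
Qed.

(** The signs at the highest crossing point [c0] persist at [c] slightly above it, where the lines
    of zeros are placed; the opposite signs are reduced to these by reflection in [part2]. *)
Lemma part2_up A B n K (G : nat -> set (R * R)) c0 : pfield n A -> pfield n B ->
  (forall j, (j < K)%N -> clc A B (G j)) ->
  (forall i j, (i < K)%N -> (j < K)%N -> G i = G j -> i = j) ->
  0 < (A (0, c0)).1 -> (B (0, c0)).1 < 0 -> (forall j y, (j < K)%N -> G j (0, y) -> y <= c0) ->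
  (K.+1%:R%:E <= Hc R n.+1)%E.
Proof.
move=> pA pB cG injG A0 B0 top.
have sA := pfield_smooth pA; have sB := pfield_smooth pB.
have lA := smoothf_lipbox sA; have lB := smoothf_lipbox sB.
have [t1 t10 Ht1] := pos_near lA A0; have [t2 t20 Ht2] := neg_near lB B0.
pose th := Num.min t1 t2 / 2.
have th0 : 0 < th by rewrite divr_gt0// lt_min t10.
have [th1 th2] : th < t1 /\ th < t2.
  have [m1 m2] : Num.min t1 t2 <= t1 /\ Num.min t1 t2 <= t2 by rewrite !ge_min !lexx orbT.
  by rewrite /th; split; lra.
pose c := c0 + th; pose c1 := c0 + th / 2; have cc1 : c1 < c by rewrite /c /c1; lra.
have Ac : 0 < (A (0, c)).1 by apply: Ht1; rewrite line_norm addrC addKr gtr0_norm.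
have Bc : (B (0, c)).1 < 0 by apply: Ht2; rewrite line_norm addrC addKr gtr0_norm.
have [l Hl] := clc_lines cG.
have /choice[X HX] : forall j, exists X : R * nat * set (R * R) * R, (j < K)%N -> let: (p, k, U, e) := X in
    [/\ odd k, G j (0, p), chain A B (G j) [set z | G j (mir z)] [set x | G j (0, x) /\ x != p] k p p &
    [/\ open U, G j `<=` U, 0 < e & forall q, `|q - p| < e ->
      chain A B U [set z | U (mir z)] setT k q q -> q = p]].
  move=> j; have [jK|_] := ltnP j K; last by exists (0, 0%N, set0, 0).
  by have [p [k [h1 h2 h3 [U [e h4]]]]] := clc_chain lA lB (cG j jK); exists (p, k, U, e).
pose p j := (X j).1.1.1; pose k j := (X j).1.1.2; pose U j := (X j).1.2.
have {}HX j : (j < K)%N -> [/\ odd (k j), G j (0, p j),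
    chain A B (G j) [set z | G j (mir z)] [set x | G j (0, x) /\ x != p j] (k j) (p j) (p j) &
    [/\ open (U j), G j `<=` U j & exists2 e, 0 < e & forall q, `|q - p j| < e ->
      chain A B (U j) [set z | U j (mir z)] setT (k j) q q -> q = p j]].
  move=> /HX; rewrite /p /k /U; case: (X j) => [[[p' k'] U'] e'] [h1 h2 h3 [h4 h5 h6 h7]].
  by split=> //; split=> //; exists e'.
(* Periodic orbits through a base point are unique, so distinct cycles cannot share it. *)
have pneq i j x : (i < K)%N -> (j < K)%N -> G j (0, x) -> x = p i -> i = j.
  move=> iK jK Gx xp; apply: injG => //; have [on Gp ch _] := HX i iK.
  have [[po _] _ _ _] := cG i iK; have [[po' _] _ _ _] := cG j jK.
  by apply: (porbit_eq lA lB on ch po po' Gp); rewrite -xp.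
have [i e e' e'0 ee H x xl xp|i iK|eta eta0 Heta] := @fin_pos R
    (fun i e => forall x, x \in l -> x != p i -> e < `|x - p i|) K.
- exact: le_lt_trans ee (H x xl xp).
- exact: seq_gap.
have Gl j x : (j < K)%N -> G j (0, x) -> x \in l.
  by move=> jK Gx; rewrite Hl; apply/asboolP; exists j.
pose D := avoid K p (eta / 2) c1.
pose r0 := Num.min (eta / 2) (th / 2).
have r00 : 0 < r0 by rewrite lt_min (divr_gt0 eta0 (ltr0Sn _ 1)) (divr_gt0 th0 (ltr0Sn _ 1)).
have [r1 r2] : r0 <= eta / 2 /\ r0 <= th / 2 by rewrite !ge_min !lexx orbT.
have oD : open D by exact: open_avoid.
have Dn i x : (i < K)%N -> `|x - p i| < r0 -> ~ D x.
  by move=> iK xr [_ /(_ i iK)]; lra.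
have DG j x : (j < K)%N -> G j (0, x) -> x != p j -> D x.
  move=> jK Gx xp; have xc := top _ _ jK Gx; split; first by rewrite /c1; lra.
  move=> i iK; have [ij|ij] := eqVneq i j.
    have := Heta i iK x (Gl _ _ jK Gx); rewrite {1}ij => /(_ xp); lra.
  have xpi : x != p i by apply: contra ij => /eqP /(pneq i j x iK jK Gx) ->.
  by have := Heta i iK x (Gl _ _ jK Gx) xpi; lra.
have [mA1 HmA] : exists m0, forall m, m0 <= m -> forall j z, (j < K)%N -> G j z -> 0 <= z.1 -> 0 < ell c m z.
  apply: (@ell_pos_fin R A B) => [j /cG[[] //]|j y jK Gy].
  by have := top _ _ jK Gy; rewrite /c; lra.
have [mB1 HmB] : exists m0, forall m, m0 <= m -> forall j z, (j < K)%N -> G j (mir z) -> 0 <= z.1 -> 0 < ell c m z.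
  have [|j y jK|m0 Hm0] := @ell_pos_fin R B A K (fun j => [set z | G j (mir z)]) c.
  - by move=> j /cG[[/porbit_mir]].
  - by rewrite /= mir_line => Gy; have := top _ _ jK Gy; rewrite /c; lra.
  - by exists m0.
pose mA := Num.max (Num.max mA1 0) ((A (0, c)).2 / (A (0, c)).1 + 1).
have [mA11 mA12 mA13] : [/\ mA1 <= mA, 0 <= mA & (A (0, c)).2 / (A (0, c)).1 < mA].
  have h : (A (0, c)).2 / (A (0, c)).1 + 1 <= mA by rewrite le_max lexx orbT.
  by split; [rewrite !le_max lexx|rewrite !le_max lexx orbT|lra].
have aA : 0 < mA * (A (0, c)).1 - (A (0, c)).2 by rewrite subr_gt0 -ltr_pdivrMr.
have nB0 : 0 < - (B (0, c)).1 by rewrite oppr_gt0.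
pose mB := Num.max mB1 (- (B (0, c)).2 / - (B (0, c)).1 + 1).
have [mB11 mB12] : mB1 <= mB /\ - (B (0, c)).2 / - (B (0, c)).1 < mB.
  have h : - (B (0, c)).2 / - (B (0, c)).1 + 1 <= mB by rewrite le_max lexx orbT.
  by split; [rewrite le_max lexx|lra].
have aB : 0 < mB * - (B (0, c)).1 - - (B (0, c)).2 by rewrite subr_gt0 -ltr_pdivrMr.
pose VA j := U j `&` [set z | 0 < ell c mA z].
pose VB j := [set z | U j (mir z)] `&` [set z | 0 < ell c mB z].
have oell m : open [set z : R * R | 0 < ell c m z].
  apply: open_balls => z /= z0.
  have sl : lipbox (fun z => (ell c m z, 0 : R)).
    by apply/smoothf_lipbox; split; [exact: pf_smooth (pf_ell c m)|exact: smooth_cst].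
  by have [e e0 He] := @pos_near R (fun z => (ell c m z, 0 : R)) z sl z0; exists e.
have oVA j : (j < K)%N -> open (VA j) by move=> /HX[_ _ _ [oU _ _]]; exact: openI.
have oVB j : (j < K)%N -> open (VB j).
  by move=> /HX[_ _ _ [oU _ _]]; apply: openI => //; exact: open_mir.
have iso j : (j < K)%N -> isolated_cycle A B (VA j) (VB j) D (k j) (p j).
  move=> jK; have [on Gp ch [oU GU [e e0 He]]] := HX j jK; split.
    apply: chainS (chain_right ch) => [z [Gz z0]|z [Gz z0]|x [Gx xp]].
    - by split; [exact: GU|exact: (HmA mA mA11 j)].
    - by split; [exact: GU|exact: (HmB mB mB11 j)].
    - exact: DG Gx xp.
  exists e => // q qe cq; apply: He => //.
  by apply: chainS cq => // z [].
pose Q j sg (b : cell R) := [/\ shifted A B sg b, [/\ cVA b = VA j, cVB b = VB j & cD b = D],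
    p j - r0 <= ca b & cb b <= p j + r0].
have cross i j sg sg' b b' : (i < K)%N -> (j < K)%N -> i != j -> Q i sg b -> Q j sg' b' -> cdisj b b'.
  move=> iK jK ij [_ [_ _ Db] b1 b2] [_ [_ _ Db'] b1' b2'].
  have [_ Gpi _ _] := HX i iK; have [_ Gpj _ _] := HX j jK.
  have pij : p j != p i by apply: contra ij => /eqP /(pneq i j _ iK jK Gpj) ->.
  have gap := Heta i iK (p j) (Gl _ _ jK Gpj) pij.
  split; last first.
    move=> x /andP[xa xb]; rewrite Db'; apply: (Dn i) => //.
    by rewrite ltr_norml; apply/andP; split; clear -xa xb b1 b2; lra.
  have [pp|pp] := ltP (p i) (p j).
    by left; move: gap; rewrite gtr0_norm ?subr_gt0//; clear -b2 b1' r1; lra.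
  by right; move: gap; rewrite ler0_norm ?subr_le0//; clear -b1 b2' r1; lra.
have [m [C [m' [C' [H1 H2 mm]]]]] : exists m C m' C',
    [/\ cells (fun b => exists2 j, (j < K)%N & Q j 1 b) m C,
        cells (fun b => exists2 j, (j < K)%N & Q j (-1) b) m' C' & (K.*2 <= m + m')%N].
  suff : forall K', (K' <= K)%N -> exists m C m' C',
    [/\ cells (fun b => exists2 j, (j < K')%N & Q j 1 b) m C,
        cells (fun b => exists2 j, (j < K')%N & Q j (-1) b) m' C' & (K'.*2 <= m + m')%N] by exact.
  elim=> [_|K' IH K'K].
    by exists 0%N, (fun=> Cell setT setT setT 0 0 0), 0%N, (fun=> Cell setT setT setT 0 0 0); split.
  have [m [C [m' [C' [H1 H2 mm]]]]] := IH (ltnW K'K).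
  have [on _ _ _] := HX K' K'K.
  have [a [Ca [a' [Ca' [Ha Ha' aa]]]]] := isolated_split (oVA _ K'K) (oVB _ K'K) oD sA sB on
    (iso _ K'K) r00 (fun x => @Dn K' x K'K).
  have dj sg b b' : (exists2 j, (j < K')%N & Q j sg b) -> Q K' sg b' -> cdisj b b' /\ cdisj b' b.
    move=> [j jK' Qb] Qb'; have jK : (j < K)%N by exact: ltn_trans K'K.
    by split; [apply: (cross j K' _ _ _ _ jK K'K _ Qb Qb')|apply: (cross K' j _ _ _ _ K'K jK _ Qb' Qb)];
      rewrite ?(ltn_eqF jK')// gtn_eqF.
  have wk sg b : (exists2 j, (j < K')%N & Q j sg b) \/ Q K' sg b -> exists2 j, (j < K'.+1)%N & Q j sg b.
    by move=> [[j jK' Qb]|Qb]; [exists j => //; exact: ltnW|exists K'].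
  exists (m + a)%N, (fun i => if (i < m)%N then C i else Ca (i - m)%N),
         (m' + a')%N, (fun i => if (i < m')%N then C' i else Ca' (i - m')%N); split.
  - exact: cellsW (wk 1) (cells_cat H1 Ha (dj 1)).
  - exact: cellsW (wk (-1)) (cells_cat H2 Ha' (dj (-1))).
  - by rewrite doubleS addnACA -addn2 leq_add.
have fin sg M Cs : `|sg| = 1 -> (K <= M)%N -> cells (fun b => exists2 j, (j < K)%N & Q j sg b) M Cs ->
    (K.+1%:R%:E <= Hc R n.+1)%E.
  move=> s1 KM Hs.
  have [b [j _ []]//|A' [[d AE] A'0 aA' win]] :=
    @shifted_cells A B sg c mA _ M Cs lA s1 Ac mA12 aA Hs.
  apply: (@le_trans _ _ (M.+1%:R%:E)); first by rewrite lee_fin ler_nat.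
  have pA' : pfield n A' by rewrite AE; exact: pfield_shift.
  apply: (@add_window R A' B n c c1 mA mB M Cs pA' pB A'0 Bc aA' aB cc1).
  have [Hs1 Hs2] := Hs; split=> // i iM; have [j jK [_ [bA bB bD] b1 b2]] := Hs1 i iM.
  split; rewrite ?bA ?bB ?bD.
  - exact: win.
  - by split; [exact: oVA|exact: oVB|exact: oD].
  - by move=> z [].
  - by move=> z [].
  - split; last by move=> x [].
    by have [_ Gp _ _] := HX j jK; have := top j _ jK Gp; rewrite /c1; clear -r2 b2; lra.
(* The two signs together have at least [2 K] windows, but only one shift can be applied; one of the
   signs has at least [K]. *)
have [Km|mK] := leqP K m; first by apply: (fin 1 m C) => //; rewrite normr1.
apply: (fin (-1) m' C') => //; first by rewrite normrN1.
rewrite -addnn in mm; rewrite -(leq_add2l K); apply: leq_trans mm _.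
by rewrite leq_add2r ltnW.
Qed.

Lemma part2 A B n K (G : nat -> set (R * R)) : pfield n A -> pfield n B ->
  (forall j, (j < K)%N -> clc A B (G j)) ->
  (forall i j, (i < K)%N -> (j < K)%N -> G i = G j -> i = j) ->
  (K.+1%:R%:E <= Hc R n.+1)%E.
Proof.
move=> pA pB cG inj; have [l Hl] := clc_lines cG.
have [K0|K0] := posnP K.
  (* Without cycles there is no crossing point from which to build. A constant field crossing the
     line is taken; the left one is folded, hence the sign -1. *)
  subst K; apply: (@part2_up (fun=> (1, 0)) (fun=> (-1, 0)) n 0 G 0) => //=.
  - by split; exact: pf_cst.
  - by split; exact: pf_cst.
have ln : l != [::].
  have [_ [[z1 z2] [Gz z0]] _ _] := cG 0%N K0.
  have : z2 \in l by rewrite Hl; apply/asboolP; exists 0%N => //; have <- : z1 = 0 := z0.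
  by case: l {Hl}.
have [c0 c0l Hc0] := seq_max ln.
have top j y : (j < K)%N -> G j (0, y) -> y <= c0.
  by move=> jK Gy; apply: Hc0; rewrite Hl; apply/asboolP; exists j.
move: c0l; rewrite Hl => /asboolP[j jK Gc].
have [_ _ _ cr] := cG j jK; have [_ /=] := cr (0, c0) (conj Gc erefl).
rewrite /fold mir_line /= mulrN oppr_gt0 => AB.
have [A0|A0] := ltP 0 (A (0, c0)).1.
  by apply: (part2_up pA pB cG inj A0 _ top); move: AB; rewrite pmulr_rlt0.
have {}A0 : (A (0, c0)).1 < 0.
  by rewrite lt_neqAle A0 andbT; apply/eqP => A00; rewrite A00 mul0r ltxx in AB.
have B0 : 0 < (B (0, c0)).1 by move: AB; rewrite nmulr_rlt0.
apply: (@part2_up B A n K (fun j => [set z | G j (mir z)]) c0) => //.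
- by move=> i iK; apply/clc_mir/cG.
- move=> i i' iK i'K E; apply: inj => //; apply/seteqP; split=> z Gz; rewrite -(mirK z).
    by have : [set z | G i' (mir z)] (mir z) by rewrite -E /= mirK.
  by have : [set z | G i (mir z)] (mir z) by rewrite E /= mirK.
- by move=> i y iK /=; rewrite mir_line; exact: top.
Qed.

End PartTwo.

(** * Many cycles in many wells *)

Section Wells.
Variable R : realType.
Implicit Types (z w : R * R) (a b c d e h m r s t u x y p : R) (g G N rho tau : R -> R)
  (V VA VB : set (R * R)) (D : set R) (A B F : R * R -> R * R).

(** Both [down g] and [up g rho 0] have the first integral [x + G y], with [G] a primitive of [g]; a
    pair [b < a] on one level thus bounds an arc [x = G a - G y] of the centre. *)
Definition level g G b a := [/\ b < a, G b = G a, g b < 0 /\ 0 < g a, continuous G &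
  forall y, b < y < a -> is_derive y 1 G (g y) /\ G y < G a].

Definition down g z : R * R := (g z.2, -1).
Definition up g rho u z : R * R := (- g z.2 - u * rho z.1, 1).

Lemma cont_affine G c d : continuous G -> continuous (fun t => G (c + d * t)).
Proof.
move=> cG t; apply: (continuous_comp (f := fun t => c + d * t)); last exact: cG.
by apply: cvgD; [exact: cvg_cst|apply: cvgM; [exact: cvg_cst|exact: cvg_id]].
Qed.

Lemma derive_lin c d t : is_derive t 1 (fun t => c + d * t) d.
Proof.
have := is_deriveD (is_derive_cst c t 1) (is_deriveZ d (is_derive_id t (1 : R))).
by rewrite add0r -[d *: 1]/(d * 1) mulr1.
Qed.

Lemma derive_affine G c d t e : is_derive (c + d * t) 1 G e -> is_derive t 1 (fun t => G (c + d * t)) (d * e).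
Proof.
move=> DG; have D1 := derive_lin c d t.
by have := is_derive1_comp (f := G) (g := fun t => c + d * t) DG D1; rewrite mulrC.
Qed.

Lemma level_down V g G b a : level g G b a -> (forall y, b <= y <= a -> V (G a - G y, y)) ->
  hpass V (down g) a b.
Proof.
move=> [ba Gba [gb ga] cG DG] HV; split=> //; exists (a - b), (fun t => (G a - G (a + -1 * t), a + -1 * t)).
split=> /=.
- by rewrite subr_ge0 ltW.
- by rewrite mulr0 addr0 subrr.
- by rewrite (_ : a + _ = b) ?Gba ?subrr//; ring.
- split=> [t|t|t tI] /=.
  + by apply: cvgB; [exact: cvg_cst|exact: cont_affine].
  + by apply: cvgD; [exact: cvg_cst|apply: cvgM; [exact: cvg_cst|exact: cvg_id]].
  + have [|D1 _] := DG (a + -1 * t); first by lra.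
    split; last exact: derive_lin.
    have := is_deriveB (is_derive_cst (G a) t 1) (derive_affine D1).
    by rewrite sub0r (mulN1r (g _)) opprK.
- by move=> t tI; rewrite subr_gt0; have [|_] := DG (a + -1 * t); first by lra.
- by move=> t tI; apply: HV; lra.
- by [].
- by apply: Or33.
Qed.

Lemma level_up V g G b a rho : level g G b a -> (forall y, b <= y <= a -> V (G a - G y, y)) ->
  hpass V (up g rho 0) b a.
Proof.
move=> [ba Gba [gb ga] cG DG] HV.
split; first by rewrite /= mul0r subr0 oppr_gt0.
exists (a - b), (fun t => (G a - G (b + 1 * t), b + 1 * t)).
split=> /=.
- by rewrite subr_ge0 ltW.
- by rewrite mulr0 addr0 Gba subrr.
- by rewrite (_ : b + _ = a) ?subrr//; ring.
- split=> [t|t|t tI] /=.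
  + by apply: cvgB; [exact: cvg_cst|exact: cont_affine].
  + by apply: cvgD; [exact: cvg_cst|apply: cvgM; [exact: cvg_cst|exact: cvg_id]].
  + have [|D1 _] := DG (b + 1 * t); first by lra.
    split; last exact: derive_lin.
    have := is_deriveB (is_derive_cst (G a) t 1) (derive_affine D1).
    by rewrite sub0r mul1r mul0r subr0.
- by move=> t tI; rewrite subr_gt0; have [|_] := DG (b + 1 * t); first by lra.
- by move=> t tI; apply: HV; lra.
- by rewrite mul0r subr0 oppr_lt0.
- by apply: Or33; split=> //; rewrite mul0r subr0 oppr_gt0.
Qed.

(** [N (a - b)] is the Melnikov integral of [rho] along the unperturbed arc from [b] to [a], given
    through a primitive so that only derivatives have to be handled. *)
Definition fluct rho G b a s := exists N, [/\ N 0 = 0, continuous N,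
  forall t, 0 < t < a - b -> is_derive t 1 N (rho (G b - G (b + t))) & 0 < s * N (a - b)].

(** A first mean value bound gives [X - x0 = O(u)]; inserted in [rho (X t) - rho (x0 t)], it makes
    the remaining error quadratic in [u]. *)
Lemma second_order (X x0 N : R -> R) rho u r S L M : 0 <= u -> 0 <= S -> 0 <= L -> 0 <= M ->
  continuous X -> continuous x0 -> continuous N -> X 0 = 0 -> x0 0 = 0 -> N 0 = 0 ->
  (forall t, 0 < t < S -> is_derive t 1 (fun t => X t - x0 t) (- (u * rho (X t)))) ->
  (forall t, 0 < t < S -> is_derive t 1 N (rho (x0 t))) ->
  (forall t, 0 < t < S -> `|X t| <= r /\ `|x0 t| <= r) ->
  (forall x, `|x| <= r -> `|rho x| <= M) ->
  (forall x y, `|x| <= r -> `|y| <= r -> `|rho x - rho y| <= L * `|x - y|) ->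
  `|X S - x0 S + u * N S| <= u ^+ 2 * (L * M * S ^+ 2).
Proof.
move=> u0 S0 L0 M0 cX cx cN X0 x00 N0 DX DN Hr HM HL.
have cd : continuous (fun t => X t - x0 t) by move=> t; apply: cvgB; [exact: cX|exact: cx].
have b1 t : 0 <= t <= S -> `|X t - x0 t| <= u * M * S.
  move=> /andP[t0 tS]; have := @mvt_abs R (fun t => X t - x0 t) _ 0 t (u * M) t0 cd.
  rewrite X0 x00 !subr0 => H; apply: le_trans (H (fun t => - (u * rho (X t))) _ _) _.
  - by move=> v vI; apply: DX; lra.
  - move=> v vI; have [|h _] := Hr v; first by lra.
    by rewrite normrN normrM ger0_norm// ler_wpM2l// HM.
  - by rewrite ler_wpM2l// mulr_ge0.
have := @mvt_abs R (fun t => X t - x0 t + u * N t)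
  (fun t => - (u * rho (X t)) + u * rho (x0 t)) 0 S (u * (L * (u * M * S))) S0.
rewrite X0 x00 N0 mulr0 addr0 !subr0 => H; apply: le_trans (H _ _ _) _.
- move=> t; apply: cvgD; first exact: cd.
  by apply: cvgM; [exact: cvg_cst|exact: cN].
- by move=> t tI; exact: is_deriveD (DX t tI) (is_deriveZ u (DN t tI)).
- move=> t tI; have [h1 h2] := Hr t tI.
  rewrite -mulrN -mulrDr normrM ger0_norm// ler_wpM2l// -normrN opprD opprK.
  by apply: le_trans (HL _ _ h1 h2) _; rewrite ler_wpM2l// b1//; lra.
- by rewrite le_eqVlt; apply/orP; left; apply/eqP; ring.
Qed.

(* The first coordinate of the perturbed orbit is x0 - u (N + O(u)), where x0 is the first coordinate of
   the unperturbed orbit and N is the integral of rho (x0). *)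
Lemma fluct_sign g G b a rho s r : level g G b a -> slip (fun z => rho z.1) ->
  (forall y, b <= y <= a -> `|G a - G y| <= r) -> 0 < r -> `|s| = 1 -> fluct rho G b a s ->
  exists2 e, 0 < e & forall u y, 0 < u <= e -> `|y - a| < e ->
    hpass [set z | `|z| < r] (up g rho u) b y -> s * (y - a) < 0.
Proof.
move=> [ba Gba [gb ga] cG DG] sr Gr r0 s1 [N [N0 cN DN NT]].
have [L L0 HL] := sr r; have [M M0 HM] := slip_bound r sr.
pose T := a - b; have T0 : 0 < T by rewrite subr_gt0.
have nz : 0 < s * N T / 2 by rewrite divr_gt0.
have [e1 e10 He1] := cont_ed (cN T) nz.
pose k := L * M * (T + 1) ^+ 2.
have k0 : 0 < k by rewrite !mulr_gt0// addr_gt0.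
pose e := Num.min (Num.min e1 1) (s * N T / 2 / (k + 1)).
have k1 : 0 < k + 1 by rewrite addr_gt0.
exists e => [|u y /andP[u0 ue] ye [_ [T' [f [T'0 f0 fT' [c1 c2 Df] fp fV _ _]]]]].
  by rewrite !lt_min e10 ltr01 divr_gt0.
have [E1 E2 E3] : [/\ e <= e1, e <= 1 & e <= s * N T / 2 / (k + 1)].
  by rewrite !ge_min !lexx !orbT.
have Y t : 0 <= t <= T' -> (f t).2 = b + t.
  move=> /andP[t0 tT]; have DY v : 0 < v < t -> is_derive v 1 (fun t => (f t).2 - t) 0.
    move=> vI; have [_ D2] := Df v ltac:(by clear -vI t0 tT; lra); have := is_deriveB D2 (is_derive_id v (1 : R)).
    by rewrite /= subrr.
  have := @mvt_abs R (fun t => (f t).2 - t) (fun=> 0) 0 t 0 t0 _ DY.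
  rewrite f0 subr0 mul0r => h; suff : (f t).2 - t - b == 0 by rewrite subr_eq0 => /eqP <-; rewrite subrK.
  rewrite -normr_le0; apply: h => [v|v _]; last by rewrite normr0.
  by apply: cvgB; [exact: c2|exact: cvg_id].
have yT : y = b + T' by rewrite -Y ?fT' ?T'0 ?lexx.
rewrite real_ltNge ?num_real//; apply/negP => sy.
(* The arcs are compared at the earlier exit time, where one first coordinate is zero and the other
   nonnegative. If [y] lay on the wrong side of [a], this would contradict the sign of [N]. *)
pose S := Num.min T T'.
have [S1 S2] : S <= T /\ S <= T' by rewrite !ge_min !lexx orbT.
have S0 : 0 <= S by rewrite le_min T'0 ltW.
pose x0 t := G a - G (b + 1 * t).
have cx : continuous x0 by move=> t; apply: cvgB; [exact: cvg_cst|exact: cont_affine].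
have Dx t : 0 < t < T -> is_derive t 1 x0 (- g (b + t)).
  move=> tI; have [|D1 _] := DG (b + 1 * t); first by move: tI; rewrite /T; clear; lra.
  have := is_deriveB (is_derive_cst (G a) t 1) (derive_affine D1).
  by rewrite sub0r !mul1r.
have x00 : x0 0 = 0 by rewrite /x0 mulr0 addr0 Gba subrr.
have Xb t : 0 <= t <= T' -> `|(f t).1| <= r.
  by move=> /fV /= fr; exact: le_trans (pnorm1 _) (ltW fr).
have xb t : 0 <= t <= T -> `|x0 t| <= r by move=> tI; apply: Gr; move: tI; rewrite /T; clear; lra.
have ST t : 0 < t < S -> 0 < t < T /\ 0 < t < T'.
  by move=> /andP[t0 tS]; rewrite t0 !(lt_le_trans tS).
have /second_order : forall t, 0 < t < S -> is_derive t 1 (fun t => (f t).1 - x0 t) (- (u * rho (f t).1)).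
  move=> t /ST[tT tT']; have [D1 _] := Df t tT'.
  have := is_deriveB D1 (Dx t tT); rewrite /= Y; last by clear -tT'; lra.
  by rewrite (_ : _ - _ - - _ = - (u * rho (f t).1)) //; ring.
move=> /(_ N r L M (ltW u0) S0 (ltW L0) (ltW M0) c1 cx cN) E.
have {}E : `|(f S).1 - x0 S + u * N S| <= u ^+ 2 * (L * M * S ^+ 2).
  apply: E => //.
  - by rewrite f0.
  - by move=> t /ST[tT _]; rewrite /x0 mul1r -Gba; exact: DN.
  - by move=> t /ST[tT tT']; split; [apply: Xb; clear -tT'|apply: xb; clear -tT]; lra.
  - by move=> x xr; apply: (HM (x, 0)); rewrite pnorm_le/= xr normr0 ltW.
  - move=> x x' xr xr'; apply: le_trans (HL (x, 0) (x', 0) _ _) _; rewrite ?pnorm_le/= ?xr ?xr' ?normr0 ?(ltW r0)//.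
    rewrite ler_wpM2l ?(ltW L0)// pnorm_le /= lexx subrr normr0 /=; exact: normr_ge0.
have Sk : L * M * S ^+ 2 <= k.
  rewrite /k ler_wpM2l ?mulr_ge0 ?(ltW L0) ?(ltW M0)// ler_sqr ?nnegrE; clear -S0 S1 T0; lra.
have fn t : 0 <= t <= T' -> 0 <= (f t).1.
  move=> /andP[t0 tT']; move: t0; rewrite le_eqVlt => /predU1P[<-|t0]; first by rewrite f0.
  by move: tT'; rewrite le_eqVlt => /predU1P[->|tT']; [rewrite fT'|rewrite ltW// fp// t0].
have xn t : 0 <= t <= T -> 0 <= x0 t.
  move=> /andP[t0 tT]; move: t0; rewrite le_eqVlt => /predU1P[<-|t0]; first by rewrite x00.
  move: tT; rewrite le_eqVlt => /predU1P[->|tT]; rewrite /x0 mul1r /T.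
    by rewrite (addrC b) subrK subrr.
  by rewrite subr_ge0 ltW//; have [|_ //] := DG (b + t); move: tT; rewrite /T; clear -t0; lra.
have s2 : s = 1 \/ s = -1 by move: s1; case: ger0P => _ h; [left|right; rewrite -h opprK].
have sS : 0 <= s * ((f S).1 - x0 S).
  have [[sE TT]|[sE TT]] : (s = 1 /\ T <= T') \/ (s = -1 /\ T' <= T).
    by case: s2 => sE; [left|right]; split=> //; move: sy; rewrite sE yT /T; clear; lra.
  - have -> : S = T by apply/min_idPl.
    rewrite sE mul1r; have -> : x0 T = 0 by rewrite /x0 mul1r /T (addrC b) subrK subrr.
    by rewrite subr0 fn// TT ltW.
  - have -> : S = T' by apply/min_idPr.
    by rewrite sE mulN1r opprB fT' subr0 xn// T'0.
have NS : s * N T / 2 < s * N S.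
  have h : `|N S - N T| < s * N T / 2.
    apply: He1; rewrite yT in ye; have ye' : `|b + T' - a| < e1 by exact: lt_le_trans E1.
    move: ye'; rewrite !ltr_norml => /andP[h1 h2]; apply/andP.
    have [h|h] : S = T \/ S = T' by rewrite /S; case: ltP => _; [left|right].
      by rewrite h subrr; clear -e10; lra.
    by rewrite h /T; clear -h1 h2; lra.
  have h' : `|s * (N S - N T)| < s * N T / 2 by rewrite normrM s1 mul1r.
  by move: h'; rewrite ltr_norml mulrBr => /andP[h1 _]; clear -h1; lra.
have h1 : `|s * ((f S).1 - x0 S + u * N S)| <= u * (u * k).
  rewrite normrM s1 mul1r; apply: le_trans E _.
  by rewrite expr2 -(mulrA u u) !(ler_wpM2l (ltW u0)).
have h2 : u * (s * N S) <= u * (u * k).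
  have := le_trans (ler_norm _) h1; rewrite mulrDr (mulrCA s u).
  by clear -sS; lra.
rewrite (ler_pM2l u0) in h2.
have h3 : u * (k + 1) <= s * N T / 2 by rewrite -ler_pdivlMr//; exact: le_trans E3.
rewrite mulrDr mulr1 in h3; clear -h2 h3 u0 NS; lra.
Qed.

Definition well g G m := [/\ continuous G, forall y, m - 1 < y < m + 1 -> is_derive y 1 G (g y),
  forall y, m - 1 < y < m -> g y < 0 & forall y, m < y < m + 1 -> 0 < g y].

Lemma well_inc g G m x y : well g G m -> m <= x -> x < y -> y < m + 1 -> G x < G y.
Proof.
move=> [cG DG _ gp] mx xy ym; apply: (@mvt_lt R G g) => // t tI; [apply: DG|apply: gp]; lra.
Qed.

Lemma well_dec g G m x y : well g G m -> m - 1 < x -> x < y -> y <= m -> G y < G x.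
Proof.
move=> [cG DG gn _] mx xy ym; rewrite -ltrN2.
apply: (@mvt_lt R (fun t => - G t) (fun t => - g t)) => // [t|t tI|t tI].
- exact: continuousN (cG t).
- by apply: is_deriveN; apply: DG; lra.
- by rewrite oppr_gt0; apply: gn; lra.
Qed.

Lemma well_level g G m b a : well g G m -> m - 1 < b < m -> m < a < m + 1 -> G b = G a -> level g G b a.
Proof.
move=> w bI aI E; have [cG DG gn gp] := w; split=> //; first by lra.
  by split; [exact: gn|exact: gp].
move=> y yI; split; first by apply: DG; lra.
have [ym|/ltW ym] := leP m y; first by apply: (well_inc w ym); lra.
by rewrite -E; apply: (well_dec w _ _ ym); lra.
Qed.

(** Every amplitude up to [a] gets a partner on the left, so that the whole window, and not only its
    ends, carries closed unperturbed chains. *)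
Definition reach_left G m b0 a := forall y, m < y <= a -> exists2 b, b0 < b < m & G b = G y.

Lemma well_amp g G m e : well g G m -> 0 < e <= 1 -> exists2 a, m < a < m + e & reach_left G m (m - e) a.
Proof.
move=> w eI; have [cG DG gn gp] := w.
have h : G m < G (m - e / 2) by apply: (well_dec w); lra.
rewrite -subr_gt0 in h; have [d d0 Hd] := cont_ed (cG m) h.
pose k := Num.min e d / 2.
have k0 : 0 < k by rewrite divr_gt0// lt_min d0; lra.
have [ke kd] : k < e /\ k < d.
  have [m1 m2] : Num.min e d <= e /\ Num.min e d <= d by rewrite !ge_min !lexx orbT.
  by rewrite /k in k0 *; split; lra.
exists (m + k) => [|y yI]; first by lra.
have Gy : G m < G y by apply: (well_inc w); lra.
have Gye : G y < G (m - e / 2).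
  have /Hd : `|y - m| < d by rewrite ger0_norm; lra.
  by rewrite ltr_norml => /andP[_]; lra.
have [||b bI E] := @ivt_dec R G (m - e / 2) m (G y) _ cG; [by lra|by lra|].
exists b => //; have bm : b != m by apply/eqP => bm; move: Gy; rewrite -E bm ltxx.
by have : b < m by [rewrite lt_neqAle bm; case/andP: bI]; lra.
Qed.

(* On (0, h) the last factor has the sign of s, so the integrand has it along every small orbit. *)
Lemma well_fluct g G m (p : nat) tau s h e : well g G m -> 0 < h -> 0 < e <= 1 -> continuous tau -> `|s| = 1 ->
  (forall x, 0 < x < h -> 0 < s * tau x) ->
  exists a b, [/\ m < a < m + e, m - 1 < b < m, G b = G a, reach_left G m (m - 1) a &
    fluct (fun x => x ^+ p * tau x) G b a s].
Proof.
move=> w h0 eI ct s1 Hs; have [cG DG gn gp] := w.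
have h2 : 0 < h / 2 by rewrite divr_gt0.
have [d d0 Hd] := cont_ed (cG m) h2.
have eI' : 0 < Num.min e d <= 1 by rewrite lt_min d0 ge_min; case/andP: eI => -> ->.
have [me md] : Num.min e d <= e /\ Num.min e d <= d by rewrite !ge_min !lexx orbT.
have [a aI ra] := well_amp w eI'.
have [|b bI E] := ra a; first by rewrite lexx andbT; case/andP: aI.
have [eI1 eI2] := andP eI.
exists a, b; split=> //; try lra.
  by move=> y /ra[b' b'I E']; exists b' => //; lra.
have [ba _ _ _ GL] : level g G b a by apply: (well_level w) => //; lra.
pose f t := G b - G (b + 1 * t).
have cf : continuous f by move=> t; apply: cvgB; [exact: cvg_cst|exact: cont_affine].
have cr : continuous (fun t => f t ^+ p * tau (f t)).
  move=> t; apply: cvgM; last exact: continuous_comp (cf t) (ct (f t)).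
  by apply: (continuous_comp (g := fun x => x ^+ p)); [exact: cf|exact: exprn_continuous].
have [N [N0 cN DN]] := antideriv cr.
have fh t : 0 < t < a - b -> 0 < f t < h.
  move=> tI; have [|_ lt] := GL (b + t); first by lra.
  rewrite /f mul1r E subr_gt0 lt -E /=.
  have /Hd : `|b - m| < d by rewrite ltr0_norm; lra.
  have /Hd : `|b + t - m| < d by rewrite ltr_norml; lra.
  by rewrite !ltr_norml => /andP[h3 _] /andP[_ h4]; lra.
exists N; split=> //; first by rewrite N0.
  by move=> t /andP[t0 _]; have := DN t t0; rewrite /f mul1r.
have := @mvt_lt R (fun t => s * N t) (fun t => s * (f t ^+ p * tau (f t))) 0 (a - b).
rewrite N0// mulr0; apply => [|t|t /andP[t0 _]|t tI]; first by rewrite subr_gt0.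
- by apply: cvgM; [exact: cvg_cst|exact: cN].
- by have := is_deriveZ s (DN t t0).
- have ft := fh t tI; have [f0 _] := andP ft.
  by rewrite mulrCA mulr_gt0 ?exprn_gt0//; exact: Hs.
Qed.

Lemma fluct_add rho rho' G b a s : continuous G -> continuous rho' -> b < a -> `|s| = 1 -> fluct rho G b a s ->
  exists2 e, 0 < e & forall c, `|c| <= e -> fluct (fun x => rho x + c * rho' x) G b a s.
Proof.
move=> cG cr ba s1 [N [N0 cN DN NT]].
pose f t := G b - G (b + 1 * t).
have cf : continuous f by move=> t; apply: cvgB; [exact: cvg_cst|exact: cont_affine].
have cr' : continuous (rho' \o f) by move=> t; exact: continuous_comp (cf t) (cr (f t)).
have [N' [N'0 cN' DN']] := antideriv cr'.
have k0 : 0 < `|N' (a - b)| + 1 by rewrite ltr_wpDl.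
exists (s * N (a - b) / (`|N' (a - b)| + 1)) => [|c ce]; first exact: divr_gt0.
exists (fun t => N t + c * N' t); split.
- by rewrite N0 N'0// mulr0 addr0.
- by move=> t; apply: cvgD; [exact: cN|apply: cvgM; [exact: cvg_cst|exact: cN']].
- move=> t tI; have [t0 _] := andP tI; have := is_deriveD (DN t tI) (is_deriveZ c (DN' t t0)).
  by rewrite /= /f mul1r.
- rewrite ler_pdivlMr// mulrDr mulr1 in ce.
  have : - (s * (c * N' (a - b))) <= `|c| * `|N' (a - b)|.
    by apply: le_trans (ler_norm _) _; rewrite normrN !normrM s1 mul1r.
  have := normr_ge0 c; have [->|c0] := eqVneq c 0; first by rewrite normr0 !mul0r !addr0.
  rewrite -normr_gt0 in c0; rewrite mulrDr; lra.
Qed.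

Lemma down_lip g : smooth (fun z : R * R => g z.2) -> lipbox (down g).
Proof. by move=> sg; apply: smoothf_lipbox; split; [exact: sg|exact: smooth_cst]. Qed.

Lemma up_lip g rho u : smooth (fun z : R * R => g z.2) -> smooth (fun z : R * R => rho z.1) ->
  lipbox (up g rho u).
Proof.
move=> sg sr; apply: smoothf_lipbox; split; last exact: smooth_cst.
rewrite (_ : (fun z => _) = fun z => -1 * g z.2 + - u * rho z.1).
  by apply: smoothD; (apply: smoothM; first exact: smooth_cst).
by apply/funext => z /=; ring.
Qed.

Lemma up_close g rho r : slip (fun z => rho z.1) -> 0 < r ->
  exists2 e, 0 < e & forall u, 0 < u <= e -> fclose r (up g rho 0) (up g rho u).
Proof.
move=> sr r0; have [M M0 HM] := slip_bound r^-1 sr.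
exists (r / M) => [|u /andP[u0 ue] z zr]; first exact: divr_gt0.
rewrite pnorm_le /= subrr normr0 (ltW r0) andbT mul0r subr0 opprK addrAC addNr add0r normrN normrM.
rewrite ler_pdivlMr// in ue; rewrite gtr0_norm//; apply: le_trans ue.
by rewrite ler_wpM2l ?HM// ltW.
Qed.

(** Opposite signs of [fluct] at two amplitudes push the returns to opposite sides. Intermediate
    points lie below the bottom [m] and base points above it, so [D] misses the base intervals of
    the well. *)
Lemma well_window g G m rho a0 b0 a1 b1 s : smooth (fun z : R * R => g z.2) ->
  smooth (fun z : R * R => rho z.1) -> well g G m -> m < a1 -> a1 < a0 -> a0 < m + 1 ->
  m - 1 < b0 < m -> m - 1 < b1 < m -> G b0 = G a0 -> G b1 = G a1 -> reach_left G m (m - 1) a0 ->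
  `|s| = 1 -> fluct rho G b0 a0 s -> fluct rho G b1 a1 (- s) ->
  exists V, open V /\ exists2 e, 0 < e & forall u, 0 < u <= e ->
    window (down g) (up g rho u) V V [set x | m - 1 < x < m] 1 a1 a0.
Proof.
move=> sg sr w ma a10 am b0I b1I E0 E1 ra s1 fl0 fl1; have [cG _ _ _] := w.
have cid : continuous (fun t : R => t) by move=> t; exact: cvg_id.
have [M M0 HM] := @curve_bounded R (fun t => (G t, t)) (m - 1) (m + 1) cG cid.
have Gy y : m - 1 <= y <= m + 1 -> `|G y| <= M /\ `|y| <= M.
  by move=> /HM; rewrite pnorm_le => /andP[].
pose r := M + M + 1; have r0 : 0 < r by rewrite /r; lra.
pose V := [set z : R * R | `|z| < r]; pose D := [set x | m - 1 < x < m].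
have oV : open V.
  rewrite (_ : V = [set z | `|z - 0| < r]); first exact: pball_open.
  by apply/seteqP; split=> z /=; rewrite subr0.
have oD : open D.
  rewrite (_ : D = `]m - 1, m[%classic); first exact: interval_open.
  by apply/seteqP; split=> x; rewrite /= in_itv.
have Gd a y : m - 1 <= a <= m + 1 -> m - 1 <= y <= m + 1 -> `|G a - G y| <= r /\ V (G a - G y, y).
  move=> /Gy[h1 h2] /Gy[h3 h4]; have h := ler_normB (G a) (G y).
  split; first by rewrite /r; lra.
  by rewrite /V /= pnorm_lt /=; apply/andP; split; rewrite /r; lra.
have lv a b : m < a < m + 1 -> m - 1 < b < m -> G b = G a -> level g G b a /\
    hpass V (down g) a b /\ hpass V (up g rho 0) b a.
  move=> aI bI E; have l := well_level w bI aI E; split=> //.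
  by split; [apply: (level_down l)|apply: (level_up rho l)] => y yI; apply: (Gd a y _ _).2; lra.
have lA := down_lip sg; have lB u := @up_lip g rho u sg sr.
have slr := smooth_slip sr.
have a0I : m < a0 < m + 1 by lra.
have a1I : m < a1 < m + 1 by lra.
have [l0 [dn0 up0]] := lv _ _ a0I b0I E0; have [l1 [dn1 up1]] := lv _ _ a1I b1I E1.
have [e0 e00 He0] : exists2 e, 0 < e & forall u y, 0 < u <= e -> `|y - a0| < e ->
    hpass V (up g rho u) b0 y -> s * (y - a0) < 0.
  by apply: (fluct_sign l0 slr _ r0 s1 fl0) => y yI; apply: (Gd a0 y _ _).1; lra.
have [e1 e10 He1] : exists2 e, 0 < e & forall u y, 0 < u <= e -> `|y - a1| < e ->
    hpass V (up g rho u) b1 y -> - s * (y - a1) < 0.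
  by apply: (fluct_sign l1 slr _ r0 _ fl1) => [y yI|]; [apply: (Gd a1 y _ _).1; lra|rewrite normrN].
have ch a b : m < a < m + 1 -> m - 1 < b < m -> G b = G a -> chain (down g) (up g rho 0) V V D 1 a a.
  by move=> aI bI E; have [_ [h1 h2]] := lv _ _ aI bI E; exists b.
have [|r1 r10 Hr1] := @chain_itv_perturb R (down g) (up g rho 0) V V D 1 a1 a0 oV oV oD lA (lB 0).
  by move=> y yI; have [|b bI E] := ra y; [lra|exists y; apply: (ch y b) => //; lra].
have [r2 r20 Hr2] := chain_perturb oV oV oD lA (lB 0) (ch _ _ a0I b0I E0) e00.
have [r3 r30 Hr3] := chain_perturb oV oV oD lA (lB 0) (ch _ _ a1I b1I E1) e10.
have [u1 u10 Hu1] := up_close g slr r10; have [u2 u20 Hu2] := up_close g slr r20.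
have [u3 u30 Hu3] := up_close g slr r30.
exists V; split=> //.
exists (Num.min (Num.min e0 e1) (Num.min u1 (Num.min u2 u3))) => [|u]; first by rewrite !lt_min e00 e10 u10 u20.
rewrite !le_min => /and4P[u0 /andP[ue0 ue1] uu1 /andP[uu2 uu3]].
have c1 := Hu1 u ltac:(by rewrite u0); have c2 := Hu2 u ltac:(by rewrite u0).
have c3 := Hu3 u ltac:(by rewrite u0).
split=> //; first by apply: Hr1 => //; exact: fclose_id.
have [|z0 z0a ch0] := Hr2 (down g) (up g rho u) lA (lB u) (fclose_id _ r20) c2 a0.
  by rewrite subrr normr0 ltW.
have [|z1 z1a ch1] := Hr3 (down g) (up g rho u) lA (lB u) (fclose_id _ r30) c3 a1.
  by rewrite subrr normr0 ltW.
exists z1, z0; split=> //.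
have h0 : s * (z0 - a0) < 0.
  have [y [h1 _ h2]] := ch0; apply: (He0 u); rewrite ?u0//.
  by rewrite -(hpass_uniq lA h1 dn0).
have h1 : - s * (z1 - a1) < 0.
  have [y [h1 _ h2]] := ch1; apply: (He1 u); rewrite ?u0//.
  by rewrite -(hpass_uniq lA h1 dn1).
have [sE|sE] : s = 1 \/ s = -1 by move: s1; case: ger0P => _ h; [left|right; rewrite -h opprK].
  by rewrite sE in h0 h1; clear -h0 h1; nra.
by rewrite sE in h0 h1; clear -h0 h1; nra.
Qed.

(** The perturbation depends on [x] alone and so acts on all wells at once: the amplitudes are
    chosen separately in each well, but with one [tau] and one pattern of signs. [p] is the power of
    [x] still factored out. *)
Definition amps (W : nat -> R) (G : nat -> R -> R) (q k p : nat) tau (a b : nat -> nat -> R) :=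
  forall j i, (j < q)%N -> (i <= k)%N ->
  [/\ W j < a j i < W j + 1, W j - 1 < b j i < W j, G j (b j i) = G j (a j i),
     reach_left (G j) (W j) (W j - 1) (a j i) /\ ((0 < i)%N -> a j i < a j i.-1) &
     fluct (fun x => x ^+ p * tau x) (G j) (b j i) (a j i) ((-1) ^+ i)].

Lemma amps_new g (W : nat -> R) (G : nat -> R -> R) q (p : nat) tau h s (e : nat -> R) : (forall j, (j < q)%N -> well g (G j) (W j)) ->
  0 < h -> (forall j, (j < q)%N -> 0 < e j <= 1) -> continuous tau -> `|s| = 1 ->
  (forall x, 0 < x < h -> 0 < s * tau x) ->
  exists a b : nat -> R, forall j, (j < q)%N -> [/\ W j < a j < W j + e j, W j - 1 < b j < W j,
    G j (b j) = G j (a j), reach_left (G j) (W j) (W j - 1) (a j) &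
    fluct (fun x => x ^+ p * tau x) (G j) (b j) (a j) s].
Proof.
move=> w h0 eI ct s1 Hs.
have /choice[X HX] : forall j, exists X : R * R, (j < q)%N -> [/\ W j < X.1 < W j + e j, W j - 1 < X.2 < W j,
    G j X.2 = G j X.1, reach_left (G j) (W j) (W j - 1) X.1 &
    fluct (fun x => x ^+ p * tau x) (G j) X.2 X.1 s].
  move=> j; have [jq|_] := ltnP j q; last by exists (0, 0).
  have [a [b H]] := well_fluct p (w j jq) h0 (eI j jq) ct s1 Hs.
  by exists (a, b).
by exists (fst \o X), (snd \o X) => j /HX.
Qed.

Lemma signr1 i : `|(-1) ^+ i| = 1 :> R.
Proof. by rewrite normrX normrN1 expr1n. Qed.

(* Each step adds a lower power of x with a small coefficient: the signs already obtained persist, while the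
   new term dominates along the orbits of small amplitude. *)
Lemma amps_ex g (W : nat -> R) (G : nat -> R -> R) q (n k : nat) : (forall j, (j < q)%N -> well g (G j) (W j)) -> (k <= n)%N ->
  exists tau, [/\ pf k (fun z : R * R => tau z.1), continuous tau &
    exists a b : nat -> nat -> R, amps W G q k (n - k) tau a b].
Proof.
move=> w; elim: k => [_|k IH kn].
  exists (fun=> 1); split; [exact: pf_cst|exact: cst_continuous|].
  have [//|j _|||x _|a [b H]] := @amps_new g W G q n (fun=> 1) 1 1 (fun=> 1) w.
  - by rewrite ltr01 lexx.
  - exact: cst_continuous.
  - by rewrite normr1.
  - by rewrite mul1r.
  exists (fun j _ => a j), (fun j _ => b j) => j i jq; rewrite leqn0 => /eqP ->.
  by have [h1 h2 h3 h4 h5] := H j jq; split=> //; rewrite subn0 expr0.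
have [tau [ptau ctau [a [b H]]]] := IH (ltnW kn).
have nk : (n - k = (n - k.+1).+1)%N by rewrite subnS prednK// subn_gt0.
set p := (n - k.+1)%N in nk *; pose s : R := (-1) ^+ k.+1.
have cp : continuous (fun x : R => x ^+ p) by exact: exprn_continuous.
have [j e e' e'0 ee Hj i c ik ce|j jq|e e0 He] := @fin_pos R (fun j e => forall i c, (i < k.+1)%N ->
    `|c| <= e -> fluct (fun x => x ^+ p.+1 * tau x + c * x ^+ p) (G j) (b j i) (a j i) ((-1) ^+ i)) q.
- by apply: Hj => //; exact: le_trans ee.
- have [i e e' e'0 ee Hi c ce|i ik|e e0 He] := @fin_pos R (fun i e => forall c, `|c| <= e ->
    fluct (fun x => x ^+ p.+1 * tau x + c * x ^+ p) (G j) (b j i) (a j i) ((-1) ^+ i)) k.+1.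
  + by apply: Hi => //; exact: le_trans ee.
  + have [aI bI _ _ fl] := H j i jq ik; have [cG _ _ _] := w j jq.
    rewrite nk in fl; apply: (fluct_add cG cp _ (signr1 i) fl); lra.
  + by exists e => // i c ik; exact: He.
(* The size [e] is admissible in all wells and for all earlier amplitudes at once; for small [x] the
   constant term gives [tau'] the sign [s]. *)
pose tau' x := s * e + x * tau x.
have ctau' : continuous tau'.
  by move=> x; apply: cvgD; [exact: cvg_cst|apply: cvgM; [exact: cvg_id|exact: ctau]].
have s1 : `|s| = 1 by exact: signr1.
have c0 : {for 0, continuous (fun x => x * tau x)} by apply: cvgM; [exact: cvg_id|exact: ctau].
have [h h0 Hh] := cont_ed c0 e0.
have pos x : 0 < x < h -> 0 < s * tau' x.
  move=> /andP[x0 xh]; have := Hh x; rewrite subr0 gtr0_norm// mul0r subr0 => /(_ xh) hx.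
  have : `|s * (x * tau x)| < e by rewrite normrM s1 mul1r.
  have -> : s * tau' x = s * s * e + s * (x * tau x) by rewrite /tau'; ring.
  by rewrite -expr2 sqrr_sign mul1r ltr_norml => /andP[h1 _]; lra.
have [j jq|a' [b' H']] := @amps_new g W G q p tau' h s (fun j => a j k - W j) w h0 _ ctau' s1 pos.
  by have [aI _ _ _ _] := H j k jq (leqnn k); lra.
exists tau'; split=> //.
  apply: pfD; first exact: pf_cst.
  by apply: (@pfM R 1 k) => //; exact: pf_X.
exists (fun j i => if i == k.+1 then a' j else a j i), (fun j i => if i == k.+1 then b' j else b j i).
move=> j i jq; rewrite leq_eqVlt => /predU1P[->|ik].
  rewrite eqxx /= (ltn_eqF (ltnSn k)); have [h1 h2 h3 h4 h5] := H' j jq.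
  have [aI _ _ _ _] := H j k jq (leqnn k).
  by split=> //; [lra|split=> // _; lra].
rewrite (ltn_eqF ik); have [h1 h2 h3 [h4 h5] h6] := H j i jq ik; split=> //.
  split=> // i0; have i1 : (i.-1 < k.+1)%N by apply: leq_ltn_trans (leq_pred i) ik.
  by rewrite (ltn_eqF i1); exact: h5.
have := He j jq i (s * e) ik; rewrite normrM s1 mul1r gtr0_norm// => /(_ (lexx e)).
congr fluct; apply/funext => x; rewrite /tau' exprSr; ring.
Qed.

Definition wellpos j : R := - (j.*2)%:R.
(** The zeros are the bottoms 0, -2, -4, ... and the lower rims [m - 1]; the upper rim of a well is
    the lower rim of the well above it, if there is one. Two degrees per well give [n./2] wells in
    degree [n]. *)
Definition wellpoly q y : R := \prod_(i < q) ((y - wellpos i) * (y - wellpos i + 1)).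

Lemma pf_wellpoly q : pf q.*2 (fun z : R * R => wellpoly q z.2).
Proof.
elim: q => [|q IH].
  by rewrite (_ : (fun z => _) = fun=> 1); [exact: pf_cst|apply/funext => z; rewrite /wellpoly big_ord0].
rewrite (_ : (fun z => _) = fun z => wellpoly q z.2 * ((z.2 - wellpos q) * (z.2 - wellpos q + 1))); last first.
  by apply/funext => z; rewrite /wellpoly big_ord_recr.
have p1 : pf 1 (fun z : R * R => z.2 - wellpos q) by apply: pfD; [exact: pf_Y|exact: pf_cst].
rewrite doubleS -addn2; apply: (pfM IH); apply: (@pfM R 1 1) => //.
by apply: pfD => //; exact: pf_cst.
Qed.

Lemma wellpos_gap i j : i != j -> wellpos i + 2 <= wellpos j \/ wellpos j + 2 <= wellpos i.
Proof.
have h k l : (k < l)%N -> wellpos l + 2 <= wellpos k.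
  move=> kl; have : (k.*2)%:R + 2 <= (l.*2)%:R :> R by rewrite -natrD ler_nat addn2 -doubleS leq_double.
  by rewrite /wellpos; lra.
by rewrite neq_ltn => /orP[/h|/h]; [right|left].
Qed.

Lemma wellpoly_sign q j y : (j < q)%N -> wellpos j - 1 < y < wellpos j + 1 ->
  0 < wellpoly q y * ((y - wellpos j) * (y - wellpos j + 1)) \/ y = wellpos j.
Proof.
move=> jq yI; have [->|yj] := eqVneq y (wellpos j); [by right|left].
rewrite /wellpoly (bigD1 (Ordinal jq)) //= mulrAC mulr_gt0//.
  have n0 : (y - wellpos j) * (y - wellpos j + 1) != 0.
    by rewrite mulf_neq0 ?subr_eq0//; apply/eqP; lra.
  by rewrite -expr2 exprn_even_gt0.
apply: prodr_gt0 => i ij; have {}ij : nat_of_ord i != j by [].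
have [h|h] := wellpos_gap ij; first by rewrite mulr_gt0//; lra.
by rewrite nmulr_rgt0; lra.
Qed.

Lemma well_ex q j : (j < q)%N -> exists G, well (wellpoly q) G (wellpos j).
Proof.
move=> jq; set m := wellpos j.
have cg : continuous (wellpoly q).
  have [fx [fy [Dg _ _]]] := pf_smooth (pf_wellpoly q) => y.
  exact: is_derive_cont (Dg (fun t => (0, t)) y 0 1 (is_derive_cst 0 y 1) (is_derive_id y 1)).
have [A [A0 cA DA]] := antideriv (cont_affine (c := m - 1) (d := 1) cg).
exists (fun y => A (1 - m + 1 * y)); split.
- exact: cont_affine.
- move=> y yI; have := DA (1 - m + 1 * y) ltac:(lra) => D; have := derive_affine D.
  by rewrite mul1r (_ : m - 1 + _ = y) //; ring.
- move=> y yI; have [|h|ym] := @wellpoly_sign q j y jq; [lra| |lra].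
  rewrite -(nmulr_lgt0 _ (x := (y - m) * (y - m + 1))) // nmulr_rlt0; lra.
- move=> y yI; have [|h|ym] := @wellpoly_sign q j y jq; [lra| |lra].
  rewrite -(pmulr_lgt0 _ (x := (y - m) * (y - m + 1))) // mulr_gt0; lra.
Qed.

Lemma divmod_inj n l l' : (l %/ n = l' %/ n)%N -> (l %% n = l' %% n)%N -> l = l'.
Proof. by move=> d m; rewrite (divn_eq l n) (divn_eq l' n) d m. Qed.

Lemma amps_dec (W : nat -> R) (G : nat -> R -> R) q n (p : nat) tau (a b : nat -> nat -> R) j i i' : amps W G q n p tau a b ->
  (j < q)%N -> (i' <= n)%N -> (i <= i')%N -> a j i' <= a j i.
Proof.
move=> H jq; elim: i' => [|i' IH] i'n; first by rewrite leqn0 => /eqP ->.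
rewrite leq_eqVlt => /predU1P[->//|ii']; have [_ _ _ [_ /(_ isT) h] _] := H j i'.+1 jq i'n.
by apply: le_trans (ltW h) (IH _ ii'); exact: ltnW.
Qed.

Theorem Hc_lower n : (0 < n)%N -> ((n./2 * n)%:R%:E <= Hc R n)%E.
Proof.
move=> n0; pose q := n./2; pose g := wellpoly q; pose W := wellpos.
have qn : (q.*2 <= n)%N by rewrite /q -{2}(odd_double_half n) leq_addl.
have pg : pf n (fun z : R * R => g z.2) := pfW qn (pf_wellpoly q).
have /choice[G HG] : forall j, exists G, (j < q)%N -> well g G (W j).
  move=> j; have [jq|_] := ltnP j q; last by exists id.
  by have [G w] := well_ex jq; exists G.
have [tau [ptau ctau [a [b H]]]] := amps_ex HG (leqnn n).
rewrite subnn in H.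
have [j e e' e'0 ee Hj i in_|j jq|e e0 He] := @fin_pos R (fun j e => forall i, (i < n)%N ->
   exists V, open V /\ forall u, 0 < u <= e -> window (down g) (up g tau u) V V
     [set x | W j - 1 < x < W j] 1 (a j i.+1) (a j i)) q.
- have [V [oV HV]] := Hj i in_; exists V; split=> // u /andP[u0 ue]; apply: HV; rewrite u0 /=; lra.
- have [i e e' e'0 ee [V [oV HV]]|i in_|e e0 He] := @fin_pos R (fun i e => 
   exists V, open V /\ forall u, 0 < u <= e -> window (down g) (up g tau u) V V
     [set x | W j - 1 < x < W j] 1 (a j i.+1) (a j i)) n.
  + exists V; split=> // u /andP[u0 ue]; apply: HV; rewrite u0 /=; lra.
  + have [aI bI E [ra _] fl] := H j i jq (ltnW in_).
    have [aI' bI' E' [_ /(_ isT) aa] fl'] := H j i.+1 jq in_.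
    have taE : (fun x => x ^+ 0 * tau x) = tau by apply/funext => x; rewrite expr0 mul1r.
    rewrite taE in fl fl'; rewrite exprS mulN1r in fl'.
    have [||V [oV [e e0 He]]] := well_window (pf_smooth pg) (pf_smooth ptau) (HG j jq) _ aa _
      bI bI' E E' ra (signr1 i) fl fl'; [lra|lra|].
    by exists e => //; exists V.
  + by exists e.
(* The index [l] encodes the well [l %/ n] and, in it, the pair of consecutive amplitudes number
   [l %% n]. *)
have /choice[V HV] : forall l, exists V, (l < q * n)%N -> open V /\ window (down g) (up g tau e) V V
   [set x | W (l %/ n)%N - 1 < x < W (l %/ n)%N] 1 (a (l %/ n)%N (l %% n).+1%N) (a (l %/ n)%N (l %% n)%N).
  move=> l; have [lq|_] := ltnP l (q * n); last by exists set0.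
  have [V [oV HV]] := He (l %/ n)%N ltac:(by rewrite ltn_divLR) (l %% n)%N ltac:(by rewrite ltn_mod).
  by exists V => _; split=> //; apply: HV; rewrite e0 lexx.
apply: (@Hc_windows R (down g) (up g tau e) n (q * n) V V
  (fun l => [set x | W (l %/ n)%N - 1 < x < W (l %/ n)%N]) (fun=> 1%N)
  (fun l => a (l %/ n)%N (l %% n).+1%N) (fun l => a (l %/ n)%N (l %% n)%N)).
- by split=> //; exact: pf_cst.
- split; last exact: pf_cst.
  rewrite (_ : (fun z => _) = fun z => -1 * g z.2 + - e * tau z.1).
    by apply: pfD; apply: (@pfM R 0 n) => //; exact: pf_cst.
  by apply/funext => z /=; ring.
- move=> l lq; have [oV w] := HV l lq; split=> //.
  rewrite (_ : [set x | _] = `]W (l %/ n)%N - 1, W (l %/ n)%N[%classic); first exact: interval_open.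
  by apply/seteqP; split=> x; rewrite /= in_itv.
- move=> l l' lq l'q ll'.
  have [jq jq'] : (l %/ n < q)%N /\ (l' %/ n < q)%N by rewrite !ltn_divLR.
  have [im im'] : (l %% n < n)%N /\ (l' %% n < n)%N by rewrite !ltn_mod.
  have [aI _ _ _ _] := H _ _ jq im; have [bI _ _ _ _] := H _ _ jq (ltnW im).
  have [aI' _ _ _ _] := H _ _ jq' im'; have [bI' _ _ _ _] := H _ _ jq' (ltnW im').
  have [E|jj] := eqVneq (l %/ n)%N (l' %/ n)%N.
    rewrite E in aI bI *; split; last by move=> x /=; lra.
    have [ii|ii] : (l %% n < l' %% n)%N \/ (l' %% n < l %% n)%N.
    - by apply/orP; rewrite -neq_ltn; apply: contraNneq ll' => E'; apply/eqP/(divmod_inj E E').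
    - by right; apply: (amps_dec H jq') => //; exact: ltnW.
    - by left; apply: (amps_dec H jq') => //; exact: ltnW.
  by have [h|h] := wellpos_gap jj; rewrite -/W in h; (split; [lra|move=> x /=; lra]).
Qed.
End Wells.

(** * The two estimates *)

Local Open Scope ereal_scope.

Theorem theorem1 (R : realType) :
  ((4%:R^-1)%:E <= limn_einf (fun n : nat => Hc R n * ((n%:R ^+ 2)^-1)%:E)) /\
  (forall n : nat, Hc R n < +oo -> 1 + Hc R n <= Hc R n.+1).
Proof.
split=> [|n Hfin].
  (* In degree 1 there is no well; from [n = 2] on, [n./2] is at least [n / 4]. *)
  apply: (@limn_einf_ge R _ _ 2) => n n2; have n0 : (0 < n)%N by apply: leq_trans n2.
  have nR : (0 < n%:R :> R)%R by rewrite ltr0n.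
  apply: le_trans (lee_wpmul2r _ (Hc_lower R n0)); last by rewrite lee_fin invr_ge0 exprn_ge0// ltW.
  rewrite -EFinM lee_fin natrM expr2 invfM mulrA mulfK ?gt_eqF// ler_pdivlMr//.
  rewrite mulrC ler_pdivrMr// -natrM ler_nat -{1}(odd_double_half n).
  rewrite (_ : (n./2 * 4 = n./2.*2 + n./2.*2)%N); last by rewrite -muln2 -mulnDr.
  by rewrite leq_add2r (leq_trans (leq_b1 _))// double_gt0 half_gt0.
(* Subtracting 1 reduces the supremum to one field at a time; finiteness of [Hc R n] makes its
   number [K] of cycles finite, and [part2] adds one. *)
rewrite addeC -leeBrDr//; apply: ge_ereal_sup => _ [Z [dP dQ] <-]; rewrite leeBrDr//.
have Zfin : pi_c Z < +oo by apply: le_lt_trans Hfin; apply: ereal_sup_ubound; exists Z.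
have [K [G [ZK GZ inj]]] := counting_fin set0 Zfin.
have [pA pB] := pfield_of dP dQ.
apply: le_trans (part2 pA pB _ inj); last by move=> j /GZ /=; rewrite clcE.
by rewrite -addn1 natrD EFinD leeD2r.
Qed.
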